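(* Let $\gamma\le1$ and $\delta\ge0$ and, for $t>0$, consider the spectral multiplier $$m_t(\mathcal{L})=\mathcal{L}^{-\delta/2}e^{it\mathcal{L}^{\gamma/2}}$$ of the twisted Laplacian $\mathcal{L}$ on $\mathbb{R}^{2d}$, associated with the function $m_t(x)=x^{-\delta/2}e^{itx^{\gamma/2}}$, $x>0$. The operator $m_t(\mathcal{L})$ is bounded on $M^p(\mathbb{R}^{2d})$ for all $1\le p\le\infty$. Moreover, if $0<t\le T$, there exists $C(T)>0$ such that $$\|m_t(\mathcal{L})f\|_{M^p}\le C(T)\,\|f\|_{M^p}.$$
   Context: $\mathbb{N}=\{0,1,2,\ldots\}$, $d\ge1$. Twisted Laplacian: with $z=(x,y)\in\mathbb{R}^{2d}$, $\mathcal{L}=-\sum_{j=1}^d\big[(\partial_{x_j}-\tfrac i2y_j)^2+(\partial_{y_j}+\tfrac i2x_j)^2\big]$ on $L^2(\mathbb{R}^{2d})$, with spectrum $\{d+2k:k\in\mathbb{N}\}$. Let $\Phi_\alpha$, $\alpha\in\mathbb{N}^d$, be the normalized Hermite functions on $\mathbb{R}^d$ (eigenfunctions of $-\Delta+|x|^2$ with eigenvalue $d+2|\alpha|$), and let $\Phi_{\alpha,\beta}(x,y)=(2\pi)^{-d}\int_{\mathbb{R}^d}e^{ix\cdot u}\Phi_\alpha(u+y/2)\Phi_\beta(u-y/2)\,du$ be the special Hermite functions, so that $\mathcal{L}\Phi_{\alpha,\beta}=(d+2|\beta|)\Phi_{\alpha,\beta}$. $Q_k$ is the orthogonal projection onto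 the closed span in $L^2(\mathbb{R}^{2d})$ of $\{\Phi_{\alpha,\beta}:|\beta|=k\}$. For a function $m$ on $\{d+2k:k\in\mathbb{N}\}$, $m(\mathcal{L})f=\sum_{k\in\mathbb{N}}m(d+2k)Q_kf$. Modulation spaces: for $f\in\mathcal{S}'(\mathbb{R}^n)$ and a fixed $g\in\mathcal{S}(\mathbb{R}^n)\setminus\{0\}$, let $V_gf(x,\xi)=(2\pi)^{-n/2}\int_{\mathbb{R}^n}e^{-i\xi\cdot y}f(y)\overline{g(y-x)}\,dy$. For $1\le p\le\infty$, $M^p(\mathbb{R}^n)$ is the space of $f\in\mathcal{S}'(\mathbb{R}^n)$ with $\|f\|_{M^p}=\|V_gf\|_{L^p(\mathbb{R}^{2n})}<\infty$. Different windows $g$ give equivalent norms. An operator $T\colon\mathcal{S}(\mathbb{R}^n)\to\mathcal{S}'(\mathbb{R}^n)$ is said to be bounded on $M^p$ if there is $C>0$ with $\|Tf\|_{M^p}\le C\|f\|_{M^p}$ for all $f\in\mathcal{S}(\mathbb{R}^n)$. The constant $C(T)$ is independent of $f$ and of $t\in(0,T]$. *)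

(* Defs.v *)
From HB Require Import structures.
From mathcomp Require Import all_boot all_order all_algebra.
From mathcomp Require Import complex.
From mathcomp Require Import all_classical all_reals all_analysis.

Set Implicit Arguments.
Unset Strict Implicit.
Unset Printing Implicit Defensive.

Import Order.TTheory GRing.Theory Num.Theory.
Import numFieldNormedType.Exports.
Import ComplexField.Normc.

Local Open Scope classical_set_scope.
Local Open Scope ring_scope.
Local Open Scope complex_scope.

(* The Borel sigma-algebra of R^n, generated by the coordinates. *)
Section measurable_rV.
Context (R : realType) (n : nat).

Let coord (i : 'I_n) (x : 'rV[R]_n) : R := x ord0 i.

Let rV_set0 : g_sigma_preimage coord set0.
Proof. exact: sigma_algebra0. Qed.

Let rV_setC A : g_sigma_preimage coord A -> g_sigma_preimage coord (~` A).
Proof. exact: sigma_algebraC. Qed.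

Let rV_bigcup (F : (set 'rV[R]_n)^nat) :
  (forall i, g_sigma_preimage coord (F i)) ->
  g_sigma_preimage coord (\bigcup_i (F i)).
Proof. exact: sigma_algebra_bigcup. Qed.

HB.instance Definition _ :=
  @isMeasurable.Build (measure_tuple_display default_measure_display)
    'rV[R]_n (g_sigma_preimage coord) rV_set0 rV_setC rV_bigcup.

Lemma measurable_coord_rV (i : 'I_n) :
  measurable_fun [set: 'rV[R]_n] (fun x : 'rV[R]_n => x ord0 i).
Proof.
move=> _ Y mY; rewrite setTI; apply: sub_sigma_algebra => /=.
rewrite -bigcup_seq/=; exists i => /=; first by rewrite mem_index_enum.
by exists Y => //; rewrite setTI.
Qed.

Lemma measurable_fun_rV d (T : measurableType d) (f : T -> 'rV[R]_n) :
  (forall i, measurable_fun [set: T] (fun t => f t ord0 i)) ->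
  measurable_fun [set: T] f.
Proof.
move=> mf _ A mA.
suff : (measurable : set (set 'rV[R]_n)) `<=`
    [set B | measurable ([set: T] `&` f @^-1` B)] by exact.
apply: smallest_sub.
  split => /=.
  - by rewrite preimage_set0 setI0; exact: measurable0.
  - move=> B; rewrite !setTI setTD => mB.
    by rewrite preimage_setC; exact: measurableC.
  - move=> F mF; rewrite preimage_bigcup setTI; apply: bigcup_measurable.
    by move=> k _; rewrite -[X in measurable X]setTI; exact: mF.
rewrite -bigcup_seq/=; apply: bigcup_sub => i _ _ [B mB <-] /=.
by rewrite setTI; exact: mf.
Qed.

End measurable_rV.

(* Lebesgue measure on R^(n+1), from the one on R^n by the product with the
   Lebesgue measure of R, carried over by (t, v) |-> (t, v_0, ..., v_(n-1)). *)
Section cons_measure.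
Context (R : realType) (n : nat).

Definition cons_rV (p : measurableTypeR R * 'rV[R]_n) : 'rV[R]_n.+1 :=
  \row_i oapp (fun j => p.2 ord0 j) p.1 (unlift ord0 i).

Lemma measurable_cons_rV : measurable_fun setT cons_rV.
Proof.
apply: measurable_fun_rV => i; rewrite /cons_rV.
under eq_fun do rewrite mxE.
case: unliftP => [j _|_] /=.
  apply: (@measurableT_comp _ _ _ _ _ _ (fun x : 'rV[R]_n => x ord0 j)) => //.
  exact: measurable_coord_rV.
exact: measurable_fst.
Qed.

Variable m : {sigma_finite_measure set 'rV[R]_n -> \bar R}.

Definition cons_measure : set 'rV[R]_n.+1 -> \bar R :=
  pushforward (lebesgue_measure \x m)%E cons_rV.

Let cons_measure0 : cons_measure set0 = 0%E.
Proof. by rewrite /cons_measure /pushforward preimage_set0 measure0. Qed.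

Let cons_measure_ge0 A : (0 <= cons_measure A)%E.
Proof. by rewrite /cons_measure /pushforward measure_ge0. Qed.

Let cons_measure_sigma_additive : semi_sigma_additive cons_measure.
Proof.
move=> F mF tF mUF; rewrite /cons_measure /pushforward preimage_bigcup.
have mpre B : measurable B -> measurable (cons_rV @^-1` B).
  by move=> mB; rewrite -[X in measurable X]setTI; exact: measurable_cons_rV.
apply: measure_semi_sigma_additive.
- by move=> k; exact: mpre.
- apply/trivIsetP => /= i j _ _ ij; rewrite -preimage_setI.
  by move/trivIsetP : tF => /(_ _ _ _ _ ij) ->//; rewrite preimage_set0.
- by rewrite -preimage_bigcup; exact: mpre.
Qed.

HB.instance Definition _ := isMeasure.Build _ _ _ cons_measure
  cons_measure0 cons_measure_ge0 cons_measure_sigma_additive.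

Let cons_measure_sigma_finite : sigma_finite setT cons_measure.
Proof.
have /sigma_finiteP[F [FT ndF Foo]] :=
  sigma_finiteT (@lebesgue_measure R : {sigma_finite_measure set _ -> \bar _}).
have /sigma_finiteP[G [GT ndG Goo]] := sigma_finiteT m.
pose h (v : 'rV[R]_n.+1) : measurableTypeR R * 'rV[R]_n :=
  (v ord0 ord0, \row_j v ord0 (lift ord0 j)).
have mh : measurable_fun setT h.
  apply: measurable_fun_pair; first exact: measurable_coord_rV.
  apply: measurable_fun_rV => i; under eq_fun do rewrite mxE.
  exact: measurable_coord_rV.
have hK p : h (cons_rV p) = p.
  case: p => t v; rewrite /h /cons_rV mxE unlift_none/=; congr pair.
  by apply/rowP => j; rewrite !mxE liftK.
exists (fun k => h @^-1` (F k `*` G k)).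
  apply/esym; rewrite -subTset => v _; have [k _ Fk] : (\bigcup_i F i) (h v).1.
    by rewrite -FT.
  have [l _ Gl] : (\bigcup_i G i) (h v).2 by rewrite -GT.
  exists (maxn k l) => //; split.
  - by move: Fk; exact/subsetPset/ndF/leq_maxl.
  - by move: Gl; exact/subsetPset/ndG/leq_maxr.
move=> k; have [mFk Fkoo] := Foo k; have [mGk Gkoo] := Goo k.
have mFG : measurable (F k `*` G k) by exact: measurableX.
split; first by rewrite -[X in measurable X]setTI; exact: mh.
rewrite /cons_measure /pushforward -comp_preimage.
rewrite (_ : h \o cons_rV = id); last exact/funext.
rewrite preimage_id product_measure1E//.
by rewrite lte_mul_pinfty// ge0_fin_numE.
Qed.

HB.instance Definition _ := Measure_isSigmaFinite.Build _ _ _ cons_measure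
  cons_measure_sigma_finite.

End cons_measure.

Fixpoint lebesgue_rV (R : realType) (n : nat) :
    {sigma_finite_measure set 'rV[R]_n -> \bar R} :=
  if n is k.+1 then cons_measure (lebesgue_rV R k)
  else dirac (0 : 'rV[R]_0).

Lemma lebesgue_rV_box (R : realType) (n : nat) (A : 'I_n -> set R) :
  (forall i, measurable (A i)) ->
  lebesgue_rV R n [set v | forall i, A i (v ord0 i)] =
  (\prod_(i < n) lebesgue_measure (A i))%E.
Proof.
elim: n A => [|n IHn] A mA.
  by rewrite big_ord0 /= diracE mem_set// => -[].
rewrite big_ord_recl -(IHn (fun i => A (lift ord0 i)))//= -product_measure1E/=.
- congr (product_measure1 _ _ _); apply/seteqP.
  split => [[t v] /= Av|[t v] /= [At Av] i].
    split=> [|i]; first by have := Av ord0; rewrite mxE unlift_none.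
    by have := Av (lift ord0 i); rewrite mxE liftK.
  by rewrite mxE; case: unliftP => [j ->|->] /=.
- exact: mA.
- rewrite [X in measurable X](_ : _ = \bigcap_(i in [set: 'I_n])
      (fun v : 'rV[R]_n => v ord0 i) @^-1` A (lift ord0 i)).
    apply: fin_bigcap_measurable => // i _.
    by rewrite -[X in measurable X]setTI; exact: measurable_coord_rV.
  by apply/seteqP; split => [v Av i _|v Av i]; [exact: Av|exact: Av].
Qed.

Section complex_functions.
Context (R : realType) (n : nat).
Local Notation Rn := 'rV[R]_n.
Implicit Types (F G f g : Rn -> R[i]).

Definition dotR (x y : Rn) : R := \sum_i x ord0 i * y ord0 i.

Definition expi (t : R) : R[i] := cos t +i* sin t.

Definition measurable_funC F :=
  measurable_fun setT (fun x => complex.Re (F x)) /\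
  measurable_fun setT (fun x => complex.Im (F x)).

Definition integralC F : R[i] :=
  (\int[lebesgue_rV R n]_x complex.Re (F x)) +i*
  (\int[lebesgue_rV R n]_x complex.Im (F x)).

Definition LnormC (p : \bar R) F : \bar R :=
  Lnorm (lebesgue_rV R n) p (fun x => (normc (F x))%:E).

Definition L2 F := measurable_funC F /\ (LnormC 2%:E F < +oo)%E.

Definition L2dist F G : \bar R := LnormC 2%:E (fun x => F x - G x).

Definition inner F G : R[i] := integralC (fun x => F x * conjc (G x)).

(* Iterated partial derivatives, in the directions listed in s. *)
Definition partialC (i : 'I_n) F : Rn -> R[i] := fun x =>
  'D_(delta_mx 0 i) (fun y => complex.Re (F y)) x +i*
  'D_(delta_mx 0 i) (fun y => complex.Im (F y)) x.

Definition partialsC (s : seq 'I_n) F : Rn -> R[i] := foldr partialC F s.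

Definition smoothC F := forall (s : seq 'I_n) (x : Rn),
  differentiable (fun y => complex.Re (partialsC s F y)) x /\
  differentiable (fun y => complex.Im (partialsC s F y)) x.

Definition schwartz_bound (N : nat) (b : R) F :=
  forall (s : seq 'I_n) (x : Rn), (size s <= N)%N ->
    (1 + `|x|) ^+ N * normc (partialsC s F x) <= b.

Definition schwartz F := smoothC F /\ forall N, exists b, schwartz_bound N b F.

(* A functional u is only meaningful on Schwartz functions; continuity is
   continuity at 0 for the usual topology of the Schwartz space. *)
Definition tempered (u : (Rn -> R[i]) -> R[i]) :=
  (forall (a : R[i]) phi psi, schwartz phi -> schwartz psi ->
    u (fun x => a * phi x + psi x) = a * u phi + u psi) /\
  (forall eps : R, 0 < eps -> exists (N : nat) (eta : R), 0 < eta /\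
    forall phi, schwartz phi -> schwartz_bound N eta phi ->
      normc (u phi) <= eps).

Definition fun_distr F : (Rn -> R[i]) -> R[i] :=
  fun phi => integralC (fun x => F x * phi x).

End complex_functions.

Section modulation_space.
Context (R : realType) (n : nat).
Local Notation Rn := 'rV[R]_n.
Local Notation distr := ((Rn -> R[i]) -> R[i]).

(* V_g u (x, xi), the integral being the pairing of u with the Schwartz function
   y |-> e^(-i xi.y) conj (g (y - x)); (x, xi) is a point of R^(2n). *)
Definition stft (g : Rn -> R[i]) (u : distr) (z : 'rV[R]_(n + n)) : R[i] :=
  ((2 * pi) `^ (- (n%:R / 2)))%:C *
  u (fun y => expi (- dotR (rsubmx z) y) * conjc (g (y - lsubmx z))).

Definition Mnorm (g : Rn -> R[i]) (p : \bar R) (u : distr) : \bar R :=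
  LnormC p (stft g u).

(* An operator from the Schwartz space to tempered distributions, given by its
   graph. *)
Definition operator_SS' (T : (Rn -> R[i]) -> distr -> Prop) :=
  forall f, schwartz f ->
    (exists u, T f u) /\
    (forall u, T f u -> tempered u) /\
    (forall u v, T f u -> T f v -> forall phi, schwartz phi -> u phi = v phi).

Definition Mp_bound (g : Rn -> R[i]) (p : \bar R)
    (T : (Rn -> R[i]) -> distr -> Prop) (C : R) :=
  forall f u, schwartz f -> T f u ->
    (Mnorm g p u <= C%:E * Mnorm g p (fun_distr f))%E.

Definition Mp_bounded (g : Rn -> R[i]) (p : \bar R)
    (T : (Rn -> R[i]) -> distr -> Prop) :=
  operator_SS' T /\ exists C : R, 0 < C /\ Mp_bound g p T C.

End modulation_space.

Section twisted_laplacian.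
Context (R : realType) (d : nat).
Local Notation R2d := 'rV[R]_(d + d).

(* Physicists' Hermite polynomials: H_(k+1) = 2 X H_k - H_k'. *)
Definition hermite_poly (k : nat) : {poly R} :=
  iter k (fun p => 2%:R *: ('X * p) - p^`()) 1.

Definition hermite_fun1 (k : nat) (t : R) : R :=
  (hermite_poly k).[t] * expR (- (t ^+ 2 / 2)) /
  Num.sqrt (2 ^+ k * k`!%:R * Num.sqrt pi).

Definition hermite_fun (a : 'I_d -> nat) (x : 'rV[R]_d) : R :=
  \prod_i hermite_fun1 (a i) (x ord0 i).

Definition mlength (a : 'I_d -> nat) : nat := (\sum_i a i)%N.

Definition special_hermite (a b : 'I_d -> nat) (z : R2d) : R[i] :=
  let x := lsubmx z in let y := rsubmx z in
  ((2 * pi) ^- d)%:C *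
  integralC (fun u : 'rV[R]_d => expi (dotR x u) *
    (hermite_fun a (u + 2^-1 *: y) * hermite_fun b (u - 2^-1 *: y))%:C).

Definition eigen_span (k : nat) (F : R2d -> R[i]) :=
  exists (N : nat) (c : 'I_N -> R[i]) (a b : 'I_N -> 'I_d -> nat),
    (forall i, mlength (b i) = k) /\
    F = fun z => \sum_(i < N) c i * special_hermite (a i) (b i) z.

(* G is Q_k f, as an element of L^2. *)
Definition is_Q (k : nat) (f G : R2d -> R[i]) :=
  [/\ L2 G,
      forall eps : R, 0 < eps -> exists2 F, eigen_span k F &
        (L2dist G F < eps%:E)%E
    & forall a b, mlength b = k ->
        inner (fun z => f z - G z) (special_hermite a b) = 0].

(* F = m(L) f, the L^2 sum of the series of m(d + 2k) Q_k f: the twisted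
   Laplacian L acts on the range of Q_k as multiplication by d + 2k. *)
Definition is_multiplier (m : R -> R[i]) (f F : R2d -> R[i]) :=
  exists q : nat -> R2d -> R[i],
    [/\ forall k, is_Q k f (q k), L2 F &
        L2dist F (fun z => \sum_(k < N) m (d + 2 * k)%:R * q k z)
          @[N --> \oo] --> 0%E].

(* The graph of m(L) as an operator into tempered distributions. *)
Definition multiplier (m : R -> R[i]) (f : R2d -> R[i])
    (u : (R2d -> R[i]) -> R[i]) : Prop :=
  exists2 F, is_multiplier m f F & u = fun_distr F.

Definition wave_multiplier (gamma delta t x : R) : R[i] :=
  (x `^ (- (delta / 2)))%:C * expi (t * x `^ (gamma / 2)).

End twisted_laplacian.

(* Main.v *)
(** Let phi be a Gaussian and V_phi the short-time Fourier transform with window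
    phi. The transform of a special Hermite function Phi_(a,b) is the conjugate of
    a product over j of A_j^(a_j) B_j^(b_j) times a Gaussian, where A and B are
    complex coordinates of the phase space; expanding in the Phi_(a,b) shows that
    V_phi (m(L) f) is an explicit integral operator applied to V_phi f. The
    modulus of its kernel is a Gaussian in A - A', times Gaussians in B and B',
    times |G(B . conj B' / 2)| with G(s) = sum_k m(d + 2k) s^k / k!. Rotating
    Gaussians reduces Schur's test for this kernel to the estimate, on one complex
    plane,
      int e^(-|s|^2/4) |G(r s / 2)| ds <= C e^(r^2/4).
    By Cauchy-Schwarz with the weight (1 + |s - r|^4)^(-1), it follows from
    bounds on the Fock space norms of G(r s / 2) and (s - r)^2 G(r s / 2), that
    is, on Poisson moments of the coefficients; these only need
    |m_k|, k^(1/2) |m_(k+1) - m_k| and k |m_(k+2) - 2 m_(k+1) + m_k| bounded. For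
    x^(-delta/2) e^(i t x^(gamma/2)) these hold uniformly in t <= T because
    gamma <= 1 makes the derivative O(x^(-1/2)) and the second one O(1/x).
    Passing from phi to another window costs a convolution with an integrable
    function. *)

From HB Require Import structures.
From mathcomp Require Import all_boot all_order all_algebra.
From mathcomp Require Import complex ring lra zify.
From mathcomp Require Import all_classical all_reals all_analysis measurable_realfun ess_sup_inf.
Require Import Defs.

Set Implicit Arguments.
Unset Strict Implicit.
Unset Printing Implicit Defensive.

Import Order.TTheory GRing.Theory Num.Theory.
Import numFieldNormedType.Exports.
Import ComplexField.Normc.

Local Open Scope classical_set_scope.
Local Open Scope ring_scope.
Local Open Scope complex_scope.

(** * Complex numbers and complex-valued integrals *)

(** For m = 1 one has G(r s / 2) = e^(r s / 2), and e^(-|s|^2/4) |G(r s / 2)| is e^(r^2/4) times a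
    Gaussian centred at s = r. For other m the mass should still sit near r, and powers of s - r
    measure its spread. In a plane a single factor s - r would leave the weight (1 + |s -
    r|^2)^(-1), which is not integrable; two factors give an integrable one, hence differences of m
    up to order two. The squared Fock norm of s^k is a multiple of 2^k k!, so the coefficients of
    G(r s / 2) carry Poisson weights of parameter rho = r^2/2. Under them k deviates from rho by
    about rho^(1/2); the factors k^(1/2) and k in front of the first and second differences are
    exactly what these deviations cost. The expansion rests on one computation: the squared
    coefficients of a shifted Gaussian, suitably normalized, have sum 1. So shifted Gaussians lie in
    the closed span of the Phi_(a,b). This yields the convergence of the expansion, a bound for the
    truncated kernels that is uniform in the truncation, and the uniqueness of m(L) f as a
    distribution. *)

Section complex_numbers.
Context {R : realType}.
Implicit Types (z w : R[i]) (u v : nat -> R[i]).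
Local Notation Re := complex.Re.
Local Notation Im := complex.Im.

Lemma ReD z w : Re (z + w) = Re z + Re w. Proof. by case: z; case: w. Qed.
Lemma ImD z w : Im (z + w) = Im z + Im w. Proof. by case: z; case: w. Qed.
Lemma ReN z : Re (- z) = - Re z. Proof. by case: z. Qed.
Lemma ImN z : Im (- z) = - Im z. Proof. by case: z. Qed.
Lemma ReM z w : Re (z * w) = Re z * Re w - Im z * Im w.
Proof. by case: z; case: w. Qed.
Lemma ImM z w : Im (z * w) = Re z * Im w + Im z * Re w.
Proof. by case: z => a b; case: w => c e /=; rewrite addrC; ring. Qed.
Lemma Re_conjc z : Re (conjc z) = Re z. Proof. by case: z. Qed.
Lemma Im_conjc z : Im (conjc z) = - Im z. Proof. by case: z. Qed.
Lemma complex_eqP z w : Re z = Re w -> Im z = Im w -> z = w.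
Proof. by case: z => a b; case: w => c e /= -> ->. Qed.
Lemma conjcD z w : conjc (z + w) = conjc z + conjc w. Proof. exact: raddfD. Qed.
Lemma conjcB z w : conjc (z - w) = conjc z - conjc w. Proof. exact: raddfB. Qed.
Lemma conjcN z : conjc (- z) = - conjc z. Proof. exact: raddfN. Qed.
Lemma conjcM z w : conjc (z * w) = conjc z * conjc w. Proof. exact: rmorphM. Qed.
Lemma conjcX z k : conjc (z ^+ k) = conjc z ^+ k. Proof. exact: rmorphXn. Qed.
Lemma conjc_sum I (r : seq I) P (F : I -> R[i]) :
  conjc (\sum_(i <- r | P i) F i) = \sum_(i <- r | P i) conjc (F i).
Proof. exact: raddf_sum. Qed.
Lemma conjc_prod I (r : seq I) P (F : I -> R[i]) :
  conjc (\prod_(i <- r | P i) F i) = \prod_(i <- r | P i) conjc (F i).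
Proof. exact: rmorph_prod. Qed.
Lemma Re_sum I (r : seq I) P (F : I -> R[i]) :
  Re (\sum_(i <- r | P i) F i) = \sum_(i <- r | P i) Re (F i).
Proof. by rewrite (big_morph _ ReD (erefl : Re 0 = 0)). Qed.
Lemma Im_sum I (r : seq I) P (F : I -> R[i]) :
  Im (\sum_(i <- r | P i) F i) = \sum_(i <- r | P i) Im (F i).
Proof. by rewrite (big_morph _ ImD (erefl : Im 0 = 0)). Qed.

Lemma normc_ge0 z : 0 <= normc z.
Proof. by case: z => a b; exact: sqrtr_ge0. Qed.
Lemma normc_sqr z : normc z ^+ 2 = Re z ^+ 2 + Im z ^+ 2.
Proof. by case: z => a b /=; rewrite sqr_sqrtr// addr_ge0// sqr_ge0. Qed.
Lemma normc_conjc z : normc (conjc z) = normc z.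
Proof. by case: z => a b /=; rewrite sqrrN. Qed.
Lemma normc_real (a : R) : normc (a%:C) = `|a|.
Proof. by rewrite /= expr0n addr0 sqrtr_sqr. Qed.
Lemma normcX z k : normc (z ^+ k) = normc z ^+ k.
Proof. by elim: k => [|k IH]; rewrite ?expr0 ?normc1// !exprS normcM IH. Qed.
Lemma normc_prod I (r : seq I) P (F : I -> R[i]) :
  normc (\prod_(i <- r | P i) F i) = \prod_(i <- r | P i) normc (F i).
Proof. by rewrite (big_morph _ (@normcM R) (@normc1 R)). Qed.
Lemma ler_normc_sum I (r : seq I) P (F : I -> R[i]) :
  normc (\sum_(i <- r | P i) F i) <= \sum_(i <- r | P i) normc (F i).
Proof.
elim/big_rec2 : _ => [|i x y _ le]; first by rewrite normc0.
by rewrite (le_trans (le_normcD _ _))// lerD2l.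
Qed.
Lemma normcBC z w : normc (z - w) = normc (w - z).
Proof. by rewrite -normcN opprB. Qed.
Lemma normc_Re_le z : `|Re z| <= normc z.
Proof.
rewrite -(ler_pXn2r (n := 2))// ?nnegrE ?normc_ge0// normc_sqr.
by rewrite real_normK ?num_real// lerDl sqr_ge0.
Qed.
Lemma normc_Im_le z : `|Im z| <= normc z.
Proof.
rewrite -(ler_pXn2r (n := 2))// ?nnegrE ?normc_ge0// normc_sqr.
by rewrite real_normK ?num_real// lerDr sqr_ge0.
Qed.
Lemma normc_le_ReIm z : normc z <= `|Re z| + `|Im z|.
Proof.
rewrite -(ler_pXn2r (n := 2))// ?nnegrE ?normc_ge0 ?addr_ge0// normc_sqr.
rewrite sqrrD !real_normK ?num_real// lerD2r lerDl.
by rewrite mulrn_wge0// mulr_ge0.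
Qed.
Lemma mul_conjc z : z * conjc z = (normc z ^+ 2)%:C.
Proof.
by rewrite normc_sqr; case: z => a b; apply: complex_eqP => /=; ring.
Qed.
Lemma ler_normcB z w : `|normc z - normc w| <= normc (z - w).
Proof.
have H a b : normc a - normc b <= normc (a - b).
  by rewrite lerBlDr; apply: le_trans (le_normcD _ _); rewrite subrK.
by rewrite ler_norml H andbT lerNl opprB normcBC H.
Qed.

Lemma normc_expi (t : R) : normc (expi t) = 1.
Proof. by rewrite /= cos2Dsin2 sqrtr1. Qed.
Lemma expiD (s t : R) : expi (s + t) = expi s * expi t.
Proof.
rewrite /expi cosD sinD; apply: complex_eqP => //=.
by rewrite addrC mulrC (mulrC (sin t)); ring.
Qed.
Lemma expi0 : expi (0 : R) = 1.
Proof. by rewrite /expi cos0 sin0. Qed.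
Lemma conjc_expi (t : R) : conjc (expi t) = expi (- t).
Proof. by rewrite /expi cosN sinN. Qed.

(* Convergence of complex sequences, phrased in R so that no topology on R[i] is
   needed. *)
Definition cvgC u (l : R[i]) := (normc (u n - l)) @[n --> \oo] --> (0 : R).

Lemma cvgC_Re u l : cvgC u l -> (Re (u n)) @[n --> \oo] --> Re l.
Proof.
move=> h; apply/cvgrPdistC_lt => e e0.
have /cvgr_lt/(_ _ e0) := h; apply: filterS => n /= ul.
by apply: le_lt_trans ul; rewrite -ReN -ReD; exact: normc_Re_le.
Qed.
Lemma cvgC_Im u l : cvgC u l -> (Im (u n)) @[n --> \oo] --> Im l.
Proof.
move=> h; apply/cvgrPdistC_lt => e e0.
have /cvgr_lt/(_ _ e0) := h; apply: filterS => n /= ul.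
by apply: le_lt_trans ul; rewrite -ImN -ImD; exact: normc_Im_le.
Qed.
Lemma cvgC_ReIm u l : (Re (u n)) @[n --> \oo] --> Re l ->
  (Im (u n)) @[n --> \oo] --> Im l -> cvgC u l.
Proof.
move=> hR hI; apply/cvgr0Pnorm_lt => e e0.
have e2 : 0 < e / 2 by rewrite divr_gt0.
near=> n; rewrite ger0_norm ?normc_ge0//.
rewrite (le_lt_trans (normc_le_ReIm _))// [ltRHS]splitr ltrD//.
- by rewrite ReD ReN; near: n; exact: cvgr_distC_lt.
- by rewrite ImD ImN; near: n; exact: cvgr_distC_lt.
Unshelve. all: by end_near. Qed.
Lemma cvgC_cst l : cvgC (fun=> l) l.
Proof. by rewrite /cvgC subrr normc0; exact: cvg_cst. Qed.
Lemma cvgC_squeeze u l (r : nat -> R) : (forall n, normc (u n - l) <= r n) ->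
  r n @[n --> \oo] --> (0 : R) -> cvgC u l.
Proof.
move=> ur r0; apply: (squeeze_cvgr _ (cvg_cst _) r0).
by apply: nearW => n; rewrite normc_ge0 ur.
Qed.
Lemma cvgC_unique u l l' : cvgC u l -> cvgC u l' -> l = l'.
Proof.
move=> h h'; apply: complex_eqP.
  by apply: (@cvg_unique _ _ (Re (u n) @[n --> \oo])) => //; exact: cvgC_Re.
by apply: (@cvg_unique _ _ (Im (u n) @[n --> \oo])) => //; exact: cvgC_Im.
Qed.
Lemma cvgCD u v l m : cvgC u l -> cvgC v m -> cvgC (fun n => u n + v n) (l + m).
Proof.
move=> hu hv; apply: (@cvgC_squeeze _ _ (fun n => normc (u n - l) + normc (v n - m))).
  by move=> n; rewrite opprD addrACA le_normcD.
by rewrite -[X in _ --> X]addr0; exact: cvgD.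
Qed.
Lemma cvgCM u v l m : cvgC u l -> cvgC v m -> cvgC (fun n => u n * v n) (l * m).
Proof.
move=> hu hv; apply: cvgC_ReIm.
  under eq_cvg do rewrite ReM.
  by rewrite ReM; apply: cvgB; apply: cvgM;
    [exact: cvgC_Re|exact: cvgC_Re|exact: cvgC_Im|exact: cvgC_Im].
under eq_cvg do rewrite ImM.
by rewrite ImM; apply: cvgD; apply: cvgM;
  [exact: cvgC_Re|exact: cvgC_Im|exact: cvgC_Im|exact: cvgC_Re].
Qed.
Lemma cvgC_normc u l : cvgC u l -> (normc (u n)) @[n --> \oo] --> normc l.
Proof.
move=> h; apply/cvgrPdistC_lt => e e0.
have /cvgr_lt/(_ _ e0) := h; apply: filterS => n /= ul.
by apply: le_lt_trans ul; exact: ler_normcB.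
Qed.
Lemma cvgC_conjc u l : cvgC u l -> cvgC (fun n => conjc (u n)) (conjc l).
Proof. by move=> h; apply: cvgC_squeeze h => n; rewrite -conjcB normc_conjc. Qed.
Lemma cvgC_prod I (r : seq I) (P : pred I) (F : nat -> I -> R[i]) (l : I -> R[i]) :
  (forall i, P i -> cvgC (F ^~ i) (l i)) ->
  cvgC (fun n => \prod_(i <- r | P i) F n i) (\prod_(i <- r | P i) l i).
Proof.
move=> h; elim: r => [|i r IH].
  by under [fun _ => _]eq_fun do rewrite big_nil; rewrite big_nil; exact: cvgC_cst.
under [fun _ => _]eq_fun do rewrite big_cons.
by rewrite big_cons; case: ifPn => // Pi; apply: cvgCM => //; exact: h.
Qed.

End complex_numbers.

Section measurable_complex.
Context {d : measure_display} {T : measurableType d} {R : realType}.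
Implicit Types (F G : T -> R[i]).
Local Notation Re := complex.Re.
Local Notation Im := complex.Im.

Definition mfC F := measurable_fun setT (fun x => Re (F x)) /\
  measurable_fun setT (fun x => Im (F x)).

Lemma mfC_cst (z : R[i]) : mfC (fun=> z).
Proof. by split; exact: measurable_cst. Qed.
Lemma mfC_real (f : T -> R) : measurable_fun setT f -> mfC (fun x => (f x)%:C).
Proof. by split => //; exact: measurable_cst. Qed.
Lemma mfC_complex (f g : T -> R) : measurable_fun setT f ->
  measurable_fun setT g -> mfC (fun x => f x +i* g x).
Proof. by []. Qed.
Lemma mfCD F G : mfC F -> mfC G -> mfC (fun x => F x + G x).
Proof.
move=> [a b] [c e]; split.
  by under eq_fun do rewrite ReD; exact: measurable_funD.
by under eq_fun do rewrite ImD; exact: measurable_funD.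
Qed.
Lemma mfCN F : mfC F -> mfC (fun x => - F x).
Proof.
move=> [a b]; split.
  by under eq_fun do rewrite ReN; exact: measurableT_comp.
by under eq_fun do rewrite ImN; exact: measurableT_comp.
Qed.
Lemma mfCB F G : mfC F -> mfC G -> mfC (fun x => F x - G x).
Proof. by move=> mF mG; apply: mfCD => //; exact: mfCN. Qed.
Lemma mfCM F G : mfC F -> mfC G -> mfC (fun x => F x * G x).
Proof.
move=> [a b] [c e]; split.
  under eq_fun do rewrite ReM.
  by apply: measurable_funB; exact: measurable_funM.
under eq_fun do rewrite ImM.
by apply: measurable_funD; exact: measurable_funM.
Qed.
Lemma mfC_conjc F : mfC F -> mfC (fun x => conjc (F x)).
Proof.
move=> [a b]; split; first by under eq_fun do rewrite Re_conjc.
by under eq_fun do rewrite Im_conjc; exact: measurableT_comp.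
Qed.
Lemma mfCX F k : mfC F -> mfC (fun x => F x ^+ k).
Proof.
move=> mF; elim: k => [|k IH]; first exact: mfC_cst.
by under [fun x => _]eq_fun do rewrite exprS; exact: mfCM.
Qed.
Lemma mfC_sum I (r : seq I) (P : pred I) (F : I -> T -> R[i]) :
  (forall i, mfC (F i)) -> mfC (fun x => \sum_(i <- r | P i) F i x).
Proof.
move=> mF; elim: r => [|i r IH].
  by under [fun x => _]eq_fun do rewrite big_nil; exact: mfC_cst.
under [fun x => _]eq_fun do rewrite big_cons.
by case: (P i) => //; exact: mfCD.
Qed.
Lemma mfC_prod I (r : seq I) (P : pred I) (F : I -> T -> R[i]) :
  (forall i, mfC (F i)) -> mfC (fun x => \prod_(i <- r | P i) F i x).
Proof.
move=> mF; elim: r => [|i r IH].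
  by under [fun x => _]eq_fun do rewrite big_nil; exact: mfC_cst.
under [fun x => _]eq_fun do rewrite big_cons.
by case: (P i) => //; exact: mfCM.
Qed.
Lemma mfC_expi (f : T -> R) : measurable_fun setT f -> mfC (fun x => expi (f x)).
Proof.
by move=> mf; split; apply: measurableT_comp => //;
  apply: continuous_measurable_fun; [exact: continuous_cos|exact: continuous_sin].
Qed.
Lemma measurable_normc F : mfC F -> measurable_fun setT (fun x => normc (F x)).
Proof.
move=> [a b]; rewrite (_ : (fun x => _) = (fun x => Num.sqrt (Re (F x) ^+ 2 + Im (F x) ^+ 2))).
  apply: (measurableT_comp (f := @Num.sqrt R)).
    by apply: continuous_measurable_fun; exact: sqrt_continuous.
  by apply: measurable_funD; exact: measurable_funX.
by apply/funext => x; rewrite -normc_sqr sqrtr_sqr ger0_norm ?normc_ge0.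
Qed.
Lemma mfC_cvg (F : nat -> T -> R[i]) G : (forall n, mfC (F n)) ->
  (forall x, cvgC (F ^~ x) (G x)) -> mfC G.
Proof.
move=> mF FG; split.
  apply: (measurable_fun_cvg (h := fun n x => Re (F n x))) => [n|x _].
    by have [] := mF n.
  exact: (cvgC_Re (FG x)).
apply: (measurable_fun_cvg (h := fun n x => Im (F n x))) => [n|x _].
  by have [] := mF n.
exact: (cvgC_Im (FG x)).
Qed.

End measurable_complex.

Lemma mfC_comp {d1 d2 : measure_display} {T1 : measurableType d1}
    {T2 : measurableType d2} {R : realType} (F : T2 -> R[i]) (h : T1 -> T2) :
  mfC F -> measurable_fun setT h -> mfC (fun x => F (h x)).
Proof. by move=> [a b] mh; split; [exact: (measurableT_comp a mh)|exact: (measurableT_comp b mh)]. Qed.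

Section complex_integral.
Context {d : measure_display} {T : measurableType d} {R : realType}.
Variable mu : {measure set T -> \bar R}.
Implicit Types (F G : T -> R[i]).
Local Notation Re := complex.Re.
Local Notation Im := complex.Im.

(** At Lebesgue measure on R^n this is convertible to [integralC]. An infinite integral is read as 0
    by [fine], which is why [intgC] accompanies nearly every identity between integrals. *)
Definition intC F : R[i] := (\int[mu]_x Re (F x)) +i* (\int[mu]_x Im (F x)).

Definition intgC F := mfC F /\ (\int[mu]_x (normc (F x))%:E < +oo)%E.

Lemma eq_intC F G : F =1 G -> intC F = intC G.
Proof. by move/funext => ->. Qed.

Lemma intgC_mfC F : intgC F -> mfC F. Proof. by case. Qed.

Lemma intgC_normc F : intgC F -> mu.-integrable setT (EFin \o (fun x => normc (F x))).
Proof.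
move=> [mF iF]; apply/integrableP; split.
  by apply/measurable_EFinP; exact: measurable_normc.
by under eq_integral do rewrite /= ger0_norm ?normc_ge0//.
Qed.

Lemma intgC_le_real F (g : T -> R) : mfC F ->
  mu.-integrable setT (EFin \o g) -> (forall x, normc (F x) <= g x) -> intgC F.
Proof.
move=> mF ig Fg; split => //.
have : mu.-integrable setT (EFin \o (fun x => normc (F x))).
  apply: le_integrable ig => //.
    by apply/measurable_EFinP; exact: measurable_normc.
  move=> x _ /=; rewrite lee_fin ger0_norm ?normc_ge0//.
  by rewrite (le_trans (Fg x))// ler_norm.
by move=> /integrableP[_]; under eq_integral do rewrite /= ger0_norm ?normc_ge0//.
Qed.

Lemma intgC_le F G : mfC F -> intgC G ->
  (forall x, normc (F x) <= normc (G x)) -> intgC F.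
Proof. by move=> mF /intgC_normc iG h; exact: intgC_le_real iG h. Qed.

Lemma intgC_Re F : intgC F -> mu.-integrable setT (EFin \o (fun x => Re (F x))).
Proof.
move=> iF; apply: le_integrable (intgC_normc iF) => //.
  by apply/measurable_EFinP; case: iF => -[].
by move=> x _ /=; rewrite lee_fin (ger0_norm (normc_ge0 _)) normc_Re_le.
Qed.
Lemma intgC_Im F : intgC F -> mu.-integrable setT (EFin \o (fun x => Im (F x))).
Proof.
move=> iF; apply: le_integrable (intgC_normc iF) => //.
  by apply/measurable_EFinP; case: iF => -[].
by move=> x _ /=; rewrite lee_fin (ger0_norm (normc_ge0 _)) normc_Im_le.
Qed.
Lemma intgC_ReIm F : mu.-integrable setT (EFin \o (fun x => Re (F x))) ->
  mu.-integrable setT (EFin \o (fun x => Im (F x))) -> intgC F.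
Proof.
move=> iR iI; apply: (@intgC_le_real _ (fun x => `|Re (F x)| + `|Im (F x)|)).
- by split; apply/measurable_EFinP; [move/measurable_int : iR|move/measurable_int : iI].
- have := integrableD measurableT (integrable_abse iR) (integrable_abse iI).
  by apply: eq_integrable.
- by move=> x; exact: normc_le_ReIm.
Qed.
Lemma intgC_real (f : T -> R) : mu.-integrable setT (EFin \o f) ->
  intgC (fun x => (f x)%:C).
Proof. by move=> h; apply: intgC_ReIm => //=; exact: integrable0. Qed.
Lemma intgC0 : intgC (fun=> 0).
Proof. by apply: intgC_ReIm; exact: integrable0. Qed.
Lemma intgCD F G : intgC F -> intgC G -> intgC (fun x => F x + G x).
Proof.
move=> iF iG; apply: intgC_ReIm.
  have := integrableD measurableT (intgC_Re iF) (intgC_Re iG).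
  by apply: eq_integrable => // x _ /=; rewrite ReD EFinD.
have := integrableD measurableT (intgC_Im iF) (intgC_Im iG).
by apply: eq_integrable => // x _ /=; rewrite ImD EFinD.
Qed.
Lemma intgCZ (a : R[i]) F : intgC F -> intgC (fun x => a * F x).
Proof.
move=> iF; apply: (@intgC_le_real _ (fun x => normc a * normc (F x))).
- by apply: mfCM; [exact: mfC_cst|exact: intgC_mfC iF].
- have := integrableZl measurableT (normc a) (intgC_normc iF).
  by apply: eq_integrable => // x _ /=; rewrite EFinM.
- by move=> x; rewrite normcM.
Qed.
Lemma intgCN F : intgC F -> intgC (fun x => - F x).
Proof. by move=> iF; apply: (intgC_le _ iF) => [|x]; [apply: mfCN; case: iF|rewrite normcN]. Qed.
Lemma intgCB F G : intgC F -> intgC G -> intgC (fun x => F x - G x).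
Proof. by move=> iF iG; apply: intgCD => //; exact: intgCN. Qed.
Lemma intgC_conjc F : intgC F -> intgC (fun x => conjc (F x)).
Proof.
by move=> iF; apply: (intgC_le _ iF) => [|x]; [apply: mfC_conjc; case: iF|rewrite normc_conjc].
Qed.
Lemma intgC_sum I (r : seq I) (P : pred I) (F : I -> T -> R[i]) :
  (forall i, intgC (F i)) -> intgC (fun x => \sum_(i <- r | P i) F i x).
Proof.
move=> mF; elim: r => [|i r IH].
  by under [fun x => _]eq_fun do rewrite big_nil; exact: intgC0.
under [fun x => _]eq_fun do rewrite big_cons.
by case: (P i) => //; exact: intgCD.
Qed.
Lemma intgC_bounded F G (M : R) : mfC F -> (forall x, normc (F x) <= M) ->
  intgC G -> intgC (fun x => F x * G x).
Proof.
move=> mF FM iG; apply: (intgC_le (G := fun x => M%:C * G x)).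
- by apply: mfCM => //; case: iG.
- exact: intgCZ.
- move=> x; rewrite !normcM ler_wpM2r ?normc_ge0// normc_real.
  by rewrite (le_trans (FM x))// ler_norm.
Qed.

Lemma intC0 : intC (fun=> 0) = 0.
Proof.
by rewrite /intC /Rintegral /= integral0.
Qed.
Lemma intCD F G : intgC F -> intgC G -> intC (fun x => F x + G x) = intC F + intC G.
Proof.
move=> iF iG; apply: complex_eqP => /=.
  rewrite -RintegralD//; [|exact: intgC_Re|exact: intgC_Re].
  by apply: eq_Rintegral => x _; rewrite ReD.
rewrite -RintegralD//; [|exact: intgC_Im|exact: intgC_Im].
by apply: eq_Rintegral => x _; rewrite ImD.
Qed.
Lemma intCZ (a : R[i]) F : intgC F -> intC (fun x => a * F x) = a * intC F.
Proof.
move=> iF; have iR := intgC_Re iF; have iI := intgC_Im iF.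
have iZ (b : R) (f : T -> R) : mu.-integrable setT (EFin \o f) ->
    mu.-integrable setT (EFin \o (fun x => b * f x)).
  move=> h; have := integrableZl measurableT b h.
  by apply: eq_integrable => // x _ /=; rewrite EFinM.
apply: complex_eqP => /=.
  rewrite ReM /= -!RintegralZl// -RintegralB//; [|exact: iZ|exact: iZ].
  by apply: eq_Rintegral => x _; rewrite ReM.
rewrite ImM /= -!RintegralZl// -RintegralD//; [|exact: iZ|exact: iZ].
by apply: eq_Rintegral => x _; rewrite ImM.
Qed.
Lemma intCZr (a : R[i]) F : intgC F -> intC (fun x => F x * a) = intC F * a.
Proof. by move=> iF; rewrite mulrC -intCZ//; apply: eq_intC => x; rewrite mulrC. Qed.
Lemma intCN F : intgC F -> intC (fun x => - F x) = - intC F.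
Proof.
move=> iF; rewrite -mulN1r -intCZ//; apply: eq_intC => x.
by rewrite mulN1r.
Qed.
Lemma intCB F G : intgC F -> intgC G -> intC (fun x => F x - G x) = intC F - intC G.
Proof. by move=> iF iG; rewrite intCD ?intCN//; exact: intgCN. Qed.
Lemma intC_conjc F : intgC F -> intC (fun x => conjc (F x)) = conjc (intC F).
Proof.
move=> iF; apply: complex_eqP => /=; first by apply: eq_Rintegral => x _; rewrite Re_conjc.
rewrite -mulN1r -RintegralZl//; last exact: intgC_Im.
by apply: eq_Rintegral => x _; rewrite Im_conjc mulN1r.
Qed.
Lemma intC_sum I (r : seq I) (P : pred I) (F : I -> T -> R[i]) :
  (forall i, intgC (F i)) ->
  intC (fun x => \sum_(i <- r | P i) F i x) = \sum_(i <- r | P i) intC (F i).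
Proof.
move=> mF; elim: r => [|i r IH].
  by under [fun x => _]eq_fun do rewrite big_nil; rewrite big_nil intC0.
under [fun x => _]eq_fun do rewrite big_cons.
rewrite big_cons; case: (P i) => //; rewrite intCD ?IH//.
by apply: intgC_sum.
Qed.
Lemma intC_real (f : T -> R) : intC (fun x => (f x)%:C) = (\int[mu]_x f x)%:C.
Proof. by apply: complex_eqP => //=; rewrite /Rintegral integral0. Qed.

(** Multiplying by the conjugate of the value z of the integral turns |z|^2 into the integral of a
    real function, to which the real inequality applies. *)
Lemma normc_intC F : intgC F -> normc (intC F) <= \int[mu]_x normc (F x).
Proof.
move=> iF; have [z zE] : {z | z = intC F} by exists (intC F).
rewrite -zE.
have [->|z0] := eqVneq z 0.
  by rewrite normc0; apply: Rintegral_ge0 => x _; exact: normc_ge0.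
have nz : 0 < normc z.
  by rewrite lt_neqAle normc_ge0 andbT eq_sym; apply: contra_neq z0 => /eq0_normc.
rewrite -(ler_pM2l nz) -expr2.
have -> : normc z ^+ 2 = Re (intC (fun x => conjc z * F x)).
  by rewrite intCZ// -zE mulrC mul_conjc.
rewrite /= -RintegralZl//; last exact: intgC_normc.
apply: le_Rintegral => //.
- exact: (intgC_Re (intgCZ _ iF)).
- have := integrableZl measurableT (normc z) (intgC_normc iF).
  by apply: eq_integrable => // x _ /=; rewrite EFinM.
- move=> x _; apply: le_trans (ler_norm _) _.
  by apply: le_trans (normc_Re_le _) _; rewrite normcM normc_conjc.
Qed.

Lemma EFin_int_normc F : intgC F ->
  (\int[mu]_x normc (F x))%:E = (\int[mu]_x (normc (F x))%:E)%E.
Proof.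
move=> iF; rewrite /Rintegral fineK//.
exact: (integrable_fin_num _ (intgC_normc iF)).
Qed.

Lemma normc_intC_le F : mfC F ->
  ((normc (intC F))%:E <= \int[mu]_x (normc (F x))%:E)%E.
Proof.
move=> mF; have [h|] := ltP (\int[mu]_x (normc (F x))%:E)%E +oo%E.
  have iF : intgC F by split.
  by rewrite -EFin_int_normc// lee_fin normc_intC.
by rewrite leye_eq => /eqP ->; rewrite leey.
Qed.

Lemma dominatedR (f : nat -> T -> R) (l g : T -> R) :
  (forall n, measurable_fun setT (f n)) -> measurable_fun setT l ->
  (forall x, f n x @[n --> \oo] --> l x) ->
  mu.-integrable setT (EFin \o g) -> (forall n x, `|f n x| <= g x) ->
  (\int[mu]_x f n x)%R @[n --> \oo] --> (\int[mu]_x l x)%R.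
Proof.
move=> mf ml fl ig fg.
have lg x : `|l x| <= g x.
  have h : `|f n x| @[n --> \oo] --> `|l x| by apply: cvg_norm; exact: fl.
  rewrite -(cvg_lim _ h)//; apply: limr_le; first by apply/cvg_ex; exists `|l x|.
  by apply: nearW => n; exact: fg.
have il : mu.-integrable setT (EFin \o l).
  apply: le_integrable ig => //; first exact/measurable_EFinP.
  by move=> x _ /=; rewrite lee_fin (le_trans (lg x))// ler_norm.
have H1 : {ae mu, forall x, setT x -> (EFin \o f n) x @[n --> \oo] --> (EFin \o l) x}.
  by apply: aeW => x _; apply: cvg_EFin; [exact: nearW|exact: fl].
have H2 : {ae mu, forall x n, setT x -> (`|(EFin \o f n) x| <= (EFin \o g) x)%E}.
  by apply: aeW => x n _ /=; rewrite lee_fin.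
have [_ _ h] := dominated_convergence measurableT
  (fun n => (measurable_EFinP _ _).2 (mf n)) ((measurable_EFinP _ _).2 ml) H1 ig H2.
apply: fine_cvg; rewrite fineK//.
exact: (integrable_fin_num _ il).
Qed.

Lemma dominatedC (F : nat -> T -> R[i]) G (g : T -> R) :
  (forall n, mfC (F n)) -> (forall x, cvgC (F ^~ x) (G x)) ->
  mu.-integrable setT (EFin \o g) -> (forall n x, normc (F n x) <= g x) ->
  intgC G /\ cvgC (fun n => intC (F n)) (intC G).
Proof.
move=> mF FG ig Fg.
have mG : mfC G by exact: mfC_cvg FG.
have Gg x : normc (G x) <= g x.
  have h := cvgC_normc (FG x).
  rewrite -(cvg_lim _ h)//; apply: limr_le; first by apply/cvg_ex; exists (normc (G x)).
  by apply: nearW => n; exact: Fg.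
have iG : intgC G by exact: intgC_le_real ig Gg.
have iF n : intgC (F n) by exact: intgC_le_real ig (Fg n).
split => //; apply: cvgC_ReIm.
- apply: (dominatedR (fun n => (mF n).1) mG.1 _ ig) => [x|n x].
    exact: cvgC_Re (FG x).
  exact: le_trans (normc_Re_le _) (Fg n x).
- apply: (dominatedR (fun n => (mF n).2) mG.2 _ ig) => [x|n x].
    exact: cvgC_Im (FG x).
  exact: le_trans (normc_Im_le _) (Fg n x).
Qed.

End complex_integral.

Section pushforwardC.
Context {d1 d2 : measure_display} {X : measurableType d1} {Y : measurableType d2} {R : realType}.
Variables (mu : {measure set X -> \bar R}) (nu : {measure set Y -> \bar R}) (h : X -> Y).
Hypothesis mh : measurable_fun setT h.
Hypothesis nuE : forall A, measurable A -> nu A = mu (h @^-1` A).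

Lemma ge0_integral_change (f : Y -> \bar R) : measurable_fun setT f ->
  (forall y, 0 <= f y)%E -> (\int[nu]_y f y = \int[mu]_x f (h x))%E.
Proof.
move=> mf f0; have := @ge0_integral_pushforward _ _ _ _ _ _ mh mu setT f measurableT mf.
rewrite preimage_setT => <-//; apply: eq_measure_integral => A mA _.
exact: nuE.
Qed.

Lemma integral_change (f : Y -> \bar R) : measurable_fun setT f ->
  (\int[nu]_y f y = \int[mu]_x f (h x))%E.
Proof.
move=> mf; rewrite integralE [RHS]integralE.
rewrite (ge0_integral_change (measurable_funepos mf))//.
rewrite (ge0_integral_change (measurable_funeneg mf))//.
by congr (_ - _)%E; apply: eq_integral => x _; rewrite !unlock.
Qed.

Lemma intC_change (F : Y -> R[i]) : mfC F -> intC nu F = intC mu (fun x => F (h x)).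
Proof.
move=> [mR mI]; rewrite /intC /Rintegral !integral_change//; exact/measurable_EFinP.
Qed.

Lemma intgC_change (F : Y -> R[i]) : mfC F -> intgC nu F <-> intgC mu (fun x => F (h x)).
Proof.
move=> mF; have e : (\int[nu]_y (normc (F y))%:E = \int[mu]_x (normc (F (h x)))%:E)%E.
  rewrite ge0_integral_change//; last by move=> y; rewrite lee_fin normc_ge0.
  by apply/measurable_EFinP; exact: measurable_normc.
split => -[_ h1]; split => //; first exact: (mfC_comp mF mh).
- by rewrite -e.
- by rewrite e.
Qed.

End pushforwardC.

(** * Tonelli and Fubini for complex integrands *)

Section fubiniC.
Context {d1 d2 : measure_display} {X : measurableType d1} {Y : measurableType d2} {R : realType}.
Variables (m1 : {sigma_finite_measure set X -> \bar R})
  (m2 : {sigma_finite_measure set Y -> \bar R}).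
Local Notation Re := complex.Re.
Local Notation Im := complex.Im.
Implicit Types (F : X * Y -> R[i]) (f : X * Y -> R).

Lemma intgC_tonelli1 F : mfC F ->
  (\int[m1]_x \int[m2]_y (normc (F (x, y)))%:E < +oo)%E -> intgC (m1 \x m2)%E F.
Proof.
move=> mF h; split => //; rewrite fubini_tonelli1//; last by move=> z; rewrite lee_fin normc_ge0.
by apply/measurable_EFinP; exact: measurable_normc.
Qed.
Lemma intgC_tonelli2 F : mfC F ->
  (\int[m2]_y \int[m1]_x (normc (F (x, y)))%:E < +oo)%E -> intgC (m1 \x m2)%E F.
Proof.
move=> mF h; split => //; rewrite fubini_tonelli2//; last by move=> z; rewrite lee_fin normc_ge0.
by apply/measurable_EFinP; exact: measurable_normc.
Qed.

(** The inner integral is finite only for almost every x, so its [fine] is removed through an almost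
    everywhere equality. *)
Let Rint1 f : (m1 \x m2)%E.-integrable setT (EFin \o f) ->
  (\int[(m1 \x m2)%E]_z f z)%R = (\int[m1]_x \int[m2]_y f (x, y))%R.
Proof.
move=> If; rewrite /Rintegral -integral12_prod_meas1//; congr fine.
apply: ae_eq_integral => //.
- exact: (measurable_fubini_F If).
- apply/measurable_EFinP; apply: measurableT_comp => //.
  exact: (measurable_fubini_F If).
- have := integrable_ae measurableT (integrable_fubini_F If).
  by apply: filterS => x /(_ I) h _; rewrite fineK.
Qed.
Let Rint2 f : (m1 \x m2)%E.-integrable setT (EFin \o f) ->
  (\int[(m1 \x m2)%E]_z f z)%R = (\int[m2]_y \int[m1]_x f (x, y))%R.
Proof.
move=> If; rewrite /Rintegral -integral21_prod_meas1//; congr fine.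
apply: ae_eq_integral => //.
- exact: (measurable_fubini_G If).
- apply/measurable_EFinP; apply: measurableT_comp => //.
  exact: (measurable_fubini_G If).
- have := ae_integrable2 If; apply: filterS => y h _.
  by rewrite fineK//; exact: (integrable_fin_num _ h).
Qed.
Let mRint1 f : (m1 \x m2)%E.-integrable setT (EFin \o f) ->
  measurable_fun setT (fun x => \int[m2]_y f (x, y))%R.
Proof.
by move=> If; apply: measurableT_comp => //; exact: (measurable_fubini_F If).
Qed.
Let mRint2 f : (m1 \x m2)%E.-integrable setT (EFin \o f) ->
  measurable_fun setT (fun y => \int[m1]_x f (x, y))%R.
Proof.
by move=> If; apply: measurableT_comp => //; exact: (measurable_fubini_G If).
Qed.

Lemma fubiniC1 F : intgC (m1 \x m2)%E F ->
  intC (m1 \x m2)%E F = intC m1 (fun x => intC m2 (fun y => F (x, y))).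
Proof. by move=> iF; rewrite /intC /= (Rint1 (intgC_Re iF)) (Rint1 (intgC_Im iF)). Qed.
Lemma fubiniC2 F : intgC (m1 \x m2)%E F ->
  intC (m1 \x m2)%E F = intC m2 (fun y => intC m1 (fun x => F (x, y))).
Proof. by move=> iF; rewrite /intC /= (Rint2 (intgC_Re iF)) (Rint2 (intgC_Im iF)). Qed.
Lemma fubiniC F : intgC (m1 \x m2)%E F ->
  intC m1 (fun x => intC m2 (fun y => F (x, y))) =
  intC m2 (fun y => intC m1 (fun x => F (x, y))).
Proof. by move=> iF; rewrite -fubiniC1// fubiniC2. Qed.
Lemma intgC_fubini1 F : intgC (m1 \x m2)%E F -> intgC m1 (fun x => intC m2 (fun y => F (x, y))).
Proof.
move=> iF; have mF := intgC_mfC iF; split.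
  by split; [exact: mRint1 (intgC_Re iF)|exact: mRint1 (intgC_Im iF)].
have : (\int[m1]_x \int[m2]_y (normc (F (x, y)))%:E < +oo)%E.
  case: iF => _; rewrite fubini_tonelli1//; last by move=> z; rewrite lee_fin normc_ge0.
  by apply/measurable_EFinP; exact: measurable_normc.
apply: le_lt_trans; apply: ge0_le_integral => //.
- by move=> x _; rewrite lee_fin normc_ge0.
- apply/measurable_EFinP; apply: measurable_normc.
  by split; [exact: mRint1 (intgC_Re iF)|exact: mRint1 (intgC_Im iF)].
- apply: (measurable_fun_fubini_tonelli_F (fun z => (normc (F z))%:E)) => //.
    by apply/measurable_EFinP; exact: measurable_normc.
  by move=> z; rewrite lee_fin normc_ge0.
- by move=> x _; apply: normc_intC_le; apply: (mfC_comp mF); exact: pair1_measurable.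
Qed.
Lemma intgC_fubini2 F : intgC (m1 \x m2)%E F -> intgC m2 (fun y => intC m1 (fun x => F (x, y))).
Proof.
move=> iF; have mF := intgC_mfC iF; split.
  by split; [exact: mRint2 (intgC_Re iF)|exact: mRint2 (intgC_Im iF)].
have : (\int[m2]_y \int[m1]_x (normc (F (x, y)))%:E < +oo)%E.
  case: iF => _; rewrite fubini_tonelli2//; last by move=> z; rewrite lee_fin normc_ge0.
  by apply/measurable_EFinP; exact: measurable_normc.
apply: le_lt_trans; apply: ge0_le_integral => //.
- by move=> x _; rewrite lee_fin normc_ge0.
- apply/measurable_EFinP; apply: measurable_normc.
  by split; [exact: mRint2 (intgC_Re iF)|exact: mRint2 (intgC_Im iF)].
- apply: (measurable_fun_fubini_tonelli_G (fun z => (normc (F z))%:E)) => //.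
    by apply/measurable_EFinP; exact: measurable_normc.
  by move=> z; rewrite lee_fin normc_ge0.
- by move=> x _; apply: normc_intC_le; apply: (mfC_comp mF); exact: pair2_measurable.
Qed.

Lemma ae_intgC1 F : intgC (m1 \x m2)%E F ->
  {ae m1, forall x, intgC m2 (fun y => F (x, y))}.
Proof.
move=> iF; have := ae_integrable1 (intgC_normc iF); apply: filterS => x h.
apply: (intgC_le_real _ h) => //.
by apply: (mfC_comp (intgC_mfC iF)); exact: pair1_measurable.
Qed.

(** Measurability passes to the section integrals: Tonelli handles the positive and negative parts,
    and their difference is a measurable extended real function even where it is not finite. *)
Lemma mfC_fubini1 F : mfC F -> mfC (fun x => intC m2 (fun y => F (x, y))).
Proof.
move=> mF.
have H (f : X * Y -> R) : measurable_fun setT f ->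
    measurable_fun setT (fun x => \int[m2]_y f (x, y))%R.
  move=> mf; apply: measurableT_comp => //.
  rewrite (_ : (fun x => _) = (fun x => (\int[m2]_y (EFin \o f)^\+ (x, y)) -
      (\int[m2]_y (EFin \o f)^\- (x, y)))%E); last first.
    apply/funext => x; rewrite integralE.
    by congr (_ - _)%E; apply: eq_integral => y _; rewrite !unlock.
  apply: emeasurable_funB.
    apply: (measurable_fun_fubini_tonelli_F (EFin \o f)^\+%E) => //.
    by apply: measurable_funepos; exact/measurable_EFinP.
  apply: (measurable_fun_fubini_tonelli_F (EFin \o f)^\-%E) => //.
  by apply: measurable_funeneg; exact/measurable_EFinP.
by split; [exact: (H _ mF.1)|exact: (H _ mF.2)].
Qed.

Lemma intgC_prod (f : X -> R[i]) (g : Y -> R[i]) : intgC m1 f -> intgC m2 g ->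
  intgC (m1 \x m2)%E (fun z => f z.1 * g z.2).
Proof.
move=> iF iG; apply: intgC_tonelli1.
  apply: mfCM; first exact: (mfC_comp (intgC_mfC iF) measurable_fst).
  exact: (mfC_comp (intgC_mfC iG) measurable_snd).
have mg : measurable_fun setT (fun y => (normc (g y))%:E).
  by apply/measurable_EFinP; apply: measurable_normc; exact: intgC_mfC iG.
have mf : measurable_fun setT (fun x => (normc (f x))%:E).
  by apply/measurable_EFinP; apply: measurable_normc; exact: intgC_mfC iF.
have e x : (\int[m2]_y (normc (f x * g y))%:E =
    (normc (f x))%:E * \int[m2]_y (normc (g y))%:E)%E.
  rewrite -(ge0_integralZl m2 measurableT mg)//.
  - by apply: eq_integral => y _; rewrite normcM EFinM.
  - by move=> y _; rewrite lee_fin normc_ge0.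
  - by rewrite lee_fin normc_ge0.
under eq_integral do rewrite /= e.
rewrite (ge0_integralZr m1 measurableT mf)//; last 2 first.
- by move=> y _; rewrite lee_fin normc_ge0.
- by apply: integral_ge0 => y _; rewrite lee_fin normc_ge0.
by rewrite -!EFin_int_normc// -EFinM ltry.
Qed.

Lemma intC_prod (f : X -> R[i]) (g : Y -> R[i]) : intgC m1 f -> intgC m2 g ->
  intC (m1 \x m2)%E (fun z => f z.1 * g z.2) = intC m1 f * intC m2 g.
Proof.
move=> iF iG; rewrite fubiniC1/=; last exact: intgC_prod.
rewrite -intCZr//; apply: eq_intC => x; exact: intCZ.
Qed.

End fubiniC.

(** * Lebesgue measure on row vectors *)

Section borel_rV.
Context {R : realType}.

Lemma rV_ballP n (x y : 'rV[R]_n) (e : R) : 0 < e ->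
  ball x e y <-> forall i, `|x ord0 i - y ord0 i| < e.
Proof.
move=> e0; split => [[_ h] i|h]; first exact: h.
by split => // i j; rewrite ord1; exact: h.
Qed.

(** Links the topology of row vectors to the sigma-algebra generated by the coordinates: an open set
    is the union of the countably many boxes with rational centre and radius 1/(k+1) that it
    contains. [C a] is empty for the other boxes. *)
Lemma rV_open_measurable n (U : set 'rV[R]_n) : open U -> measurable U.
Proof.
move=> oU.
pose B (a : 'rV[rat]_n * nat) : set 'rV[R]_n :=
  [set y | forall i, `|ratr (a.1 ord0 i) - y ord0 i| < a.2.+1%:R^-1].
pose C a : set 'rV[R]_n := if `[< B a `<=` U >] then B a else set0.
have mB a : measurable (B a).
  rewrite (_ : B a = \bigcap_(i in [set: 'I_n])
      (fun y : 'rV[R]_n => y ord0 i) @^-1` ball (ratr (a.1 ord0 i) : R) a.2.+1%:R^-1).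
    apply: fin_bigcap_measurable => // i _.
    rewrite -[X in measurable X]setTI; apply: measurable_coord_rV => //.
    exact: measurable_ball.
  by apply/seteqP; split => [y h i _|y h i]; exact: h.
have -> : U = \bigcup_a C a.
  apply/seteqP; split => [x Ux|x [a _]]; last by rewrite /C; case: asboolP => //; exact.
  have /nbhs_ballP[e /= e0 xeU] : nbhs x U by exact: open_nbhs_nbhs.
  (* A box of radius 1/(k+1) whose centre is within 1/(k+1) of x contains x and lies within 2/(k+1)
     of it. *)
  have [k ke] : exists k, 2 * k.+1%:R^-1 < e.
    have /(_ (e / 2)) [|k hk] := @ltr_add_invr R 0; first by rewrite divr_gt0.
    by exists k; rewrite mulrC -ltr_pdivlMr//; rewrite add0r in hk.
  have k0 : 0 < k.+1%:R^-1 :> R by rewrite invr_gt0.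
  have [q hq] : exists q : 'I_n -> rat, forall i, `|ratr (q i) - x ord0 i| < k.+1%:R^-1.
    have H i : exists r : rat, `|ratr r - x ord0 i| < k.+1%:R^-1.
      have [r] : exists r : rat, ratr r \in `]x ord0 i, (x ord0 i + k.+1%:R^-1)[.
        by apply: rat_in_itvoo; rewrite ltrDl.
      rewrite in_itv /= => /andP[h1 h2]; exists r; rewrite ltr_distl h2 andbT.
      by rewrite (lt_trans _ h1)// ltrBlDr ltrDl.
    by exists (fun i => sval (cid (H i))) => i; exact: (svalP (cid (H i))).
  exists (\row_i q i, k) => //; rewrite /C; case: asboolP => [_ i|[]].
    by rewrite /= mxE; exact: hq.
  move=> y h; apply: xeU; apply/rV_ballP => // i.
  apply: le_lt_trans ke; rewrite mulr_natl mulr2n.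
  rewrite -[X in `|X|](subrKA (ratr (q i))); apply: le_trans (ler_normD _ _) _.
  rewrite lerD// ltW//; first by rewrite distrC; exact: hq.
  by have := h i; rewrite /= mxE.
apply: countable_bigcupT_measurable; first exact: countableP.
by move=> a; rewrite /C; case: asboolP.
Qed.

Lemma continuous_measurable_rV n (f : 'rV[R]_n -> R) :
  continuous f -> measurable_fun setT f.
Proof.
move=> cf; apply: (measurability _ (RGenOpens.measurableE R)).
move=> _ [_ [a [b ->] <-]]; rewrite setTI; apply: rV_open_measurable.
by move/continuousP : cf; apply; exact: interval_open.
Qed.

Lemma measurable_row_mx d (T : measurableType d) m n (f : T -> 'rV[R]_m) (g : T -> 'rV[R]_n) :
  measurable_fun setT f -> measurable_fun setT g ->
  measurable_fun setT (fun t => row_mx (f t) (g t)).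
Proof.
move=> mf mg; apply: measurable_fun_rV => i; case: (splitP i) => j ij.
  rewrite (_ : i = lshift n j); last exact: val_inj.
  by under eq_fun do rewrite row_mxEl; exact: (measurableT_comp (@measurable_coord_rV R m j) mf).
rewrite (_ : i = rshift m j); last exact: val_inj.
by under eq_fun do rewrite row_mxEr; exact: (measurableT_comp (@measurable_coord_rV R n j) mg).
Qed.
Lemma measurable_lsubmx m n : measurable_fun setT (fun z : 'rV[R]_(m + n) => lsubmx z).
Proof. by apply: measurable_fun_rV => i; under eq_fun do rewrite mxE; exact: measurable_coord_rV. Qed.
Lemma measurable_rsubmx m n : measurable_fun setT (fun z : 'rV[R]_(m + n) => rsubmx z).
Proof. by apply: measurable_fun_rV => i; under eq_fun do rewrite mxE; exact: measurable_coord_rV. Qed.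
Lemma measurable_coordT d (T : measurableType d) n (f : T -> 'rV[R]_n) i :
  measurable_fun setT f -> measurable_fun setT (fun t => f t ord0 i).
Proof. by move=> mf; exact: (measurableT_comp (@measurable_coord_rV R n i) mf). Qed.
Lemma measurable_addrV d (T : measurableType d) n (f g : T -> 'rV[R]_n) :
  measurable_fun setT f -> measurable_fun setT g ->
  measurable_fun setT (fun t => f t + g t).
Proof.
move=> mf mg; apply: measurable_fun_rV => i; under eq_fun do rewrite mxE.
by apply: measurable_funD; exact: measurable_coordT.
Qed.
Lemma measurable_scalerV d (T : measurableType d) n (f : T -> 'rV[R]_n) (c : R) :
  measurable_fun setT f -> measurable_fun setT (fun t => c *: f t).
Proof.
move=> mf; apply: measurable_fun_rV => i; under eq_fun do rewrite mxE.
by apply: measurable_funM => //; exact: measurable_coordT.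
Qed.
Lemma measurable_subrV d (T : measurableType d) n (f g : T -> 'rV[R]_n) :
  measurable_fun setT f -> measurable_fun setT g ->
  measurable_fun setT (fun t => f t - g t).
Proof.
move=> mf mg; under eq_fun do rewrite -scaleN1r.
by apply: measurable_addrV => //; exact: measurable_scalerV.
Qed.
Lemma measurable_dotR d (T : measurableType d) n (f g : T -> 'rV[R]_n) :
  measurable_fun setT f -> measurable_fun setT g ->
  measurable_fun setT (fun t => dotR (f t) (g t)).
Proof.
move=> mf mg; apply: measurable_sum => i.
by apply: measurable_funM; exact: measurable_coordT.
Qed.

End borel_rV.

Section affine_line.
Context {R : realType}.
Local Notation leb := (@lebesgue_measure R).
Local Open Scope ereal_scope.

Let mshift (c a : R) : measurable_fun setT (fun t : measurableTypeR R => (c * t + a)%R : measurableTypeR R).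
Proof. by apply: measurable_funD => //; exact: measurable_funM. Qed.

(** By uniqueness of Lebesgue measure: c times its pushforward under t -> c t + a has the right
    value on half-open intervals. *)
Let affine_pos (c a : R) (f : R -> \bar R) : (0 < c)%R -> measurable_fun setT f ->
  (forall t, 0 <= f t) -> \int[leb]_t f (c * t + a)%R = (c^-1)%:E * \int[leb]_t f t.
Proof.
move=> c0 mf f0.
pose h := fun t : measurableTypeR R => (c * t + a)%R : measurableTypeR R.
pose k : {nonneg R} := NngNum (ltW c0).
have mE A : measurable A -> leb A = mscale k leb (h @^-1` A).
  move=> mA.
  pose nu0 : {measure set _ -> \bar _} :=
    measure_function_pushforward__canonical__measure_function_Measure leb (mshift c a).
  suff H : leb A = mscale k nu0 A by exact: H.
  apply: lebesgue_measure_unique => // _ [[x y] _ <-].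
  rewrite /= /mscale /nu0 /= /pushforward -/h.
  have -> : h @^-1` `]x, y]%classic = `]((x - a) / c)%R, ((y - a) / c)%R]%classic.
    by apply/seteqP; split => t /=; rewrite !in_itv/= ltr_pdivrMr// ler_pdivlMr// ltrBlDr lerBrDr
      [(t * c)%R]mulrC.
  rewrite !lebesgue_measure_itv/= !lte_fin ltr_pM2r ?invr_gt0// ltrD2r.
  case: ifP => // _; last by rewrite mule0.
  rewrite -?EFinN -!EFinD -EFinM; congr EFin; rewrite -mulrBl opprB addrA subrK.
  by rewrite mulrCA divff ?mulr1// gt_eqF.
have mfh : measurable_fun setT (fun t => f (h t)).
  by apply: (measurableT_comp mf); exact: mshift.
have -> : \int[leb]_t f t = \int[mscale k leb]_t f (h t).
  by rewrite (ge0_integral_change (mshift c a) mE).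
by rewrite ge0_integral_mscale// muleA -EFinM mulVf ?gt_eqF// mul1e.
Qed.

Lemma integral_affine (c a : R) (f : R -> \bar R) : c != 0%R -> measurable_fun setT f ->
  (forall t, 0 <= f t) -> \int[leb]_t f (c * t + a)%R = (`|c|^-1)%:E * \int[leb]_t f t.
Proof.
move=> c0 mf f0; have [cp|cn|/eqP] := ltrgt0P c; last by rewrite (negbTE c0).
  exact: affine_pos.
rewrite -(@affine_pos (- c) a f)//; last by rewrite oppr_gt0.
have mN : measurable_fun setT (-%R : measurableTypeR R -> measurableTypeR R).
  by apply: continuous_measurable_fun; exact: opp_continuous.
have NE A : measurable A -> leb A = leb ((-%R : measurableTypeR R -> measurableTypeR R) @^-1` A).
  by move=> mA; rewrite -[LHS](lebesgue_measureN mA).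
rewrite [RHS](ge0_integral_change mN NE)//.
  by apply: eq_integral => t _; rewrite mulrNN.
by apply: (measurableT_comp mf); exact: mshift.
Qed.

End affine_line.

Lemma integral_indicT {d : measure_display} {T : measurableType d} {R : realType}
    (mu : {measure set T -> \bar R}) (A : set T) : measurable A ->
  (\int[mu]_x (\1_A x)%:E = mu A)%E.
Proof. by move=> mA; rewrite integral_indic// setIT. Qed.

(** * Splitting Lebesgue measure on R^n along groups of coordinates *)

Section tonelli_rV.
Context {R : realType}.
Local Notation leb n := (lebesgue_rV R n).
Local Notation leb1 := (@lebesgue_measure R).
Local Open Scope ereal_scope.

Lemma integral_rV0 (f : 'rV[R]_0 -> \bar R) : measurable_fun setT f ->
  \int[leb 0]_x f x = f 0%R.
Proof. by move=> mf; rewrite integral_dirac// diracT mul1e. Qed.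

Lemma lebesgue_rVS n (A : set 'rV[R]_n.+1) : measurable A ->
  leb n.+1 A = (leb1 \x leb n) (@cons_rV R n @^-1` A).
Proof. by []. Qed.

Lemma integral_rVS n (f : 'rV[R]_n.+1 -> \bar R) : measurable_fun setT f ->
  (forall x, 0 <= f x) ->
  \int[leb n.+1]_x f x = \int[leb1]_t \int[leb n]_v f (cons_rV (t, v)).
Proof.
move=> mf f0.
rewrite (ge0_integral_change (@measurable_cons_rV R n) (@lebesgue_rVS n))//.
rewrite fubini_tonelli1//.
by apply: (measurableT_comp mf); exact: measurable_cons_rV.
Qed.

Lemma measurable_row_mx2 m n :
  measurable_fun setT (fun p : 'rV[R]_m * 'rV[R]_n => row_mx p.1 p.2).
Proof. by apply: measurable_row_mx; [exact: measurable_fst|exact: measurable_snd]. Qed.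

Lemma row_mx_cons m n t (v : 'rV[R]_m) (w : 'rV[R]_n) :
  row_mx (cons_rV (t, v)) w = cons_rV (t, row_mx v w) :> 'rV[R]_(m.+1 + n).
Proof.
apply/rowP => i; rewrite [RHS]mxE; case: unliftP => [j ->|->] /=.
  case: (splitP j) => k jk.
    rewrite (_ : j = lshift n k) ?row_mxEl; last exact: val_inj.
    rewrite (_ : lift ord0 _ = lshift n (lift ord0 k)) ?row_mxEl; last exact: val_inj.
    by rewrite mxE liftK.
  rewrite (_ : j = rshift m k) ?row_mxEr; last exact: val_inj.
  by rewrite (_ : lift ord0 _ = rshift m.+1 k) ?row_mxEr//; exact: val_inj.
rewrite (_ : ord0 = lshift n ord0) ?row_mxEl; last exact: val_inj.
by rewrite mxE unlift_none.
Qed.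

(** Induction peels the first coordinate off the left block; [m.+1 + n] and [(m + n).+1] are
    convertible, which lets [row_mx_cons] identify the two ways of listing the coordinates. *)
Lemma integral_rVD m n (f : 'rV[R]_(m + n) -> \bar R) : measurable_fun setT f ->
  (forall x, 0 <= f x) ->
  \int[leb (m + n)]_z f z = \int[leb m]_x \int[leb n]_y f (row_mx x y).
Proof.
elim: m f => [|m IH] f mf f0.
  rewrite integral_rV0.
    by apply: eq_integral => y _; rewrite row_thin_mx.
  apply: (measurable_fun_fubini_tonelli_F (fun p : 'rV[R]_0 * 'rV[R]_n => f (row_mx p.1 p.2))) => //.
  by apply: (measurableT_comp mf); exact: measurable_row_mx2.
have mg : measurable_fun setT (fun p : measurableTypeR R * 'rV[R]_(m + n) => f (cons_rV p)).
  by apply: (measurableT_comp mf); exact: measurable_cons_rV.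
transitivity (\int[leb1]_t \int[leb (m + n)]_v f (cons_rV (t, v))).
  exact: integral_rVS.
rewrite integral_rVS; last 2 first.
- apply: (measurable_fun_fubini_tonelli_F
    (fun p : 'rV[R]_m.+1 * 'rV[R]_n => f (row_mx p.1 p.2))) => //.
  by apply: (measurableT_comp mf); exact: measurable_row_mx2.
- by move=> x; exact: integral_ge0.
apply: eq_integral => t _; rewrite IH//.
  by apply: eq_integral => v _; apply: eq_integral => w _; rewrite -row_mx_cons.
by apply: (measurableT_comp mg); exact: pair1_measurable.
Qed.

Lemma lebesgue_rVD m n (A : set 'rV[R]_(m + n)) : measurable A ->
  leb (m + n) A = (leb m \x leb n) ((fun p => row_mx p.1 p.2) @^-1` A).
Proof.
move=> mA.
rewrite -integral_indicT//.
have mi : measurable_fun setT (fun z : 'rV[R]_(m + n) => (\1_A z)%:E : \bar R).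
  exact/measurable_EFinP.
rewrite integral_rVD//.
have mB : measurable ((fun p : 'rV[R]_m * 'rV[R]_n => row_mx p.1 p.2) @^-1` A).
  by rewrite -[X in measurable X]setTI; exact: measurable_row_mx2.
rewrite -[RHS]integral_indicT//.
rewrite fubini_tonelli1//; last exact/measurable_EFinP.
Qed.

Lemma integral_affine_rV n (c : R) (a : 'rV[R]_n) (f : 'rV[R]_n -> \bar R) :
  c != 0%R -> measurable_fun setT f -> (forall x, 0 <= f x) ->
  \int[leb n]_x f (c *: x + a)%R = ((`|c| ^+ n)^-1)%:E * \int[leb n]_x f x.
Proof.
move=> c0; elim: n a f => [|n IH] a f mf f0.
  rewrite expr0 invr1 mul1e !integral_rV0//.
    by congr f; apply/rowP => -[].
  apply: (measurableT_comp mf); apply: measurable_addrV => //.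
  by apply: measurable_scalerV.
have mfa : measurable_fun setT (fun x : 'rV[R]_n.+1 => f (c *: x + a)%R).
  by apply: (measurableT_comp mf); apply: measurable_addrV => //; exact: measurable_scalerV.
rewrite !integral_rVS//.
pose a' : 'rV[R]_n := (\row_j a ord0 (lift ord0 j))%R.
have E t v : (c *: cons_rV (t, v) + a = cons_rV (c * t + a ord0 ord0, c *: v + a'))%R.
  apply/rowP => i; rewrite !mxE; by case: unliftP => [j ->|->] /=; rewrite ?mxE.
have mg : measurable_fun setT (fun p : measurableTypeR R * 'rV[R]_n => f (cons_rV p)).
  by apply: (measurableT_comp mf); exact: measurable_cons_rV.
under eq_integral.
  move=> t _; under eq_integral do rewrite E.
  rewrite (IH a' (fun v => f (cons_rV ((c * t + a ord0 ord0)%R, v))))//; last first.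
    by apply: (measurableT_comp mg); exact: pair1_measurable.
  over.
have mi : measurable_fun setT (fun t => \int[leb n]_v f (cons_rV (t, v))).
  by apply: (measurable_fun_fubini_tonelli_F (fun p => f (cons_rV p))).
have ma : measurable_fun setT (fun t : measurableTypeR R =>
    (c * t + a ord0 ord0)%R : measurableTypeR R).
  by apply: measurable_funD => //; exact: measurable_funM.
rewrite (ge0_integralZl leb1 measurableT (measurableT_comp mi ma)); last 2 first.
- by move=> t _; exact: integral_ge0.
- by rewrite lee_fin invr_ge0 exprn_ge0.
rewrite (@integral_affine _ c _ (fun t => \int[leb n]_v f (cons_rV (t, v))))//; last first.
  by move=> t; exact: integral_ge0.
by rewrite muleA -EFinM exprS invfM [(_ * `|c|^-1)%R]mulrC.
Qed.

Lemma lebesgue_rV_shift n (a : 'rV[R]_n) (A : set 'rV[R]_n) : measurable A ->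
  leb n A = leb n ((fun x => x + a)%R @^-1` A).
Proof.
move=> mA; rewrite -integral_indicT//.
rewrite -[RHS]integral_indicT; last first.
  by rewrite -[X in measurable X]setTI; exact: measurable_addrV.
have := @integral_affine_rV n 1 a (fun z => (\1_A z)%:E) (oner_neq0 _).
rewrite normr1 expr1n invr1 mul1e => <-//; last exact/measurable_EFinP.
by apply: eq_integral => x _; rewrite scale1r.
Qed.

Lemma integral_shift_rV n (a : 'rV[R]_n) (f : 'rV[R]_n -> \bar R) :
  measurable_fun setT f -> (forall x, 0 <= f x) ->
  \int[leb n]_x f (x + a)%R = \int[leb n]_x f x.
Proof.
move=> mf f0; rewrite [RHS](ge0_integral_change (h := fun x : 'rV[R]_n => (x + a)%R) _ (@lebesgue_rV_shift n a))//.
exact: measurable_addrV.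
Qed.

Lemma integral_reflect_rV n (a : 'rV[R]_n) (f : 'rV[R]_n -> \bar R) :
  measurable_fun setT f -> (forall x, 0 <= f x) ->
  \int[leb n]_x f (a - x)%R = \int[leb n]_x f x.
Proof.
move=> mf f0; have := @integral_affine_rV n (-1) a f.
rewrite normrN1 expr1n invr1 mul1e oppr_eq0 oner_eq0 => <-//.
by apply: eq_integral => x _; rewrite scaleN1r addrC.
Qed.

Lemma intC_shift n (a : 'rV[R]_n) (F : 'rV[R]_n -> R[i]) : mfC F ->
  intC (leb n) (fun x => F (x + a)%R) = intC (leb n) F.
Proof.
move=> mF; rewrite [RHS](intC_change (h := fun x : 'rV[R]_n => (x + a)%R) _ (@lebesgue_rV_shift n a))//.
exact: measurable_addrV.
Qed.
Lemma intgC_shift n (a : 'rV[R]_n) (F : 'rV[R]_n -> R[i]) : intgC (leb n) F ->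
  intgC (leb n) (fun x => F (x + a)%R).
Proof.
have mh : measurable_fun setT (fun x : 'rV[R]_n => (x + a)%R) by exact: measurable_addrV.
by move=> iF; apply: (intgC_change mh (@lebesgue_rV_shift n a) (intgC_mfC iF)).1.
Qed.

(* The d pairs (x_j, y_j) of R^d x R^d are handled one at a time, each as a point of
   R^(1+1). *)
Definition pairrV d (j : 'I_d) (z : 'rV[R]_(d + d)) : 'rV[R]_(1 + 1) :=
  row_mx (const_mx (z ord0 (lshift d j))) (const_mx (z ord0 (rshift d j))).

Definition glue_rV d (p : 'rV[R]_(1 + 1) * 'rV[R]_(d + d)) : 'rV[R]_(d.+1 + d.+1) :=
  row_mx (cons_rV (p.1 ord0 (lshift 1 ord0), lsubmx p.2))
         (cons_rV (p.1 ord0 (rshift 1 ord0), rsubmx p.2)).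

Lemma measurable_pairrV d j : measurable_fun setT (@pairrV d j).
Proof.
apply: measurable_row_mx; apply: measurable_fun_rV => i; rewrite ord1;
  by under eq_fun do rewrite mxE; exact: measurable_coord_rV.
Qed.

Lemma measurable_cons_rVT d' (T : measurableType d') n (f : T -> R) (g : T -> 'rV[R]_n) :
  measurable_fun setT f -> measurable_fun setT g ->
  measurable_fun setT (fun t => cons_rV (f t, g t)).
Proof.
move=> mf mg.
apply: (@measurableT_comp _ _ _ _ _ _ (@cons_rV R n) _ (fun t => (f t : measurableTypeR R, g t))).
  exact: measurable_cons_rV.
exact: measurable_fun_pair.
Qed.

Lemma measurable_glue_rV d : measurable_fun setT (@glue_rV d).
Proof.
apply: measurable_row_mx; apply: measurable_cons_rVT.
- by apply: measurable_coordT; exact: measurable_fst.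
- by apply: (measurableT_comp (@measurable_lsubmx R d d)); exact: measurable_snd.
- by apply: measurable_coordT; exact: measurable_fst.
- by apply: (measurableT_comp (@measurable_rsubmx R d d)); exact: measurable_snd.
Qed.

Lemma pairrV_glue0 d (p : 'rV[R]_(1 + 1) * 'rV[R]_(d + d)) :
  pairrV ord0 (glue_rV p) = p.1.
Proof.
rewrite /pairrV /glue_rV row_mxEl row_mxEr !mxE !unlift_none /=.
rewrite -[RHS]hsubmxK; congr row_mx; apply/rowP => i; by rewrite !mxE (ord1 i).
Qed.
Lemma pairrV_glueS d (p : 'rV[R]_(1 + 1) * 'rV[R]_(d + d)) j :
  pairrV (lift ord0 j) (glue_rV p) = pairrV j p.2.
Proof.
by rewrite /pairrV /glue_rV row_mxEl row_mxEr !mxE !liftK /= !mxE.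
Qed.

Lemma integral_plane (f : R -> R -> \bar R) :
  measurable_fun setT (fun p : measurableTypeR R * measurableTypeR R => f p.1 p.2) ->
  (forall t s, 0 <= f t s) ->
  \int[leb (1 + 1)]_p f (p ord0 (lshift 1 ord0)) (p ord0 (rshift 1 ord0)) =
  \int[leb1]_t \int[leb1]_s f t s.
Proof.
move=> mf f0.
have H1 (g : R -> \bar R) : measurable_fun setT g -> (forall t, 0 <= g t) ->
    \int[leb 1]_x g (x ord0 ord0) = \int[leb1]_t g t.
  move=> mg g0; have mgc : measurable_fun setT (fun x : 'rV[R]_1 => g (x ord0 ord0)).
    by apply: (measurableT_comp mg); exact: measurable_coord_rV.
  rewrite integral_rVS//.
  apply: eq_integral => t _; rewrite integral_rV0 ?mxE ?unlift_none//.
  apply: (measurableT_comp mgc).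
  by apply: measurable_cons_rVT.
have mf2 : measurable_fun setT
    (fun p : 'rV[R]_(1 + 1) => f (p ord0 (lshift 1 ord0)) (p ord0 (rshift 1 ord0))).
  apply: (@measurableT_comp _ _ _ _ _ _ (fun p : measurableTypeR R * measurableTypeR R => f p.1 p.2) _
    (fun p : 'rV[R]_(1 + 1) => (p ord0 (lshift 1 ord0), p ord0 (rshift 1 ord0)))) => //.
  by apply: measurable_fun_pair; exact: measurable_coord_rV.
rewrite integral_rVD//.
under eq_integral.
  move=> x _; under eq_integral do rewrite row_mxEl row_mxEr.
  rewrite (H1 (f (x ord0 ord0)))//; last exact: (measurableT_comp mf (pair1_measurable _)).
  over.
rewrite (H1 (fun t => \int[leb1]_s f t s))//.
  by apply: (measurable_fun_fubini_tonelli_F (fun p : measurableTypeR R * measurableTypeR R => f p.1 p.2)).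
by move=> t; exact: integral_ge0.
Qed.

Lemma integral_glue d (f : 'rV[R]_(d.+1 + d.+1) -> \bar R) : measurable_fun setT f ->
  (forall x, 0 <= f x) ->
  \int[leb (d.+1 + d.+1)]_z f z = \int[leb (1 + 1)]_p \int[leb (d + d)]_z f (glue_rV (p, z)).
Proof.
move=> mf f0.
pose g (t s : R) (v w : 'rV[R]_d) := f (row_mx (cons_rV (t, v)) (cons_rV (s, w))).
have mg d' (T : measurableType d') (t s : T -> R) (v w : T -> 'rV[R]_d) :
    measurable_fun setT t -> measurable_fun setT s -> measurable_fun setT v ->
    measurable_fun setT w -> measurable_fun setT (fun a => g (t a) (s a) (v a) (w a)).
  by move=> *; apply: (measurableT_comp mf); apply: measurable_row_mx;
    exact: measurable_cons_rVT.
have g0 t s v w : 0 <= g t s v w by exact: f0.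
transitivity (\int[leb1]_t \int[leb1]_s \int[leb d]_v \int[leb d]_w g t s v w).
  rewrite integral_rVD// integral_rVS; last 2 first.
  - apply: (measurable_fun_fubini_tonelli_F
      (fun p : 'rV[R]_d.+1 * 'rV[R]_d.+1 => f (row_mx p.1 p.2))) => //.
    by apply: (measurableT_comp mf); exact: measurable_row_mx2.
  - by move=> x; exact: integral_ge0.
  apply: eq_integral => t _.
  under eq_integral.
    move=> v _; rewrite integral_rVS//; last first.
      by apply: (measurableT_comp mf); apply: measurable_row_mx => //.
    over.
  rewrite /=.
  (* The block order is t, v, s, w, while the pair (t, s) must come first: Tonelli moves s across
     v. *)
  apply: (@fubini_tonelli _ _ _ _ _ (leb d) leb1
    (fun p : 'rV[R]_d * measurableTypeR R => \int[leb d]_w g t p.2 p.1 w)).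
    apply: (measurable_fun_fubini_tonelli_F
      (fun q : ('rV[R]_d * measurableTypeR R) * 'rV[R]_d => g t q.1.2 q.1.1 q.2)) => //.
    apply: mg => //; do ?exact: measurableT_comp.
  by move=> p; exact: integral_ge0.
transitivity (\int[leb1]_t \int[leb1]_s \int[leb (d + d)]_z g t s (lsubmx z) (rsubmx z)).
  apply: eq_integral => t _; apply: eq_integral => s _.
  rewrite integral_rVD; last by move=> z; exact: f0.
    by apply: eq_integral => v _; apply: eq_integral => w _; rewrite row_mxKl row_mxKr.
  by apply: mg => //; [exact: measurable_lsubmx|exact: measurable_rsubmx].
rewrite -(@integral_plane (fun t s => \int[leb (d + d)]_z g t s (lsubmx z) (rsubmx z)))//.
- apply: (measurable_fun_fubini_tonelli_F
    (fun q : (measurableTypeR R * measurableTypeR R) * 'rV[R]_(d + d) =>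
      g q.1.1 q.1.2 (lsubmx q.2) (rsubmx q.2))) => //.
  apply: mg; do ?exact: measurableT_comp.
  + by apply: (measurableT_comp (@measurable_lsubmx R d d)); exact: measurable_snd.
  + by apply: (measurableT_comp (@measurable_rsubmx R d d)); exact: measurable_snd.
- by move=> t s; exact: integral_ge0.
Qed.

Lemma lebesgue_rV_glue d (A : set 'rV[R]_(d.+1 + d.+1)) : measurable A ->
  leb (d.+1 + d.+1) A = (leb (1 + 1) \x leb (d + d)) (@glue_rV d @^-1` A).
Proof.
move=> mA; rewrite -integral_indicT//.
have mi : measurable_fun setT (fun z : 'rV[R]_(d.+1 + d.+1) => (\1_A z)%:E : \bar R).
  exact/measurable_EFinP.
rewrite integral_glue//.
have mB : measurable (@glue_rV d @^-1` A).
  by rewrite -[X in measurable X]setTI; exact: measurable_glue_rV.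
rewrite -[RHS]integral_indicT//.
by rewrite fubini_tonelli1//; exact/measurable_EFinP.
Qed.

End tonelli_rV.

Section product_functions.
Context {R : realType}.
Local Notation leb n := (lebesgue_rV R n).
Local Notation leb1 := (@lebesgue_measure R).

Lemma intC_rV0 (F : 'rV[R]_0 -> R[i]) : mfC F -> intC (leb 0) F = F 0.
Proof.
move=> [mR mI]; apply: complex_eqP => /=; rewrite /Rintegral integral_rV0//;
  exact/measurable_EFinP.
Qed.

Lemma intgC_cst_rV0 (c : R[i]) : intgC (leb 0) (fun=> c).
Proof. by split; [exact: mfC_cst|rewrite integral_rV0// ltry]. Qed.

Lemma prodC_rV n (F : 'I_n -> R -> R[i]) : (forall i, intgC leb1 (F i)) ->
  intgC (leb n) (fun x => \prod_i F i (x ord0 i)) /\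
  intC (leb n) (fun x => \prod_i F i (x ord0 i)) = \prod_i intC leb1 (F i).
Proof.
elim: n F => [|n IH] F iF.
  under [fun x => _]eq_fun do rewrite big_ord0.
  by rewrite big_ord0; split; [exact: intgC_cst_rV0|rewrite intC_rV0//; exact: mfC_cst].
have [iP eP] := IH (fun i => F (lift ord0 i)) (fun i => iF _).
have mP : mfC (fun x : 'rV[R]_n.+1 => \prod_i F i (x ord0 i)).
  by apply: mfC_prod => i; apply: (mfC_comp (intgC_mfC (iF i))); exact: measurable_coord_rV.
have E p : \prod_i F i (cons_rV p ord0 i) =
    F ord0 p.1 * \prod_i F (lift ord0 i) (p.2 ord0 i).
  rewrite big_ord_recl mxE unlift_none /=; congr (_ * _).
  by apply: eq_bigr => i _; rewrite mxE liftK.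
split.
  apply/(intgC_change (@measurable_cons_rV R n) (@lebesgue_rVS R n)) => //.
  by under [fun p => _]eq_fun do rewrite E; exact: intgC_prod (iF ord0) iP.
rewrite (intC_change (@measurable_cons_rV R n) (@lebesgue_rVS R n))//.
under eq_intC do rewrite E.
by rewrite (intC_prod (iF ord0) iP) big_ord_recl eP.
Qed.

Lemma prodC_pair d (F : 'I_d -> 'rV[R]_(1 + 1) -> R[i]) :
  (forall i, intgC (leb (1 + 1)) (F i)) ->
  intgC (leb (d + d)) (fun z => \prod_i F i (pairrV i z)) /\
  intC (leb (d + d)) (fun z => \prod_i F i (pairrV i z)) = \prod_i intC (leb (1 + 1)) (F i).
Proof.
elim: d F => [|d IH] F iF.
  under [fun x => _]eq_fun do rewrite big_ord0.
  by rewrite big_ord0; split; [exact: intgC_cst_rV0|rewrite intC_rV0//; exact: mfC_cst].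
have [iP eP] := IH (fun i => F (lift ord0 i)) (fun i => iF _).
have mP : mfC (fun x : 'rV[R]_(d.+1 + d.+1) => \prod_i F i (pairrV i x)).
  by apply: mfC_prod => i; apply: (mfC_comp (intgC_mfC (iF i))); exact: measurable_pairrV.
have E p : \prod_i F i (pairrV i (glue_rV p)) =
    F ord0 p.1 * \prod_i F (lift ord0 i) (pairrV i p.2).
  rewrite big_ord_recl pairrV_glue0; congr (_ * _).
  by apply: eq_bigr => i _; rewrite pairrV_glueS.
split.
  apply/(intgC_change (@measurable_glue_rV R d) (@lebesgue_rV_glue R d)) => //.
  by under [fun p => _]eq_fun do rewrite E; exact: intgC_prod (iF ord0) iP.
rewrite (intC_change (@measurable_glue_rV R d) (@lebesgue_rV_glue R d))//.
under eq_intC do rewrite E.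
by rewrite (intC_prod (iF ord0) iP) big_ord_recl eP.
Qed.

Lemma intgC_rVD m n (F : 'rV[R]_(m + n) -> R[i]) : mfC F ->
  intgC (leb (m + n)) F <-> intgC (leb m \x leb n)%E (fun p => F (row_mx p.1 p.2)).
Proof. exact: (intgC_change (@measurable_row_mx2 R m n) (@lebesgue_rVD R m n)). Qed.
Lemma intC_rVD m n (F : 'rV[R]_(m + n) -> R[i]) : mfC F ->
  intC (leb (m + n)) F = intC (leb m \x leb n)%E (fun p => F (row_mx p.1 p.2)).
Proof. exact: (intC_change (@measurable_row_mx2 R m n) (@lebesgue_rVD R m n)). Qed.

End product_functions.

(** * Differentiation and Gaussian integrals *)

Section directional_derivative.
Context {R : realType} {n : nat}.
Local Notation V := 'rV[R]_n.
Local Notation Re := complex.Re.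
Local Notation Im := complex.Im.
Implicit Types (F G : V -> R[i]) (v x : V).

(** Moves a directional derivative to a function of one real variable, where the chain rule
    [is_derive1_comp] and the mean value theorem are available. *)
Lemma is_derive_lineP (f : V -> R) x v (df : R) :
  is_derive x v f df <-> is_derive (0 : R) (1 : R) (fun h : R => f (h *: v + x)) df.
Proof.
have E : 'D_v f x = 'D_1 (fun h : R => f (h *: v + x)) 0.
  rewrite /derive; set g1 := (X in lim (X @ _)); set g2 := (X in _ = lim (X @ _)).
  suff -> : g1 = g2 by [].
  by rewrite funeqE /g1 /g2 => h /=; rewrite addr0 scale0r add0r [_%:A]mulr1.
split=> -[h1 h2]; apply: DeriveDef.
- exact: (derivable1P _ _ _).1.
- by rewrite -E.
- exact: (derivable1P _ _ _).2.
- by rewrite E.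
Qed.

Lemma is_derive_lineT (f : V -> R) x v (h df : R) :
  is_derive (h *: v + x) v f df -> is_derive h 1 (fun h : R => f (h *: v + x)) df.
Proof.
move=> /is_derive_lineP H.
have -> : (fun h : R => f (h *: v + x)) =
    (fun k : R => f (k *: v + (h *: v + x))) \o (fun k => k - h).
  by apply/funext => k /=; rewrite addrA -scalerDl subrK.
rewrite -[df]mulr1; apply: is_derive1_comp; first by rewrite subrr.
by apply: is_derive_eq; rewrite subr0.
Qed.

Definition isD v F G := forall x,
  is_derive x v (fun y => Re (F y)) (Re (G x)) /\
  is_derive x v (fun y => Im (F y)) (Im (G x)).

Lemma isD_eq v F G G' : G =1 G' -> isD v F G -> isD v F G'.
Proof. by move=> /funext ->. Qed.
Lemma isD_cst v (c : R[i]) : isD v (fun=> c) (fun=> 0).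
Proof. by move=> x; split; exact: is_derive_cst. Qed.
Lemma isDD v F G F' G' : isD v F F' -> isD v G G' ->
  isD v (fun x => F x + G x) (fun x => F' x + G' x).
Proof.
move=> hF hG x; have [a b] := hF x; have [c e] := hG x; split.
  under [fun y => _]eq_fun do rewrite ReD.
  by rewrite ReD; exact: is_deriveD.
under [fun y => _]eq_fun do rewrite ImD.
by rewrite ImD; exact: is_deriveD.
Qed.
Lemma isDM v F G F' G' : isD v F F' -> isD v G G' ->
  isD v (fun x => F x * G x) (fun x => F' x * G x + F x * G' x).
Proof.
move=> hF hG x; have [a b] := hF x; have [c e] := hG x; split.
  under [fun y => _]eq_fun do rewrite ReM.
  apply: (@is_derive_eq _ _ _ _ _ _ _ _ (is_deriveB (is_deriveM a c) (is_deriveM b e))).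
  by rewrite ReD !ReM /GRing.scale /=; ring.
under [fun y => _]eq_fun do rewrite ImM.
apply: (@is_derive_eq _ _ _ _ _ _ _ _ (is_deriveD (is_deriveM a e) (is_deriveM b c))).
by rewrite ImD !ImM /GRing.scale /=; ring.
Qed.
Lemma isDZ v (c : R[i]) F F' : isD v F F' -> isD v (fun x => c * F x) (fun x => c * F' x).
Proof.
move=> h; apply: isD_eq (isDM (isD_cst v c) h) => x.
by rewrite mul0r add0r.
Qed.
Lemma isD_conjc v F F' : isD v F F' -> isD v (fun x => conjc (F x)) (fun x => conjc (F' x)).
Proof.
move=> hF x; have [a b] := hF x; split.
  under [fun y => _]eq_fun do rewrite Re_conjc.
  by rewrite Re_conjc.
under [fun y => _]eq_fun do rewrite Im_conjc.
by rewrite Im_conjc; exact: is_deriveN.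
Qed.
Lemma isDX v F F' k : isD v F F' ->
  isD v (fun x => F x ^+ k.+1) (fun x => k.+1%:R * F x ^+ k * F' x).
Proof.
move=> hF; elim: k => [|k IH].
  by apply: isD_eq hF => x; rewrite expr0 !mul1r.
under [fun x => _]eq_fun do rewrite exprS.
apply: isD_eq (isDM hF IH) => x.
by rewrite [k.+2%:R]mulrSr exprS; ring.
Qed.
Lemma isD_coord v i : isD v (fun x => (x ord0 i)%:C) (fun=> (v ord0 i)%:C).
Proof.
move=> x; split => /=; last exact: is_derive_cst.
apply/is_derive_lineP.
under [fun h => _]eq_fun do rewrite !mxE.
apply: is_derive_eq; rewrite /GRing.scale /=; ring.
Qed.
Lemma isD_sum v I (r : seq I) (P : pred I) (F F' : I -> V -> R[i]) :
  (forall i, isD v (F i) (F' i)) ->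
  isD v (fun x => \sum_(i <- r | P i) F i x) (fun x => \sum_(i <- r | P i) F' i x).
Proof.
move=> h; elim: r => [|i r IH].
  have H0 (H : I -> V -> R[i]) : (fun x => \sum_(i <- [::] | P i) H i x) = fun=> 0.
    by apply/funext => x; rewrite big_nil.
  by rewrite !H0; exact: isD_cst.
have HS (H : I -> V -> R[i]) : (fun x => \sum_(j <- i :: r | P j) H j x) =
    if P i then (fun x => H i x + \sum_(j <- r | P j) H j x)
    else (fun x => \sum_(j <- r | P j) H j x).
  by case: ifP => Pi; apply/funext => x; rewrite big_cons Pi.
by rewrite !HS; case: (P i) => //; exact: isDD.
Qed.

End directional_derivative.

Section complex_exponential.
Context {R : realType}.
Local Notation Re := complex.Re.
Local Notation Im := complex.Im.
Implicit Types z w : R[i].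

Definition cexp z : R[i] := (expR (Re z))%:C * expi (Im z).

Lemma cexpD z w : cexp (z + w) = cexp z * cexp w.
Proof. by rewrite /cexp ReD ImD expRD expiD rmorphM; ring. Qed.
Lemma cexp0 : cexp 0 = 1.
Proof. by rewrite /cexp /= expR0 expi0 mulr1. Qed.
Lemma normc_cexp z : normc (cexp z) = expR (Re z).
Proof. by rewrite normcM normc_expi normc_real mulr1 ger0_norm ?expR_ge0. Qed.
Lemma cexp_real (a : R) : cexp a%:C = (expR a)%:C.
Proof. by rewrite /cexp /= expi0 mulr1. Qed.
Lemma cexp_im (a : R) : cexp (0 +i* a) = expi a.
Proof. by rewrite /cexp /= expR0 mul1r. Qed.
Lemma conjc_cexp z : conjc (cexp z) = cexp (conjc z).
Proof. by rewrite /cexp conjcM conjc_real conjc_expi Re_conjc Im_conjc. Qed.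
Lemma cexp_sum I (r : seq I) (P : pred I) (F : I -> R[i]) :
  cexp (\sum_(i <- r | P i) F i) = \prod_(i <- r | P i) cexp (F i).
Proof. exact: (big_morph _ cexpD cexp0). Qed.
Lemma mfC_cexp {d : measure_display} {T : measurableType d} (F : T -> R[i]) :
  mfC F -> mfC (fun x => cexp (F x)).
Proof.
move=> [a b]; apply: mfCM; last exact: mfC_expi.
by apply: mfC_real; exact: measurableT_comp.
Qed.
Lemma isD_cexp n v (F F' : 'rV[R]_n -> R[i]) : isD v F F' ->
  isD v (fun x => cexp (F x)) (fun x => F' x * cexp (F x)).
Proof.
move=> hF x; have [/is_derive_lineP a /is_derive_lineP b] := hF x.
have E0 : 0 *: v + x = x by rewrite scale0r add0r.
split; apply/is_derive_lineP.
  under [fun h => _]eq_fun do rewrite /cexp ReM /= mul0r subr0.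
  apply: (@is_derive_eq _ _ _ _ _ _ _ _ (is_deriveM
    (is_derive1_comp (is_derive_expR _) a) (is_derive1_comp (is_derive_cos _) b))).
  by rewrite /= E0 /cexp !ReM !ImM /= /GRing.scale /=; ring.
under [fun h => _]eq_fun do rewrite /cexp ImM /= mul0r addr0.
apply: (@is_derive_eq _ _ _ _ _ _ _ _ (is_deriveM
  (is_derive1_comp (is_derive_expR _) a) (is_derive1_comp (is_derive_sin _) b))).
by rewrite /= E0 /cexp !ImM !ReM /= /GRing.scale /=; ring.
Qed.

End complex_exponential.

(** * An integrable polynomial weight on R^n *)

Section weights.
Context {R : realType}.
Local Notation leb n := (lebesgue_rV R n).
Local Notation leb1 := (@lebesgue_measure R).

Lemma coord_le_norm n (x : 'rV[R]_n) i : `|x ord0 i| <= `|x|.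
Proof.
rewrite [X in _ <= X]mx_normrE.
by apply: (le_bigmax _ (fun ij : 'I_1 * 'I_n => `|x ij.1 ij.2|) (ord0, i)).
Qed.
Lemma norm_le_coord n (x : 'rV[R]_n) (M : R) : 0 <= M ->
  (forall i, `|x ord0 i| <= M) -> `|x| <= M.
Proof.
move=> M0 h; rewrite [X in X <= _]mx_normrE.
by apply: bigmax_le => // -[i j] _ /=; rewrite ord1.
Qed.
Lemma norm_delta_le n (h : R) (j : 'I_n) : `|h *: delta_mx 0 j : 'rV[R]_n| <= `|h|.
Proof.
apply: norm_le_coord => // i; rewrite !mxE eqxx /=.
by case: (i == j); rewrite ?mulr1// mulr0 normr0.
Qed.

(** Here [|x|] is the sup norm, so (1 + |x|)^2 dominates 1 + x_i^2 for every i. The exponent 2 n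
    thus gives a bound by a product of n functions 1/(1 + x_i^2), each integrable on the line. *)
Definition japN n (x : 'rV[R]_n) : R := ((1 + `|x|) ^+ (2 * n)%N)^-1.

Lemma jap_gt0 n (x : 'rV[R]_n) : 0 < 1 + `|x|.
Proof. by rewrite ltr_wpDr. Qed.
Lemma japN_gt0 n (x : 'rV[R]_n) : 0 < japN x.
Proof. by rewrite invr_gt0 exprn_gt0// jap_gt0. Qed.
Lemma japN_le1 n (x : 'rV[R]_n) : japN x <= 1.
Proof. by rewrite invf_le1 ?exprn_gt0 ?jap_gt0// exprn_ege1// lerDl. Qed.

Lemma integrable_oneDsqrV : leb1.-integrable setT (EFin \o (fun t : R => (1 + t ^+ 2)^-1)).
Proof.
have m : measurable_fun setT (fun t : R => (1 + t ^+ 2)^-1).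
  by apply: continuous_measurable_fun; exact: continuous_oneDsqrV.
have p t : 0 < 1 + t ^+ 2 :> R by rewrite ltr_wpDr// sqr_ge0.
apply/integrableP; split; first exact/measurable_EFinP.
under eq_integral do rewrite /= ger0_norm ?invr_ge0 ?ltW//.
rewrite (@ge0_symfun_integralT _ (fun t : R => (1 + t ^+ 2)^-1))//.
- rewrite (_ : [set x | _] = `[0, +oo[%classic); last first.
    by apply/seteqP; split => x/=; rewrite in_itv/= andbT.
  have := @integral0y_oneDsqr R; rewrite /oneDsqr /= => ->.
  by rewrite -EFinM ltry.
- by move=> x; rewrite invr_ge0 ltW.
- exact: continuous_oneDsqrV.
- by move=> x /=; rewrite sqrrN.
Qed.

Lemma measurable_norm_rV n : measurable_fun setT (fun x : 'rV[R]_n => `|x|).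
Proof. by apply: continuous_measurable_rV; exact: norm_continuous. Qed.

Lemma measurable_japN n : measurable_fun setT (@japN n).
Proof.
pose h (t : R) := ((1 + `|t|) ^+ (2 * n))^-1.
have mh : measurable_fun setT h.
  apply: continuous_measurable_fun => t; apply: cvgV.
    by rewrite gt_eqF// exprn_gt0// ltr_wpDr.
  apply: (@continuous_comp _ _ _ (fun t : R => 1 + `|t|) (fun u : R => u ^+ (2 * n))).
    by apply: cvgD; [exact: cvg_cst|exact: norm_continuous].
  exact: exprn_continuous.
rewrite (_ : @japN n = h \o (fun x : 'rV[R]_n => `|x|)); first exact: (measurableT_comp mh (@measurable_norm_rV n)).
by apply/funext => x; rewrite /h /= normr_id.
Qed.

Lemma integrable_japN n : (leb n).-integrable setT (EFin \o @japN n).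
Proof.
have iF : intgC leb1 (fun t : R => ((1 + t ^+ 2)^-1)%:C).
  exact: intgC_real integrable_oneDsqrV.
have [iP _] := @prodC_rV R n (fun _ t => ((1 + t ^+ 2)^-1)%:C) (fun=> iF).
apply: le_integrable (intgC_normc iP) => //.
  by apply/measurable_EFinP; exact: measurable_japN.
move=> x _ /=; rewrite lee_fin ger0_norm ?(ltW (japN_gt0 _))//.
rewrite ger0_norm ?normc_ge0// normc_prod.
have -> : japN x = \prod_(i < n) ((1 + `|x|) ^+ 2)^-1.
  by rewrite prodr_const card_ord exprVn -exprM.
apply: ler_prod => i _; rewrite invr_ge0 (exprn_ge0 _ (ltW (jap_gt0 x)))/= expr0n addr0 sqrtr_sqr.
have p : 0 < 1 + (x ord0 i) ^+ 2 by rewrite ltr_wpDr// sqr_ge0.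
have p' : 0 <= (1 + (x ord0 i) ^+ 2)^-1 by rewrite invr_ge0 ltW.
rewrite (ger0_norm p') lef_pV2 ?posrE ?exprn_gt0 ?jap_gt0//.
rewrite sqrrD expr1n -addrA lerD2l -[leLHS]real_normK ?num_real//.
rewrite ler_wpDl// ?mul1r ?mulrn_wge0// lerXn2r ?nnegrE//.
exact: coord_le_norm.
Qed.

Lemma japN_shift n (x a : 'rV[R]_n) : `|a| <= 1 -> japN (x + a) <= 2 ^+ (2 * n) * japN x.
Proof.
move=> a1; rewrite /japN -ler_pdivrMl ?exprn_gt0// -invfM -exprMn.
rewrite lef_pV2 ?posrE ?exprn_gt0 ?mulr_gt0 ?jap_gt0//.
apply: lerXn2r; rewrite ?nnegrE ?mulr_ge0 ?addr_ge0//.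
have : `|x| <= `|x + a| + `|a|.
  by rewrite -[X in `|X| <= _](addrK a) (le_trans (ler_normB _ _)).
have := normr_ge0 (x + a); lra.
Qed.

Lemma intgC_japN n (F : 'rV[R]_n -> R[i]) (C : R) : mfC F ->
  (forall x, normc (F x) <= C * japN x) -> intgC (leb n) F.
Proof.
move=> mF h; apply: (intgC_le_real mF _ h).
have := integrableZl measurableT C (integrable_japN n).
by apply: eq_integrable => // x _ /=; rewrite EFinM.
Qed.

End weights.

Section integral_of_derivative.
Context {R : realType} {n : nat}.
Local Notation leb n := (lebesgue_rV R n).
Local Notation Re := complex.Re.
Local Notation Im := complex.Im.

(** Difference quotients of f have integral 0 by translation invariance. They converge to g, and
    dominated convergence passes to the limit. *)
Let int_partialR (j : 'I_n) (f g : 'rV[R]_n -> R) (C : R) :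
  measurable_fun setT f -> (forall x, is_derive x (delta_mx 0 j) f (g x)) ->
  (forall x, `|f x| <= C * japN x) -> (forall x, `|g x| <= C * japN x) ->
  measurable_fun setT g /\ \int[leb n]_x g x = 0.
Proof.
move=> mf fg fC gC.
pose e k : R := k.+1%:R^-1.
have e0 k : 0 < e k by rewrite invr_gt0.
have e1 k : e k <= 1 by rewrite invf_le1// ler1n.
pose q k (x : 'rV[R]_n) := (e k)^-1 * (f (x + e k *: delta_mx 0 j) - f x).
have msh k : measurable_fun setT (fun x : 'rV[R]_n => f (x + e k *: delta_mx 0 j)).
  by apply: (measurableT_comp mf); exact: measurable_addrV.
have mq k : measurable_fun setT (q k).
  by apply: measurable_funM => //; exact: measurable_funB.
have qg x : q k x @[k --> \oo] --> g x.
  have [d1 d2] := fg x.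
  have := d1; rewrite /derivable => /cvg_ex[l hl].
  have gl : g x = l by rewrite -d2; apply: cvg_lim.
  rewrite gl.
  have et : e k @[k --> \oo] --> (0 : R).
    exact: (cvg_harmonic (R := R)).
  have hl' := (cvgr_dnbhsP _ _ _).1 hl e.
  rewrite (_ : (fun k => q k x) = (fun k => (e k)^-1 *: ((f \o shift x) (e k *: delta_mx 0 j) - f x))).
    apply: hl'; split => // k; by rewrite gt_eqF.
  by apply/funext => k; rewrite /q /= [x + _]addrC.
(* By the mean value theorem the quotient equals g at a point at distance at most 1 from x;
   [japN_shift] charges 2^(2n) for the displacement. *)
have qb k x : `|q k x| <= (C * 2 ^+ (2 * n)) * japN x.
  pose L := fun h : R => f (h *: delta_mx 0 j + x).
  have dL (h : R) : is_derive h (1 : R) L (g (h *: delta_mx 0 j + x)) by exact: is_derive_lineT.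
  have cL : {within `[0, e k], continuous L}.
    by apply: derivable_within_continuous => h _; have [] := dL h.
  have [c] := MVT (e0 k) (fun h _ => dL h) cL.
  rewrite in_itv/= => /andP[c0 ck].
  rewrite subr0 /L scale0r add0r [X in f X]addrC => E.
  rewrite /q E mulrC mulfK ?gt_eqF//; apply: le_trans (gC _) _.
  have C0 : 0 <= C.
    have := le_trans (normr_ge0 _) (gC x).
    by rewrite pmulr_lge0 ?japN_gt0.
  rewrite -mulrA ler_wpM2l// addrC japN_shift//.
  apply: le_trans (norm_delta_le _ _) _.
  by rewrite ger0_norm ?(ltW c0)// (le_trans (ltW ck)).
have mg : measurable_fun setT g.
  by apply: (measurable_fun_cvg (h := q)) => // x _; exact: qg.
split => //.
have iG : (leb n).-integrable setT (EFin \o (fun x => (C * 2 ^+ (2 * n)) * japN x)).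
  have := integrableZl measurableT (C * 2 ^+ (2 * n)) (integrable_japN n).
  by apply: eq_integrable => // x _ /=; rewrite EFinM.
have := dominatedR mq mg qg iG qb.
have If : (leb n).-integrable setT (EFin \o f).
  have := integrableZl measurableT C (integrable_japN n) => i1.
  apply: le_integrable i1 => //; first exact/measurable_EFinP.
  by move=> x _ /=; rewrite lee_fin (le_trans (fC x))// ler_norm.
have q0 k : \int[leb n]_x q k x = 0.
  have mC : mfC (fun x => (f x)%:C) by exact: mfC_real.
  have iC : intgC (leb n) (fun x => (f x)%:C) by exact: intgC_real.
  have iS := intgC_shift (e k *: delta_mx 0 j) iC.
  have := intC_shift (e k *: delta_mx 0 j) mC.
  rewrite !intC_real => -[E].
  rewrite /q RintegralZl//; last first.
    have := integrableB measurableT (intgC_Re iS) If.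
    by apply: eq_integrable => // x _ /=; rewrite EFinB.
  rewrite RintegralB//; last exact: (intgC_Re iS).
  by rewrite E subrr mulr0.
under eq_cvg do rewrite q0.
by move=> h; have := cvg_unique _ h (cvg_cst (0 : R)) => ->.
Qed.

Lemma int_partial (j : 'I_n) (F G : 'rV[R]_n -> R[i]) (C : R) :
  mfC F -> isD (delta_mx 0 j) F G ->
  (forall x, normc (F x) <= C * japN x) -> (forall x, normc (G x) <= C * japN x) ->
  intgC (leb n) G /\ intC (leb n) G = 0.
Proof.
move=> [mR mI] FG FC GC.
have [a b] := int_partialR mR (fun x => (FG x).1)
  (fun x => le_trans (normc_Re_le _) (FC x)) (fun x => le_trans (normc_Re_le _) (GC x)).
have [c e] := int_partialR mI (fun x => (FG x).2)
  (fun x => le_trans (normc_Im_le _) (FC x)) (fun x => le_trans (normc_Im_le _) (GC x)).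
split; first exact: (intgC_japN (conj a c) GC).
by apply: complex_eqP.
Qed.

End integral_of_derivative.

Section gaussian_decay.
Context {R : realType}.

(** Since (1 + r)^N <= e^(N r), it suffices to maximize (A + N) r - c r^2; the witness is the
    exponential of that maximum. *)
Lemma expR_quad_bound (A c : R) (N : nat) : 0 < c ->
  exists2 C, 0 < C & forall r, 0 <= r -> (1 + r) ^+ N * expR (A * r - c * r ^+ 2) <= C.
Proof.
move=> c0; exists (expR ((A + N%:R) ^+ 2 / (4 * c))); first exact: expR_gt0.
move=> r r0.
have h : (1 + r) ^+ N <= expR (N%:R * r).
  rewrite expRM_natl lerXn2r ?nnegrE ?expR_ge0 ?addr_ge0//.
  exact: expR_ge1Dx.
apply: le_trans (ler_wpM2r (expR_ge0 _) h) _.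
rewrite -expRD ler_expR ler_pdivlMr ?mulr_gt0// -subr_ge0.
rewrite (_ : _ - _ = (A + N%:R - 2 * c * r) ^+ 2); first exact: sqr_ge0.
by ring.
Qed.

Lemma gauss_dec n (P Q : 'rV[R]_n -> R[i]) (A B c : R) (k : nat) : 0 < c ->
  (forall x, normc (P x) <= B * (1 + `|x|) ^+ k) ->
  (forall x, complex.Re (Q x) <= A * `|x| - c * `|x| ^+ 2) ->
  exists C, forall x, normc (P x * cexp (Q x)) <= C * japN x.
Proof.
move=> c0 hP hQ; have [C C0 hC] := expR_quad_bound A (k + 2 * n) c0.
exists (`|B| * C) => x; rewrite normcM normc_cexp /japN ler_pdivlMr ?exprn_gt0 ?jap_gt0//.
have j0 : 0 <= 1 + `|x| by rewrite addr_ge0.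
apply: (@le_trans _ _ ((`|B| * (1 + `|x|) ^+ k) * expR (A * `|x| - c * `|x| ^+ 2) * (1 + `|x|) ^+ (2 * n))).
  rewrite ler_wpM2r ?exprn_ge0// ler_pM ?normc_ge0 ?expR_ge0 ?ler_expR//.
  by apply: le_trans (hP x) _; rewrite ler_wpM2r ?exprn_ge0// ler_norm.
rewrite -!mulrA ler_wpM2l// [expR _ * _]mulrC mulrA -exprD.
exact: hC.
Qed.

End gaussian_decay.

Section affine_complex.
Context {R : realType} {n : nat}.
Local Notation leb n := (lebesgue_rV R n).

Lemma measurable_affine_rV (c : R) (a : 'rV[R]_n) :
  measurable_fun setT (fun x : 'rV[R]_n => c *: x + a).
Proof. by apply: measurable_addrV => //; exact: measurable_scalerV. Qed.

Let int_affineR (c : R) (a : 'rV[R]_n) (f : 'rV[R]_n -> R) : c != 0 ->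
  (leb n).-integrable setT (EFin \o f) ->
  \int[leb n]_x f (c *: x + a) = (`|c| ^+ n)^-1 * \int[leb n]_x f x.
Proof.
move=> c0 If; have mf := measurable_int _ If.
rewrite /Rintegral.
have -> : (\int[leb n]_x (f (c *: x + a))%:E =
   ((`|c| ^+ n)^-1)%:E * \int[leb n]_x (f x)%:E)%E.
  rewrite integralE.
  rewrite (_ : (\int[leb n]_x (fun x => (f (c *: x + a))%:E)^\+ x =
     \int[leb n]_x (EFin \o f)^\+ (c *: x + a)%R)%E); last first.
    by apply: eq_integral => x _; rewrite !unlock.
  rewrite (_ : (\int[leb n]_x (fun x => (f (c *: x + a))%:E)^\- x =
     \int[leb n]_x (EFin \o f)^\- (c *: x + a)%R)%E); last first.
    by apply: eq_integral => x _; rewrite !unlock.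
  rewrite (integral_affine_rV _ c0 (measurable_funepos mf))//.
  rewrite (integral_affine_rV _ c0 (measurable_funeneg mf))//.
  have kf : (((`|c| ^+ n)^-1)%:E : \bar R) \is a fin_num by [].
  rewrite -(muleBr kf (integrable_add_def measurableT If)).
  by congr (_ * _)%E; rewrite [in RHS]integralE.
by rewrite fineM//; exact: (integrable_fin_num _ If).
Qed.

Lemma intC_affine (c : R) (a : 'rV[R]_n) (F : 'rV[R]_n -> R[i]) : c != 0 ->
  intgC (leb n) F ->
  intC (leb n) (fun x => F (c *: x + a)) = ((`|c| ^+ n)^-1)%:C * intC (leb n) F.
Proof.
move=> c0 iF; apply: complex_eqP; rewrite ?ReM ?ImM /=.
  by rewrite (int_affineR _ c0 (intgC_Re iF)) mul0r subr0.
by rewrite (int_affineR _ c0 (intgC_Im iF)) mul0r addr0.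
Qed.

Lemma intgC_affine (c : R) (a : 'rV[R]_n) (F : 'rV[R]_n -> R[i]) : c != 0 ->
  intgC (leb n) F -> intgC (leb n) (fun x => F (c *: x + a)).
Proof.
move=> c0 [mF iF]; split; first exact: (mfC_comp mF (measurable_affine_rV c a)).
rewrite (integral_affine_rV _ c0 (f := fun x => (normc (F x))%:E)); last 2 first.
- by apply/measurable_EFinP; exact: measurable_normc.
- by move=> x; rewrite lee_fin normc_ge0.
by apply: lte_mul_pinfty => //; rewrite lee_fin invr_ge0 exprn_ge0.
Qed.

End affine_complex.

(** * One-dimensional Gaussian integrals with a complex linear term *)

Section gaussian_integral.
Context {R : realType}.
Local Notation leb n := (lebesgue_rV R n).
Local Notation leb1 := (@lebesgue_measure R).
Local Notation Re := complex.Re.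
Local Notation Im := complex.Im.

Lemma line_intC (F : R -> R[i]) : intgC leb1 F ->
  intgC (leb 1) (fun x => F (x ord0 ord0)) /\
  intC (leb 1) (fun x => F (x ord0 ord0)) = intC leb1 F.
Proof.
move=> iF; have := @prodC_rV R 1 (fun=> F) (fun=> iF).
by under [fun x => \prod_(i < 1) _]eq_fun do rewrite big_ord1; rewrite big_ord1.
Qed.

Definition gaussC (s : R) (l : R[i]) (t : R) : R[i] := cexp ((- (s * t ^+ 2))%:C + l * t%:C).

Lemma mfC_gaussC (s : R) (l : R[i]) : mfC (gaussC s l).
Proof.
apply: mfC_cexp; apply: mfCD.
  apply: mfC_real; apply: continuous_measurable_fun => t.
  by apply: cvgN; apply: cvgM; [exact: cvg_cst|exact: exprn_continuous].
by apply: mfCM; [exact: mfC_cst|exact: mfC_real].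
Qed.

Lemma normc_gaussC (s : R) (l : R[i]) t :
  normc (gaussC s l t) = expR (Re l * t - s * t ^+ 2).
Proof. by rewrite normc_cexp ReD ReM /= mulr0 subr0 addrC. Qed.

Lemma intgC_polygauss (s : R) (l : R[i]) (p : R -> R[i]) (B : R) (k : nat) : 0 < s ->
  mfC p -> (forall t, normc (p t) <= B * (1 + `|t|) ^+ k) ->
  intgC leb1 (fun t => p t * gaussC s l t).
Proof.
move=> s0 mp hp; have [C C0 hC] := expR_quad_bound `|Re l| (k + 2) s0.
have iC : leb1.-integrable setT (EFin \o (fun t : R => (`|B| * C) * (1 + t ^+ 2)^-1)).
  have := integrableZl measurableT (`|B| * C) integrable_oneDsqrV.
  by apply: eq_integrable => // x _ /=; rewrite EFinM.
apply: (intgC_le_real _ iC); first by apply: mfCM => //; exact: mfC_gaussC.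
move=> t; rewrite normcM normc_gaussC.
have t2 : 0 < 1 + t ^+ 2 by rewrite ltr_wpDr// sqr_ge0.
have j0 : 0 <= 1 + `|t| by rewrite addr_ge0.
rewrite ler_pdivlMr//.
apply: (@le_trans _ _ ((`|B| * (1 + `|t|) ^+ k) * expR (`|Re l| * `|t| - s * `|t| ^+ 2) * (1 + `|t|) ^+ 2)).
  apply: ler_pM; rewrite ?mulr_ge0 ?normc_ge0 ?expR_ge0 ?(ltW t2)//.
    apply: ler_pM; rewrite ?normc_ge0 ?expR_ge0//.
      by apply: le_trans (hp t) _; rewrite ler_wpM2r ?exprn_ge0// ler_norm.
    rewrite ler_expR real_normK ?num_real// lerD2r -normrM; exact: ler_norm.
  have e : t ^+ 2 = `|t| ^+ 2 by rewrite real_normK ?num_real.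
  by rewrite e; have := normr_ge0 t; nra.
rewrite -!mulrA ler_wpM2l// [expR _ * _]mulrC mulrA -exprD.
exact: hC.
Qed.

Lemma intgC_gaussC (s : R) (l : R[i]) : 0 < s -> intgC leb1 (gaussC s l).
Proof.
move=> s0; have h : forall t : R, normc (1 : R[i]) <= 1 * (1 + `|t|) ^+ 0.
  by move=> t; rewrite normc1 expr0 mulr1.
have := intgC_polygauss l s0 (mfC_cst 1) h.
by under [fun t => _]eq_fun do rewrite mul1r.
Qed.

(** The integrand is the derivative of [gaussC]. The line is viewed as R^1 so that [int_partial]
    applies. This is the source of the differential equation in [cosint_derive]. *)
Lemma gaussC_ibp (l : R[i]) (s : R) : 0 < s ->
  intC leb1 (fun t => ((- (2 * s * t))%:C + l) * gaussC s l t) = 0.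
Proof.
move=> s0.
have ip : intgC leb1 (fun t => ((- (2 * s * t))%:C + l) * gaussC s l t).
  apply: (@intgC_polygauss s l _ (2 * s + normc l) 1) => //.
    apply: mfCD; last exact: mfC_cst.
    apply: mfC_real; apply: continuous_measurable_fun => t.
    by apply: cvgN; apply: cvgM; [exact: cvg_cst|exact: cvg_id].
  move=> t; apply: le_trans (le_normcD _ _) _; rewrite normc_real normrN normrM ger0_norm ?mulr_ge0 ?ltW//.
  have := normc_ge0 l; have := normr_ge0 t; rewrite expr1; nra.
have [i1 <-] := line_intC ip.
pose F (x : 'rV[R]_1) := gaussC s l (x ord0 ord0).
pose P (x : 'rV[R]_1) := (- (2 * s * x ord0 ord0))%:C + l.
have nx (x : 'rV[R]_1) : `|x| = `|x ord0 ord0|.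
  apply/eqP; rewrite eq_le coord_le_norm andbT; apply: norm_le_coord => // i.
  by rewrite (ord1 i).
have QE (x : 'rV[R]_1) : Re ((- (s * x ord0 ord0 ^+ 2))%:C + l * (x ord0 ord0)%:C) <=
    `|Re l| * `|x| - s * `|x| ^+ 2.
  rewrite ReD ReM /= mulr0 subr0 nx real_normK ?num_real// addrC lerD2r -normrM.
  exact: ler_norm.
have P1 (x : 'rV[R]_1) : normc (1 : R[i]) <= 1 * (1 + `|x|) ^+ 0.
  by rewrite normc1 expr0 mulr1.
have P2 (x : 'rV[R]_1) : normc (P x) <= (2 * s + normc l) * (1 + `|x|) ^+ 1.
  rewrite /P; apply: le_trans (le_normcD _ _) _.
  rewrite normc_real normrN normrM ger0_norm ?mulr_ge0 ?ltW// nx.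
  have := normc_ge0 l; have := normr_ge0 (x ord0 ord0); rewrite expr1; nra.
have [C1 h1] := gauss_dec s0 P1 QE.
have [C2 h2] := gauss_dec s0 P2 QE.
have C0 (C : R) (x : 'rV[R]_1) : C * japN x <= (`|C1| + `|C2|) * japN x <-> C <= `|C1| + `|C2|.
  by rewrite ler_pM2r ?japN_gt0.
have := @int_partial R 1 ord0 F (fun x => P x * F x) (`|C1| + `|C2|).
case.
- by apply: (mfC_comp (mfC_gaussC s l)); exact: measurable_coord_rV.
- have hc := @isD_coord R 1 (delta_mx 0 ord0) ord0.
  rewrite mxE !eqxx /= in hc.
  have hl := isDZ l hc.
  have hq := isDZ (- s)%:C (isDM hc hc).
  have := isD_cexp (isDD hq hl).
  rewrite (_ : (fun x : 'rV_1 => cexp _) = F); last first.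
    apply/funext => x; rewrite /F /gaussC; congr cexp; congr (_ + _).
    by apply: complex_eqP => /=; ring.
  apply: isD_eq => x; rewrite /F /gaussC; congr (_ * cexp (_ + _)).
  + by rewrite /P; apply: complex_eqP; rewrite ?(ReD, ImD, ReM, ImM) /=; ring.
  + by apply: complex_eqP => /=; ring.
- move=> x; have := h1 x; rewrite mul1r => /le_trans -> //.
  by apply/C0; rewrite (le_trans (ler_norm _))// lerDl.
- move=> x; apply: le_trans (h2 x) _.
  by apply/C0; rewrite (le_trans (ler_norm _))// lerDr.
- by [].
Qed.

(** The real part of e^(i th) times the Fourier integral of the Gaussian. The free phase th lets one
    real function give both parts of the integral, at th = 0 and th = - pi / 2. *)
Let cosint (th tau : R) := \int[leb1]_t (expR (- t ^+ 2) * cos (2 * tau * t + th)).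

Let gaussE (th tau t : R) : expi th * gaussC 1 (0 +i* (2 * tau)) t =
  (expR (- t ^+ 2) * cos (2 * tau * t + th)) +i* (expR (- t ^+ 2) * sin (2 * tau * t + th)).
Proof.
rewrite /gaussC cexpD cexp_real.
have -> : (0 +i* (2 * tau)) * t%:C = 0 +i* (2 * tau * t).
  by apply: complex_eqP => /=; ring.
rewrite cexp_im mulrCA -expiD mul1r [th + _]addrC.
by apply: complex_eqP => /=; ring.
Qed.

Let int_trig th tau :
  leb1.-integrable setT (EFin \o (fun t => expR (- t ^+ 2) * cos (2 * tau * t + th))).
Proof.
have := intgC_Re (intgCZ (expi th) (intgC_gaussC (0 +i* (2 * tau)) (ltr01 : 0 < 1 :> R))).
by apply: eq_integrable => // t _; rewrite /comp gaussE.
Qed.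

(** Differentiate under the integral sign; then the imaginary part of e^(i th) times [gaussC_ibp]
    turns the factor t into a multiple of tau, which closes the equation. *)
Let cosint_derive (th tau : R) : is_derive tau (1 : R) (cosint th) (- (2 * tau) * cosint th tau).
Proof.
pose f (x t : R) := expR (- t ^+ 2) * cos (2 * x * t + th).
have df x t : is_derive x (1 : R) (f ^~ t) (expR (- t ^+ 2) * (- sin (2 * x * t + th) * (2 * t))).
  rewrite /f; apply: is_derive_eq.
  by rewrite /GRing.scale /=; ring.
have pf x t : partial1of2 f x t = - (2 * t) * expR (- t ^+ 2) * sin (2 * x * t + th).
  rewrite partial1of2E; have [_ ->] := df x t; ring.
pose G (t : R) := 2 * `|t| * expR (- t ^+ 2).
have iG : leb1.-integrable setT (EFin \o G).
  have h : forall t : R, normc ((2 * `|t|)%:C) <= 2 * (1 + `|t|) ^+ 1.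
    move=> t; rewrite normc_real ger0_norm ?mulr_ge0// expr1; have := normr_ge0 t; lra.
  have mp : mfC (fun t : R => (2 * `|t|)%:C).
    by apply: mfC_real; apply: measurable_funM => //; exact: measurableT_comp.
  have := intgC_Re (intgC_polygauss 0 (ltr01 : 0 < 1 :> R) mp h).
  apply: eq_integrable => // t _; rewrite /comp.
  by rewrite /gaussC mul0r addr0 cexp_real ReM /= mulr0 subr0 mul1r.
have I0 : (`](tau - 1), (tau + 1)[%classic : set R) tau.
  by rewrite /= in_itv /= ltrBlDr !ltrDl ltr01.
have Gub : forall x t, `](tau - 1), (tau + 1)[%classic x -> setT t -> `|partial1of2 f x t| <= G t.
  move=> x t _ _; rewrite pf !normrM normrN normrM ger0_norm// (ger0_norm (expR_ge0 _)).
  by rewrite ler_piMr ?mulr_ge0 ?expR_ge0// ler_norml sin_geN1 sin_le1.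
have G0 t : 0 <= G t by rewrite !mulr_ge0// expR_ge0.
have intf : forall x, `](tau - 1), (tau + 1)[%classic x -> leb1.-integrable setT (EFin \o f x).
  by move=> x _; exact: int_trig.
have derf : forall x t, `](tau - 1), (tau + 1)[%classic x -> setT t -> derivable (f ^~ t) x 1.
  by move=> x t _ _; have [] := df x t.
have D1 := @derivable_under_integral R _ _ leb1 f setT measurableT tau (tau - 1) (tau + 1)
  I0 intf derf G G0 iG Gub.
have D2 := @differentiation_under_integral R _ _ leb1 f setT measurableT tau (tau - 1) (tau + 1)
  I0 intf derf G G0 iG Gub.
have -> : - (2 * tau) * cosint th tau = \int[leb1]_t partial1of2 f tau t.
  have ib := gaussC_ibp (0 +i* (2 * tau)) (ltr01 : 0 < 1 :> R).
  have := congr1 (fun z => Im (expi th * z)) ib.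
  rewrite mulr0 -intCZ; last first.
    apply: (@intgC_polygauss 1 (0 +i* (2 * tau)) _ (2 + normc (0 +i* (2 * tau))) 1) => //.
      apply: mfCD; last exact: mfC_cst.
      apply: mfC_real; apply: continuous_measurable_fun => t.
      by apply: cvgN; apply: cvgM; [exact: cvg_cst|exact: cvg_id].
    move=> t; apply: le_trans (le_normcD _ _) _.
    rewrite normc_real normrN normrM mulr1 ger0_norm//.
    have := normc_ge0 (0 +i* (2 * tau)); have := normr_ge0 t; rewrite expr1; nra.
  change ((\int[leb1]_t Im (expi th * (((- (2 * 1 * t))%:C + (0 +i* (2 * tau))) *
    gaussC 1 (0 +i* (2 * tau)) t)) = 0) -> - (2 * tau) * cosint th tau = \int[leb1]_t partial1of2 f tau t).
  rewrite (_ : (\int[leb1]_t Im _)%R = \int[leb1]_t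
      (partial1of2 f tau t + (2 * tau) * f tau t)); last first.
    apply: eq_Rintegral => t _; rewrite mulrCA gaussE ImM /= pf /f; ring.
  have ip : leb1.-integrable setT (EFin \o partial1of2 f tau).
    apply: le_integrable iG => //.
      apply/measurable_EFinP.
      rewrite (_ : partial1of2 f tau = fun t =>
         - (2 * t) * expR (- t ^+ 2) * sin (2 * tau * t + th)); last by apply/funext => t; rewrite pf.
      apply: measurable_funM; first apply: measurable_funM.
      - by apply: measurableT_comp => //; exact: measurable_funM.
      - by apply: measurableT_comp => //; apply: measurableT_comp => //; exact: measurable_funX.
      - apply: measurableT_comp; first by apply: continuous_measurable_fun; exact: continuous_sin.
        by apply: measurable_funD => //; exact: measurable_funM.
    by move=> t _ /=; rewrite lee_fin (ger0_norm (G0 t)); apply: Gub.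
  rewrite RintegralD//; last first.
    have := integrableZl measurableT (2 * tau) (int_trig th tau).
    by apply: eq_integrable => // t _ /=; rewrite EFinM.
  rewrite RintegralZl//; last exact: int_trig.
  by move/eqP; rewrite addr_eq0 => /eqP ->; rewrite mulNr.
rewrite -D2 derive1E; exact: derivableP.
Qed.

(** By [cosint_derive] the product with e^(tau^2) has derivative 0; its value at tau = 0 is the
    classical Gaussian integral. *)
Let cosintE th tau : cosint th tau = Num.sqrt pi * cos th * expR (- tau ^+ 2).
Proof.
pose y (x : R) := cosint th x * expR (x ^+ 2).
have dy x : is_derive x (1 : R) y 0.
  have h := cosint_derive th x.
  have h2 : is_derive x (1 : R) (fun x : R => expR (x ^+ 2)) (expR (x ^+ 2) * (2 * x)).
    by apply: is_derive_eq; rewrite /GRing.scale /=; ring.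
  apply: (@is_derive_eq _ _ _ _ _ _ _ _ (is_deriveM h h2)).
  by rewrite /GRing.scale /=; ring.
have yc a b : y a = y b.
  wlog ab : a b / a < b.
    move=> H; have [/H//|/H/esym//|->//] := ltgtP a b.
  have cy : {within `[a, b], continuous y}.
    by apply: derivable_within_continuous => x _; have [] := dy x.
  have [c _] := MVT ab (fun x _ => dy x) cy.
  by rewrite mul0r => /eqP; rewrite subr_eq0 => /eqP.
have y0 : y 0 = Num.sqrt pi * cos th.
  rewrite /y /cosint expr0n expR0 mulr1.
  rewrite (_ : (fun t => _) = fun t => cos th * gauss_fun t).
    rewrite RintegralZl//; last exact: integrableT_gauss.
    by rewrite /Rintegral integralT_gauss /= mulrC.
  by apply/funext => t; rewrite mulr0 mul0r add0r mulrC.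
by rewrite -y0 (yc 0 tau) /y -mulrA -expRD subrr expR0 mulr1.
Qed.

Lemma intC_gauss1 (tau : R) : intC leb1 (gaussC 1 (0 +i* (2 * tau))) =
  (Num.sqrt pi * expR (- tau ^+ 2))%:C.
Proof.
have H th : Re (expi th * intC leb1 (gaussC 1 (0 +i* (2 * tau)))) =
    Num.sqrt pi * cos th * expR (- tau ^+ 2).
  rewrite -intCZ; last exact: intgC_gaussC.
  rewrite -cosintE; apply: eq_Rintegral => t _; by rewrite gaussE.
apply: complex_eqP; first by have := H 0; rewrite expi0 mul1r cos0 mulr1.
have := H (- (pi / 2)); rewrite cosN cos_pihalf mulr0 mul0r.
rewrite ReM {1 2}/expi /= cosN sinN cos_pihalf sin_pihalf mul0r mulN1r opprK add0r.
by [].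
Qed.

Lemma intC_gaussC (s : R) (l : R[i]) : 0 < s ->
  intC leb1 (gaussC s l) = (Num.sqrt (pi / s))%:C * cexp (l ^+ 2 * ((4 * s)^-1)%:C).
Proof.
move=> s0; pose q := Num.sqrt s.
have q0 : 0 < q by rewrite sqrtr_gt0.
have q2 : q ^+ 2 = s by rewrite sqr_sqrtr// ltW.
case: l => sg tau.
(* The real substitution q t + a completes the square for the real part of [l], while its imaginary
   part becomes the frequency 2 k. The constants left over form the factor (sg + i tau)^2 / (4 s) in
   the exponent. *)
pose k := tau / (2 * q); pose a := - (sg / (2 * q)).
have [i1 e1] := line_intC (intgC_gaussC (0 +i* (2 * k)) (ltr01 : 0 < 1 :> R)).
have [i2 e2] := line_intC (intgC_gaussC (sg +i* tau) s0).
have := intC_affine (const_mx a) (lt0r_neq0 q0) i1.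
rewrite e1 -e2 intC_gauss1 expr1 (gtr0_norm q0).
rewrite (_ : (fun x : 'rV[R]_1 => _) = fun x => cexp ((- (sg ^+ 2 / (4 * s))) +i* (- (sg * tau / (2 * s))))
    * gaussC s (sg +i* tau) (x ord0 ord0)); last first.
  apply/funext => x; rewrite /gaussC !mxE -cexpD; congr cexp.
  by apply: complex_eqP => /=; rewrite /k /a -q2; field; rewrite gt_eqF.
rewrite intCZ//; set I := intC _ _ => E.
have -> : I = cexp (sg ^+ 2 / (4 * s) +i* (sg * tau / (2 * s))) *
    (cexp ((- (sg ^+ 2 / (4 * s))) +i* (- (sg * tau / (2 * s)))) * I).
  rewrite mulrA -cexpD (_ : _ + _ = 0) ?cexp0 ?mul1r//.
  by apply: complex_eqP => /=; rewrite subrr.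
rewrite E sqrtrM ?pi_ge0// sqrtrV ?ltW// -/q.
set A := cexp (sg ^+ 2 / (4 * s) +i* _).
have <- : A * (expR (- k ^+ 2))%:C = cexp ((sg +i* tau) ^+ 2 * ((4 * s)^-1)%:C).
  rewrite -cexp_real -cexpD; congr cexp.
  by apply: complex_eqP => /=; rewrite /k -q2; field; rewrite gt_eqF.
by rewrite !rmorphM /=; ring.
Qed.

Lemma intgC_gaussD n (s : R) (l : 'I_n -> R[i]) : 0 < s ->
  intgC (leb n) (fun x => \prod_i gaussC s (l i) (x ord0 i)).
Proof. by move=> s0; exact: (@prodC_rV R n _ (fun i => intgC_gaussC (l i) s0)).1. Qed.
Lemma intC_gaussD n (s : R) (l : 'I_n -> R[i]) : 0 < s ->
  intC (leb n) (fun x => \prod_i gaussC s (l i) (x ord0 i)) =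
  \prod_i ((Num.sqrt (pi / s))%:C * cexp (l i ^+ 2 * ((4 * s)^-1)%:C)).
Proof.
move=> s0; rewrite (@prodC_rV R n _ (fun i => intgC_gaussC (l i) s0)).2.
by apply: eq_bigr => i _; exact: intC_gaussC.
Qed.

End gaussian_integral.

(** * The short-time Fourier transform *)

Section square_integrable.
Context {d : measure_display} {T : measurableType d} {R : realType}.
Variable mu : {measure set T -> \bar R}.
Implicit Types F G : T -> R[i].

Definition sqi F := mfC F /\ mu.-integrable setT (EFin \o (fun x => normc (F x) ^+ 2)).
Definition sq F : R := \int[mu]_x (normc (F x) ^+ 2).
Definition ip F G : R[i] := intC mu (fun x => F x * conjc (G x)).

Lemma measurable_normc2 F : mfC F -> measurable_fun setT (fun x => normc (F x) ^+ 2).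
Proof. by move=> mF; apply: measurable_funX; exact: measurable_normc. Qed.

Lemma sqiP F : mfC F -> sqi F <-> (\int[mu]_x (normc (F x) ^+ 2)%:E < +oo)%E.
Proof.
move=> mF; have e : (\int[mu]_x `|(EFin \o (fun x => normc (F x) ^+ 2)%R) x| =
    \int[mu]_x (normc (F x) ^+ 2)%:E)%E.
  by apply: eq_integral => x _ /=; rewrite ger0_norm ?sqr_ge0.
split => [[_ /integrableP[_]]|h]; first by rewrite e.
split => //; apply/integrableP; rewrite e; split => //.
by apply/measurable_EFinP; exact: measurable_normc2.
Qed.

Lemma sq_ge0 F : 0 <= sq F.
Proof. by apply: Rintegral_ge0 => x _; exact: sqr_ge0. Qed.
Lemma sqiE F : sqi F -> (sq F)%:E = (\int[mu]_x (normc (F x) ^+ 2)%:E)%E.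
Proof. by move=> [_ i]; rewrite /sq /Rintegral fineK//; exact: (integrable_fin_num _ i). Qed.

Lemma sqi_le F (g : T -> R) : mfC F -> mu.-integrable setT (EFin \o g) ->
  (forall x, normc (F x) ^+ 2 <= g x) -> sqi F.
Proof.
move=> mF ig h; split => //; apply: le_integrable ig => //.
  by apply/measurable_EFinP; exact: measurable_normc2.
move=> x _ /=; rewrite lee_fin ger0_norm ?sqr_ge0//.
by rewrite (le_trans (h x))// ler_norm.
Qed.

Lemma sqiM F G : sqi F -> sqi G -> intgC mu (fun x => F x * G x).
Proof.
move=> [mF iF] [mG iG].
apply: (intgC_le_real _ (g := fun x => normc (F x) ^+ 2 + normc (G x) ^+ 2)).
- exact: mfCM.
- have := integrableD measurableT iF iG.
  by apply: eq_integrable => // x _ /=; rewrite EFinD.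
- move=> x; rewrite normcM; have := normc_ge0 (F x); have := normc_ge0 (G x); nra.
Qed.
Lemma sqiZ (c : R[i]) F : sqi F -> sqi (fun x => c * F x).
Proof.
move=> [mF iF]; split; first by apply: mfCM => //; exact: mfC_cst.
have := integrableZl measurableT (normc c ^+ 2) iF.
by apply: eq_integrable => // x _ /=; rewrite normcM exprMn EFinM.
Qed.
Lemma sqiD F G : sqi F -> sqi G -> sqi (fun x => F x + G x).
Proof.
move=> [mF iF] [mG iG].
apply: (@sqi_le _ (fun x => 2 * (normc (F x) ^+ 2 + normc (G x) ^+ 2))).
- exact: mfCD.
- have := integrableZl measurableT 2 (integrableD measurableT iF iG).
  by apply: eq_integrable => // x _ /=; rewrite EFinM EFinD.
- move=> x; have h := le_normcD (F x) (G x).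
  have h0 := normc_ge0 (F x + G x); have h1 := normc_ge0 (F x); have h2 := normc_ge0 (G x).
  apply: (@le_trans _ _ ((normc (F x) + normc (G x)) ^+ 2)); first by rewrite lerXn2r ?nnegrE ?addr_ge0.
  by have := sqr_ge0 (normc (F x) - normc (G x)); nra.
Qed.
Lemma sqi_conjc F : sqi F -> sqi (fun x => conjc (F x)).
Proof.
move=> [mF iF]; split; first exact: mfC_conjc.
by apply: eq_integrable iF => // x _ /=; rewrite normc_conjc.
Qed.
Lemma sqiN F : sqi F -> sqi (fun x => - F x).
Proof.
by move=> h; have := sqiZ (-1) h; under [fun x => _]eq_fun do rewrite mulN1r.
Qed.
Lemma sqiB F G : sqi F -> sqi G -> sqi (fun x => F x - G x).
Proof. by move=> hF hG; apply: sqiD => //; exact: sqiN. Qed.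
Lemma sqi0 : sqi (fun=> 0).
Proof.
split; first exact: mfC_cst.
by under [fun x => _]eq_fun do rewrite normc0 expr0n; exact: integrable0.
Qed.
Lemma sqi_sum I (r : seq I) (P : pred I) (F : I -> T -> R[i]) :
  (forall i, sqi (F i)) -> sqi (fun x => \sum_(i <- r | P i) F i x).
Proof.
move=> mF; elim: r => [|i r IH].
  by under [fun x => _]eq_fun do rewrite big_nil; exact: sqi0.
under [fun x => _]eq_fun do rewrite big_cons.
by case: (P i) => //; exact: sqiD.
Qed.
Lemma sqi_ip F G : sqi F -> sqi G -> intgC mu (fun x => F x * conjc (G x)).
Proof. by move=> hF hG; apply: sqiM => //; exact: sqi_conjc. Qed.

Lemma sq_ip F : sqi F -> ip F F = (sq F)%:C.
Proof. by move=> hF; rewrite /ip -intC_real; apply: eq_intC => x; rewrite mul_conjc. Qed.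
Lemma ip_conjc F G : sqi F -> sqi G -> ip G F = conjc (ip F G).
Proof.
move=> hF hG; rewrite /ip -intC_conjc; last exact: sqi_ip.
by apply: eq_intC => x; rewrite conjcM conjcK mulrC.
Qed.
Lemma ipDl F G H : sqi F -> sqi G -> sqi H -> ip (fun x => F x + G x) H = ip F H + ip G H.
Proof.
move=> hF hG hH; rewrite /ip -intCD; [|exact: sqi_ip|exact: sqi_ip].
by apply: eq_intC => x; rewrite mulrDl.
Qed.
Lemma ipZl (c : R[i]) F G : sqi F -> sqi G -> ip (fun x => c * F x) G = c * ip F G.
Proof.
move=> hF hG; rewrite /ip -intCZ; last exact: sqi_ip.
by apply: eq_intC => x; rewrite mulrA.
Qed.
Lemma ipNl F G : sqi F -> sqi G -> ip (fun x => - F x) G = - ip F G.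
Proof.
move=> hF hG; rewrite -[RHS]mulN1r -ipZl//; congr ip; apply/funext => x.
by rewrite mulN1r.
Qed.
Lemma ipBl F G H : sqi F -> sqi G -> sqi H -> ip (fun x => F x - G x) H = ip F H - ip G H.
Proof. by move=> hF hG hH; rewrite ipDl ?ipNl//; exact: sqiN. Qed.
Lemma ip_suml I (r : seq I) (P : pred I) (F : I -> T -> R[i]) G :
  (forall i, sqi (F i)) -> sqi G ->
  ip (fun x => \sum_(i <- r | P i) F i x) G = \sum_(i <- r | P i) ip (F i) G.
Proof.
move=> hF hG; rewrite /ip.
under [fun x => _]eq_fun do rewrite mulr_suml.
by apply: intC_sum => i; exact: sqi_ip.
Qed.
Lemma ipZr (c : R[i]) F G : sqi F -> sqi G -> ip G (fun x => c * F x) = conjc c * ip G F.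
Proof.
by move=> hF hG; rewrite ip_conjc ?ipZl// ?conjcM -?ip_conjc//; exact: sqiZ.
Qed.
Lemma ipBr F G H : sqi F -> sqi G -> sqi H -> ip H (fun x => F x - G x) = ip H F - ip H G.
Proof.
by move=> hF hG hH; rewrite ip_conjc ?ipBl// ?conjcB -?ip_conjc//; exact: sqiB.
Qed.
Lemma ip_sumr I (r : seq I) (P : pred I) (F : I -> T -> R[i]) G :
  (forall i, sqi (F i)) -> sqi G ->
  ip G (fun x => \sum_(i <- r | P i) F i x) = \sum_(i <- r | P i) ip G (F i).
Proof.
move=> hF hG; rewrite ip_conjc// ?ip_suml ?conjc_sum//; last exact: sqi_sum.
by apply: eq_bigr => i _; rewrite -ip_conjc.
Qed.

Lemma cauchy_schwarz F G : sqi F -> sqi G ->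
  (\int[mu]_x normc (F x * G x)) ^+ 2 <= sq F * sq G.
Proof.
move=> hF hG; have [mF iF] := hF; have [mG iG] := hG.
set I := \int[mu]_x _.
have iFG : mu.-integrable setT (EFin \o (fun x => normc (F x * G x))) by exact: intgC_normc (sqiM hF hG).
have q x y : 0 <= x ^+ 2 * sq F - 2 * x * y * I + y ^+ 2 * sq G.
  have i1 (c : R) (f : T -> R) : mu.-integrable setT (EFin \o f) ->
      mu.-integrable setT (EFin \o (fun t => c * f t)).
    move=> h; have := integrableZl measurableT c h.
    by apply: eq_integrable => // t _ /=; rewrite EFinM.
  have i2 (f g : T -> R) : mu.-integrable setT (EFin \o f) -> mu.-integrable setT (EFin \o g) ->
      mu.-integrable setT (EFin \o (fun t => f t + g t)).
    move=> h1 h2; have := integrableD measurableT h1 h2.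
    by apply: eq_integrable => // t _ /=; rewrite EFinD.
  have := @Rintegral_ge0 _ _ _ mu setT
    (fun t => x ^+ 2 * normc (F t) ^+ 2 + (- (2 * x * y)) * normc (F t * G t) + y ^+ 2 * normc (G t) ^+ 2).
  rewrite RintegralD//; [|by apply: i2; exact: i1|exact: i1].
  rewrite RintegralD//; [|exact: i1|exact: i1].
  rewrite !RintegralZl// -/I -/(sq F) -/(sq G) mulNr; apply => t _.
  have -> : x ^+ 2 * normc (F t) ^+ 2 + - (2 * x * y) * normc (F t * G t) +
    y ^+ 2 * normc (G t) ^+ 2 = (x * normc (F t) - y * normc (G t)) ^+ 2 by rewrite normcM; ring.
  exact: sqr_ge0.
have I0 : 0 <= I by apply: Rintegral_ge0 => x _; exact: normc_ge0.
have [B0|B0] := eqVneq (sq G) 0.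
  rewrite B0 mulr0; have [->|In0] := eqVneq I 0; first by rewrite expr0n.
  have Ip : 0 < I by rewrite lt_neqAle eq_sym In0.
  (* When [sq G] is 0 the quadratic form is linear in its second argument; this value makes it equal
     to -1, a contradiction. *)
  have := q 1 ((sq F + 1) / (2 * I)).
  rewrite B0 mulr0 addr0 expr1n mul1r mulr1.
  have -> : 2 * ((sq F + 1) / (2 * I)) * I = sq F + 1 by field.
  by rewrite opprD addrA subrr sub0r oppr_ge0 ler10.
have Bp : 0 < sq G by rewrite lt_neqAle eq_sym B0 sq_ge0.
have := q (sq G) I.
have -> : sq G ^+ 2 * sq F - 2 * sq G * I * I + I ^+ 2 * sq G = sq G * (sq F * sq G - I ^+ 2) by ring.
by rewrite pmulr_rge0// subr_ge0.
Qed.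

Lemma ip_le F G : sqi F -> sqi G -> normc (ip F G) ^+ 2 <= sq F * sq G.
Proof.
move=> hF hG.
have e : sq G = sq (fun x => conjc (G x)).
  by apply: eq_Rintegral => x _; rewrite normc_conjc.
rewrite e; apply: le_trans (cauchy_schwarz hF (sqi_conjc hG)).
rewrite lerXn2r ?nnegrE ?normc_ge0//.
  by apply: Rintegral_ge0 => x _; exact: normc_ge0.
by apply: normc_intC; exact: sqi_ip.
Qed.

Lemma sqB F G : sqi F -> sqi G ->
  sq (fun x => F x - G x) = sq F - 2 * complex.Re (ip F G) + sq G.
Proof.
move=> hF hG; have hB := sqiB hF hG.
have := sq_ip hB; rewrite ipBl// !ipBr// !sq_ip// (ip_conjc hF hG).
move=> /(congr1 (@complex.Re R)); rewrite !(ReD, ReN) Re_conjc /= => <-; ring.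
Qed.

Lemma ip_cvg (F : nat -> T -> R[i]) G H : (forall n, sqi (F n)) -> sqi G -> sqi H ->
  sq (fun x => G x - F n x) @[n --> \oo] --> (0 : R) ->
  cvgC (fun n => ip (F n) H) (ip G H).
Proof.
move=> hF hG hH h.
apply: (@cvgC_squeeze _ _ _ (fun n => Num.sqrt (sq (fun x => G x - F n x) * sq H))).
  move=> n; rewrite normcBC -ipBl//.
  rewrite -[leLHS]ger0_norm ?normc_ge0// -sqrtr_sqr ler_wsqrtr//.
  by apply: ip_le => //; exact: sqiB.
have -> : 0 = Num.sqrt (0 * sq H) by rewrite mul0r sqrtr0.
apply: (@continuous_cvg _ _ _ _ _ _ (@Num.sqrt R)); first exact: sqrt_continuous.
by apply: cvgM => //; exact: cvg_cst.
Qed.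

Lemma eq_sq F G : F =1 G -> sq F = sq G.
Proof. by move/funext => ->. Qed.

End square_integrable.

Lemma intgC_mul_expi {d : measure_display} {T : measurableType d} {R : realType}
    (mu : {measure set T -> \bar R}) (F : T -> R[i]) (q : T -> R) :
  intgC mu F -> measurable_fun setT q -> intgC mu (fun x => F x * expi (q x)).
Proof.
move=> iF mq; apply: (intgC_le _ iF).
  by apply: mfCM; [exact: intgC_mfC iF|exact: mfC_expi].
by move=> x; rewrite normcM normc_expi mulr1.
Qed.

Lemma ae_eq_intC {d : measure_display} {T : measurableType d} {R : realType}
    (mu : {measure set T -> \bar R}) (F G : T -> R[i]) : mfC F -> mfC G ->
  {ae mu, forall x, F x = G x} -> intC mu F = intC mu G.
Proof.
move=> [a b] [c e] h; rewrite /intC /Rintegral; congr (fine _ +i* fine _).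
  apply: ae_eq_integral => //; [exact/measurable_EFinP|exact/measurable_EFinP|].
  by apply: filterS h => x -> _.
apply: ae_eq_integral => //; [exact/measurable_EFinP|exact/measurable_EFinP|].
by apply: filterS h => x -> _.
Qed.

Section nice_functions.
Context {R : realType} {n : nat}.
Local Notation Rn := 'rV[R]_n.
Local Notation leb n := (lebesgue_rV R n).
Implicit Types (f g h : Rn -> R[i]).

(** The class through which windows, Schwartz functions and special Hermite functions enter. Decay
    by [japN] gives boundedness, L^1 and L^2; continuity serves pointwise Fourier inversion in
    [parseval_L1]. *)
Definition nice f := [/\ continuous (fun x => complex.Re (f x)),
  continuous (fun x => complex.Im (f x)) &
  exists C : R, forall x, normc (f x) <= C * japN x].

Lemma nice_mfC f : nice f -> mfC f.
Proof. by move=> [a b _]; split; exact: continuous_measurable_rV. Qed.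
Lemma nice_bounded f : nice f -> exists2 C : R, 0 < C & forall x, normc (f x) <= C.
Proof.
move=> [_ _ [C hC]]; exists (`|C| + 1); first by rewrite ltr_wpDl.
move=> x; apply: le_trans (hC x) _; apply: (@le_trans _ _ (`|C| * 1)).
  rewrite (le_trans (ler_wpM2r (ltW (japN_gt0 x)) (ler_norm C)))//.
  by rewrite ler_wpM2l ?japN_le1.
by rewrite mulr1 lerDl.
Qed.
Lemma nice_intgC f : nice f -> intgC (leb n) f.
Proof. by move=> hf; have [_ _ [C hC]] := hf; apply: intgC_japN hC; exact: nice_mfC. Qed.
Lemma nice_sqi f : nice f -> sqi (leb n) f.
Proof.
move=> hf; have [C C0 hC] := nice_bounded hf; have := nice_intgC hf => hi.
apply: (sqi_le (g := fun x => C * normc (f x)) (nice_mfC hf)).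
  have := integrableZl measurableT C (intgC_normc hi).
  by apply: eq_integrable => // x _ /=; rewrite EFinM.
by move=> x; rewrite expr2 ler_wpM2r ?normc_ge0.
Qed.
Lemma nice_conjc f : nice f -> nice (fun x => conjc (f x)).
Proof.
move=> [a b [C hC]]; split.
- by under [fun x => _]eq_fun do rewrite Re_conjc.
- under [fun x => _]eq_fun do rewrite Im_conjc.
  by move=> x; exact: (cvgN (b x)).
- by exists C => x; rewrite normc_conjc.
Qed.
Lemma niceM_bounded f g (B : R) : nice f -> continuous (fun x => complex.Re (g x)) ->
  continuous (fun x => complex.Im (g x)) -> (forall x, normc (g x) <= B) ->
  nice (fun x => f x * g x).
Proof.
move=> [a b [C hC]] c e gB; split.
- under [fun x => _]eq_fun do rewrite ReM.
  by move=> x; exact: (cvgB (cvgM (a x) (c x)) (cvgM (b x) (e x))).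
- under [fun x => _]eq_fun do rewrite ImM.
  by move=> x; exact: (cvgD (cvgM (a x) (e x)) (cvgM (b x) (c x))).
- exists (`|C| * B) => x; rewrite normcM mulrAC ler_pM ?normc_ge0//.
  by apply: le_trans (hC x) _; rewrite ler_wpM2r ?(ltW (japN_gt0 _))// ler_norm.
Qed.
Lemma shift_continuous (a : Rn) (f : Rn -> R) : continuous f -> continuous (fun x : Rn => f (x + a)).
Proof.
move=> cf x; apply: (@continuous_comp _ _ _ (fun x : Rn => x + a) f); last exact: cf.
exact: (cvgD cvg_id (cvg_cst a)).
Qed.
Lemma niceM_shift f g (a : Rn) : nice f -> nice g -> nice (fun x => f x * g (x + a)).
Proof.
move=> hf hg; have [B B0 hB] := nice_bounded hg; have [c e _] := hg.
exact: (niceM_bounded hf (shift_continuous (a := a) c) (shift_continuous (a := a) e) (fun x => hB (x + a))).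
Qed.

Lemma continuous_coord_rV i : continuous (fun y : Rn => y ord0 i).
Proof. by move=> y; exact: coord_continuous. Qed.
Lemma continuous_sum_rV I (r : seq I) (F : I -> Rn -> R) :
  (forall i, continuous (F i)) -> continuous (fun y => \sum_(i <- r) F i y).
Proof.
move=> cF; elim: r => [|i r IH].
  rewrite (_ : (fun y => _) = cst 0); first exact: cst_continuous.
  by apply/funext => y; rewrite big_nil.
rewrite (_ : (fun y => _) = (fun y => F i y + \sum_(j <- r) F j y)).
  by move=> y; exact: (cvgD (cF i y) (IH y)).
by apply/funext => y; rewrite big_cons.
Qed.
Lemma continuous_dotR (x : Rn) : continuous (fun y : Rn => dotR x y).
Proof.
apply: continuous_sum_rV => i y.
by have := cvgM (cvg_cst (x ord0 i)) (@continuous_coord_rV i y); exact.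
Qed.
Lemma nice_expi f (q : Rn -> R) : nice f -> continuous q ->
  nice (fun y => f y * expi (q y)).
Proof.
move=> hf cq; apply: (niceM_bounded (B := 1)) => //.
- by move=> y; apply: (@continuous_comp _ _ _ q (@cos R)); [exact: cq|exact: continuous_cos].
- by move=> y; apply: (@continuous_comp _ _ _ q (@sin R)); [exact: cq|exact: continuous_sin].
- by move=> y; rewrite normc_expi.
Qed.
Lemma continuousC_cvg (f : Rn -> R[i]) (u : nat -> Rn) x :
  continuous (fun x => complex.Re (f x)) -> continuous (fun x => complex.Im (f x)) ->
  u k @[k --> \oo] --> x -> cvgC (fun k => f (u k)) (f x).
Proof.
move=> cR cI ux; apply: cvgC_ReIm.
  exact: (cvg_comp u (fun x => complex.Re (f x)) ux (cR x)).
exact: (cvg_comp u (fun x => complex.Im (f x)) ux (cI x)).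
Qed.

End nice_functions.

(** * Parseval's formula by Gaussian regularization *)

Section parseval.
Context {R : realType} {n : nat}.
Local Notation Rn := 'rV[R]_n.
Local Notation leb n := (lebesgue_rV R n).

(** Gaussian cut-offs in frequency, bounded by 1 and tending to 1; their Fourier transforms form an
    approximate identity at scale 1/(k+1). *)
Let gk (k : nat) (xi : Rn) : R[i] := \prod_i gaussC (k.+1%:R^-1 ^+ 2) 0 (xi ord0 i).

Let gkE k xi : gk k xi = (expR (- (k.+1%:R^-1 ^+ 2 * \sum_i xi ord0 i ^+ 2)))%:C.
Proof.
rewrite /gk /gaussC -cexp_sum -cexp_real; congr cexp.
rewrite (eq_bigr (fun i => (- (k.+1%:R^-1 ^+ 2 * xi ord0 i ^+ 2))%:C)).
  by rewrite -rmorph_sum /= sumrN mulr_sumr.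
by move=> i _; rewrite mul0r addr0.
Qed.
Let gk_le1 k xi : normc (gk k xi) <= 1.
Proof.
rewrite gkE normc_real ger0_norm ?expR_ge0// -expR0 ler_expR oppr_le0.
by rewrite mulr_ge0 ?sqr_ge0// sumr_ge0// => i _; exact: sqr_ge0.
Qed.
Let s0 k : 0 < k.+1%:R^-1 ^+ 2 :> R.
Proof. by rewrite exprn_gt0 ?invr_gt0. Qed.
Let e_cvg : (k.+1%:R^-1 : R) @[k --> \oo] --> (0 : R).
Proof. exact: (cvg_harmonic (R := R)). Qed.
Let gk_cvg xi : cvgC (gk ^~ xi) 1.
Proof.
have h : expR (- (k.+1%:R^-1 ^+ 2 * \sum_i xi ord0 i ^+ 2)) @[k --> \oo] --> (1 : R).
  rewrite -[X in _ --> X]expR0.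
  apply: (@continuous_cvg _ _ _ _ _ _ (@expR R)); first exact: continuous_expR.
  rewrite -[X in _ --> X]oppr0; apply: cvgN; under eq_cvg do rewrite expr2.
  set S := \sum_i _.
  have h : (k.+1%:R^-1 * k.+1%:R^-1 * S) @[k --> \oo] --> 0 * 0 * S.
    exact: (cvgM (cvgM e_cvg e_cvg) (cvg_cst S)).
  by rewrite !mul0r in h.
apply: cvgC_ReIm.
  by under eq_cvg do rewrite gkE.
by under eq_cvg do rewrite gkE; exact: cvg_cst.
Qed.
Let mgk k : mfC (gk k).
Proof. exact: intgC_mfC (intgC_gaussD (fun=> 0) (s0 k)). Qed.

Let FTg k (t : Rn) : intC (leb n) (fun xi => gk k xi * expi (dotR xi t)) =
  \prod_(i < n) ((Num.sqrt pi * k.+1%:R) * expR (- ((k.+1%:R * t ord0 i) ^+ 2 / 4)))%:C.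
Proof.
transitivity (intC (leb n) (fun xi : Rn => \prod_i gaussC (k.+1%:R^-1 ^+ 2) (0 +i* t ord0 i) (xi ord0 i))).
  apply: eq_intC => xi.
  have -> : expi (dotR xi t) = \prod_i cexp (0 +i* (xi ord0 i * t ord0 i)).
    rewrite -cexp_sum -cexp_im; congr cexp; apply: complex_eqP.
      by rewrite Re_sum /= big1.
    by rewrite Im_sum.
  rewrite -big_split /=; apply: eq_bigr => i _.
  rewrite /gaussC -cexpD; congr cexp; apply: complex_eqP => /=; ring.
rewrite intC_gaussD//; apply: eq_bigr => i _.
rewrite rmorphM /=; congr (_ * _).
  congr (_ +i* 0); rewrite sqrtrM ?pi_ge0// sqrtrV ?sqr_ge0// sqrtr_sqr.
  by rewrite gtr0_norm ?invr_gt0// invrK.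
rewrite -cexp_real; congr cexp; apply: complex_eqP => /=; last by ring.
by field; rewrite nat1r pnatr_eq0.
Qed.

Let FTg_scaled k (r : Rn) :
  intC (leb n) (fun xi => gk k xi * expi (dotR xi (k.+1%:R^-1 *: r))) =
  (k.+1%:R ^+ n)%:C * \prod_(i < n) ((Num.sqrt pi)%:C * gaussC (4^-1) 0 (r ord0 i)).
Proof.
rewrite FTg.
have -> : (k.+1%:R ^+ n)%:C = \prod_(i < n) (k.+1%:R : R)%:C.
  by rewrite prodr_const card_ord rmorphXn.
rewrite -big_split /=; apply: eq_bigr => i _.
rewrite /gaussC mul0r addr0 cexp_real -!rmorphM /=; congr (_ +i* 0).
rewrite mxE mulVKf ?pnatr_eq0//.
by rewrite [4^-1 * _]mulrC mulrA [k.+1%:R * _]mulrC.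
Qed.

(** With the cut-off [gk] inserted every double integral converges absolutely, and Fubini moves the
    cut-off onto v, where it becomes the local average [Wk]. As k grows, the frequency side
    converges because U W is integrable, and the other side because v is continuous and bounded. *)
Lemma parseval_L1 (u v : Rn -> R[i]) : intgC (leb n) u -> nice v ->
  let U xi := intC (leb n) (fun y => u y * expi (- dotR xi y)) in
  let W xi := intC (leb n) (fun y => v y * expi (dotR xi y)) in
  intgC (leb n) (fun xi => U xi * W xi) ->
  intC (leb n) (fun xi => U xi * W xi) = ((2 * pi) ^+ n)%:C * intC (leb n) (fun y => u y * v y).
Proof.
move=> iu nv U W iUW.
have iv := nice_intgC nv; have mv := nice_mfC nv; have mu := intgC_mfC iu.
have [M M0 hM] := nice_bounded nv; have [cR cI _] := nv.
have mdot d' (T : measurableType d') (f g : T -> Rn) : measurable_fun setT f ->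
    measurable_fun setT g -> measurable_fun setT (fun t => dotR (f t) (g t)).
  exact: measurable_dotR.
have mE : mfC (fun p : Rn * Rn => expi (dotR p.1 p.2)).
  by apply: mfC_expi; apply: mdot; [exact: measurable_fst|exact: measurable_snd].
have mE' : mfC (fun p : Rn * Rn => expi (- dotR p.1 p.2)).
  by apply: mfC_expi; apply: measurableT_comp => //; apply: mdot; [exact: measurable_fst|exact: measurable_snd].
have mU : mfC U.
  apply: (mfC_fubini1 (leb n) (F := fun p : Rn * Rn => u p.2 * expi (- dotR p.1 p.2))).
  by apply: mfCM => //; exact: (mfC_comp mu measurable_snd).
have mW : mfC W.
  apply: (mfC_fubini1 (leb n) (F := fun p : Rn * Rn => v p.2 * expi (dotR p.1 p.2))).
  by apply: mfCM => //; exact: (mfC_comp mv measurable_snd).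
pose G (r : Rn) : R[i] := \prod_(i < n) ((Num.sqrt pi)%:C * gaussC (4^-1) 0 (r ord0 i)).
have q0 : 0 < (4^-1 : R) by rewrite invr_gt0.
have GE r : G r = (Num.sqrt pi ^+ n)%:C * \prod_i gaussC (4^-1) 0 (r ord0 i).
  by rewrite /G big_split /= prodr_const card_ord rmorphXn.
have iG : intgC (leb n) G.
  rewrite (_ : G = fun r => (Num.sqrt pi ^+ n)%:C * \prod_i gaussC (4^-1) 0 (r ord0 i)); last exact/funext.
  exact: intgCZ (intgC_gaussD _ q0).
have IG : intC (leb n) G = ((2 * pi) ^+ n)%:C.
  rewrite (_ : G = fun r => (Num.sqrt pi ^+ n)%:C * \prod_i gaussC (4^-1) 0 (r ord0 i)); last exact/funext.
  rewrite intCZ ?intC_gaussD//; last exact: intgC_gaussD.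
  rewrite expr0n mul0r cexp0 mulr1 prodr_const card_ord -rmorphXn -rmorphM /=; congr (_ +i* 0).
  rewrite -exprMn invrK -sqrtrM ?pi_ge0//; congr (_ ^+ n).
  rewrite (_ : pi * (pi * 4) = (2 * pi) ^+ 2); last by ring.
  by rewrite sqrtr_sqr ger0_norm// mulr_ge0 ?pi_ge0.
pose Wk k y := intC (leb n) (fun xi => gk k xi * W xi * expi (- dotR xi y)).
have WB xi : normc (W xi) <= \int[leb n]_y normc (v y).
  apply: le_trans (normc_intC _) _.
    by apply: intgC_mul_expi => //; exact: mdot.
  rewrite le_eqVlt; apply/orP; left; apply/eqP; apply: eq_Rintegral => y _.
  by rewrite normcM normc_expi mulr1.
have igW k : intgC (leb n) (fun xi => gk k xi * W xi).
  under [fun y => _]eq_fun do rewrite mulrC.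
  by apply: (intgC_bounded mW WB); exact: (intgC_gaussD (fun=> 0) (s0 k)).
(* Substituting y' = y + r / (k+1) turns the transform of the cut-off into the fixed Gaussian [G],
   whose integral (2 pi)^n is the constant of the statement. *)
have WkE k y : Wk k y = intC (leb n) (fun r => v (k.+1%:R^-1 *: r + y) * G r).
  pose F (p : Rn * Rn) := gk k p.1 * v p.2 * expi (dotR p.1 (p.2 - y)).
  have iF : intgC (leb n \x leb n)%E F.
    apply: intgC_mul_expi; first exact: intgC_prod (intgC_gaussD (fun=> 0) (s0 k)) iv.
    apply: mdot; first exact: measurable_fst.
    by apply: measurable_subrV => //; exact: measurable_snd.
  have -> : Wk k y = intC (leb n) (fun xi => intC (leb n) (fun y' => F (xi, y'))).
    apply: eq_intC => xi; rewrite /F /=.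
    have iW : intgC (leb n) (fun y0 => v y0 * expi (dotR xi y0)).
      by apply: intgC_mul_expi => //; exact: mdot.
    rewrite mulrAC -intCZ//; apply: eq_intC => y'.
    have -> : dotR xi (y' - y) = - dotR xi y + dotR xi y'.
      rewrite /dotR -sumrN -big_split /=; apply: eq_bigr => i _; rewrite !mxE; ring.
    by rewrite expiD; ring.
  rewrite fubiniC//.
  have -> : intC (leb n) (fun y' => intC (leb n) (fun xi => F (xi, y'))) =
      intC (leb n) (fun t => v (t + y) * intC (leb n) (fun xi => gk k xi * expi (dotR xi t))).
    pose H (y' : Rn) := v y' * intC (leb n) (fun xi => gk k xi * expi (dotR xi (y' - y))).
    have HE : H =1 (fun y' => intC (leb n) (fun xi => F (xi, y'))).
      move=> y'; rewrite /H /F /= -intCZ; first by apply: eq_intC => xi; ring.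
      by apply: intgC_mul_expi; [exact: (intgC_gaussD (fun=> 0) (s0 k))|exact: mdot].
    have mH : mfC H by rewrite (funext HE); exact: intgC_mfC (intgC_fubini2 iF).
    rewrite -(eq_intC _ HE) -(intC_shift y mH); apply: eq_intC => t.
    by rewrite /H addrK.
  pose H (t : Rn) := v (t + y) * intC (leb n) (fun xi => gk k xi * expi (dotR xi t)).
  have iH : intgC (leb n) H.
    pose H0 (y' : Rn) := intC (leb n) (fun xi => F (xi, y')).
    have := intgC_shift y (intgC_fubini2 iF).
    rewrite (_ : (fun x => _) = H)//; apply/funext => t.
    rewrite /H /F /= -intCZ; first by apply: eq_intC => xi; rewrite addrK; ring.
    by apply: intgC_mul_expi; [exact: (intgC_gaussD (fun=> 0) (s0 k))|exact: mdot].
  have ek0 : (k.+1%:R^-1 : R) != 0 by rewrite invr_eq0 pnatr_eq0.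
  have := intC_affine 0 ek0 iH; rewrite /H.
  rewrite gtr0_norm ?invr_gt0// -exprVn invrK => E.
  have kC0 : ((k.+1%:R : R) ^+ n)%:C != 0 by rewrite eq_complex /= expf_eq0 pnatr_eq0 andbF.
  apply: (mulfI kC0); rewrite -E -intCZ; last first.
    apply: (intgC_bounded _ (M := M)) => //.
    by apply: (mfC_comp mv); exact: measurable_affine_rV.
  by apply: eq_intC => r; rewrite addr0 FTg_scaled -/(G r); ring.
have WkB k y : normc (Wk k y) <= M * \int[leb n]_r normc (G r).
  have iv' : intgC (leb n) (fun r => v (k.+1%:R^-1 *: r + y) * G r).
    by apply: (intgC_bounded (M := M)) => //; apply: (mfC_comp mv); exact: measurable_affine_rV.
  rewrite WkE; apply: le_trans (normc_intC iv') _.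
  rewrite -RintegralZl//; last exact: intgC_normc.
  apply: le_Rintegral => //; first exact: intgC_normc.
    have := integrableZl measurableT M (intgC_normc iG).
    by apply: eq_integrable => // t _ /=; rewrite EFinM.
  by move=> r _; rewrite normcM ler_wpM2r ?normc_ge0.
have mWk k : mfC (Wk k).
  apply: (mfC_fubini1 (leb n) (F := fun p : Rn * Rn => gk k p.2 * W p.2 * expi (- dotR p.2 p.1))).
  apply: mfCM; first exact: (mfC_comp (intgC_mfC (igW k)) measurable_snd).
  by apply: mfC_expi; apply: measurableT_comp => //; apply: mdot; [exact: measurable_snd|exact: measurable_fst].
have Wk_cvg y : cvgC (Wk ^~ y) (((2 * pi) ^+ n)%:C * v y).
  have := @dominatedC _ _ _ (leb n) (fun k r => v (k.+1%:R^-1 *: r + y) * G r)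
    (fun r => v y * G r) (fun r => M * normc (G r)).
  case.
  - move=> k; apply: mfCM; last exact: intgC_mfC iG.
    by apply: (mfC_comp mv); exact: measurable_affine_rV.
  - move=> r; apply: cvgCM; last exact: cvgC_cst.
    apply: continuousC_cvg => //.
    rewrite -[X in _ --> X]add0r -{1}(scale0r r); apply: cvgD; last exact: cvg_cst.
    by apply: cvgZr_tmp; exact: e_cvg.
  - have := integrableZl measurableT M (intgC_normc iG).
    by apply: eq_integrable => // t _ /=; rewrite EFinM.
  - by move=> k r; rewrite normcM ler_wpM2r ?normc_ge0.
  - move=> _; rewrite intCZ// IG mulrC => h.
    by under [fun k => _]eq_fun do rewrite WkE.
pose J k := intC (leb n) (fun xi => gk k xi * (U xi * W xi)).
have J1 : cvgC J (intC (leb n) (fun xi => U xi * W xi)).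
  have [] // := @dominatedC _ _ _ (leb n) (fun k xi => gk k xi * (U xi * W xi))
    (fun xi => U xi * W xi) (fun xi => normc (U xi * W xi)).
  - by move=> k; apply: mfCM => //; exact: mfCM.
  - by move=> xi; rewrite -[X in cvgC _ X]mul1r; apply: cvgCM; [exact: gk_cvg|exact: cvgC_cst].
  - exact: intgC_normc.
  - by move=> k xi; rewrite normcM ler_piMl ?normc_ge0.
have JE k : J k = intC (leb n) (fun y => u y * Wk k y).
  pose F (p : Rn * Rn) := gk k p.1 * W p.1 * u p.2 * expi (- dotR p.1 p.2).
  have iF : intgC (leb n \x leb n)%E F.
    apply: intgC_mul_expi; first exact: intgC_prod (igW k) iu.
    by apply: measurableT_comp => //; apply: mdot; [exact: measurable_fst|exact: measurable_snd].
  transitivity (intC (leb n) (fun xi => intC (leb n) (fun y => F (xi, y)))).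
    apply: eq_intC => xi; rewrite /F /= [U xi * _]mulrC mulrA -intCZ.
      by apply: eq_intC => y; rewrite mulrA.
    by apply: intgC_mul_expi => //; apply: measurableT_comp => //; exact: mdot.
  rewrite fubiniC//; apply: eq_intC => y; rewrite /F /= -intCZ.
    by apply: eq_intC => xi; ring.
  by apply: intgC_mul_expi => //; apply: measurableT_comp => //; exact: mdot.
apply: (cvgC_unique J1).
have := @dominatedC _ _ _ (leb n) (fun k y => u y * Wk k y)
  (fun y => u y * (((2 * pi) ^+ n)%:C * v y)) (fun y => (M * \int[leb n]_r normc (G r)) * normc (u y)).
case.
- by move=> k; exact: mfCM.
- by move=> y; apply: cvgCM; [exact: cvgC_cst|exact: Wk_cvg].
- have := integrableZl measurableT (M * \int[leb n]_r normc (G r)) (intgC_normc iu).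
  by apply: eq_integrable => // t _ /=; rewrite EFinM.
- by move=> k y; rewrite normcM mulrC ler_wpM2r ?normc_ge0.
- move=> _; rewrite -intCZ; last first.
    under [fun x => _]eq_fun do rewrite mulrC.
    exact: (intgC_bounded mv hM).
  rewrite (_ : (fun y => u y * (_ * v y)) = (fun y => ((2 * pi) ^+ n)%:C * (u y * v y))).
    by rewrite (funext JE).
  by apply/funext => y; ring.
Qed.

End parseval.

(** * Moyal's identity *)

Section moyal.
Context {R : realType} {n : nat}.
Local Notation Rn := 'rV[R]_n.
Local Notation leb n := (lebesgue_rV R n).
Implicit Types (f g h : Rn -> R[i]).

(** For functions, [stft] without its factor (2 pi)^(-n/2). The factor returns as the constant [c]
    of [multiplier_Mp_bound]. *)
Definition stf g f (z : 'rV[R]_(n + n)) : R[i] := intC (leb n)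
  (fun y => f y * (expi (- dotR (rsubmx z) y) * conjc (g (y - lsubmx z)))).

Let mshift g : nice g -> mfC (fun p : 'rV[R]_(n + n) * Rn => g (p.2 - lsubmx p.1)).
Proof.
move=> ng; apply: (mfC_comp (nice_mfC ng)); apply: measurable_subrV; first exact: measurable_snd.
by apply: (measurableT_comp (@measurable_lsubmx R n n)); exact: measurable_fst.
Qed.

Lemma mfC_stf g f : nice g -> mfC f -> mfC (stf g f).
Proof.
move=> ng mf; apply: (mfC_fubini1 (leb n) (F := fun p : 'rV[R]_(n + n) * Rn =>
  f p.2 * (expi (- dotR (rsubmx p.1) p.2) * conjc (g (p.2 - lsubmx p.1))))).
apply: mfCM; first exact: (mfC_comp mf measurable_snd).
apply: mfCM; last by apply: mfC_conjc; exact: mshift.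
apply: mfC_expi; apply: measurableT_comp => //; apply: measurable_dotR; last exact: measurable_snd.
by apply: (measurableT_comp (@measurable_rsubmx R n n)); exact: measurable_fst.
Qed.

Lemma nice_shift g (a : Rn) : nice g -> nice (fun y => g (y + a)).
Proof.
move=> [cR cI [C hC]]; split; [exact: shift_continuous cR|exact: shift_continuous cI|].
have j0 : 0 < 1 + `|a| by rewrite ltr_wpDr.
exists (`|C| * (1 + `|a|) ^+ (2 * n)) => x; apply: le_trans (hC _) _.
rewrite -mulrA; apply: (@le_trans _ _ (`|C| * japN (x + a))).
  by rewrite ler_wpM2r ?(ltW (japN_gt0 _)) ?ler_norm.
rewrite ler_wpM2l// /japN -ler_pdivrMl ?exprn_gt0// -invfM -exprMn.
rewrite lef_pV2 ?posrE ?exprn_gt0 ?mulr_gt0 ?jap_gt0//.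
apply: lerXn2r; rewrite ?nnegrE ?mulr_ge0 ?addr_ge0//.
have : `|x| <= `|x + a| + `|a|.
  by rewrite -[X in `|X| <= _](addrK a) (le_trans (ler_normB _ _)).
have := normr_ge0 (x + a); have := normr_ge0 a; nra.
Qed.

Definition tfshift g (z : 'rV[R]_(n + n)) (y : Rn) : R[i] :=
  g (y - lsubmx z) * expi (dotR (rsubmx z) y).

Lemma nice_tfshift g z : nice g -> nice (tfshift g z).
Proof. by move=> ng; apply: nice_expi; [exact: nice_shift|exact: continuous_dotR]. Qed.

Lemma stf_ip g f z : stf g f z = ip (leb n) f (tfshift g z).
Proof.
apply: eq_intC => y; rewrite /tfshift conjcM conjc_expi; ring.
Qed.

(** For almost every position x the frequency integral is Parseval's formula for f conj(psi(. - x))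
    and conj(h) gam(. - x). Integrating over x then separates the pair f, h from the two windows, by
    reflection and translation invariance. *)
Lemma moyal f h (psi gam : Rn -> R[i]) : sqi (leb n) f -> nice h -> nice psi -> nice gam ->
  intgC (leb (n + n)) (fun z => stf psi f z * conjc (stf gam h z)) ->
  intC (leb (n + n)) (fun z => stf psi f z * conjc (stf gam h z)) =
  ((2 * pi) ^+ n)%:C * (ip (leb n) f h * ip (leb n) gam psi).
Proof.
move=> hf nh npsi ngam iV.
have mV := intgC_mfC iV; have mf := hf.1; have mh := nice_mfC nh.
rewrite intC_rVD//; have {}iV := (intgC_rVD mV).1 iV.
rewrite fubiniC1//.
pose k (y : Rn) := gam y * conjc (psi y).
have nk : nice k.
  have := niceM_shift 0 ngam (nice_conjc npsi).
  by under [fun x => _]eq_fun do rewrite addr0.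
have ifh := sqi_ip hf (nice_sqi nh).
pose G (p : Rn * Rn) := (f p.2 * conjc (h p.2)) * k (p.2 - p.1).
have mG : mfC G.
  apply: mfCM; first exact: (mfC_comp (intgC_mfC ifh) measurable_snd).
  apply: (mfC_comp (nice_mfC nk)).
  by apply: measurable_subrV; [exact: measurable_snd|exact: measurable_fst].
have kr y : (\int[leb n]_x (normc (k (y - x)))%:E = \int[leb n]_x (normc (k x))%:E)%E.
  apply: (@integral_reflect_rV R n y (fun x => (normc (k x))%:E)).
    by apply/measurable_EFinP; apply: measurable_normc; exact: nice_mfC.
  by move=> x; rewrite lee_fin normc_ge0.
have iG : intgC (leb n \x leb n)%E G.
  apply: intgC_tonelli2 => //.
  have e y : (\int[leb n]_x (normc (G (x, y)))%:E =
      (normc (f y * conjc (h y)))%:E * \int[leb n]_x (normc (k x))%:E)%E.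
    rewrite -(kr y) -ge0_integralZl//.
    - by apply: eq_integral => x _; rewrite /G normcM EFinM.
    - apply/measurable_EFinP; apply: measurable_normc; apply: (mfC_comp (nice_mfC nk)).
      exact: measurable_subrV.
    - by move=> x _; rewrite lee_fin normc_ge0.
    - by rewrite lee_fin normc_ge0.
  under eq_integral do rewrite e.
  rewrite -(EFin_int_normc (nice_intgC nk)) ge0_integralZr//.
  - by rewrite -(EFin_int_normc ifh) -EFinM ltry.
  - by apply/measurable_EFinP; apply: measurable_normc; exact: intgC_mfC ifh.
  - by move=> y _; rewrite lee_fin normc_ge0.
  - by rewrite lee_fin; apply: Rintegral_ge0 => x _; exact: normc_ge0.
transitivity (intC (leb n) (fun x => ((2 * pi) ^+ n)%:C * intC (leb n) (fun y => G (x, y)))).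
  apply: ae_eq_intC.
  - exact: intgC_mfC (intgC_fubini1 iV).
  - by apply: mfCM; [exact: mfC_cst|exact: intgC_mfC (intgC_fubini1 iG)].
  apply: filterS (ae_intgC1 iV) => x.
  pose u (y : Rn) := f y * conjc (psi (y - x)).
  pose v (y : Rn) := conjc (h y) * gam (y - x).
  have iu : intgC (leb n) u.
    by apply: sqiM => //; apply: sqi_conjc; apply: nice_sqi; exact: nice_shift.
  have nv : nice v by exact: niceM_shift (nice_conjc nh) ngam.
  have E xi : stf psi f (row_mx x xi) * conjc (stf gam h (row_mx x xi)) =
      intC (leb n) (fun y => u y * expi (- dotR xi y)) *
      intC (leb n) (fun y => v y * expi (dotR xi y)).
    rewrite /stf -intC_conjc; last first.
      have := sqi_ip (nice_sqi nh) (nice_sqi (nice_tfshift (row_mx x xi) ngam)).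
      congr intgC; apply/funext => y; rewrite /tfshift conjcM conjc_expi; ring.
    congr (_ * _); apply: eq_intC => y; rewrite row_mxKl row_mxKr /u /v.
      by ring.
    by rewrite !conjcM conjcK conjc_expi opprK; ring.
  rewrite /=; under [fun y => _]eq_fun do rewrite E.
  move=> h1; rewrite (parseval_L1 iu nv h1); congr (_ * _).
  by apply: eq_intC => y; rewrite /u /v /G /k /=; ring.
rewrite intCZ; last exact: intgC_fubini1.
congr (_ * _); rewrite fubiniC//.
have Ek y : intC (leb n) (fun x => G (x, y)) = (f y * conjc (h y)) * ip (leb n) gam psi.
  have := intC_affine y (_ : (-1 : R) != 0) (nice_intgC nk).
  rewrite -[ip _ gam psi]/(intC (leb n) k) normrN1 expr1n invr1 mul1r oppr_eq0 oner_eq0 => /(_ isT) <-.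
  rewrite -intCZ; last by apply: intgC_affine (nice_intgC nk); rewrite oppr_eq0 oner_eq0.
  by apply: eq_intC => x; rewrite /G /= scaleN1r [- x + y]addrC.
under eq_intC do rewrite Ek.
by rewrite intCZr.
Qed.

End moyal.

Section schwartz_class.
Context {R : realType} {n : nat}.
Local Notation Rn := 'rV[R]_n.
Local Notation leb n := (lebesgue_rV R n).
Implicit Types (F G h : Rn -> R[i]).

(** All functions reached from h by partial derivatives, products with coordinates and linear
    combinations. This class is stable under the operation of [stf_gphi_step], and Schwartz decay is
    inherited along the induction. *)
Inductive schwartz_gen h : (Rn -> R[i]) -> Prop :=
| sg_partials s : schwartz_gen h (partialsC s h)
| sg_add F G : schwartz_gen h F -> schwartz_gen h G -> schwartz_gen h (fun x => F x + G x)
| sg_scale (c : R[i]) F : schwartz_gen h F -> schwartz_gen h (fun x => c * F x)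
| sg_coord j F : schwartz_gen h F -> schwartz_gen h (fun x => (x ord0 j)%:C * F x).

Lemma sg_decay h F : schwartz h -> schwartz_gen h F ->
  forall N, exists C : R, forall x, (1 + `|x|) ^+ N * normc (F x) <= C.
Proof.
move=> [_ hb]; elim => [s|F1 G1 _ IF _ IG|c F1 _ IF|j F1 _ IF] N.
- have [b hb'] := hb (maxn N (size s)); exists b => x.
  apply: le_trans (hb' s x (leq_maxr _ _)); apply: ler_wpM2r; first exact: normc_ge0.
  by apply: ler_weXn2l; [rewrite lerDl|exact: leq_maxl].
- have [a ha] := IF N; have [b hb'] := IG N; exists (a + b) => x.
  apply: le_trans (lerD (ha x) (hb' x)); rewrite -mulrDr ler_wpM2l ?exprn_ge0 ?addr_ge0//.
  exact: le_normcD.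
- have [a ha] := IF N; exists (normc c * a) => x.
  by rewrite normcM mulrCA ler_wpM2l ?normc_ge0.
- have [a ha] := IF N.+1; exists a => x; apply: le_trans (ha x).
  rewrite normcM normc_real exprS mulrA ler_wpM2r ?normc_ge0// mulrC.
  rewrite ler_wpM2r ?exprn_ge0 ?addr_ge0//.
  by rewrite (le_trans (coord_le_norm x j))// lerDr.
Qed.

Lemma sg_continuous h F : schwartz h -> schwartz_gen h F ->
  continuous (fun x => complex.Re (F x)) /\ continuous (fun x => complex.Im (F x)).
Proof.
move=> [hs _]; elim => [s|F1 G1 _ [a b] _ [c e]|c F1 _ [a b]|j F1 _ [a b]].
- by split => x; apply: differentiable_continuous; have [] := hs s x.
- split=> x.
    under [fun x => _]eq_fun do rewrite ReD.
    exact: (cvgD (a x) (c x)).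
  under [fun x => _]eq_fun do rewrite ImD.
  exact: (cvgD (b x) (e x)).
- split=> x.
    under [fun x => _]eq_fun do rewrite ReM.
    exact: (cvgB (cvgM (cvg_cst _) (a x)) (cvgM (cvg_cst _) (b x))).
  under [fun x => _]eq_fun do rewrite ImM.
  exact: (cvgD (cvgM (cvg_cst _) (b x)) (cvgM (cvg_cst _) (a x))).
- split=> x.
    under [fun x => _]eq_fun do rewrite ReM /= mul0r subr0.
    exact: (cvgM (@continuous_coord_rV R n j x) (a x)).
  under [fun x => _]eq_fun do rewrite ImM /= mul0r addr0.
  exact: (cvgM (@continuous_coord_rV R n j x) (b x)).
Qed.

Lemma sg_nice h F : schwartz h -> schwartz_gen h F -> nice F.
Proof.
move=> hs hF; have [a b] := sg_continuous hs hF; split => //.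
have [C hC] := sg_decay hs hF (2 * n); exists C => x.
by rewrite /japN ler_pdivlMr ?exprn_gt0 ?jap_gt0// mulrC.
Qed.

Lemma schwartz_nice h : schwartz h -> nice h.
Proof. by move=> hs; exact: (sg_nice hs (sg_partials h [::])). Qed.

Lemma sg_isD h F (j : 'I_n) : schwartz h -> schwartz_gen h F ->
  exists2 G, schwartz_gen h G & isD (delta_mx 0 j) F G.
Proof.
move=> [hs _]; elim => [s|F1 G1 _ [F' a b] _ [G' c e]|c F1 _ [F' a b]|i F1 F1s [F' a b]].
- exists (partialsC (j :: s) h); first exact: sg_partials.
  move=> x; have [d1 d2] := hs s x.
  by split; apply: derivableP; exact: diff_derivable.
- by exists (fun x => F' x + G' x); [exact: sg_add|exact: isDD].
- by exists (fun x => c * F' x); [exact: sg_scale|exact: isDZ].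
- exists (fun x => ((delta_mx 0 j : Rn) ord0 i)%:C * F1 x + (x ord0 i)%:C * F' x).
    by apply: sg_add; [exact: sg_scale|exact: sg_coord].
  exact: isDM (isD_coord _ i) b.
Qed.

End schwartz_class.

(** * The Gaussian window: decay and covariance *)

Section gaussian_window.
Context {R : realType} {n : nat}.
Local Notation Rn := 'rV[R]_n.
Local Notation leb n := (lebesgue_rV R n).
Implicit Types (F G h : Rn -> R[i]) (z w : 'rV[R]_(n + n)).

(** The factor 1/4 is the one in the exponent of the special Hermite functions, so that the product
    of a shifted window with one of them has the quadratic part of [wexp]. *)
Definition gphi (y : Rn) : R[i] := (expR (- (\sum_i y ord0 i ^+ 2) / 4))%:C.

Lemma sumsq_ge_norm (y : Rn) : `|y| ^+ 2 <= \sum_i y ord0 i ^+ 2.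
Proof.
have S0 : 0 <= \sum_i y ord0 i ^+ 2 by apply: sumr_ge0 => i _; exact: sqr_ge0.
rewrite -(sqr_sqrtr S0) lerXn2r ?nnegrE ?sqrtr_ge0//.
apply: norm_le_coord; first exact: sqrtr_ge0.
move=> i; rewrite -sqrtr_sqr ler_wsqrtr// (bigD1 i)//= lerDl.
by apply: sumr_ge0 => k _; exact: sqr_ge0.
Qed.

Lemma gphi_bound (y : Rn) : normc (gphi y) <= expR (- `|y| ^+ 2 / 4).
Proof.
rewrite normc_real ger0_norm ?expR_ge0// ler_expR ler_pM2r ?invr_gt0// lerN2.
exact: sumsq_ge_norm.
Qed.

Lemma nice_gphi : nice gphi.
Proof.
split.
- move=> y; apply: (@continuous_comp _ _ _ (fun y : Rn => - (\sum_i y ord0 i ^+ 2) / 4) (@expR R)).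
    have cs : continuous (fun y : Rn => \sum_i y ord0 i ^+ 2).
      apply: continuous_sum_rV => i x.
      exact: (@continuous_comp _ _ _ (fun y : Rn => y ord0 i) (fun t : R => t ^+ 2) x
        (@continuous_coord_rV R n i x) (@exprn_continuous R 2 _)).
    exact: (cvgM (cvgN (cs y)) (cvg_cst _)).
  exact: continuous_expR.
- rewrite (_ : (fun x => complex.Im (gphi x)) = cst 0)//; exact: cst_continuous.
- have c0 : 0 < (4^-1 : R) by rewrite invr_gt0.
  have [C C0 hC] := expR_quad_bound 0 (2 * n) c0; exists C => y.
  rewrite /japN ler_pdivlMr ?exprn_gt0 ?jap_gt0//.
  apply: le_trans (hC `|y| (normr_ge0 y)); rewrite mulrC ler_wpM2l ?exprn_ge0 ?addr_ge0//.
  by apply: le_trans (gphi_bound y) _; rewrite mul0r sub0r mulrC mulrN.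
Qed.

Definition tfexp z (y : Rn) : R[i] :=
  \sum_i ((- (y ord0 i - lsubmx z ord0 i) ^+ 2 / 4) +i* (rsubmx z ord0 i * y ord0 i)).

Lemma tfshift_gphi z y : tfshift gphi z y = cexp (tfexp z y).
Proof.
rewrite /tfshift /gphi /tfexp -cexp_real -cexp_im -cexpD; congr cexp.
apply: complex_eqP; rewrite ?(ReD, ImD, Re_sum, Im_sum) /=.
  rewrite addr0 -sumrN mulr_suml; apply: eq_bigr => i _; by rewrite !mxE.
by rewrite add0r.
Qed.

Lemma conj_tfshift_isD z (j : 'I_n) : isD (delta_mx 0 j) (fun y => conjc (tfshift gphi z y))
  (fun y => ((- (y ord0 j - lsubmx z ord0 j) / 2) -i* (rsubmx z ord0 j)) * conjc (tfshift gphi z y)).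
Proof.
have -> : (fun y => conjc (tfshift gphi z y)) = (fun y => conjc (cexp (tfexp z y))).
  by apply/funext => y; rewrite tfshift_gphi.
pose Q' (y : Rn) : R[i] := (- (y ord0 j - lsubmx z ord0 j) / 2) +i* (rsubmx z ord0 j).
have dQ : isD (delta_mx 0 j) (tfexp z) Q'.
  have h i := @isD_coord R n (delta_mx 0 j) i.
  have hi i := isDD (isDZ (- 4^-1)%:C (isDM (isDD (h i) (isD_cst _ (- (lsubmx z ord0 i)%:C)))
    (isDD (h i) (isD_cst _ (- (lsubmx z ord0 i)%:C))))) (isDZ (0 +i* rsubmx z ord0 i) (h i)).
  have := isD_sum (index_enum _) xpredT hi.
  rewrite (_ : (fun x => \sum_(i <- _ | _) _) = tfexp z); last first.
    apply/funext => y; apply: eq_bigr => i _.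
    by apply: complex_eqP; rewrite ?(ReD, ImD, ReM, ImM, ReN, ImN) /=; field.
  move=> hd; apply: isD_eq hd => y; rewrite (bigD1 j)//= big1 ?addr0.
    rewrite !mxE !eqxx /= /Q'.
    by apply: complex_eqP; rewrite ?(ReD, ImD, ReM, ImM, ReN, ImN) /= ?mxE; field.
  move=> i ij; rewrite !mxE eqxx (negbTE ij) /=.
  by apply: complex_eqP; rewrite ?(ReD, ImD, ReM, ImM, ReN, ImN) /=; ring.
apply: isD_eq (isD_conjc (isD_cexp dQ)) => y.
by rewrite conjcM tfshift_gphi.
Qed.

(** Integrate the derivative of F times the conjugate shifted Gaussian. Differentiating the Gaussian
    produces -(y_j - x_j)/2 - i xi_j; the part in y_j is put into F', namely the derivative of F
    minus y_j F / 2, and the rest is the multiplier. *)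
Lemma stf_gphi_step h F (j : 'I_n) : schwartz h -> schwartz_gen h F ->
  exists2 F', schwartz_gen h F' & forall z, stf gphi F' z =
    ((- (lsubmx z ord0 j) / 2) +i* (rsubmx z ord0 j)) * stf gphi F z.
Proof.
move=> hs hF; have [G hG dG] := sg_isD j hs hF.
pose F' x := G x + (- 2^-1)%:C * ((x ord0 j)%:C * F x).
have hF' : schwartz_gen h F'.
  by apply: sg_add => //; apply: sg_scale; exact: sg_coord.
exists F' => // z.
have nE := nice_tfshift z nice_gphi.
have nF := sg_nice hs hF; have nG := sg_nice hs hG; have nF' := sg_nice hs hF'.
pose E y := conjc (tfshift gphi z y).
have E1 y : normc (E y) <= 1.
  rewrite /E normc_conjc normcM normc_expi mulr1.
  apply: le_trans (gphi_bound _) _; rewrite -expR0 ler_expR mulNr oppr_le0.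
  by rewrite mulr_ge0 ?sqr_ge0 ?invr_ge0.
pose a : R[i] := (- (lsubmx z ord0 j) / 2) +i* (rsubmx z ord0 j).
have dFE := isDM dG (conj_tfshift_isD z j).
pose H y := F' y * E y + (- a) * (F y * E y).
have dFE' : isD (delta_mx 0 j) (fun y => F y * E y) H.
  apply: isD_eq dFE => y; rewrite /H /F' /a /E.
  rewrite (_ : (_ -i* _) = (- 2^-1)%:C * (y ord0 j)%:C + - a); first by rewrite /a; ring.
  by apply: complex_eqP; rewrite ?(ReD, ImD, ReM, ImM, ReN, ImN) /=; field.
have [_ _ [C1 hC1]] := nF; have [_ _ [C2 hC2]] := nF'.
have nn (C : R) (y : Rn) : C * japN y <= `|C| * japN y by rewrite ler_wpM2r ?ler_norm ?(ltW (japN_gt0 _)).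
have [iH H0] : intgC (leb n) H /\ intC (leb n) H = 0.
  apply: (int_partial (j := j) (F := fun y => F y * E y) (C := `|C2| + (1 + normc a) * `|C1|)) => //.
  - by apply: mfCM; [exact: nice_mfC|apply: mfC_conjc; exact: nice_mfC].
  - move=> y; rewrite normcM; apply: (@le_trans _ _ (`|C1| * japN y)).
      apply: (@le_trans _ _ (normc (F y))); first by rewrite ler_piMr ?normc_ge0.
      exact: le_trans (hC1 y) (nn C1 y).
    rewrite ler_wpM2r ?(ltW (japN_gt0 _))//.
    have := normr_ge0 C1; have := normr_ge0 C2; have := normc_ge0 a; nra.
  - move=> y; apply: le_trans (le_normcD _ _) _; rewrite !normcM normcN.
    have h1 : normc (F' y) * normc (E y) <= `|C2| * japN y.
      apply: (@le_trans _ _ (normc (F' y))); first by rewrite ler_piMr ?normc_ge0.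
      exact: le_trans (hC2 y) (nn C2 y).
    have h2 : normc (F y) * normc (E y) <= `|C1| * japN y.
      apply: (@le_trans _ _ (normc (F y))); first by rewrite ler_piMr ?normc_ge0.
      exact: le_trans (hC1 y) (nn C1 y).
    have := ler_wpM2l (normc_ge0 a) h2.
    have := japN_gt0 y; have := normr_ge0 C1 => c1 j0 h3.
    have : 0 <= `|C1| * japN y by rewrite mulr_ge0 ?(ltW j0).
    lra.
have iF'E := sqi_ip (nice_sqi nF') (nice_sqi nE).
have iFE := sqi_ip (nice_sqi nF) (nice_sqi nE).
move: H0; rewrite /H intCD//; last exact: intgCZ.
rewrite intCZ// mulNr => /eqP; rewrite subr_eq0 => /eqP.
by rewrite !stf_ip.
Qed.

Lemma stf_bounded F (psi : Rn -> R[i]) : sqi (leb n) F -> nice psi ->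
  forall z, normc (stf psi F z) ^+ 2 <= sq (leb n) F * sq (leb n) psi.
Proof.
move=> hF npsi z; rewrite stf_ip.
have hT := nice_sqi (nice_tfshift z npsi).
apply: le_trans (ip_le hF hT) _; rewrite ler_wpM2l ?sq_ge0//.
rewrite le_eqVlt; apply/orP; left; apply/eqP.
have mP : measurable_fun setT (fun y : Rn => (normc (psi y) ^+ 2)%:E).
  by apply/measurable_EFinP; apply: measurable_normc2; exact: nice_mfC.
rewrite /sq /Rintegral; congr fine.
rewrite -(integral_shift_rV (- lsubmx z) mP) => [|y]; last by rewrite lee_fin sqr_ge0.
by apply: eq_integral => y _; rewrite normcM normc_expi mulr1.
Qed.

(** Iterating [stf_gphi_step] bounds every power of the numbers -x_j/2 + i xi_j times the transform.
    One of these numbers has modulus at least |z| / 2, so all polynomial decay follows. *)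
Lemma stf_gphi_decay h : schwartz h ->
  exists C, forall z, normc (stf gphi h z) <= C * japN z.
Proof.
move=> hs; pose M := (2 * (n + n))%N.
pose a (j : 'I_n) z : R[i] := (- (lsubmx z ord0 j) / 2) +i* (rsubmx z ord0 j).
have H0 F : schwartz_gen h F -> exists C, forall z, normc (stf gphi F z) <= C.
  move=> hF; have nF := sg_nice hs hF.
  exists (Num.sqrt (sq (leb n) F * sq (leb n) gphi)) => z.
  rewrite -[leLHS]ger0_norm ?normc_ge0// -sqrtr_sqr ler_wsqrtr//.
  by apply: stf_bounded; [exact: nice_sqi|exact: nice_gphi].
have H1 (j : 'I_n) k F : schwartz_gen h F ->
    exists C, forall z, normc (a j z) ^+ k * normc (stf gphi F z) <= C.
  elim: k F => [|k IH] F hF.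
    by have [C hC] := H0 F hF; exists C => z; rewrite expr0 mul1r.
  have [F' hF' E] := stf_gphi_step j hs hF.
  have [C hC] := IH F' hF'; exists C => z.
  by rewrite exprSr -mulrA -normcM -E.
have hh := sg_partials h [::].
have [c hc] : exists c : 'I_n -> R, forall j z, normc (a j z) ^+ M * normc (stf gphi h z) <= c j.
  by exists (fun j => sval (cid (H1 j M h hh))) => j; exact: (svalP (cid (H1 j M h hh))).
have [c0 hc0] := H0 h hh.
exists (2 ^+ M * (c0 + 2 ^+ M * \sum_j c j)) => z.
rewrite /japN ler_pdivlMr ?exprn_gt0 ?jap_gt0// -/M.
have S0 : 0 <= \sum_j normc (a j z) ^+ M.
  by apply: sumr_ge0 => j _; rewrite exprn_ge0 ?normc_ge0.
have jM : (1 + `|z|) ^+ M <= 2 ^+ M * (1 + 2 ^+ M * \sum_j normc (a j z) ^+ M).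
  have [z0|z0] := eqVneq `|z| 0.
    rewrite z0 addr0 expr1n; apply: (@le_trans _ _ (1 * 1)); first by rewrite mulr1.
    rewrite ler_pM ?exprn_ege1 ?ler1n// lerDl mulr_ge0 ?exprn_ge0//.
  (* The coordinate attaining the sup norm of z is a position or a frequency; it is read from the
     real or the imaginary part of [a j z] respectively, the real part costing the factor 2. *)
  have [j hj] : exists j : 'I_n, `|z| <= 2 * normc (a j z).
    have [[i0 i] /= E] := mx_norm_neq0 z0.
    have {}E : `|z| = `|z ord0 i| by move: E; rewrite (ord1 i0).
    case: (splitP i) => j ij.
      exists j; rewrite E (_ : i = lshift n j); last exact: val_inj.
      have := normc_Re_le (a j z); rewrite /a /= mxE normrM normrN.
      by rewrite (@ger0_norm _ 2^-1) ?invr_ge0// => h1; lra.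
    exists j; rewrite E (_ : i = rshift n j); last exact: val_inj.
    have h0 := normc_ge0 (a j z); have := normc_Im_le (a j z).
    by move: h0; rewrite /a /= !mxE; lra.
  have zM : `|z| ^+ M <= 2 ^+ M * \sum_j normc (a j z) ^+ M.
    apply: (@le_trans _ _ ((2 * normc (a j z)) ^+ M)).
      by rewrite lerXn2r ?nnegrE ?mulr_ge0 ?normc_ge0.
    rewrite exprMn ler_wpM2l ?exprn_ge0// (bigD1 j)//= lerDl.
    by apply: sumr_ge0 => k _; rewrite exprn_ge0 ?normc_ge0.
  apply: (@le_trans _ _ (2 ^+ M * (1 + `|z| ^+ M))); last by rewrite ler_wpM2l ?exprn_ge0// lerD2l.
  apply: (@le_trans _ _ ((2 * Num.max 1 `|z|) ^+ M)).
    rewrite lerXn2r ?nnegrE ?addr_ge0 ?mulr_ge0 ?le_max ?ler01//.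
    by rewrite mulr_natl mulr2n lerD// le_max lexx ?orbT.
  rewrite exprMn ler_wpM2l ?exprn_ge0//.
  by case: (leP 1 `|z|) => _; rewrite ?expr1n ?lerDl ?lerDr// exprn_ge0.
rewrite mulrC; apply: le_trans (ler_wpM2r (normc_ge0 _) jM) _.
rewrite -mulrA ler_wpM2l ?exprn_ge0// mulrDl mul1r lerD ?hc0//.
rewrite -mulrA ler_wpM2l ?exprn_ge0// mulr_suml.
by apply: ler_sum => j _; exact: hc.
Qed.

(** Translating the integration variable by the position exchanges window and signal, up to a phase
    and a conjugation. Decay for one order of the pair thus gives it for the other. *)
Lemma stf_swap (psi gam : Rn -> R[i]) z : nice psi -> nice gam ->
  normc (stf psi gam z) = normc (stf gam psi (- z)).
Proof.
move=> np ng; set x := lsubmx z; set xi := rsubmx z.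
have xN : lsubmx (- z) = - x by apply/rowP => i; rewrite !mxE.
have xiN : rsubmx (- z) = - xi by apply/rowP => i; rewrite !mxE.
pose F (y : Rn) := gam y * (expi (- dotR xi y) * conjc (psi (y - x))).
have mF : mfC F.
  apply: mfCM; first exact: nice_mfC.
  apply: mfCM; last by apply: mfC_conjc; apply: nice_mfC; exact: nice_shift.
  by apply: mfC_expi; apply: measurableT_comp => //; exact: measurable_dotR.
rewrite {1}/stf -(intC_shift x mF).
have i1 := sqi_ip (nice_sqi np) (nice_sqi (nice_tfshift (- z) ng)).
have -> : intC (leb n) (fun y => F (y + x)) = expi (- dotR xi x) * conjc (stf gam psi (- z)).
  rewrite stf_ip -intC_conjc// -intCZ; last exact: intgC_conjc.
  apply: eq_intC => y; rewrite /F /tfshift xN xiN addrK opprK.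
  have -> : dotR xi (y + x) = dotR xi y + dotR xi x.
    by rewrite /dotR -big_split /=; apply: eq_bigr => i _; rewrite !mxE mulrDr.
  have -> : dotR (- xi) y = - dotR xi y.
    by rewrite /dotR -sumrN; apply: eq_bigr => i _; rewrite !mxE mulNr.
  by rewrite opprD expiD !(conjcM, conjcK); ring.
by rewrite normcM normc_expi mul1r normc_conjc.
Qed.

Lemma stf_tfshift (psi gam : Rn -> R[i]) w z : nice psi -> nice gam ->
  normc (stf psi (tfshift gam w) z) = normc (stf psi gam (z - w)).
Proof.
move=> np ng; set x := lsubmx z; set xi := rsubmx z.
set x' := lsubmx w; set xi' := rsubmx w.
have xN : lsubmx (z - w) = x - x' by apply/rowP => i; rewrite !mxE.
have xiN : rsubmx (z - w) = xi - xi' by apply/rowP => i; rewrite !mxE.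
pose F (y : Rn) := tfshift gam w y * (expi (- dotR xi y) * conjc (psi (y - x))).
have mF : mfC F.
  apply: mfCM; first by apply: nice_mfC; exact: nice_tfshift.
  apply: mfCM; last by apply: mfC_conjc; apply: nice_mfC; exact: nice_shift.
  by apply: mfC_expi; apply: measurableT_comp => //; exact: measurable_dotR.
rewrite {1}/stf -(intC_shift x' mF).
have i1 := sqi_ip (nice_sqi ng) (nice_sqi (nice_tfshift (z - w) np)).
have -> : intC (leb n) (fun y => F (y + x')) =
    expi (dotR xi' x' - dotR xi x') * stf psi gam (z - w).
  rewrite stf_ip -intCZ//.
  apply: eq_intC => y; rewrite /F /tfshift xN xiN -/x' -/xi' addrK.
  have E (u v v' : Rn) : dotR u (v + v') = dotR u v + dotR u v'.
    by rewrite /dotR -big_split /=; apply: eq_bigr => i _; rewrite !mxE mulrDr.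
  have -> : dotR (xi - xi') y = dotR xi y - dotR xi' y.
    by rewrite /dotR -sumrN -big_split /=; apply: eq_bigr => i _; rewrite !mxE mulrBl.
  rewrite !E conjcM conjc_expi (_ : y + x' - x = y - (x - x')); last by rewrite opprB addrA addrAC.
  rewrite !(opprD, opprK, expiD); ring.
by rewrite normcM normc_expi mul1r.
Qed.

End gaussian_window.

Section window_change.
Context {R : realType} {n : nat}.
Local Notation Rn := 'rV[R]_n.
Local Notation leb n := (lebesgue_rV R n).
Implicit Types (F h : Rn -> R[i]) (z w : 'rV[R]_(n + n)).

(** By continuity |h|^2 exceeds half its value at a point where h does not vanish, on a box of
    positive measure. *)
Lemma sq_gt0 h : nice h -> (exists x, h x != 0) -> 0 < sq (leb n) h.
Proof.
move=> nh [x0 hx0]; have [cR cI _] := nh.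
pose f x := normc (h x) ^+ 2.
have cf : continuous f.
  have -> : f = fun x => complex.Re (h x) ^+ 2 + complex.Im (h x) ^+ 2.
    by apply/funext => x; rewrite /f normc_sqr.
  move=> x; have sq2 (u : Rn -> R) : continuous u -> {for x, continuous (fun y => u y ^+ 2)}.
    by move=> cu; apply: (@continuous_comp _ _ _ u (fun t : R => t ^+ 2)); [exact: cu|exact: exprn_continuous].
  exact: (cvgD (sq2 _ cR) (sq2 _ cI)).
have f0 : 0 < f x0.
  rewrite exprn_gt0// lt_neqAle normc_ge0 andbT eq_sym.
  by apply: contra_neq hx0 => /eq0_normc.
have f2 : f x0 / 2 < f x0 by rewrite ltr_pdivrMr// ltr_pMr// ltr1n.
have /cvgr_gt/(_ _ f2)/nbhs_ballP[e /= e0 hb] := cf x0.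
pose A (i : 'I_n) : set R := ball (x0 ord0 i) e.
pose B : set Rn := [set v | forall i, A i (v ord0 i)].
have mB : measurable B.
  rewrite (_ : B = \bigcap_(i in [set: 'I_n]) (fun y : Rn => y ord0 i) @^-1` A i).
    apply: fin_bigcap_measurable => // i _.
    rewrite -[X in measurable X]setTI; apply: measurable_coord_rV => //.
    exact: measurable_ball.
  by apply/seteqP; split => [y hy i _|y hy i]; exact: hy.
have mu_B : (0 < leb n B)%E.
  rewrite lebesgue_rV_box => [|i]; last exact: measurable_ball.
  have E i : lebesgue_measure (A i) = (e *+ 2)%:E by rewrite lebesgue_measure_ball// ltW.
  rewrite (eq_bigr (fun=> (e *+ 2)%:E)) => [|i _]; last exact: E.
  rewrite prodEFin lte_fin; apply: prodr_gt0 => i _.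
  by rewrite pmulrn_lgt0.
rewrite -lte_fin sqiE; last exact: nice_sqi.
apply: (@lt_le_trans _ _ (\int[leb n]_x (((f x0 / 2)%:E * (\1_B x)%:E)))%E).
  rewrite ge0_integralZl//; last 2 first.
  - by apply/measurable_EFinP.
  - by rewrite lee_fin ltW// divr_gt0.
  by rewrite integral_indicT// mule_gt0// lte_fin divr_gt0.
apply: ge0_le_integral => //.
- by move=> x _; rewrite -EFinM lee_fin mulr_ge0// ltW// divr_gt0.
- by apply: measurable_funeM; exact/measurable_EFinP.
- by apply/measurable_EFinP; apply: measurable_normc2; exact: nice_mfC.
- move=> x _; rewrite -EFinM lee_fin indicE.
  case: (boolP (x \in B)) => [xB|_]; last by rewrite mulr0 sqr_ge0.
  rewrite mulr1 ltW//; apply: hb; apply/rV_ballP => // i.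
  by move: xB; rewrite inE; exact.
Qed.

(* Moyal's identity with equal windows, as a pointwise bound of one short-time
   Fourier transform by a convolution of another. *)
Lemma window_change (psi gam : Rn -> R[i]) F : sqi (leb n) F -> nice psi -> nice gam ->
  0 < sq (leb n) psi -> (exists C, forall z, normc (stf psi gam z) <= C * japN z) ->
  forall w, ((normc (stf gam F w))%:E <= \int[leb (n + n)]_z
    (((2 * pi) ^+ n * sq (leb n) psi)^-1 * normc (stf psi gam (z - w)) * normc (stf psi F z))%:E)%E.
Proof.
move=> hF np ng sp [C hC] w.
have nT := nice_tfshift w ng.
have mV := mfC_stf np hF.1; have mW := mfC_stf np (nice_mfC nT).
have iW : intgC (leb (n + n)) (stf psi (tfshift gam w)).
  have mg := mfC_stf np (nice_mfC ng).
  have i0 : intgC (leb (n + n)) (stf psi gam) by exact: intgC_japN mg hC.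
  apply: (intgC_le mW (intgC_shift (- w) i0)) => z.
  by rewrite stf_tfshift.
have iVW : intgC (leb (n + n)) (fun z => stf psi F z * conjc (stf psi (tfshift gam w) z)).
  apply: (intgC_bounded mV (M := Num.sqrt (sq (leb n) F * sq (leb n) psi))); last exact: intgC_conjc.
  move=> z; rewrite -[leLHS]ger0_norm ?normc_ge0// -sqrtr_sqr ler_wsqrtr//.
  exact: stf_bounded.
have := moyal hF nT np np iVW.
rewrite sq_ip; last exact: nice_sqi.
rewrite -stf_ip => E.
have k0 : 0 < (2 * pi) ^+ n * sq (leb n) psi by rewrite mulr_gt0// exprn_gt0// mulr_gt0// pi_gt0.
have -> : normc (stf gam F w) = ((2 * pi) ^+ n * sq (leb n) psi)^-1 *
    normc (intC (leb (n + n)) (fun z => stf psi F z * conjc (stf psi (tfshift gam w) z))).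
  rewrite E !normcM !normc_real !ger0_norm ?sq_ge0 ?exprn_ge0 ?mulr_ge0 ?pi_ge0//.
  rewrite [_ ^+ n * (_ * _)]mulrCA [_ * (_ * sq _ _)]mulrC mulKf// gt_eqF//.
have k0' : (0 <= (((2 * pi) ^+ n * sq (leb n) psi)^-1)%:E)%E by rewrite lee_fin invr_ge0 ltW.
rewrite EFinM; apply: (le_trans (lee_wpmul2l k0' (normc_intC_le (leb (n + n)) (intgC_mfC iVW)))).
rewrite -ge0_integralZl//.
- apply: ge0_le_integral => //.
  + by move=> z _; rewrite mule_ge0 ?lee_fin ?normc_ge0 ?invr_ge0 ?(ltW k0).
  + apply: measurable_funeM; apply/measurable_EFinP; apply: measurable_normc.
    exact: intgC_mfC iVW.
  + apply/measurable_EFinP; apply: measurable_funM; last exact: measurable_normc.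
    apply: measurable_funM => //; apply: (measurableT_comp (measurable_normc (mfC_stf np (nice_mfC ng)))).
    exact: measurable_subrV.
  + move=> z _; rewrite -EFinM lee_fin normcM normc_conjc stf_tfshift// -mulrA.
    by rewrite [normc _ * normc _]mulrC.
- by apply/measurable_EFinP; apply: measurable_normc; exact: intgC_mfC iVW.
- by move=> z _; rewrite lee_fin normc_ge0.
Qed.

End window_change.

(** * Schur's test *)

Section schur_test.
Context {d : measure_display} {T : measurableType d} {R : realType}.
Variable mu : {sigma_finite_measure set T -> \bar R}.
Variables (K : T * T -> R) (C : R).
Hypotheses (mK : measurable_fun setT K) (K0 : forall p, 0 <= K p) (C0 : 0 < C).
Hypothesis Krow : forall w, (\int[mu]_z (K (z, w))%:E <= C%:E)%E.
Hypothesis Kcol : forall z, (\int[mu]_w (K (z, w))%:E <= C%:E)%E.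

Let mK1 w : measurable_fun setT (fun z => K (z, w)).
Proof. exact: (measurableT_comp mK (pair2_measurable w)). Qed.

(** For finite p = r, Hölder against the kernel and the row bound give V^r <= C^(r-1) times the
    integral of K U^r; Tonelli and the column bound finish. For p infinite the row bound alone is
    used. *)
Lemma schur_test (U V : T -> R) (p : \bar R) : (1 <= p)%E ->
  measurable_fun setT U -> measurable_fun setT V ->
  (forall x, 0 <= U x) -> (forall x, 0 <= V x) ->
  (forall w, ((V w)%:E <= \int[mu]_z (K (z, w) * U z)%:E)%E) ->
  (Lnorm mu p (fun x => (V x)%:E) <= C%:E * Lnorm mu p (fun x => (U x)%:E))%E.
Proof.
move=> p1 mU mV U0 V0 VKU.
have mKU w : measurable_fun setT (fun z => K (z, w) * U z) by exact: measurable_funM.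
rewrite unlock; case: p p1 => [r|_|//]; last first.
  (* At p = +oo [Lnorm] is 0 by convention when the whole space has measure 0. *)
  case: ifPn => [mu0|]; last by rewrite mule0.
  have M0 : (0 <= ess_sup mu (abse \o (fun x => (U x)%:E)))%E.
    by apply: ess_sup_gee => //; apply: aeW => t /=; rewrite lee_fin normr_ge0.
  set M := ess_sup mu _ in M0 *.
  have [My|Mfin] := eqVneq M +oo%E.
    by rewrite My gt0_muley ?lte_fin// leey.
  have Mr : M = (fine M)%:E.
    by rewrite fineK// ge0_fin_numE// ltey.
  apply/ess_supP; apply: aeW => w /=.
  rewrite ger0_norm//; apply: (le_trans (VKU w)).
  apply: (@le_trans _ _ (\int[mu]_z (K (z, w) * fine M)%:E)%E).
    apply: ae_ge0_le_integral => //.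
    - by move=> z _; rewrite lee_fin mulr_ge0.
    - exact/measurable_EFinP.
    - by move=> z _; rewrite lee_fin mulr_ge0// fine_ge0.
    - by apply/measurable_EFinP; exact: measurable_funM.
    - have := ess_sup_ge mu (abse \o (fun x => (U x)%:E)); apply: filterS => z.
      rewrite -/M Mr /= lee_fin => h _; rewrite lee_fin ler_wpM2l//.
      by rewrite (le_trans (ler_norm _)).
  under eq_integral do rewrite EFinM.
  rewrite ge0_integralZr//; last 3 first.
  - exact/measurable_EFinP.
  - by move=> z _; rewrite lee_fin.
  - by rewrite -Mr.
  by rewrite -Mr lee_wpmul2r.
rewrite lee_fin => r1.
have r0 : 0 < r by rewrite (lt_le_trans ltr01).
have mpow (W : T -> R) (a : R) : measurable_fun setT W -> measurable_fun setT (fun x => W x `^ a).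
  by move=> mW; exact: (measurableT_comp (@measurable_powR R a) mW).
have mU' : measurable_fun setT (fun x => U x `^ r) by exact: mpow.
have mV' : measurable_fun setT (fun x => V x `^ r) by exact: mpow.
have EU : (\int[mu]_x `|(U x)%:E| `^ r = \int[mu]_x (U x `^ r)%:E)%E.
  by apply: eq_integral => x _; rewrite /= ger0_norm// poweR_EFin.
have EV : (\int[mu]_x `|(V x)%:E| `^ r = \int[mu]_x (V x `^ r)%:E)%E.
  by apply: eq_integral => x _; rewrite /= ger0_norm// poweR_EFin.
rewrite EU EV; set IU := (\int[mu]_x (U x `^ r)%:E)%E.
have IU0 : (0 <= IU)%E by apply: integral_ge0 => x _; rewrite lee_fin powR_ge0.
have mKUr w : measurable_fun setT (fun z => K (z, w) * U z `^ r) by exact: measurable_funM.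
pose B w := (\int[mu]_z (K (z, w) * U z `^ r)%:E)%E.
have B0 w : (0 <= B w)%E by apply: integral_ge0 => x _; rewrite lee_fin mulr_ge0 ?powR_ge0.
have mKUp : measurable_fun setT (fun p : T * T => K p * U p.1 `^ r).
  by apply: measurable_funM => //; exact: (measurableT_comp mU' measurable_fst).
have mB : measurable_fun setT B.
  apply: (@measurable_fun_fubini_tonelli_G _ _ _ _ _ mu (fun p => (K p * U p.1 `^ r)%:E)) => //.
    exact/measurable_EFinP.
  by move=> q; rewrite lee_fin mulr_ge0 ?powR_ge0.
have VB w : ((V w `^ r)%:E <= (C `^ (r - 1))%:E * B w)%E.
  (* At r = 1 the conjugate exponent is infinite; there the claim is the hypothesis on V itself. *)
  move: r1; rewrite le_eqVlt => /predU1P[r1|r1].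
    rewrite -r1 powRr1// subrr powRr0 mul1e; apply: (le_trans (VKU w)).
    rewrite le_eqVlt; apply/orP; left; apply/eqP.
    by apply: eq_integral => z _; rewrite -r1 powRr1.
  pose q := r / (r - 1).
  have rm : 0 < r - 1 by rewrite subr_gt0.
  have q0 : 0 < q by rewrite divr_gt0.
  have qr : q^-1 + r^-1 = 1 by rewrite /q; field; rewrite !gt_eqF.
  (* The kernel is split as K^(1/q) K^(1/r): the first factor meets the row bound, the second
     carries U. *)
  pose f z := K (z, w) `^ q^-1; pose g z := K (z, w) `^ r^-1 * U z.
  have mf : measurable_fun setT f by exact: mpow.
  have mg : measurable_fun setT g by apply: measurable_funM => //; exact: mpow.
  have := hoelder mu mf mg q0 r0 qr.
  rewrite Lnorm1.
  have -> : (\int[mu]_x `|(EFin \o (f \* g)%R) x| = \int[mu]_z (K (z, w) * U z)%:E)%E.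
    apply: eq_integral => z _ /=.
    rewrite /f /g mulrA -powRD ?qr ?oner_eq0// powRr1// ger0_norm// mulr_ge0//.
  rewrite !Lnorm.unlock.
  have -> : (\int[mu]_x `|(EFin \o f) x| `^ q = \int[mu]_z (K (z, w))%:E)%E.
    apply: eq_integral => z _; rewrite /= ger0_norm ?powR_ge0// ?poweR_EFin /f.
    by rewrite -powRrM mulVf ?gt_eqF// powRr1.
  have -> : (\int[mu]_x `|(EFin \o g) x| `^ r = B w)%E.
    apply: eq_integral => z _; rewrite /= /g ger0_norm ?mulr_ge0 ?powR_ge0// ?poweR_EFin.
    by rewrite powRM ?powR_ge0// -powRrM mulVf ?gt_eqF// powRr1.
  move=> h; have {}h := le_trans (VKU w) h.
  have IK0 : (0 <= \int[mu]_z (K (z, w))%:E)%E by apply: integral_ge0 => z _; rewrite lee_fin.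
  have h2 : ((V w)%:E <= (C `^ q^-1)%:E * B w `^ r^-1)%E.
    apply: (le_trans h); apply: lee_wpmul2r; first exact: poweR_ge0.
    rewrite -poweR_EFin; apply: gt0_ler_poweR; rewrite ?invr_ge0 ?(ltW q0)//.
    - by rewrite in_itv /= IK0 leey.
    - by rewrite in_itv /= lee_fin (ltW C0) leey.
  have : ((V w)%:E `^ r <= ((C `^ q^-1)%:E * B w `^ r^-1) `^ r)%E.
    apply: gt0_ler_poweR; rewrite ?(ltW r0)//.
    - by rewrite in_itv /= lee_fin V0 leey.
    - by rewrite in_itv /= mule_ge0 ?poweR_ge0 ?lee_fin ?powR_ge0// leey.
  rewrite poweR_EFin poweRM ?lee_fin ?powR_ge0 ?poweR_ge0// -poweRrM mulVf ?gt_eqF//.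
  rewrite poweRe1// poweR_EFin -powRrM.
  by rewrite (_ : q^-1 * r = r - 1)// /q; field; rewrite !gt_eqF.
have main : (\int[mu]_x (V x `^ r)%:E <= (C `^ r)%:E * IU)%E.
  apply: (@le_trans _ _ (\int[mu]_w ((C `^ (r - 1))%:E * B w))%E).
    apply: ge0_le_integral; [exact: measurableT| | | |by move=> x _; exact: VB].
    - by move=> x _; rewrite lee_fin powR_ge0.
    - exact/measurable_EFinP.
    - exact: measurable_funeM.
  rewrite ge0_integralZl//; last by rewrite lee_fin powR_ge0.
  have -> : (C `^ r)%:E = ((C `^ (r - 1))%:E * C%:E)%E.
    by rewrite -EFinM -{3}(powRr1 (ltW C0)) -powRD ?subrK// gt_eqF ?implybT.
  rewrite -muleA; apply: lee_wpmul2l; first by rewrite lee_fin powR_ge0.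
  rewrite /B -(@fubini_tonelli _ _ _ _ _ mu mu (fun p => (K p * U p.1 `^ r)%:E))/=; last 2 first.
  - exact/measurable_EFinP.
  - by move=> q; rewrite lee_fin mulr_ge0 ?powR_ge0.
  have mUe : measurable_fun setT (fun x => (U x `^ r)%:E) by exact/measurable_EFinP.
  rewrite /IU -ge0_integralZl//; last 2 first.
  - by move=> x _; rewrite lee_fin powR_ge0.
  - by rewrite lee_fin ltW.
  have mK2 z : measurable_fun setT (fun w => (K (z, w))%:E).
    by apply/measurable_EFinP; exact: (measurableT_comp mK (pair1_measurable z)).
  have e z : (\int[mu]_w (K (z, w) * U z `^ r)%:E =
      \int[mu]_w (K (z, w))%:E * (U z `^ r)%:E)%E.
    rewrite -ge0_integralZr//.
    - by move=> x _; rewrite lee_fin.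
    - by rewrite lee_fin powR_ge0.
  apply: ge0_le_integral; first exact: measurableT.
  - by move=> z _; apply: integral_ge0 => w _; rewrite lee_fin mulr_ge0 ?powR_ge0.
  - apply: (@measurable_fun_fubini_tonelli_F _ _ _ _ _ mu (fun p => (K p * U p.1 `^ r)%:E)) => //.
      exact/measurable_EFinP.
    by move=> q; rewrite lee_fin mulr_ge0 ?powR_ge0.
  - exact: measurable_funeM.
  - by move=> z _; rewrite e; apply: lee_wpmul2r; rewrite ?lee_fin ?powR_ge0//; exact: Kcol.
apply: (@le_trans _ _ (((C `^ r)%:E * IU) `^ r^-1)%E).
  apply: gt0_ler_poweR; rewrite ?invr_ge0 ?(ltW r0)//.
  - by rewrite in_itv /= leey andbT; apply: integral_ge0 => x _; rewrite lee_fin powR_ge0.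
  - by rewrite in_itv /= leey andbT mule_ge0// lee_fin powR_ge0.
rewrite poweRM ?lee_fin ?powR_ge0// ?poweR_EFin -powRrM mulfV ?gt_eqF// powRr1//.
exact: ltW.
Qed.

End schur_test.

Section convolution_kernel.
Context {R : realType} {n : nat}.
Local Notation leb n := (lebesgue_rV R n).

Lemma schur_convolution (k : 'rV[R]_n -> R) (C : R) (U V : 'rV[R]_n -> R) (p : \bar R) :
  (1 <= p)%E -> 0 < C -> measurable_fun setT k -> (forall x, 0 <= k x) ->
  (\int[leb n]_x (k x)%:E <= C%:E)%E ->
  measurable_fun setT U -> measurable_fun setT V ->
  (forall x, 0 <= U x) -> (forall x, 0 <= V x) ->
  (forall w, ((V w)%:E <= \int[leb n]_z (k (z - w) * U z)%:E)%E) ->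
  (Lnorm (leb n) p (fun x => (V x)%:E) <= C%:E * Lnorm (leb n) p (fun x => (U x)%:E))%E.
Proof.
move=> p1 C0 mk k0 kC mU mV U0 V0 h.
have mke : measurable_fun setT (fun x => (k x)%:E) by exact/measurable_EFinP.
have k0e x : (0 <= (k x)%:E)%E by rewrite lee_fin.
apply: (@schur_test _ _ _ (leb n) (fun q => k (q.1 - q.2)) C) => //.
- apply: (measurableT_comp mk).
  by apply: measurable_subrV; [exact: measurable_fst|exact: measurable_snd].
- by move=> w /=; rewrite (integral_shift_rV (- w) mke).
- by move=> z /=; rewrite (integral_reflect_rV z mke).
Qed.

End convolution_kernel.

(** * Special Hermite functions *)

Section polynomially_bounded.
Context {R : realType}.
Local Notation leb n := (lebesgue_rV R n).

Definition polyb n (P : 'rV[R]_n -> R[i]) := mfC P /\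
  exists (B : R) (k : nat), forall x, normc (P x) <= B * (1 + `|x|) ^+ k.

Lemma polybP n (P : 'rV[R]_n -> R[i]) : polyb P -> exists2 B : R, 0 <= B &
  exists k : nat, forall m x, (k <= m)%N -> normc (P x) <= B * (1 + `|x|) ^+ m.
Proof.
move=> [_ [B [k h]]]; exists `|B| => //; exists k => m x km.
apply: le_trans (h x) _; apply: ler_pM.
- have j : 0 < (1 + `|x|) ^+ k by rewrite exprn_gt0 ?jap_gt0.
  by rewrite -(pmulr_lge0 _ j) (le_trans (normc_ge0 _) (h x)).
- by rewrite exprn_ge0 ?addr_ge0.
- exact: ler_norm.
- by apply: ler_weXn2l => //; rewrite lerDl.
Qed.

Lemma polyb_cst n (c : R[i]) : polyb (fun _ : 'rV[R]_n => c).
Proof. by split; [exact: mfC_cst|exists (normc c), 0%N => x; rewrite expr0 mulr1]. Qed.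
Lemma polyb_coord n (i : 'I_n) : polyb (fun x : 'rV[R]_n => (x ord0 i)%:C).
Proof.
split; first by apply: mfC_real; exact: measurable_coord_rV.
exists 1, 1%N => x; rewrite expr1 mul1r normc_real.
by rewrite (le_trans (coord_le_norm x i))// lerDr.
Qed.
Lemma polybD n (P Q : 'rV[R]_n -> R[i]) : polyb P -> polyb Q -> polyb (fun x => P x + Q x).
Proof.
move=> hP hQ; have [A A0 [k hA]] := polybP hP; have [B B0 [m hB]] := polybP hQ.
split; first by apply: mfCD; [case: hP|case: hQ].
exists (A + B), (maxn k m) => x; apply: le_trans (le_normcD _ _) _.
by rewrite mulrDl lerD ?hA ?hB ?leq_maxl ?leq_maxr.
Qed.
Lemma polybM n (P Q : 'rV[R]_n -> R[i]) : polyb P -> polyb Q -> polyb (fun x => P x * Q x).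
Proof.
move=> hP hQ; have [A A0 [k hA]] := polybP hP; have [B B0 [m hB]] := polybP hQ.
split; first by apply: mfCM; [case: hP|case: hQ].
exists (A * B), (k + m)%N => x; rewrite normcM exprD mulrACA.
by apply: ler_pM; rewrite ?normc_ge0 ?hA ?hB.
Qed.
Lemma polyb_conjc n (P : 'rV[R]_n -> R[i]) : polyb P -> polyb (fun x => conjc (P x)).
Proof.
move=> [mP [B [k h]]]; split; first exact: mfC_conjc.
by exists B, k => x; rewrite normc_conjc.
Qed.
Lemma polybX n (P : 'rV[R]_n -> R[i]) m : polyb P -> polyb (fun x => P x ^+ m).
Proof.
move=> hP; elim: m => [|m IH]; first exact: polyb_cst.
by under [fun x => _]eq_fun do rewrite exprS; exact: polybM.
Qed.

Lemma polyb_cexp n (P Q : 'rV[R]_n -> R[i]) (A c : R) : 0 < c -> polyb P -> mfC Q ->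
  (forall x, complex.Re (Q x) <= A * `|x| - c * `|x| ^+ 2) ->
  mfC (fun x => P x * cexp (Q x)) /\
  exists C, forall x, normc (P x * cexp (Q x)) <= C * japN x.
Proof.
move=> c0 [mP [B [k hP]]] mQ hQ; split; last exact: gauss_dec hP hQ.
by apply: mfCM => //; exact: mfC_cexp.
Qed.

Lemma intgC_polyb_cexp n (P Q : 'rV[R]_n -> R[i]) (A c : R) : 0 < c -> polyb P -> mfC Q ->
  (forall x, complex.Re (Q x) <= A * `|x| - c * `|x| ^+ 2) ->
  intgC (leb n) (fun x => P x * cexp (Q x)).
Proof.
by move=> c0 hP mQ hQ; have [mPQ [C hC]] := polyb_cexp c0 hP mQ hQ; exact: intgC_japN hC.
Qed.

Lemma int_partial_cexp n (j : 'I_n) (P P' Q Q' : 'rV[R]_n -> R[i]) (A c : R) : 0 < c ->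
  polyb P -> polyb P' -> polyb Q' -> mfC Q ->
  (forall x, complex.Re (Q x) <= A * `|x| - c * `|x| ^+ 2) ->
  isD (delta_mx 0 j) P P' -> isD (delta_mx 0 j) Q Q' ->
  intC (leb n) (fun x => (P' x + P x * Q' x) * cexp (Q x)) = 0.
Proof.
move=> c0 hP hP' hQ' mQ hQ dP dQ.
have [m1 [C1 h1]] := polyb_cexp c0 hP mQ hQ.
have [m2 [C2 h2]] := polyb_cexp c0 (polybD hP' (polybM hP hQ')) mQ hQ.
have C0 (C : R) (x : 'rV[R]_n) : C <= `|C1| + `|C2| -> C * japN x <= (`|C1| + `|C2|) * japN x.
  by rewrite ler_pM2r ?japN_gt0.
have [] // := @int_partial R n j (fun x => P x * cexp (Q x))
  (fun x => (P' x + P x * Q' x) * cexp (Q x)) (`|C1| + `|C2|) m1.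
- by apply: isD_eq (isDM dP (isD_cexp dQ)) => x; rewrite mulrDl mulrA.
- by move=> x; apply: le_trans (h1 x) (C0 _ _ _); rewrite (le_trans (ler_norm _))// lerDl.
- by move=> x; apply: le_trans (h2 x) (C0 _ _ _); rewrite (le_trans (ler_norm _))// lerDr.
Qed.

End polynomially_bounded.

(** * The Fourier-Wigner transform of two Hermite functions of one variable *)

Section hermite_moments.
Context {R : realType}.
Local Notation leb n := (lebesgue_rV R n).
Local Notation leb1 := (@lebesgue_measure R).
Local Notation hp := (hermite_poly R).

Lemma hermite_polyS k : hp k.+1 = 2%:R *: ('X * hp k) - (hp k)^`().
Proof. by []. Qed.

(** By induction from the defining recurrence. At k = 0 the clipped predecessor [k.-1] is multiplied
    by 0; [shp] uses the same convention. *)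
Lemma deriv_hermite k : (hp k)^`() = (2 * k)%N%:R *: hp k.-1.
Proof.
elim: k => [|k IH]; first by rewrite /hermite_poly /= derivC muln0 scale0r.
rewrite hermite_polyS derivB derivZ derivM derivX mul1r.
case: k IH => [|k] IH.
  by rewrite IH muln0 scale0r mulr0 addr0 linear0 subr0.
rewrite IH /= derivZ -scalerAr.
rewrite scalerDr scalerA [2%:R * _]mulrC -scalerA -addrA -scalerBr.
rewrite -hermite_polyS -scalerDl; congr (_ *: _).
by rewrite -natrD; congr _%:R; lia.
Qed.

Let Qx (x : R) (u : 'rV[R]_1) : R[i] := (- (1 * u ord0 ord0 ^+ 2))%:C + (0 +i* x) * (u ord0 ord0)%:C.

Let ReQx x (u : 'rV[R]_1) : complex.Re (Qx x u) <= 0 * `|u| - 1 * `|u| ^+ 2.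
Proof.
rewrite ReD ReM /= mulr0 subr0 mul0r addr0 mul0r sub0r lerN2 !mul1r.
rewrite -[leRHS]real_normK ?num_real// lerXn2r ?nnegrE//.
by apply: norm_le_coord => // i; rewrite (ord1 i).
Qed.

Let mQx x : mfC (Qx x).
Proof.
apply: mfCD.
  by apply: mfC_real; apply: measurableT_comp => //; apply: measurable_funM => //;
    apply: measurable_funX; exact: measurable_coord_rV.
by apply: mfCM; [exact: mfC_cst|apply: mfC_real; exact: measurable_coord_rV].
Qed.

Let peval (Q : {poly R}) (u : 'rV[R]_1) : R[i] := (Q.[u ord0 ord0])%:C.

Let polyb_peval Q : polyb (peval Q).
Proof.
elim/poly_ind: Q => [|p c IH].
  rewrite /peval; under [fun u => _]eq_fun do rewrite horner0; exact: polyb_cst.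
rewrite /peval; under [fun u => _]eq_fun do rewrite hornerMXaddC rmorphD rmorphM /=.
apply: polybD; last exact: polyb_cst.
by apply: polybM => //; exact: polyb_coord.
Qed.

Let isD_peval Q : isD (delta_mx 0 ord0) (peval Q) (peval Q^`()).
Proof.
have hc := @isD_coord R 1 (delta_mx 0 ord0) ord0.
rewrite mxE !eqxx /= in hc.
elim/poly_ind: Q => [|p c IH].
  rewrite /peval; under [fun u => _]eq_fun do rewrite horner0.
  by apply: isD_eq (isD_cst _ 0) => u; rewrite derivC horner0.
rewrite {1}/peval; under [fun u => _]eq_fun do rewrite hornerMXaddC rmorphD rmorphM /=.
apply: isD_eq (isDD (isDM IH hc) (isD_cst _ c%:C)) => u.
rewrite /peval derivMXaddC !hornerE rmorphD rmorphM /=; ring.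
Qed.

Definition hmoment (x : R) (Q : {poly R}) : R[i] :=
  intC (leb 1) (fun u => peval Q u * cexp (Qx x u)).

Lemma intgC_hmoment x Q : intgC (leb 1) (fun u => peval Q u * cexp (Qx x u)).
Proof. exact: (intgC_polyb_cexp ltr01 (polyb_peval Q) (mQx x) (ReQx x)). Qed.

Lemma hmomentD x P Q : hmoment x (P + Q) = hmoment x P + hmoment x Q.
Proof.
rewrite /hmoment -intCD; [|exact: intgC_hmoment|exact: intgC_hmoment].
by apply: eq_intC => u; rewrite /peval hornerD rmorphD mulrDl.
Qed.
Lemma hmomentZ x c Q : hmoment x (c *: Q) = c%:C * hmoment x Q.
Proof.
rewrite /hmoment -intCZ; last exact: intgC_hmoment.
by apply: eq_intC => u; rewrite /peval hornerZ rmorphM mulrA.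
Qed.
Lemma hmomentB x P Q : hmoment x (P - Q) = hmoment x P - hmoment x Q.
Proof. by rewrite hmomentD -[- Q]scaleN1r hmomentZ rmorphN mulN1r. Qed.

Lemma hmoment_ibp x Q : 2 * hmoment x ('X * Q) = hmoment x Q^`() + (0 +i* x) * hmoment x Q.
Proof.
have hc := @isD_coord R 1 (delta_mx 0 ord0) ord0.
rewrite mxE !eqxx /= in hc.
pose Q' (u : 'rV[R]_1) : R[i] := (- (2 * u ord0 ord0))%:C + (0 +i* x).
have pQ' : polyb Q'.
  have := polybD (polybM (polyb_cst 1 (- 2)%:C) (polyb_coord ord0)) (polyb_cst 1 (0 +i* x)).
  by under [fun x => _]eq_fun do rewrite -rmorphM mulNr.
have dQ : isD (delta_mx 0 ord0) (Qx x) Q'.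
  have := isDD (isDZ (- 1)%:C (isDM hc hc)) (isDZ (0 +i* x) hc).
  rewrite (_ : (fun u : 'rV_1 => _) = Qx x); last first.
    apply/funext => u; rewrite /Qx; congr (_ + _).
    by apply: complex_eqP => /=; ring.
  by apply: isD_eq => u; rewrite /Q'; apply: complex_eqP; rewrite ?(ReD, ImD, ReM, ImM) /=; ring.
have := int_partial_cexp ltr01 (polyb_peval Q) (polyb_peval Q^`()) pQ' (mQx x) (ReQx x) (isD_peval Q) dQ.
move=> h; apply/eqP; rewrite -subr_eq0 -oppr_eq0 opprB -h; apply/eqP.
rewrite /hmoment -!intCZ; try exact: intgC_hmoment.
rewrite -intCD; [|exact: intgC_hmoment|by apply: intgCZ; exact: intgC_hmoment].
rewrite -intCB; last 2 first.
- by apply: intgCD; [|apply: intgCZ]; exact: intgC_hmoment.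
- by apply: intgCZ; exact: intgC_hmoment.
apply: eq_intC => u; rewrite /peval /Q' hornerM hornerX rmorphN !rmorphM /=; ring.
Qed.

(** The two Gaussians e^(-(u + y/2)^2/2) and e^(-(u - y/2)^2/2) multiply to e^(-u^2) e^(-y^2/4). The
    first factor is in [hmoment]; the second is restored in [hermite_fun1_pair]. *)
Definition hpair (x y : R) (m n : nat) : R[i] :=
  hmoment x ((hp m \Po ('X + (y / 2)%:P)) * (hp n \Po ('X - (y / 2)%:P))).

Let comp_hpS (c : R) k : hp k.+1 \Po ('X + c%:P) =
  2%:R *: ('X * (hp k \Po ('X + c%:P))) + (2 * c) *: (hp k \Po ('X + c%:P)) - (hp k \Po ('X + c%:P))^`().
Proof.
rewrite hermite_polyS comp_polyB comp_polyZ comp_polyM comp_polyX.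
rewrite deriv_comp derivD derivX derivC addr0 mulr1; congr (_ - _).
by rewrite mulrDl scalerDr mul_polyC -scalerA.
Qed.

Let deriv_comp_hp (c : R) k : (hp k \Po ('X + c%:P))^`() = (2 * k)%N%:R *: (hp k.-1 \Po ('X + c%:P)).
Proof.
by rewrite deriv_comp derivD derivX derivC addr0 mulr1 deriv_hermite comp_polyZ.
Qed.

Lemma hpairSl x y m : hpair x y m.+1 0 = (y +i* x) * hpair x y m 0.
Proof.
rewrite /hpair; set B := _ \Po ('X - _); have B1 : B = 1 by rewrite /B comp_polyC.
rewrite comp_hpS B1 !mulr1 hmomentB hmomentD !hmomentZ.
have := hmoment_ibp x (hp m \Po ('X + (y / 2)%:P)); rewrite rmorph_nat => ->.
rewrite (_ : (2 * (y / 2))%:C = y%:C); last by congr (_%:C); field.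
set J := hmoment _ (_ \Po _); set J' := hmoment _ _.
rewrite (_ : y +i* x = y%:C + (0 +i* x)); last by apply: complex_eqP => /=; ring.
by ring.
Qed.

(** In H_(n+1) = 2 X H_n - H_n' the factor X is removed by integration by parts. The derivative
    falling on H_n cancels the second term; the one falling on H_m lowers m. *)
Lemma hpairSr x y m n : hpair x y m n.+1 =
  - conjc (y +i* x) * hpair x y m n + (2 * m)%N%:R * hpair x y m.-1 n.
Proof.
rewrite /hpair -polyCN; set A := hp m \Po _; set A' := hp m.-1 \Po _.
have dA : A^`() = (2 * m)%N%:R *: A' by rewrite /A deriv_comp_hp.
rewrite comp_hpS; set B := hp n \Po _.
rewrite (_ : A * _ = 2%:R *: ('X * (A * B)) + (2 * - (y / 2)) *: (A * B) - A * B^`()); last first.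
  rewrite mulrBr mulrDr -!scalerAr; congr (_ *: _ + _ - _); ring.
rewrite hmomentB hmomentD !hmomentZ.
have := hmoment_ibp x (A * B); rewrite rmorph_nat => ->.
rewrite derivM hmomentD dA -scalerAl hmomentZ rmorph_nat.
rewrite (_ : (2 * - (y / 2))%:C = - y%:C); last by rewrite -rmorphN; congr (_%:C); field.
rewrite (_ : - conjc (y +i* x) = - y%:C + (0 +i* x)); last by apply: complex_eqP => /=; ring.
by ring.
Qed.

Lemma hpair00 x y : hpair x y 0 0 = (Num.sqrt pi * expR (- x ^+ 2 / 4))%:C.
Proof.
rewrite /hpair !comp_polyC -polyCM mulr1 /hmoment.
have [i1 e1] := line_intC (intgC_gaussC (0 +i* x) (ltr01 : 0 < 1 :> R)).
rewrite (_ : (fun u => _) = fun u : 'rV[R]_1 => gaussC 1 (0 +i* x) (u ord0 ord0)); last first.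
  by apply/funext => u; rewrite /peval hornerC mul1r.
rewrite e1 intC_gaussC// divr1 [RHS]rmorphM -[X in _ = _ * X]cexp_real.
by congr (_ * cexp _); apply: complex_eqP => /=; field.
Qed.

(* (y + ix)-polynomials of the special Hermite functions: up to the Gaussian
   and the normalization, the Fourier-Wigner transform of two Hermite
   functions. *)
Fixpoint shp (m n : nat) (w : R[i]) {struct n} : R[i] :=
  if n is n'.+1 then - conjc w * shp m n' w + (2 * m)%N%:R * shp m.-1 n' w else w ^+ m.

Lemma hpairE x y m n : hpair x y m n =
  (Num.sqrt pi * expR (- x ^+ 2 / 4))%:C * shp m n (y +i* x).
Proof.
elim: n m => [|n IH] m.
  elim: m => [|m IH]; first by rewrite hpair00 mulr1.
  by rewrite hpairSl IH /= [_ ^+ m.+1]exprS; ring.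
by rewrite hpairSr !IH /=; ring.
Qed.

End hermite_moments.

Section special_hermite_formula.
Context {R : realType}.
Local Notation leb n := (lebesgue_rV R n).
Local Notation leb1 := (@lebesgue_measure R).

Lemma line_intgC (F : R -> R[i]) : mfC F ->
  intgC (leb 1) (fun x => F (x ord0 ord0)) -> intgC leb1 F.
Proof.
move=> mF [_ iF]; split => //.
have mN : measurable_fun setT (fun t : R => (normc (F t))%:E).
  by apply/measurable_EFinP; exact: measurable_normc.
have e (t : R) v : cons_rV (t, v) ord0 (ord0 : 'I_1) = t by rewrite mxE unlift_none.
rewrite integral_rVS in iF; last 2 first.
- exact: (measurableT_comp mN (@measurable_coord_rV R 1 ord0)).
- by move=> x; rewrite lee_fin normc_ge0.
apply: le_lt_trans iF; rewrite le_eqVlt; apply/orP; left; apply/eqP.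
apply: eq_integral => t _; under eq_integral do rewrite e.
by rewrite integral_rV0.
Qed.

(** The order y + i x, rather than x + i y, is imposed by the recurrences of [hpair], whose
    multipliers are y + i x and minus its conjugate. *)
Definition theta (p : 'rV[R]_(1 + 1)) : R[i] :=
  p ord0 (rshift 1 ord0) +i* p ord0 (lshift 1 ord0).

Definition shnorm (m n : nat) : R := Num.sqrt (2 ^+ (m + n) * m`!%:R * n`!%:R).

Definition shf (m n : nat) (w : R[i]) : R[i] :=
  ((2 * pi)^-1 * expR (- normc w ^+ 2 / 4) / shnorm m n)%:C * shp m n w.

Lemma hermite_fun1_pair (x y : R) (m n : nat) :
  let F u := expi (x * u) * (hermite_fun1 m (u + y / 2) * hermite_fun1 n (u - y / 2))%:C in
  intgC leb1 F /\ ((2 * pi)^-1)%:C * intC leb1 F = shf m n (y +i* x).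
Proof.
move=> F.
pose hp := hermite_poly R.
pose Q := (hp m \Po ('X + (y / 2)%:P)) * (hp n \Po ('X - (y / 2)%:P)).
pose k : R := expR (- y ^+ 2 / 4) / (Num.sqrt pi * shnorm m n).
have s0 : 0 < Num.sqrt (pi : R) by rewrite sqrtr_gt0 pi_gt0.
have f0 j : 0 < (j`!%:R : R) by rewrite ltr0n fact_gt0.
have sn0 : 0 < shnorm m n by rewrite sqrtr_gt0 !mulr_gt0// exprn_gt0.
have H u : hermite_fun1 m (u + y / 2) * hermite_fun1 n (u - y / 2) =
    k * Q.[u] * expR (- (1 * u ^+ 2)).
  rewrite /hermite_fun1 /Q hornerM !horner_comp !hornerD hornerN hornerX !hornerC.
  rewrite mulrACA -invfM mulrACA -expRD.
  rewrite (_ : - _ - _ = - y ^+ 2 / 4 + - (1 * u ^+ 2)); last by field.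
  rewrite expRD /k /shnorm -!sqrtrM ?mulr_ge0 ?exprn_ge0 ?ler0n ?sqrtr_ge0 ?pi_ge0//.
  rewrite (_ : 2 ^+ m * m`!%:R * _ * _ = pi * (2 ^+ (m + n) * m`!%:R * n`!%:R)); first by ring.
  by rewrite exprD -[pi in RHS](sqr_sqrtr (pi_ge0 R)); ring.
have FE u : F u = k%:C * ((Q.[u])%:C * cexp ((- (1 * u ^+ 2))%:C + (0 +i* x) * u%:C)).
  rewrite cexpD -[in RHS](_ : 0 +i* (x * u) = (0 +i* x) * u%:C); last first.
    by apply: complex_eqP => /=; ring.
  by rewrite cexp_im cexp_real /F H !rmorphM mulrC !mulrA.
have mF : mfC F.
  rewrite (_ : F = fun u => k%:C * ((Q.[u])%:C * cexp ((- (1 * u ^+ 2))%:C + (0 +i* x) * u%:C))); last exact/funext.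
  apply: mfCM; first exact: mfC_cst.
  apply: mfCM; last exact: mfC_gaussC.
  by apply: mfC_real; apply: continuous_measurable_fun; exact: continuous_horner.
have EF : (fun u : 'rV[R]_1 => F (u ord0 ord0)) = fun u => k%:C * ((Q.[u ord0 ord0])%:C *
    cexp ((- (1 * u ord0 ord0 ^+ 2))%:C + (0 +i* x) * (u ord0 ord0)%:C)).
  by apply/funext => u; rewrite FE.
have iF : intgC leb1 F.
  apply: line_intgC => //; rewrite EF.
  by apply: intgCZ; exact: (intgC_hmoment x Q).
split=> //.
have [i1 <-] := line_intC iF.
rewrite EF intCZ; last exact: (intgC_hmoment x Q).
have -> : intC (leb 1) (fun u : 'rV[R]_1 => (Q.[u ord0 ord0])%:C *
  cexp ((- (1 * u ord0 ord0 ^+ 2))%:C + (0 +i* x) * (u ord0 ord0)%:C)) = hpair x y m n by [].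
rewrite hpairE /shf !mulrA -!rmorphM /=; congr (_%:C * _).
rewrite sqr_sqrtr ?addr_ge0 ?sqr_ge0// (_ : - (y ^+ 2 + x ^+ 2) / 4 = - y ^+ 2 / 4 + - x ^+ 2 / 4); last by field.
by rewrite expRD /k; set c := (2 * pi)^-1; field; rewrite !gt_eqF.
Qed.

Lemma special_hermiteE d (a b : 'I_d -> nat) (z : 'rV[R]_(d + d)) :
  special_hermite a b z = \prod_j shf (a j) (b j) (theta (pairrV j z)).
Proof.
pose x j := lsubmx z ord0 j; pose y j := rsubmx z ord0 j.
pose F j u := expi (x j * u) * (hermite_fun1 (a j) (u + y j / 2) * hermite_fun1 (b j) (u - y j / 2))%:C.
have [iF eF] := prodC_rV (fun j => (hermite_fun1_pair (x j) (y j) (a j) (b j)).1).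
rewrite /special_hermite /=.
have -> : integralC (fun u : 'rV[R]_d => expi (dotR (lsubmx z) u) *
    (hermite_fun a (u + 2^-1 *: rsubmx z) * hermite_fun b (u - 2^-1 *: rsubmx z))%:C) =
  intC (leb d) (fun u : 'rV[R]_d => \prod_j F j (u ord0 j)).
  apply: eq_intC => u; rewrite /F big_split /=; congr (_ * _).
    rewrite /dotR -cexp_im -(big_morph _ expiD expi0) //.
    by rewrite cexp_im.
  rewrite -rmorph_prod /= big_split /=; congr (_%:C); congr (_ * _);
    by apply: eq_bigr => j _; rewrite /y !mxE [2^-1 * _]mulrC.
rewrite {}eF -exprVn rmorphXn /= -[X in _ ^+ X]card_ord -prodr_const -big_split /=.
apply: eq_bigr => j _; rewrite (hermite_fun1_pair (x j) (y j) (a j) (b j)).2.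
by rewrite /theta /pairrV /x /y row_mxEr row_mxEl !mxE.
Qed.

End special_hermite_formula.

(** * Integration by parts in theta and its conjugate *)

Section plane_calculus.
Context {R : realType}.
Local Notation leb n := (lebesgue_rV R n).
Local Notation P2 := 'rV[R]_(1 + 1).
Local Notation ex := (delta_mx 0 (lshift 1 ord0) : P2).
Local Notation ey := (delta_mx 0 (rshift 1 ord0) : P2).
Local Notation "'I'" := ((0 : R) +i* (1 : R)).

(* A and B are the Wirtinger derivatives of T in theta = y + i x and its
   conjugate. *)
Definition wirtinger (T A B : P2 -> R[i]) :=
  [/\ polyb T, polyb A, polyb B, isD ey T (fun p => A p + B p) &
      isD ex T (fun p => I * (A p - B p))].

Lemma wirtinger_eq T A B A' B' : A =1 A' -> B =1 B' -> wirtinger T A B -> wirtinger T A' B'.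
Proof. by move=> /funext -> /funext ->. Qed.

Lemma wirtinger_cst (c : R[i]) : wirtinger (fun=> c) (fun=> 0) (fun=> 0).
Proof.
split; [exact: polyb_cst|exact: polyb_cst|exact: polyb_cst| |].
- by apply: isD_eq (isD_cst _ c) => p; rewrite addr0.
- by apply: isD_eq (isD_cst _ c) => p; rewrite subr0 mulr0.
Qed.

Lemma wirtingerD T A B T' A' B' : wirtinger T A B -> wirtinger T' A' B' ->
  wirtinger (fun p => T p + T' p) (fun p => A p + A' p) (fun p => B p + B' p).
Proof.
move=> [a b c e f] [a' b' c' e' f']; split; try exact: polybD.
- by apply: isD_eq (isDD e e') => p; ring.
- by apply: isD_eq (isDD f f') => p; ring.
Qed.

Lemma wirtingerM T A B T' A' B' : wirtinger T A B -> wirtinger T' A' B' ->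
  wirtinger (fun p => T p * T' p) (fun p => A p * T' p + T p * A' p)
    (fun p => B p * T' p + T p * B' p).
Proof.
move=> [a b c e f] [a' b' c' e' f']; split.
- exact: polybM.
- by apply: polybD; exact: polybM.
- by apply: polybD; exact: polybM.
- by apply: isD_eq (isDM e e') => p; ring.
- by apply: isD_eq (isDM f f') => p; ring.
Qed.

Lemma wirtinger_conjc T A B : wirtinger T A B ->
  wirtinger (fun p => conjc (T p)) (fun p => conjc (B p)) (fun p => conjc (A p)).
Proof.
move=> [a b c e f]; split; try exact: polyb_conjc.
- by apply: isD_eq (isD_conjc e) => p; rewrite conjcD addrC.
- apply: isD_eq (isD_conjc f) => p; rewrite conjcM conjcB.
  by apply: complex_eqP; rewrite !(ReM, ImM, ReD, ImD, ReN, ImN) /=; ring.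
Qed.

Lemma wirtinger_theta : wirtinger theta (fun=> 1) (fun=> 0).
Proof.
have E : theta = fun p : P2 => (p ord0 (rshift 1 ord0))%:C + I * (p ord0 (lshift 1 ord0))%:C.
  by apply/funext => p; apply: complex_eqP; rewrite !(ReM, ImM, ReD, ImD) /=; ring.
have xy : (lshift 1 ord0 : 'I_(1 + 1)) == rshift 1 ord0 = false by [].
have yx : (rshift 1 ord0 : 'I_(1 + 1)) == lshift 1 ord0 = false by [].
rewrite E; split; [|exact: polyb_cst|exact: polyb_cst| |].
- by apply: polybD; [|apply: polybM; first exact: polyb_cst]; exact: polyb_coord.
- apply: isD_eq (isDD (isD_coord _ _) (isDZ I (isD_coord _ _))) => p.
  by rewrite !mxE !eqxx xy /= rmorph0 mulr0 !addr0.
- apply: isD_eq (isDD (isD_coord _ _) (isDZ I (isD_coord _ _))) => p.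
  by rewrite !mxE !eqxx yx /= rmorph0 subr0 add0r.
Qed.

Lemma shp0 m (w : R[i]) : shp m 0 w = w ^+ m.
Proof. by [].  Qed.
Lemma shpS m n (w : R[i]) : shp m n.+1 w = - conjc w * shp m n w + (2 * m)%N%:R * shp m.-1 n w.
Proof. by []. Qed.

(** Up to sign and scaling, [shp] are the complex Hermite polynomials; differentiating in theta or
    in its conjugate lowers one index each. *)
Lemma wirtinger_shp m n : wirtinger (fun p => shp m n (theta p))
  (fun p => m%:R * shp m.-1 n (theta p)) (fun p => - (n%:R * shp m n.-1 (theta p))).
Proof.
elim: n m => [|n IH] m.
  elim: m => [|m IHm].
    by apply: wirtinger_eq (wirtinger_cst 1) => p; rewrite ?mul0r ?oppr0.
  under [fun p => shp _ _ _]eq_fun do rewrite /= exprS.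
  apply: wirtinger_eq (wirtingerM wirtinger_theta IHm) => p /=.
    case: m {IHm} => [|m]; first by rewrite mul0r mulr0 addr0 expr0.
    by rewrite /= exprS -[in RHS](addn1 m.+1) natrD; ring.
  by rewrite !mul0r oppr0 mulr0 addr0.
have wN := wirtingerM (wirtinger_cst (-1)) (wirtinger_conjc wirtinger_theta).
have := wirtingerD (wirtingerM wN (IH m)) (wirtingerM (wirtinger_cst (2 * m)%N%:R) (IH m.-1)).
under [fun p => _ + _]eq_fun do rewrite mulN1r.
apply: wirtinger_eq => p; cbv beta; rewrite ?(conjc0, conjc1) ?shpS;
  move: (theta p) => w.
  by case: m => [|m]; rewrite /= ?natrM; ring.
case: n {IH} => [|n]; case: m => [|m]; rewrite /= ?natrM.
- ring.
- ring.
- rewrite -[n.+2]addn1 natrD; ring.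
- rewrite -[n.+2]addn1 natrD; ring.
Qed.

Variables a b : R[i].

(** At a = b = 0 this is the weight for the orthogonality of [shp]; general a, b give the pairings
    with shifted Gaussians. *)
Definition wexp (p : P2) : R[i] :=
  - 2^-1%:C * (theta p * conjc (theta p)) + (a * theta p - b * conjc (theta p)).

Let wirtinger_wexp : wirtinger wexp (fun p => a - 2^-1%:C * conjc (theta p))
  (fun p => - b - 2^-1%:C * theta p).
Proof.
have wt := wirtinger_theta; have wc := wirtinger_conjc wt.
have := wirtingerD (wirtingerM (wirtinger_cst (- 2^-1%:C)) (wirtingerM wt wc))
  (wirtingerD (wirtingerM (wirtinger_cst a) wt) (wirtingerM (wirtinger_cst (- b)) wc)).
rewrite (_ : (fun p => _ + _) = wexp); last first.
  by apply/funext => p; rewrite /wexp [- b * _]mulNr.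
by apply: wirtinger_eq => p; rewrite ?conjc0 ?conjc1; ring.
Qed.

Lemma Re_wexp (p : P2) : complex.Re (wexp p) <=
  2 * (normc a + normc b) * `|p| - 2^-1 * `|p| ^+ 2.
Proof.
have tn : normc (theta p) <= 2 * `|p|.
  apply: le_trans (normc_le_ReIm _) _; rewrite /theta /=.
  by rewrite [2 * _]mulr_natl [_ *+ _]mulr2n lerD ?coord_le_norm.
have h1 : `|p| ^+ 2 <= normc (theta p) ^+ 2.
  apply: le_trans (sumsq_ge_norm p) _.
  by rewrite normc_sqr big_split_ord /= !big_ord1 addrC.
have h2 (z w : R[i]) : complex.Re (z * w) <= normc z * normc w.
  by rewrite -normcM (le_trans (ler_norm _))// normc_Re_le.
have h0 (r t : R) : complex.Re (- r%:C * t%:C) = - r * t.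
  by rewrite -rmorphN -rmorphM.
rewrite /wexp mul_conjc ReD h0 ReD ReN.
have h3 : - complex.Re (b * conjc (theta p)) <= normc b * normc (theta p).
  rewrite -ReN -mulNr; apply: le_trans (h2 _ _) _.
  by rewrite normcN normc_conjc.
have h4 := h2 a (theta p).
have na := normc_ge0 a; have nb := normc_ge0 b.
have h5 := ler_wpM2l na tn; have h6 := ler_wpM2l nb tn.
by move: h1 h3 h4 h5 h6; lra.
Qed.

Let c0 : 0 < 2^-1 :> R. Proof. by rewrite invr_gt0. Qed.
Let mwexp : mfC wexp. Proof. by have [[]] := wirtinger_wexp. Qed.

Lemma intgC_wint T : polyb T -> intgC (leb (1 + 1)) (fun p => T p * cexp (wexp p)).
Proof. by move=> hT; exact: (intgC_polyb_cexp c0 hT mwexp Re_wexp). Qed.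

Definition wint (T : P2 -> R[i]) : R[i] := intC (leb (1 + 1)) (fun p => T p * cexp (wexp p)).

Lemma wintD T T' : polyb T -> polyb T' -> wint (fun p => T p + T' p) = wint T + wint T'.
Proof.
move=> hT hT'; rewrite /wint -intCD; [|exact: intgC_wint|exact: intgC_wint].
by apply: eq_intC => p; rewrite mulrDl.
Qed.
Lemma wintZ (c : R[i]) T : polyb T -> wint (fun p => c * T p) = c * wint T.
Proof.
move=> hT; rewrite /wint -intCZ; last exact: intgC_wint.
by apply: eq_intC => p; rewrite mulrA.
Qed.

(** The integrals of the two real partial derivatives vanish. Their combinations corresponding to
    theta and its conjugate vanish too, and solving for the terms in conj(theta) T and theta T gives
    the two formulas. *)
Lemma wint_ibp T A B : wirtinger T A B ->
  wint (fun p => conjc (theta p) * T p) = 2 * wint A + 2 * a * wint T /\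
  wint (fun p => theta p * T p) = 2 * wint B - 2 * b * wint T.
Proof.
move=> [pT pA pB dy dx]; have [pQ pQa pQb qy qx] := wirtinger_wexp.
have [pt _ _ _ _] := wirtinger_theta; have pct := polyb_conjc pt.
pose I2 T := intC (leb (1 + 1)) (fun p => T p * cexp (wexp p)).
have pD := polybD pQa pQb.
have pDI (U V : P2 -> R[i]) : polyb U -> polyb V -> polyb (fun p => I * (U p - V p)).
  move=> pU pV; apply: polybM; first exact: polyb_cst.
  by have := polybD pU (polybM (polyb_cst _ (-1)) pV); under [fun x => _]eq_fun do rewrite mulN1r.
have hy := int_partial_cexp c0 pT (polybD pA pB) pD mwexp Re_wexp dy qy.
have hx := int_partial_cexp c0 pT (pDI _ _ pA pB) (pDI _ _ pQa pQb) mwexp Re_wexp dx qx.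
have Ia : intgC (leb (1 + 1)) (fun p => (A p + T p * (a - 2^-1%:C * conjc (theta p))) * cexp (wexp p)).
  by apply: intgC_wint; apply: polybD => //; exact: polybM.
have Ib : intgC (leb (1 + 1)) (fun p => (B p + T p * (- b - 2^-1%:C * theta p)) * cexp (wexp p)).
  by apply: intgC_wint; apply: polybD => //; exact: polybM.
set wa := intC (leb (1 + 1)) (fun p => (A p + T p * (a - 2^-1%:C * conjc (theta p))) * cexp (wexp p)).
set wb := intC (leb (1 + 1)) (fun p => (B p + T p * (- b - 2^-1%:C * theta p)) * cexp (wexp p)).
have e1 : wa + wb = 0.
  by rewrite -hy /wa /wb -intCD//; apply: eq_intC => p; ring.
have e2 : wa - wb = 0.
  apply: (mulfI (x := I)); first by rewrite eq_complex /= oner_eq0 andbF.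
  by rewrite mulr0 -hx /wa /wb -intCB// -intCZ; [apply: eq_intC => p; ring|exact: intgCB].
have a0 : wa = 0.
  
  have wab : wa = wb by apply/eqP; rewrite -subr_eq0 e2.
  by move/eqP: e1; rewrite -wab -mulr2n mulrn_eq0 => /eqP.
have b0 : wb = 0 by move: e1; rewrite a0 add0r.
have hz (z : R[i]) : z = 2 * (2^-1%:C * z).
  by apply: complex_eqP; rewrite !(ReM, ImM) /=; field.
have pcT := polybM pct pT; have ptT := polybM pt pT.
split.
- have : 2 * wa = 0 by rewrite a0 mulr0.
  rewrite /wa -intCZ// => e.
  rewrite -[LHS]addr0 -e /wint -!intCZ; [|exact: intgC_wint|exact: intgC_wint].
  rewrite -intCD; [|exact: intgC_wint|exact: intgCZ].
  rewrite -intCD; [|by apply: intgCZ; exact: intgC_wint|by apply: intgCZ; exact: intgC_wint].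
  by apply: eq_intC => p; rewrite [conjc _ * _ in LHS]hz; ring.
- have : 2 * wb = 0 by rewrite b0 mulr0.
  rewrite /wb -intCZ// => e.
  rewrite -[LHS]addr0 -e /wint -!intCZ; [|exact: intgC_wint|exact: intgC_wint].
  rewrite -intCD; [|exact: intgC_wint|exact: intgCZ].
  rewrite -intCB; [|by apply: intgCZ; exact: intgC_wint|by apply: intgCZ; exact: intgC_wint].
  by apply: eq_intC => p; rewrite [theta _ * _ in LHS]hz; ring.
Qed.

End plane_calculus.

Section plane_moments.
Context {R : realType}.
Local Notation leb n := (lebesgue_rV R n).
Local Notation P2 := 'rV[R]_(1 + 1).

Lemma wint1 (a b : R[i]) : wint a b (fun=> 1) = (2 * pi)%:C * cexp (- 2 * a * b).
Proof.
pose l (i : 'I_(1 + 1)) := match fintype.split i with inl _ => (0 +i* 1) * (a + b) | inr _ => a - b end.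
have h : (0 : R) < 2^-1 by rewrite invr_gt0.
rewrite /wint (_ : (fun p : P2 => _) = (fun p => \prod_i gaussC 2^-1 (l i) (p ord0 i))); last first.
  apply/funext => p; rewrite big_split_ord /= !big_ord1 mul1r.
  rewrite /l (unsplitK (inl ord0)) (unsplitK (inr ord0)) /gaussC -cexpD; congr cexp.
  rewrite /wexp mul_conjc normc_sqr.
  rewrite /theta; case: (a) => a1 a2; case: (b) => b1 b2.
  by apply: complex_eqP => /=; field.
rewrite intC_gaussD// big_split_ord /= !big_ord1 /l (unsplitK (inl ord0)) (unsplitK (inr ord0)).
have -> : Num.sqrt (pi / 2^-1) = Num.sqrt (2 * pi) :> R by rewrite invrK mulrC.
rewrite mulrACA -rmorphM -expr2 sqr_sqrtr ?mulr_ge0 ?pi_ge0// -cexpD; congr (_ * cexp _).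
have -> : (4 * 2^-1)^-1 = 2^-1 :> R by field.
by case: (a) => a1 a2; case: (b) => b1 b2; apply: complex_eqP; rewrite !(ReD, ImD, ReM, ImM, ReN, ImN) /=; field.
Qed.

Let pshp m n : polyb (fun p : P2 => conjc (shp m n (theta p))).
Proof. by apply: polyb_conjc; have [] := @wirtinger_shp R m n. Qed.

Lemma wint_shpSr (a b : R[i]) T A B m n : wirtinger T A B ->
  wint a b (fun p => T p * conjc (shp m n.+1 (theta p))) =
  - 2 * wint a b (fun p => B p * conjc (shp m n (theta p))) +
  2 * b * wint a b (fun p => T p * conjc (shp m n (theta p))).
Proof.
move=> wT; have [pT pA pB _ _] := wT.
have := (wint_ibp a b (wirtingerM wT (wirtinger_conjc (wirtinger_shp m n)))).2.
have [_ _ pS _ _] := wirtinger_conjc (@wirtinger_shp R m n).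
rewrite wintD => [h||]; [|exact: polybM|exact: polybM].
have [pt _ _ _ _] := @wirtinger_theta R.
rewrite (_ : (fun p => _) = (fun p => -1 * (theta p * (T p * conjc (shp m n (theta p)))) +
    (2 * m)%N%:R * (T p * conjc (shp m.-1 n (theta p))))); last first.
  apply/funext => p; rewrite shpS conjcD !conjcM conjcN conjcK rmorph_nat; ring.
rewrite wintD; last 2 first.
- by apply: polybM; [exact: polyb_cst|apply: polybM => //; exact: polybM].
- by apply: polybM; [exact: polyb_cst|exact: polybM].
rewrite !wintZ; [|by apply: polybM => //; exact: polybM|exact: polybM].
rewrite h (_ : (fun p => T p * conjc (m%:R * _)) = (fun p => m%:R * (T p * conjc (shp m.-1 n (theta p))))); last first.
  by apply/funext => p; rewrite conjcM rmorph_nat; ring.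
by rewrite wintZ; [rewrite natrM; ring|exact: polybM].
Qed.

Lemma wint_shpSl (a b : R[i]) T A B m : wirtinger T A B ->
  wint a b (fun p => T p * conjc (shp m.+1 0 (theta p))) =
  2 * wint a b (fun p => A p * conjc (shp m 0 (theta p))) +
  2 * a * wint a b (fun p => T p * conjc (shp m 0 (theta p))).
Proof.
move=> wT; have [pT pA pB _ _] := wT.
have := (wint_ibp a b (wirtingerM wT (wirtinger_conjc (wirtinger_shp m 0)))).1.
rewrite (_ : (fun p => A p * _ + T p * _) = (fun p => A p * conjc (shp m 0 (theta p)))); last first.
  by apply/funext => p; rewrite mul0r oppr0 conjc0 mulr0 addr0.
move=> <-; congr (wint a b _); apply/funext => p.
by rewrite !shp0 exprS conjcM; ring.
Qed.

(** A generating-function identity: for T = 1 the recurrences have no derivative term, so raising m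
    multiplies by 2 a and raising n by 2 b, starting from the Gaussian integral [wint1]. *)
Lemma wint_shp (a b : R[i]) m n :
  wint a b (fun p => conjc (shp m n (theta p))) =
  (2 * a) ^+ m * (2 * b) ^+ n * ((2 * pi)%:C * cexp (- 2 * a * b)).
Proof.
rewrite (_ : (fun p => _) = (fun p => 1 * conjc (shp m n (theta p)))); last first.
  by apply/funext => p; rewrite mul1r.
have w0 T : wint a b (fun p => 0 * T p) = 0.
  rewrite /wint (_ : (fun p => _) = fun=> 0); first exact: intC0.
  by apply/funext => p; rewrite !mul0r.
elim: n => [|n IH].
  elim: m => [|m IHm].
    rewrite !expr0 !mul1r -wint1; congr (wint a b _).
    by apply/funext => p; rewrite shp0 expr0 conjc1 mulr1.
  by rewrite (wint_shpSl a b m (wirtinger_cst 1)) w0 IHm exprS; ring.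
by rewrite (wint_shpSr a b m n (wirtinger_cst 1)) w0 IH [_ ^+ n.+1]exprS; ring.
Qed.

(** At a = b = 0 the recurrences lower an index of both factors at once, so induction ends at a
    vanishing term or at the Gaussian integral. *)
Lemma wint_shp_ortho m' n' m n :
  wint 0 0 (fun p => shp m' n' (theta p) * conjc (shp m n (theta p))) =
  if (m' == m) && (n' == n) then (2 * pi * (2 ^+ (m + n) * m`!%:R * n`!%:R))%:C else 0 :> R[i].
Proof.
(* The recurrences lower the second factor. Conjugate symmetry covers the cases where that factor
   has already run out of an index and the first has not. *)
have sym k j k' j' : wint 0 0 (fun p => shp k j (theta p) * conjc (shp k' j' (theta p))) =
    conjc (wint 0 0 (fun p => shp k' j' (theta p) * conjc (shp k j (theta p)))) :> R[i].
  rewrite /wint -intC_conjc; last first.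
    by apply: intgC_wint; apply: polybM; [have [] := @wirtinger_shp R k' j'|exact: pshp].
  apply: eq_intC => p; rewrite [RHS]conjcM conjc_cexp [X in _ = X * _]conjcM conjcK [X in _ = X * _]mulrC.
  congr (_ * cexp _).
  rewrite /wexp !mul0r subr0 addr0 conjcM conjcN conjcM conjcK mulrC.
  by rewrite conjc_real [theta p * _]mulrC mulrC.
have h0 k j k' : wint 0 0 (fun p => shp k 0 (theta p) * conjc (shp k' j.+1 (theta p))) = 0 :> R[i].
  rewrite (wint_shpSr 0 0 _ _ (wirtinger_shp k 0)) mulr0 mul0r addr0.
  rewrite /wint (_ : (fun p => _) = fun=> 0) ?intC0 ?mulr0//.
  by apply/funext => p; rewrite !mul0r oppr0 !mul0r.
have h00 k j : wint 0 0 (fun p => shp 0 0 (theta p) * conjc (shp k j (theta p))) =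
    if (k == 0)%N && (j == 0)%N then (2 * pi)%:C else 0 :> R[i].
  under [X in wint _ _ X]eq_fun do rewrite mul1r.
  rewrite wint_shp !mulr0 cexp0 mulr1.
  by case: k => [|k]; case: j => [|j]; rewrite ?expr0 ?mul1r ?exprS ?mul0r ?mulr0 ?mul0r.
have Zc (c : R[i]) k j k' j' : wint 0 0 (fun p => c * shp k j (theta p) * conjc (shp k' j' (theta p))) =
    c * wint 0 0 (fun p => shp k j (theta p) * conjc (shp k' j' (theta p))).
  rewrite -wintZ; last by apply: polybM; [have [] := @wirtinger_shp R k j|exact: pshp].
  by congr wint; apply/funext => p; rewrite mulrA.
elim: n n' => [|n IH] n'.
  case: n' => [|n']; last by rewrite sym h0 conjc0 andbF.
  rewrite andbT addn0 fact0 mulr1; elim: m m' => [|m IH] m'.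
    rewrite sym h00 eqxx andbT; case: ifP => _; last by rewrite conjc0.
    by rewrite conjc_real expr0 fact0 !mulr1.
  rewrite (wint_shpSl 0 0 _ (wirtinger_shp m' 0)) mulr0 mul0r addr0 Zc IH.
  case: m' => [|m'] /=; first by rewrite mul0r mulr0.
  rewrite eqSS; case: eqVneq => [->|]; last by rewrite !mulr0.
  rewrite -!(rmorph_nat (real_complex R)) -!rmorphM; congr (_%:C).
  by rewrite factS natrM exprS; ring.
rewrite (wint_shpSr 0 0 _ _ (wirtinger_shp m' n')) mulr0 mul0r addr0.
rewrite (_ : (fun p => - _ * _) = (fun p => (- n'%:R) * shp m' n'.-1 (theta p) * conjc (shp m n (theta p)))); last first.
  by apply/funext => p; rewrite [- n'%:R * _]mulNr.
rewrite Zc IH; case: n' => [|n']; first by rewrite oppr0 mul0r mulr0 andbF.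
rewrite succnK eqSS; case: ifP => [/andP[_ /eqP->]|_]; last by rewrite !mulr0.
rewrite [LHS]mulrA mulrNN.
rewrite -!(rmorph_nat (real_complex R)) -!rmorphM; congr (_%:C).
by rewrite addnS factS natrM exprS; ring.
Qed.

End plane_moments.

Section continuous_complex.
Context {R : realType} {n : nat}.
Local Notation Rn := 'rV[R]_n.
Implicit Types F G : Rn -> R[i].

Definition contC F := continuous (fun x => complex.Re (F x)) /\
  continuous (fun x => complex.Im (F x)).

Lemma contC_cst c : contC (fun=> c).
Proof. by split; exact: cst_continuous. Qed.
Lemma contC_real (f : Rn -> R) : continuous f -> contC (fun x => (f x)%:C).
Proof. by split => //; exact: cst_continuous. Qed.
Lemma contC_coord i : contC (fun x => (x ord0 i)%:C).
Proof. by apply: contC_real; exact: continuous_coord_rV. Qed.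
Lemma contCD F G : contC F -> contC G -> contC (fun x => F x + G x).
Proof.
move=> [a b] [c e]; split => x.
- under [fun y => _]eq_fun do rewrite ReD; exact: (cvgD (a x) (c x)).
- under [fun y => _]eq_fun do rewrite ImD; exact: (cvgD (b x) (e x)).
Qed.
Lemma contCM F G : contC F -> contC G -> contC (fun x => F x * G x).
Proof.
move=> [a b] [c e]; split => x.
- under [fun y => _]eq_fun do rewrite ReM.
  exact: (cvgB (cvgM (a x) (c x)) (cvgM (b x) (e x))).
- under [fun y => _]eq_fun do rewrite ImM.
  exact: (cvgD (cvgM (a x) (e x)) (cvgM (b x) (c x))).
Qed.
Lemma contC_conjc F : contC F -> contC (fun x => conjc (F x)).
Proof.
move=> [a b]; split => x.
- by under [fun y => _]eq_fun do rewrite Re_conjc; exact: a.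
- by under [fun y => _]eq_fun do rewrite Im_conjc; exact: (cvgN (b x)).
Qed.
Lemma contCX F k : contC F -> contC (fun x => F x ^+ k).
Proof.
move=> hF; elim: k => [|k IH]; first exact: contC_cst.
by under [fun x => _]eq_fun do rewrite exprS; exact: contCM.
Qed.
Lemma contC_prod I (r : seq I) (F : I -> Rn -> R[i]) :
  (forall i, contC (F i)) -> contC (fun x => \prod_(i <- r) F i x).
Proof.
move=> cF; elim: r => [|i r IH].
  by under [fun x => _]eq_fun do rewrite big_nil; exact: contC_cst.
by under [fun x => _]eq_fun do rewrite big_cons; exact: contCM.
Qed.
Lemma polyb_prod I (r : seq I) (F : I -> Rn -> R[i]) :
  (forall i, polyb (F i)) -> polyb (fun x => \prod_(i <- r) F i x).
Proof.
move=> cF; elim: r => [|i r IH].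
  by under [fun x => _]eq_fun do rewrite big_nil; exact: polyb_cst.
by under [fun x => _]eq_fun do rewrite big_cons; exact: polybM.
Qed.

End continuous_complex.

Section special_hermite_family.
Context {R : realType}.
Local Notation leb n := (lebesgue_rV R n).
Local Notation P2 := 'rV[R]_(1 + 1).

Lemma shnorm_gt0 m n : 0 < @shnorm R m n.
Proof. by rewrite sqrtr_gt0 !mulr_gt0 ?exprn_gt0 ?ltr0n ?fact_gt0. Qed.

Let pi20 : 0 < 2 * pi :> R. Proof. by rewrite mulr_gt0// pi_gt0. Qed.

Lemma shfE m n (w : R[i]) : shf m n w =
  ((2 * pi)^-1 / @shnorm R m n)%:C * shp m n w * cexp (- 4^-1%:C * (w * conjc w)).
Proof.
have -> : cexp (- 4^-1%:C * (w * conjc w)) = (expR (- normc w ^+ 2 / 4))%:C.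
  by rewrite mul_conjc -rmorphN -rmorphM cexp_real; congr (expR _)%:C; field.
by rewrite /shf [RHS]mulrAC -rmorphM; congr (_%:C * _); ring.
Qed.

Lemma conjc_shfE m n (w : R[i]) : conjc (shf m n w) =
  ((2 * pi)^-1 / @shnorm R m n)%:C * conjc (shp m n w) * cexp (- 4^-1%:C * (w * conjc w)).
Proof.
rewrite shfE [LHS]conjcM conjc_cexp [X in X * _]conjcM conjc_real; congr (_ * cexp _).
by rewrite mul_conjc -rmorphN -rmorphM conjc_real.
Qed.

Lemma nice_special_hermite d (a b : 'I_d -> nat) : nice (special_hermite (R := R) a b).
Proof.
pose t j (z : 'rV[R]_(d + d)) : R[i] := (z ord0 (rshift d j))%:C + (0 +i* 1) * (z ord0 (lshift d j))%:C.
have tE j z : theta (pairrV j z) = t j z.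
  rewrite /theta /pairrV row_mxEr row_mxEl !mxE.
  by apply: complex_eqP; rewrite !(ReD, ImD, ReM, ImM) /=; ring.
have ct j : contC (t j).
  by apply: contCD; [|apply: contCM; first exact: contC_cst]; exact: contC_coord.
have pt j : polyb (t j).
  by apply: polybD; [|apply: polybM; first exact: polyb_cst]; exact: polyb_coord.
have cs j m n : contC (fun z => shp m n (t j z)).
  elim: n m => [|n IH] m; first exact: contCX.
  apply: contCD; last by apply: contCM => //; exact: contC_cst.
  apply: contCM => //.
  have := contCM (contC_cst (-1)) (contC_conjc (ct j)).
  by under [fun x => _]eq_fun do rewrite mulN1r.
have ps j m n : polyb (fun z => shp m n (t j z)).
  elim: n m => [|n IH] m; first exact: polybX.
  apply: polybD; last by apply: polybM => //; exact: polyb_cst.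
  apply: polybM => //.
  have := polybM (polyb_cst _ (-1)) (polyb_conjc (pt j)).
  by under [fun x => _]eq_fun do rewrite mulN1r.
pose P z := \prod_j (((2 * pi)^-1 / @shnorm R (a j) (b j))%:C * shp (a j) (b j) (t j z)).
pose q (z : 'rV[R]_(d + d)) := - (\sum_i z ord0 i ^+ 2) / 4.
have E : special_hermite (R := R) a b = fun z => P z * gphi z.
  apply/funext => z; rewrite special_hermiteE /P /gphi.
  have h j : - 4^-1%:C * (theta (pairrV j z) * conjc (theta (pairrV j z))) =
      (- (z ord0 (lshift d j) ^+ 2 + z ord0 (rshift d j) ^+ 2) / 4)%:C.
    rewrite mul_conjc normc_sqr /theta /pairrV row_mxEr row_mxEl !mxE /= -rmorphN -rmorphM.
    by congr (_%:C); field.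
  under eq_bigr do rewrite shfE h.
  rewrite big_split /= -cexp_sum -cexp_real; congr (_ * cexp _).
    by apply: eq_bigr => j _; rewrite tE.
  by rewrite -rmorph_sum big_split_ord /= -big_split /= -mulr_suml sumrN.
have [gc1 gc2 _] := @nice_gphi R (d + d).
have cP : contC P.
  by apply: contC_prod => j; apply: contCM => //; exact: contC_cst.
have [cR cI] := contCM cP (conj gc1 gc2).
rewrite E; split => //.
have pP : polyb P by apply: polyb_prod => j; apply: polybM => //; exact: polyb_cst.
have [_ [B [k hP]]] := pP.
have h z : complex.Re (q z)%:C <= 0 * `|z| - 4^-1 * `|z| ^+ 2.
  rewrite mul0r sub0r /= /q mulNr lerN2 mulrC ler_pM2r ?invr_gt0//.
  exact: sumsq_ge_norm.
have c4 : 0 < 4^-1 :> R by rewrite invr_gt0.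
have [C hC] := gauss_dec c4 hP h.
by exists C => z; have := hC z; rewrite cexp_real.
Qed.

Lemma shf_ortho m' n' m n :
  intgC (leb (1 + 1)) (fun p => shf m' n' (theta p) * conjc (shf m n (theta p))) /\
  intC (leb (1 + 1)) (fun p => shf m' n' (theta p) * conjc (shf m n (theta p))) =
  if (m' == m) && (n' == n) then ((2 * pi)^-1)%:C else 0.
Proof.
pose k m n : R := (2 * pi)^-1 / @shnorm R m n.
rewrite (_ : (fun p => _) = fun p => (k m' n' * k m n)%:C *
    (shp m' n' (theta p) * conjc (shp m n (theta p)) * cexp (wexp 0 0 p))); last first.
  apply/funext => p; rewrite shfE conjc_shfE.
  have -> : wexp 0 0 p = - 4^-1%:C * (theta p * conjc (theta p)) + - 4^-1%:C * (theta p * conjc (theta p)).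
    rewrite /wexp !mul0r subr0 addr0 mul_conjc.
    by apply: complex_eqP; rewrite !(ReD, ImD, ReM, ImM, ReN, ImN) /=; field.
  have G (x y u v e f : R[i]) : x * u * e * (y * v * f) = x * y * (u * v * (e * f)) by ring.
  by rewrite G -rmorphM -cexpD.
have pI : polyb (fun p : P2 => shp m' n' (theta p) * conjc (shp m n (theta p))).
  apply: polybM; first by have [] := @wirtinger_shp R m' n'.
  by apply: polyb_conjc; have [] := @wirtinger_shp R m n.
have iI := intgC_wint 0 0 pI.
split; first exact: intgCZ.
rewrite intCZ// -/(wint 0 0 (fun p => shp m' n' (theta p) * conjc (shp m n (theta p)))).
rewrite wint_shp_ortho; case: ifP => [/andP[/eqP-> /eqP->]|_]; last by rewrite mulr0.
rewrite -rmorphM; congr (_%:C); rewrite /k.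
have n0 : 0 < 2 ^+ (m + n) * m`!%:R * n`!%:R :> R.
  by rewrite !mulr_gt0 ?exprn_gt0 ?ltr0n ?fact_gt0.
rewrite -(sqr_sqrtr (ltW n0)) -/(@shnorm R m n).
set c := 2 * pi; have := lt0r_neq0 pi20; rewrite -/c; clearbody c => c0.
by field; rewrite c0 lt0r_neq0// shnorm_gt0.
Qed.

Lemma special_hermite_ip d (a b a' b' : 'I_d -> nat) :
  ip (leb (d + d)) (special_hermite a b) (special_hermite a' b') =
  \prod_j (if (a j == a' j) && (b j == b' j) then ((2 * pi)^-1)%:C else 0 : R[i]).
Proof.
have [iF eF] := prodC_pair (fun j => (shf_ortho (a j) (b j) (a' j) (b' j)).1).
rewrite /ip; under [fun x => _]eq_fun do rewrite !special_hermiteE conjc_prod -big_split /=.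
rewrite eF; apply: eq_bigr => j _; exact: (shf_ortho (a j) (b j) (a' j) (b' j)).2.
Qed.

(** With the factor (2 pi)^(-d) in their definition these functions have squared norm (2 pi)^(-d);
    this is where the powers of [kap] come from. *)
Lemma special_hermite_sq d (a b : 'I_d -> nat) :
  ip (leb (d + d)) (special_hermite a b) (special_hermite a b) = ((2 * pi) ^- d)%:C :> R[i].
Proof.
rewrite special_hermite_ip; under eq_bigr do rewrite !eqxx.
by rewrite prodr_const card_ord -exprVn rmorphXn.
Qed.

Lemma special_hermite_ortho d (a b a' b' : 'I_d -> nat) : (a, b) <> (a', b') ->
  ip (leb (d + d)) (special_hermite a b) (special_hermite a' b') = 0 :> R[i].
Proof.
move=> ne; rewrite special_hermite_ip.
have [j hj] : exists j, ~~ ((a j == a' j) && (b j == b' j)).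
  apply/not_existsP => h; apply: ne; congr pair; apply/funext => j;
    by have /negP/negPn/andP[/eqP ? /eqP ?] := h j.
by rewrite (bigD1 j)//= (negbTE hj) mul0r.
Qed.

End special_hermite_family.

(** * Coefficients of shifted Gaussians along the special Hermite functions *)

Section coherent_coefficients.
Context {R : realType}.
Local Notation leb n := (lebesgue_rV R n).
Local Notation P2 := 'rV[R]_(1 + 1).

(** A normalized monomial in A and B, times a Gaussian and a phase. As functions on phase space
    these coefficients have the form of a Bargmann-Fock basis in two complex variables. *)
Definition coh (m n : nat) (A B : R[i]) : R[i] :=
  expi (- complex.Im (A * B) / 2) *
  (expR (- (normc A ^+ 2 + normc B ^+ 2) / 4) / @shnorm R m n)%:C * (A ^+ m * B ^+ n).

(** The shifted Gaussian times the Gaussian of [shf] has exponent [wexp] with a = A / 2 and b = B /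
    2, up to a constant, so [wint_shp] returns the monomial A^m B^n. *)
Lemma shf_coh (p q xi eta : R) m n :
  let A := (q / 2 + xi) +i* (eta - p / 2) in let B := (xi - q / 2) -i* (p / 2 + eta) in
  let F (u : P2) := cexp (((- (u ord0 (lshift 1 ord0) - p) ^+ 2 / 4) +i* (xi * u ord0 (lshift 1 ord0))) +
        ((- (u ord0 (rshift 1 ord0) - q) ^+ 2 / 4) +i* (eta * u ord0 (rshift 1 ord0)))) *
      conjc (shf m n (theta u)) in
  intgC (leb (1 + 1)) F /\ intC (leb (1 + 1)) F = coh m n A B.
Proof.
move=> A B F; pose a := 2^-1%:C * A; pose b := 2^-1%:C * B.
pose k : R := (2 * pi)^-1 / @shnorm R m n * expR (- (p ^+ 2 + q ^+ 2) / 4).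
have EF : F = fun u => k%:C * (conjc (shp m n (theta u)) * cexp (wexp a b u)).
  apply/funext => u; rewrite /F conjc_shfE.
  have G1 (e c s f : R[i]) : e * (c * s * f) = c * (s * (e * f)) by ring.
  have G2 (c e s f : R[i]) : c * e * (s * f) = c * (s * (e * f)) by ring.
  have -> : k%:C = ((2 * pi)^-1 / @shnorm R m n)%:C * cexp (- (p ^+ 2 + q ^+ 2) / 4)%:C.
    by rewrite cexp_real -rmorphM.
  rewrite G1 -cexpD G2 -cexpD.
  congr (_ * (_ * cexp _)).
  rewrite /wexp /theta /a /b /A /B.
  by apply: complex_eqP; rewrite !(ReD, ImD, ReM, ImM, ReN, ImN) /=; field.
have pS : polyb (fun u : P2 => conjc (shp m n (theta u))).
  by apply: polyb_conjc; have [] := @wirtinger_shp R m n.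
have iS := intgC_wint a b pS.
rewrite EF; split; first exact: intgCZ.
rewrite intCZ// -/(wint a b (fun u => conjc (shp m n (theta u)))) wint_shp.
have h2 (z : R[i]) : 2 * (2^-1%:C * z) = z.
  by apply: complex_eqP; rewrite !(ReM, ImM) /=; field.
rewrite /a /b !h2 /coh /k.
(* Because |A|^2 + |B|^2 = p^2 + q^2 + 2 Re(A B), the constant from completing the square and the
   modulus of e^(-A B / 2) merge into one Gaussian in A and B. *)
have -> : expR (- (normc A ^+ 2 + normc B ^+ 2) / 4) =
    expR (- (p ^+ 2 + q ^+ 2) / 4) * expR (- complex.Re (A * B) / 2).
  by rewrite -expRD !normc_sqr; congr expR; rewrite /A /B /=; field.
have -> : cexp (- 2 * (2^-1%:C * A) * (2^-1%:C * B)) =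
    (expR (- complex.Re (A * B) / 2))%:C * expi (- complex.Im (A * B) / 2).
  by rewrite /cexp; congr ((expR _)%:C * expi _); rewrite /A /B;
    rewrite !(ReM, ImM, ReN, ImN) /=; field.
set E := expR _; set E' := expR _; set c := 2 * pi; set T := expi _.
have c0 : c != 0 by rewrite lt0r_neq0// mulr_gt0// pi_gt0.
clearbody c E E' T.
have -> : c^-1 / shnorm m n * E = c^-1 * (E / @shnorm R m n) by ring.
have -> : E * E' / shnorm m n = E / @shnorm R m n * E' by ring.
have {}c0 : (c^-1)%:C * c%:C = 1 :> R[i] by rewrite -rmorphM mulVf.
rewrite !(rmorphM (real_complex R) _ (_ / _)) (rmorphM (real_complex R) (_ / _)).
transitivity ((c^-1)%:C * c%:C * (T * ((E / @shnorm R m n)%:C * E'%:C) * (A ^+ m * B ^+ n))); first by ring.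
by rewrite c0 mul1r.
Qed.

Variable d : nat.
Implicit Types w : 'rV[R]_((d + d) + (d + d)).

(** With position (p, q) in [lsubmx w] and frequency (xi, eta) in [rsubmx w], [cal] and [cbe] are
    the A and B of [shf_coh] in the j-th plane. *)
Definition cal w (j : 'I_d) : R[i] :=
  (lsubmx w ord0 (rshift d j) / 2 + rsubmx w ord0 (lshift d j)) +i*
  (rsubmx w ord0 (rshift d j) - lsubmx w ord0 (lshift d j) / 2).
Definition cbe w (j : 'I_d) : R[i] :=
  (rsubmx w ord0 (lshift d j) - lsubmx w ord0 (rshift d j) / 2) -i*
  (lsubmx w ord0 (lshift d j) / 2 + rsubmx w ord0 (rshift d j)).

Definition ccoef (a b : 'I_d -> nat) w : R[i] :=
  \prod_j coh (a j) (b j) (cal w j) (cbe w j).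

Lemma tfshift_ip a b w : ip (leb (d + d)) (tfshift gphi w) (special_hermite a b) = ccoef a b w.
Proof.
have [iF eF] := prodC_pair (fun j => (shf_coh (lsubmx w ord0 (lshift d j))
  (lsubmx w ord0 (rshift d j)) (rsubmx w ord0 (lshift d j)) (rsubmx w ord0 (rshift d j)) (a j) (b j)).1).
rewrite /ip (_ : (fun z => _ * _) = (fun z : 'rV[R]_(d + d) => \prod_j (cexp
  (((- (pairrV j z ord0 (lshift 1 ord0) - lsubmx w ord0 (lshift d j)) ^+ 2 / 4) +i*
      (rsubmx w ord0 (lshift d j) * pairrV j z ord0 (lshift 1 ord0))) +
   ((- (pairrV j z ord0 (rshift 1 ord0) - lsubmx w ord0 (rshift d j)) ^+ 2 / 4) +i*
      (rsubmx w ord0 (rshift d j) * pairrV j z ord0 (rshift 1 ord0)))) *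
   conjc (shf (a j) (b j) (theta (pairrV j z)))))); last first.
  apply/funext => z; rewrite special_hermiteE conjc_prod [RHS]big_split; congr (_ * _).
  rewrite tfshift_gphi /tfexp -cexp_sum big_split_ord /= -big_split /=; congr cexp.
  by apply: eq_bigr => j _; rewrite /pairrV row_mxEl row_mxEr !mxE.
rewrite eF; apply: eq_bigr => j _; exact: (shf_coh _ _ _ _ (a j) (b j)).2.
Qed.

End coherent_coefficients.

(** * Spectral projections and multipliers *)

Section fatou_almost_everywhere.
Context {d : measure_display} {T : measurableType d} {R : realType}.
Variable mu : {measure set T -> \bar R}.

Lemma fatou_ae (f : nat -> T -> R) (g : T -> R) (M : \bar R) :
  (forall n, measurable_fun setT (f n)) -> (forall n x, 0 <= f n x) ->
  measurable_fun setT g -> (forall x, 0 <= g x) ->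
  {ae mu, forall x, f n x @[n --> \oo] --> g x} ->
  (\forall n \near \oo, \int[mu]_x (f n x)%:E <= M)%E ->
  (\int[mu]_x (g x)%:E <= M)%E.
Proof.
move=> mf f0 mg g0 fg fM.
have mfe n : measurable_fun setT (EFin \o f n) by exact/measurable_EFinP.
have mL : measurable_fun setT (fun x => limn_einf (fun n => (f n x)%:E)).
  apply: (emeasurable_fun_cvg (fun n x => einfs (fun k => (f k x)%:E) n)).
    by move=> n; exact: measurable_fun_einfs.
  by move=> x _; rewrite limn_einf_lim; exact: is_cvg_einfs.
have L0 x : (0 <= limn_einf (fun n => (f n x)%:E))%E.
  rewrite limn_einf_lim; apply: lime_ge; first exact: is_cvg_einfs.
  apply: nearW => n; apply: le_ereal_inf_tmp => _ [k _ <-].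
  by rewrite lee_fin.
apply: (@le_trans _ _ (\int[mu]_x limn_einf (fun n => (f n x)%:E))%E).
  apply: ae_ge0_le_integral => //.
  - by move=> x _; rewrite lee_fin.
  - exact/measurable_EFinP.
  - move: fg; apply: filterS => x fgx _.
    have h : (f n x)%:E @[n --> \oo] --> (g x)%:E by apply/fine_cvgP; split => //; exact: nearW.
    by rewrite is_cvg_limn_einfE ?(cvg_lim _ h)//; apply/cvg_ex; exists (g x)%:E.
apply: le_trans (fatou mu measurableT mfe _) _.
  by move=> n x _; rewrite lee_fin.
rewrite limn_einf_lim; apply: lime_le; first exact: is_cvg_einfs.
near=> n; apply: (@le_trans _ _ (\int[mu]_x (f n x)%:E)%E).
  by apply: ereal_inf_lbound; exists n => //=.
by near: n.
Unshelve. all: by end_near. Qed.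

End fatou_almost_everywhere.

(** * Completeness of L^2 and orthogonal series *)

Section riesz_fischer.
Context {d : measure_display} {T : measurableType d} {R : realType}.
Variable mu : {sigma_finite_measure set T -> \bar R}.
Implicit Types F G : T -> R[i].

Lemma sqi_add_sub F G : sqi mu G -> sqi mu (fun x => F x - G x) -> sqi mu F.
Proof.
by move=> hG h; have := sqiD h hG; under [fun x => _]eq_fun do rewrite subrK.
Qed.

Lemma cvgC_series_abs (u : nat -> R[i]) : cvgn (series (fun n => normc (u n))) ->
  exists l, cvgC (fun n => \sum_(k < n) u k) l.
Proof.
move=> h.
have hc (f : R[i] -> R) : (forall z, `|f z| <= normc z) -> cvgn (series (fun n => f (u n))).
  move=> fz; apply: normed_cvg; apply: series_le_cvg h => n; [exact: normr_ge0|exact: normc_ge0|exact: fz].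
have /cvg_ex[/= a ha] := hc _ (@normc_Re_le R); have /cvg_ex[/= b hb] := hc _ (@normc_Im_le R).
exists (a +i* b); apply: cvgC_ReIm.
- under eq_fun do rewrite Re_sum -(big_mkord xpredT (fun k => complex.Re (u k))); exact: ha.
- under eq_fun do rewrite Im_sum -(big_mkord xpredT (fun k => complex.Im (u k))); exact: hb.
Qed.

(** The squared increments stay summable in the mean after weighting by 2^k, so for almost every x
    the weighted series is finite; this forces the increments themselves to be summable. The shape
    of the bound is that of [epsilon_trick0]. *)
Lemma sq_cvg_subseq (u : nat -> T -> R[i]) : (forall k, sqi mu (u k)) ->
  (forall k, sq mu (fun x => u k.+1 x - u k x) <= (2 ^+ k)^-1 * (1 / (2 ^ k.+1)%:R)) ->
  exists2 F, mfC F & {ae mu, forall x, cvgC (u ^~ x) (F x)}.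
Proof.
move=> hu hq.
pose w k x : R := 2 ^+ k * normc (u k.+1 x - u k x) ^+ 2.
have w0 k x : 0 <= w k x by apply: mulr_ge0; [exact: exprn_ge0|exact: sqr_ge0].
have hd k := sqiB (hu k.+1) (hu k).
have mw k : measurable_fun setT (fun x => (w k x)%:E).
  apply/measurable_EFinP; apply: measurable_funM => //.
  by apply: measurable_normc2; case: (hd k).
have mn k : measurable_fun setT (fun x => (normc (u k.+1 x - u k x) ^+ 2)%:E).
  by apply/measurable_EFinP; apply: measurable_normc2; case: (hd k).
pose h x := (\sum_(0 <= k <oo) (w k x)%:E)%E.
have h0 x : (0 <= h x)%E by apply: nneseries_ge0 => k _ _; rewrite lee_fin.
have mh : measurable_fun setT h.
  by apply: ge0_emeasurable_sum => // k x _ _; rewrite lee_fin.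
have ih : mu.-integrable setT h.
  apply/integrableP; split => //.
  under eq_integral do rewrite gee0_abs//.
  rewrite integral_nneseries//; last by move=> k x _; rewrite lee_fin.
  apply: (@le_lt_trans _ _ 1%:E); last exact: ltry.
  apply: le_trans (epsilon_trick0 xpredT (ler01 : 0 <= 1 :> R)).
  apply: lee_nneseries => [k _ _|k _]; first by apply: integral_ge0 => x _; rewrite lee_fin.
  under eq_integral do rewrite EFinM.
  rewrite (ge0_integralZl mu measurableT (mn k)); last 2 first.
  - by move=> x _; rewrite lee_fin sqr_ge0.
  - by rewrite lee_fin exprn_ge0.
  rewrite -(sqiE (hd k)) -EFinM lee_fin; have := hq k.
  by rewrite -ler_pdivlMl ?exprn_gt0// => /le_trans; apply.
have ae := integrable_ae measurableT ih.
have C x : h x \is a fin_num -> exists l, cvgC (u ^~ x) l.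
  move=> hx.
  have cw : cvgn (series (fun k => w k x)).
    apply: nondecreasing_is_cvgn.
      by apply: nondecreasing_series => k _ _; exact: w0.
    exists (fine (h x)) => _ [n _ <-].
    rewrite -lee_fin fineK// /series /= -sumEFin.
    by apply: nneseries_lim_ge => k _ _; rewrite lee_fin.
  have cg : cvgn (series (fun k => (2^-1 : R) ^+ k)).
    have h12 : `|2^-1 : R| < 1 by rewrite ger0_norm ?invr_ge0// invf_lt1// ltr1n.
  have := is_cvg_geometric_series (a := 1) h12.
  by rewrite (_ : geometric _ _ = fun k => 2^-1 ^+ k)//; apply/funext => k; rewrite /= mul1r.
  have cs : cvgn (series (fun k => normc (u k.+1 x - u k x))).
    apply: (@series_le_cvg _ _ (fun k => w k x + 2^-1 ^+ k)).
    - by move=> k; exact: normc_ge0.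
    - by move=> k; rewrite addr_ge0// exprn_ge0// invr_ge0.
    (* The elementary y <= 2^k y^2 + 2^(-k), from (2^k y - 1)^2 >= 0. *)
    - move=> k; rewrite /w exprVn; set y := normc _; set c := 2 ^+ k.
      have c0 : 0 < c by rewrite exprn_gt0.
      have y0 : 0 <= y by exact: normc_ge0.
      rewrite -(ler_pM2l c0) mulrDr mulfV ?gt_eqF//.
      have := sqr_ge0 (c * y - 1); rewrite sqrrB1 => q.
      have : 0 <= c * y by rewrite mulr_ge0// ltW.
      nra.
    rewrite (_ : series _ = series (fun k => w k x) \+ series (fun k => 2^-1 ^+ k)); last first.
      by apply/funext => n; rewrite /series /= big_split.
    exact: is_cvgD.
  have [l hl] := cvgC_series_abs cs.
  exists (l + u 0%N x); apply: (cvgC_squeeze (r := fun n => normc (\sum_(k < n) (u k.+1 x - u k x) - l))) => // n.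
  rewrite -(big_mkord xpredT (fun k => u k.+1 x - u k x)) telescope_sumr//.
  by rewrite (_ : u n x - (l + u 0%N x) = u n x - u 0%N x - l)//; ring.
(* Setting the limit to 0 off this measurable set makes it an everywhere limit of measurable
   functions. *)
pose E := [set x | h x \is a fin_num].
have mE : measurable E.
  by rewrite -[E]setTI; exact: emeasurable_fin_num.
have /boolp.choice[F hF] : forall x, exists l, h x \is a fin_num -> cvgC (u ^~ x) l.
  by move=> x; have [/C[l hl]|_] := boolP (h x \is a fin_num); [exists l|exists 0].
exists (fun x => (\1_E x)%:C * F x).
  apply: (@mfC_cvg _ _ _ (fun k x => (\1_E x)%:C * u k x)).
    by move=> k; apply: mfCM; [apply: mfC_real; exact: measurable_indic|case: (hu k)].
  move=> x; rewrite indicE; case: (boolP (x \in E)) => [/set_mem/hF xE|_].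
    by rewrite mul1r; under eq_fun do rewrite mul1r.
  by rewrite mul0r; under eq_fun do rewrite mul0r; exact: cvgC_cst.
move: ae; apply: filterS => x /(_ I) hx.
by rewrite indicE mem_set// mul1r; exact: hF.
Qed.

Lemma L2_complete (S : nat -> T -> R[i]) : (forall n, sqi mu (S n)) ->
  (forall eps : R, 0 < eps -> exists N, forall m n, (N <= m)%N -> (N <= n)%N ->
     sq mu (fun x => S m x - S n x) <= eps) ->
  exists2 F, sqi mu F & sq mu (fun x => F x - S n x) @[n --> \oo] --> (0 : R).
Proof.
move=> hS hC.
pose eps k : R := (2 ^+ k)^-1 * (1 / (2 ^ k.+1)%:R).
have eps0 k : 0 < eps k by rewrite mulr_gt0 ?invr_gt0 ?exprn_gt0// divr_gt0// ltr0n expn_gt0.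
have /boolp.choice[N hN] : forall k, exists N, forall m n, (N <= m)%N -> (N <= n)%N ->
    sq mu (fun x => S m x - S n x) <= eps k by move=> k; exact: hC.
(* Adding k and all earlier thresholds makes M nondecreasing and at least both k and N k. *)
pose M k := (k + \sum_(j < k.+1) N j)%N.
have NM k : (N k <= M k)%N by rewrite /M big_ord_recr /= addnA leq_addl.
have MM k : (M k <= M k.+1)%N by rewrite /M [X in (_ <= _ + X)%N]big_ord_recr leq_add// leq_addr.
have Mmono : {homo M : m n / (m <= n)%N} by exact: homo_leq leqnn leq_trans MM.
have [F mF hF] := sq_cvg_subseq (fun k => hS (M k))
  (fun k => hN k _ _ (leq_trans (NM k) (MM k)) (NM k)).
(* Fatou along the subsequence: for n fixed, F - S n is the almost everywhere limit of S (M k) - S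
   n. *)
have key (e : R) n : 0 < e -> (exists N, forall m, (N <= m)%N -> sq mu (fun x => S (M m) x - S n x) <= e) ->
    sqi mu (fun x => F x - S n x) /\ sq mu (fun x => F x - S n x) <= e.
  move=> e0 [N0 hN0].
  have mFn : mfC (fun x => F x - S n x) by apply: mfCB => //; case: (hS n).
  have b : (\int[mu]_x (normc (F x - S n x) ^+ 2)%:E <= e%:E)%E.
    apply: (@fatou_ae _ _ _ mu (fun k x => normc (S (M k) x - S n x) ^+ 2)).
    - by move=> k; apply: measurable_normc2; apply: mfCB; [case: (hS (M k))|case: (hS n)].
    - by move=> k x; exact: sqr_ge0.
    - exact: measurable_normc2.
    - by move=> x; exact: sqr_ge0.
    - move: hF; apply: filterS => x hx.
      have h1 := cvgC_normc (cvgCD hx (cvgC_cst (- S n x))).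
      by under eq_fun do rewrite expr2; rewrite expr2; exact: (cvgM h1 h1).
    - exists N0 => // k /= kN; rewrite -sqiE; last exact: sqiB.
      by rewrite lee_fin; exact: hN0.
  have i : sqi mu (fun x => F x - S n x) by apply/sqiP => //; rewrite (le_lt_trans b)// ltry.
  by split => //; rewrite -lee_fin sqiE.
have kn (e : R) : 0 < e -> exists N, forall n, (N <= n)%N ->
    sqi mu (fun x => F x - S n x) /\ sq mu (fun x => F x - S n x) <= e.
  move=> e0; have [N0 hN0] := hC e e0; exists N0 => n nN; apply: key => //.
  exists N0 => m mN; apply: hN0 => //; apply: (leq_trans mN).
  exact: leq_addr.
have hFi : sqi mu F.
  have [N0 /(_ N0 (leqnn _))[h _]] := kn 1 ltr01.
  exact: (sqi_add_sub (hS N0) h).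
exists F => //; apply/cvgrPdist_le => e e0.
have [N0 hN0] := kn e e0; exists N0 => // n /= nN.
by rewrite sub0r normrN ger0_norm ?sq_ge0//; exact: (hN0 n nN).2.
Qed.

Lemma ortho_series (g : nat -> T -> R[i]) (B : R) : (forall i, sqi mu (g i)) ->
  (forall i j, i != j -> ip mu (g i) (g j) = 0) ->
  (forall n, \sum_(i < n) sq mu (g i) <= B) ->
  exists2 F, sqi mu F & sq mu (fun x => F x - \sum_(i < n) g i x) @[n --> \oo] --> (0 : R).
Proof.
move=> hg og hB.
have hS n : sqi mu (fun x => \sum_(i < n) g i x) by exact: sqi_sum.
have hseg m n : sqi mu (fun x => \sum_(m <= i < n) g i x) by exact: sqi_sum.
have sqseg m n : sq mu (fun x => \sum_(m <= i < n) g i x) = \sum_(m <= i < n) sq mu (g i).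
  have := sq_ip (hseg m n); rewrite ip_suml// => E.
  have {E} : \sum_(m <= i < n) (sq mu (g i))%:C = (sq mu (fun x => \sum_(m <= i < n) g i x))%:C.
    rewrite -E; rewrite !big_nat; apply: eq_bigr => i imn.
    rewrite ip_sumr// (bigD1_seq i) ?mem_index_iota ?iota_uniq//= big1 ?addr0 ?sq_ip//.
    by move=> j ji; apply: og; rewrite eq_sym.
  by rewrite -rmorph_sum => -[<-].
have cv : cvgn (series (fun i => sq mu (g i))).
  apply: nondecreasing_is_cvgn.
    by apply: nondecreasing_series => i _ _; exact: sq_ge0.
  by exists B => _ [n _ <-]; rewrite /series /= big_mkord.
have /cauchy_cvgP/cauchy_seriesP ca := cv.
apply: L2_complete => // eps e0.
have [[P Q] [[p1 _ hP] [q1 _ hQ]] hPQ] := ca eps e0.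
pose N := maxn p1 q1.
have key m n : (N <= m)%N -> (m <= n)%N -> \sum_(m <= i < n) sq mu (g i) <= eps.
  move=> Nm mn; have := hPQ (m, n); rewrite /=.
  move=> h; have /h/ltW : P m /\ Q n.
    split; [apply: hP|apply: hQ] => /=.
      by apply: leq_trans Nm; exact: leq_maxl.
    by apply: leq_trans mn; apply: leq_trans Nm; exact: leq_maxr.
  by apply: le_trans; exact: ler_norm.
have D m n : (n <= m)%N -> sq mu (fun x => \sum_(i < m) g i x - \sum_(i < n) g i x) =
    \sum_(n <= i < m) sq mu (g i).
  move=> nm; rewrite -sqseg; apply: eq_sq => x.
  by rewrite -!(big_mkord xpredT (fun i => g i x)) (big_cat_nat (n := n))//= addrAC subrr add0r.
exists N => m n Nm Nn; case: (leqP n m) => [nm|/ltnW mn]; first by rewrite D//; exact: key.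
rewrite (_ : sq mu _ = sq mu (fun x => \sum_(i < n) g i x - \sum_(i < m) g i x)).
  by rewrite D//; exact: key.
by apply: eq_Rintegral => x _; rewrite normcBC.
Qed.

(** The last hypothesis makes each g_i the component of f along itself, so |f - sum g_i|^2
    integrates to |f|^2 minus the sum of the |g_i|^2. *)
Lemma bessel (g : nat -> T -> R[i]) f : sqi mu f -> (forall i, sqi mu (g i)) ->
  (forall i j, i != j -> ip mu (g i) (g j) = 0) ->
  (forall i, ip mu f (g i) = (sq mu (g i))%:C) ->
  forall n, \sum_(i < n) sq mu (g i) <= sq mu f.
Proof.
move=> hf hg og fg n.
have hS : sqi mu (fun x => \sum_(i < n) g i x) by exact: sqi_sum.
have e1 : ip mu f (fun x => \sum_(i < n) g i x) = (\sum_(i < n) sq mu (g i))%:C.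
  by rewrite ip_sumr// rmorph_sum; apply: eq_bigr => i _; exact: fg.
have e2 : (sq mu (fun x => \sum_(i < n) g i x))%:C = (\sum_(i < n) sq mu (g i))%:C.
  rewrite -sq_ip// ip_suml// rmorph_sum; apply: eq_bigr => i _.
  rewrite ip_sumr// (bigD1 i)//= big1 ?addr0 ?sq_ip//.
  by move=> j ji; apply: og; rewrite eq_sym; apply: contra ji => /eqP/val_inj->.
have := sq_ge0 mu (fun x => f x - \sum_(i < n) g i x); rewrite sqB// e1 /=.
by move: e2 => -[->]; lra.
Qed.

End riesz_fischer.

(** * Inner products of projections and multipliers with special Hermite functions *)

Section spectral_projections.
Context {R : realType} {d : nat}.
Local Notation leb n := (lebesgue_rV R n).
Local Notation V := 'rV[R]_(d + d).
Local Notation mu := (leb (d + d)).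
Local Notation sh := (@special_hermite R d).
Implicit Types F G H f q : V -> R[i].

Lemma L2P n (F : 'rV[R]_n -> R[i]) : L2 F <-> sqi (leb n) F.
Proof.
have e : LnormC 2%:E F = ((\int[leb n]_x (normc (F x) ^+ 2)%:E) `^ 2^-1)%E.
  rewrite /LnormC Lnorm.unlock; congr (_ `^ _)%E; apply: eq_integral => x _.
  by rewrite /= ger0_norm ?normc_ge0// powR_mulrn ?normc_ge0.
split=> [[mF h]|[mF iF]].
  apply/sqiP => //; rewrite ltey; apply/eqP => E.
  by move: h; rewrite e E poweRyr ?invr_eq0 ?pnatr_eq0// ltxx.
split => //; rewrite e -(sqiE (conj mF iF)) poweR_EFin; exact: ltry.
Qed.

Lemma L2distE n (F G : 'rV[R]_n -> R[i]) : sqi (leb n) (fun x => F x - G x) ->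
  L2dist F G = (Num.sqrt (sq (leb n) (fun x => F x - G x)))%:E.
Proof.
move=> h; rewrite /L2dist /LnormC Lnorm.unlock.
rewrite -powR12_sqrt ?sq_ge0// -poweR_EFin sqiE//; congr (_ `^ _)%E.
by apply: eq_integral => x _; rewrite /= ger0_norm ?normc_ge0// powR_mulrn ?normc_ge0.
Qed.

Lemma sh_sqi a b : sqi mu (sh a b).
Proof. by apply: nice_sqi; exact: nice_special_hermite. Qed.

Lemma eigen_span_sqi k F : eigen_span k F -> sqi mu F.
Proof.
move=> [N [c [a [b [_ ->]]]]]; apply: sqi_sum => i; apply: sqiZ; exact: sh_sqi.
Qed.

Lemma eigen_span_ip k F H : eigen_span k F -> sqi mu H ->
  (forall a b, mlength b = k -> ip mu (sh a b) H = 0) -> ip mu F H = 0.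
Proof.
move=> [N [c [a [b [bk ->]]]]] hH h.
rewrite ip_suml//; last by move=> i; apply: sqiZ; exact: sh_sqi.
by rewrite big1// => i _; rewrite ipZl ?h ?mulr0//; exact: sh_sqi.
Qed.

Lemma is_Q_sqi k f q : is_Q k f q -> sqi mu q.
Proof. by move=> [/L2P]. Qed.

(** Orthogonality to the generators extends to finite combinations, and then to q, which they
    approximate, by continuity of the inner product. *)
Lemma is_Q_ip0 k f q H : is_Q k f q -> sqi mu H ->
  (forall a b, mlength b = k -> ip mu (sh a b) H = 0) -> ip mu q H = 0.
Proof.
move=> Qq hH h; have hq := is_Q_sqi Qq; have [_ app _] := Qq.
have /boolp.choice[F hF] : forall n : nat, exists F, eigen_span k F /\
    sq mu (fun x => q x - F x) <= n.+1%:R^-1.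
  move=> n; have e0 : 0 < (n.+1%:R^-1 : R) by [].
  have [F sF] := app (Num.sqrt n.+1%:R^-1) ltac:(by rewrite sqrtr_gt0).
  have hF := eigen_span_sqi sF.
  rewrite (L2distE (sqiB hq hF)) lte_fin => /ltW h2; exists F; split => //.
  by rewrite -(ler_sqrt (sq mu (fun x => q x - F x)))// ltW.
have cv := ip_cvg (fun n => eigen_span_sqi (hF n).1) hq hH.
apply: (cvgC_unique (u := fun n => ip mu (F n) H)).
  apply: cv; apply: (squeeze_cvgr _ (cvg_cst 0) (@cvg_harmonic R)).
  by apply: nearW => n; rewrite sq_ge0 /=; exact: (hF n).2.
rewrite (_ : (fun n => _) = fun=> 0); first exact: cvgC_cst.
by apply/funext => n; exact: (eigen_span_ip (hF n).1).
Qed.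

Lemma ip_sym0 F G : sqi mu F -> sqi mu G -> ip mu F G = 0 -> ip mu G F = 0.
Proof. by move=> hF hG e; rewrite (ip_conjc hF hG) e conjc0. Qed.

Lemma sh_ortho_length a b a' b' : mlength b != mlength b' -> ip mu (sh a b) (sh a' b') = 0.
Proof.
by move=> /eqP ne; apply: special_hermite_ortho => -[_ e]; apply: ne; rewrite e.
Qed.

Lemma is_Q_sh k f q a b : sqi mu f -> is_Q k f q ->
  ip mu q (sh a b) = if mlength b == k then ip mu f (sh a b) else 0.
Proof.
move=> hf Qq; have hq := is_Q_sqi Qq; have [_ _ o] := Qq.
case: eqP => [e|/eqP ne].
  have : ip mu (fun z => f z - q z) (sh a b) = 0 := o a b e.
  by rewrite ipBl//; [move/eqP; rewrite subr_eq0 => /eqP|exact: sh_sqi].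
apply: (is_Q_ip0 Qq); first exact: sh_sqi.
by move=> a' b' e; apply: sh_ortho_length; rewrite e eq_sym.
Qed.

Lemma is_Q_ortho k l f q q' : sqi mu f -> k != l -> is_Q k f q -> is_Q l f q' -> ip mu q q' = 0.
Proof.
move=> hf kl Qq Qq'; have hq' := is_Q_sqi Qq'.
apply: (is_Q_ip0 Qq) => // a b e; apply: ip_sym0 => //; first exact: sh_sqi.
by rewrite (is_Q_sh a b hf Qq') e (negbTE kl).
Qed.

Lemma is_Q_self k f q : sqi mu f -> is_Q k f q -> ip mu f q = (sq mu q)%:C.
Proof.
move=> hf Qq; have hq := is_Q_sqi Qq; have hB := sqiB hf hq.
have e : ip mu (fun x => f x - q x) q = 0.
  apply: ip_sym0 => //; apply: (is_Q_ip0 Qq) => // a b e.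
  by apply: ip_sym0 => //; [exact: sh_sqi|exact: (let: And3 _ _ o := Qq in o a b e)].
by move/eqP: e; rewrite ipBl// subr_eq0 sq_ip// => /eqP.
Qed.

Variable m : R -> R[i].
Local Notation mk k := (m (d + 2 * k)%:R).

Lemma multiplier_sqi f F : is_multiplier m f F -> sqi mu F.
Proof. by move=> [q [_ /L2P]]. Qed.

(** Only the term k = |b| of a partial sum pairs with [sh a b], so the pairings are constant once N
    > |b|; L^2 convergence carries this to F. *)
Lemma multiplier_sh f F a b : sqi mu f -> is_multiplier m f F ->
  ip mu F (sh a b) = mk (mlength b) * ip mu f (sh a b).
Proof.
move=> hf [q [hq /L2P hF cv]].
have sq' k : sqi mu (fun z => mk k * q k z) by apply: sqiZ; exact: is_Q_sqi (hq k).
have hS N : sqi mu (fun z => \sum_(k < N) mk k * q k z) by apply: sqi_sum => i; exact: sq'.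
have cv' : sq mu (fun x => F x - \sum_(k < N) mk k * q k x) @[N --> \oo] --> (0 : R).
  have c1 : Num.sqrt (sq mu (fun x => F x - \sum_(k < N) mk k * q k x)) @[N --> \oo] --> (0 : R).
    by move: cv; under eq_fun do rewrite (L2distE (sqiB hF (hS _))); move=> /fine_cvgP[].
  have c2 := cvgM c1 c1; rewrite mulr0 in c2.
  rewrite (_ : (fun N => sq _ _) = (fun N => Num.sqrt (sq mu (fun x => F x - \sum_(k < N) mk k * q k x)) *
      Num.sqrt (sq mu (fun x => F x - \sum_(k < N) mk k * q k x)))); first exact: c2.
  by apply/funext => N; rewrite -expr2 sqr_sqrtr// sq_ge0.
apply: (cvgC_unique (ip_cvg hS hF (sh_sqi a b) cv')).
apply: (cvgC_squeeze (r := fun N => if (mlength b < N)%N then 0 else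
   normc (ip mu (fun z => \sum_(k < N) mk k * q k z) (sh a b) - mk (mlength b) * ip mu f (sh a b)))).
  move=> N; case: ifP => // bN; rewrite ip_suml//; last exact: sh_sqi.
  rewrite (bigD1 (Ordinal bN))//= big1 ?addr0.
    rewrite ipZl; [|exact: is_Q_sqi (hq _)|exact: sh_sqi].
    by rewrite (is_Q_sh _ _ hf (hq _)) eqxx subrr normc0.
  move=> k kb; rewrite ipZl; [|exact: is_Q_sqi (hq _)|exact: sh_sqi].
  rewrite (is_Q_sh _ _ hf (hq _)) ifF ?mulr0//.
  by apply/negbTE; apply: contra kb => /eqP e; apply/eqP/val_inj; rewrite /= e.
apply: cvg_near_cst; exists (mlength b).+1 => // N /= bN; by rewrite bN.
Qed.

End spectral_projections.

Section existence.
Context {R : realType} {d : nat}.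
Local Notation leb n := (lebesgue_rV R n).
Local Notation V := 'rV[R]_(d + d).
Local Notation mu := (leb (d + d)).
Local Notation sh := (@special_hermite R d).
Local Notation index := ({ffun 'I_d -> nat} * {ffun 'I_d -> nat})%type.
Implicit Types F G H f q : V -> R[i].
Hypothesis d0 : (0 < d)%N.

Let kap : R := (2 * pi) ^+ d.
Let kap0 : 0 < kap. Proof. by rewrite exprn_gt0// mulr_gt0// pi_gt0. Qed.

(* An enumeration of the special Hermite functions of one eigenspace, padded
   with zeros. *)
Definition shenum (k n : nat) : V -> R[i] :=
  if @pickle_inv index n is Some i then
    if mlength i.2 == k then sh i.1 i.2 else fun=> 0
  else fun=> 0.

Let shenum_sqi k n : sqi mu (shenum k n).
Proof.
rewrite /shenum; case: pickle_inv => [i|]; last exact: sqi0.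
by case: ifP => _; [exact: sh_sqi|exact: sqi0].
Qed.

Let ip0l F : ip mu (fun=> 0) F = 0.
Proof. by rewrite /ip; under eq_intC do rewrite mul0r; exact: intC0. Qed.
Let ip0r F : ip mu F (fun=> 0) = 0.
Proof. by rewrite /ip; under eq_intC do rewrite conjc0 mulr0; exact: intC0. Qed.

Lemma shenum_ortho k i j : i != j -> ip mu (shenum k i) (shenum k j) = 0.
Proof.
move=> ij; rewrite /shenum.
case Ei: (@pickle_inv index i) => [x|]; last by rewrite ip0l.
case Ej: (@pickle_inv index j) => [y|]; last by rewrite ip0r.
case: ifP => _; last by rewrite ip0l.
case: ifP => _; last by rewrite ip0r.
apply: special_hermite_ortho => -[e1 e2]; move/eqP: ij; apply.
have := @pickle_invK index i; have := @pickle_invK index j; rewrite Ei Ej /= => <- <-.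
congr pickle; case: x y e1 e2 {Ei Ej} => x1 x2 [y1 y2] /= e1 e2.
by congr pair; apply/ffunP => t; rewrite ?e1 ?e2.
Qed.

Lemma shenum_sq k n f : sqi mu f ->
  sq mu (fun x => kap%:C * ip mu f (shenum k n) * shenum k n x) =
  kap * normc (ip mu f (shenum k n)) ^+ 2.
Proof.
move=> hf; have hs := shenum_sqi k n.
have /eqP := sq_ip (sqiZ (kap%:C * ip mu f (shenum k n)) hs).
rewrite ipZl ?ipZr//; last exact: sqiZ.
rewrite conjcM conjc_real [X in X == _](_ : _ = (kap ^+ 2 * normc (ip mu f (shenum k n)) ^+ 2)%:C *
    ip mu (shenum k n) (shenum k n)); last first.
  have -> : (kap ^+ 2 * normc (ip mu f (shenum k n)) ^+ 2)%:C =
      kap%:C ^+ 2 * (ip mu f (shenum k n) * conjc (ip mu f (shenum k n))).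
    by rewrite mul_conjc -rmorphXn -rmorphM.
  by ring.
rewrite /shenum; case: pickle_inv => [i|]; last first.
  by rewrite ip0r normc0 !expr0n !mulr0 mul0r => /eqP[<-].
case: ifP => _; last by rewrite ip0r normc0 !expr0n !mulr0 mul0r => /eqP[<-].
rewrite special_hermite_sq -rmorphM => /eqP/(@complexI R) <-.
by rewrite -/kap; field; rewrite gt_eqF.
Qed.

(** q is the Fourier series of f along the enumeration; [kap] compensates for the squared norm of
    the special Hermite functions. Bessel's inequality gives convergence. *)
Lemma is_Q_exists k f : sqi mu f -> exists q, is_Q k f q.
Proof.
move=> hf; pose c n := kap%:C * ip mu f (shenum k n).
pose g n x := c n * shenum k n x.
have hg n : sqi mu (g n) by apply: sqiZ; exact: shenum_sqi.
have og i j : i != j -> ip mu (g i) (g j) = 0.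
  by move=> ij; rewrite ipZl ?ipZr ?shenum_ortho ?mulr0.
have fg i : ip mu f (g i) = (sq mu (g i))%:C.
  rewrite (shenum_sq k i hf) (ipZr _ (shenum_sqi k i) hf) /c conjcM conjc_real.
  by rewrite (rmorphM (real_complex R)) -[X in _ = _ * X]mul_conjc; ring.
have [q hq cv] := ortho_series hg og (bessel hf hg og fg).
have hS n : sqi mu (fun x => \sum_(i < n) g i x) by exact: sqi_sum.
exists q; split; first exact/L2P.
- move=> eps e0; have e20 : 0 < eps ^+ 2 by rewrite exprn_gt0.
  have /cvgrPdist_lt /(_ _ e20)[N _ /(_ N (leqnn _))] := cv.
  rewrite sub0r normrN ger0_norm ?sq_ge0// => hN.
  exists (fun x => \sum_(i < N) g i x); last first.
    rewrite (L2distE (sqiB hq (hS N))) lte_fin -(ltr_pXn2r (n := 2))// ?nnegrE ?sqrtr_ge0 ?(ltW e0)//.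
    by rewrite sqr_sqrtr ?sq_ge0.
  (* A padding term has coefficient 0, yet [eigen_span] demands an index of length k for it. Placing
     k on the first coordinate provides one, which is where d > 0 enters. *)
  pose b0 (j : 'I_d) := if val j == 0%N then k else 0%N.
  have b0k : mlength b0 = k.
    rewrite /mlength; case: d d0 @b0 => // d' _ /=.
    by rewrite big_ord_recl /= big1 ?addn0.
  pose ok n := if @pickle_inv index n is Some i then mlength i.2 == k else false.
  pose a' n : 'I_d -> nat := if @pickle_inv index n is Some i then i.1 else fun=> 0%N.
  pose b' n : 'I_d -> nat := if @pickle_inv index n is Some i then
     (if mlength i.2 == k then i.2 : 'I_d -> nat else b0) else b0.
  exists N, (fun i : 'I_N => if ok i then c i else 0), (fun i : 'I_N => a' i), (fun i : 'I_N => b' i).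
  split.
    by move=> i; rewrite /b'; case: pickle_inv => [x|//]; case: eqP.
  apply/funext => z; apply: eq_bigr => i _; rewrite /g /shenum /ok /a' /b'.
  by case: pickle_inv => [x|]; [case: eqP => _|]; rewrite ?mul0r ?mulr0.
- move=> a b bk; change (ip mu (fun z => f z - q z) (sh a b) = 0).
  pose n0 := pickle (([ffun j => a j], [ffun j => b j]) : index).
  have en : shenum k n0 = sh a b.
    rewrite /shenum /n0 pickleK_inv /=.
    have -> : [ffun j => a j] = a :> ('I_d -> nat) by apply/funext => j; rewrite ffunE.
    have -> : [ffun j => b j] = b :> ('I_d -> nat) by apply/funext => j; rewrite ffunE.
    by rewrite bk eqxx.
  rewrite ipBl//; last exact: sh_sqi.
  apply/eqP; rewrite subr_eq0 eq_sym; apply/eqP.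
  apply: (cvgC_unique (ip_cvg hS hq (sh_sqi a b) cv)).
  apply: (cvgC_squeeze (r := fun N => if (n0 < N)%N then 0 else
     normc (ip mu (fun z => \sum_(k < N) g k z) (sh a b) - ip mu f (sh a b)))).
    move=> N; case: ifP => // bN; rewrite ip_suml//; last exact: sh_sqi.
    rewrite (bigD1 (Ordinal bN))//= big1 ?addr0.
      rewrite ipZl; [|exact: shenum_sqi|exact: sh_sqi].
      rewrite /c en special_hermite_sq mulrAC -rmorphM -/kap mulfV ?gt_eqF// mul1r.
      by rewrite subrr normc0.
    move=> j jn; rewrite ipZl; [|exact: shenum_sqi|exact: sh_sqi].
    by rewrite -en shenum_ortho ?mulr0.
  by apply: cvg_near_cst; exists n0.+1 => // N /= bN; rewrite bN.
Qed.

Variable m : R -> R[i].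
Hypothesis m1 : forall k : nat, normc (m (d + 2 * k)%:R) <= 1.

Lemma multiplier_exists f : sqi mu f -> exists F, is_multiplier m f F.
Proof.
move=> hf; have /boolp.choice[q hq] : forall k, exists q, is_Q k f q by move=> k; exact: is_Q_exists.
have hqi k : sqi mu (q k) := is_Q_sqi (hq k).
pose g k x := m (d + 2 * k)%:R * q k x.
have hg n : sqi mu (g n) by exact: sqiZ.
have oq i j : i != j -> ip mu (q i) (q j) = 0.
  by move=> ij; exact: (is_Q_ortho hf ij (hq i) (hq j)).
have og i j : i != j -> ip mu (g i) (g j) = 0.
  by move=> ij; rewrite ipZl ?ipZr ?oq ?mulr0//; exact: hqi.
have gq i : sq mu (g i) <= sq mu (q i).
  rewrite /sq /g; under eq_Rintegral do rewrite normcM exprMn.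
  rewrite RintegralZl//; last by case: (hqi i).
  rewrite ler_piMl ?sq_ge0//; have := m1 i; have := normc_ge0 (m (d + 2 * i)%:R); nra.
have B n : \sum_(i < n) sq mu (g i) <= sq mu f.
  apply: le_trans (bessel hf hqi oq (fun i => is_Q_self hf (hq i)) n).
  exact: ler_sum.
have [F hF cv] := ortho_series hg og B.
exists F, q; split => //; first exact/L2P.
have hS n : sqi mu (fun x => \sum_(i < n) g i x) by exact: sqi_sum.
under eq_fun do rewrite (L2distE (sqiB hF (hS _))).
apply/fine_cvgP; split; first exact: nearW.
rewrite -[0 in X in _ --> X](sqrtr0 R) /=.
exact: (cvg_comp _ _ cv (@sqrt_continuous R 0)).
Qed.

End existence.

(** * The kernel of a multiplier on the phase space *)

Section complex_exponential_series.
Context {R : realType}.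

(** The real and imaginary parts have different mean value points, hence the factor 2. *)
Lemma normc_MVT (f g : R -> R[i]) (a b M : R) : a <= b ->
  (forall t, a <= t <= b -> is_derive t 1 (fun u => complex.Re (f u)) (complex.Re (g t)) /\
     is_derive t 1 (fun u => complex.Im (f u)) (complex.Im (g t))) ->
  (forall t, a <= t <= b -> normc (g t) <= M) ->
  normc (f b - f a) <= 2 * M * (b - a).
Proof.
move=> ab df gM.
have H (F dF : R -> R) : (forall t, a <= t <= b -> is_derive t 1 F (dF t)) ->
    (forall t, a <= t <= b -> `|dF t| <= M) -> `|F b - F a| <= M * (b - a).
  move=> hF hM; move: ab; rewrite le_eqVlt => /predU1P[->|ltab].
    by rewrite !subrr normr0 mulr0.
  have cF : {within `[a, b], continuous F}.
    apply: derivable_within_continuous => x; rewrite in_itv /= => xab.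
    by have [] := hF x xab.
  have dF' x : x \in `]a, b[ -> is_derive x 1 F (dF x).
    by rewrite in_itv /= => /andP[/ltW p /ltW q]; apply: hF; rewrite p q.
  have [c cab ->] := MVT ltab dF' cF.
  have ba : 0 <= b - a by rewrite subr_ge0 ltW.
  rewrite normrM [`|b - a|]ger0_norm//; apply: ler_wpM2r => //.
  by move: cab; rewrite in_itv /= => /andP[/ltW p /ltW q]; apply: hM; rewrite p q.
apply: le_trans (normc_le_ReIm _) _; rewrite ReD ReN ImD ImN -mulrA mulr_natl mulr2n.
apply: lerD.
- apply: (H (fun u => complex.Re (f u)) (fun u => complex.Re (g u))) => t tab.
    by have [] := df t tab.
  exact: le_trans (normc_Re_le _) (gM t tab).
- apply: (H (fun u => complex.Im (f u)) (fun u => complex.Im (g u))) => t tab.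
    by have [] := df t tab.
  exact: le_trans (normc_Im_le _) (gM t tab).
Qed.

Definition expcoef (k : nat) (s : R[i]) : R[i] := (k`!%:R^-1)%:C * s ^+ k.

Lemma normc_expcoef k s : normc (expcoef k s) = exp_coeff (normc s) k.
Proof.
rewrite normcM normcX normc_real ger0_norm ?invr_ge0//.
by rewrite /exp_coeff /= mulrC.
Qed.

Let invfactS k : (k`!%:R^-1)%:C = k.+1%:R * ((k.+1)`!%:R^-1)%:C :> R[i].
Proof.
rewrite -(rmorph_nat (real_complex R)) -rmorphM; congr (_%:C).
by rewrite factS natrM invfM mulrA mulfV ?pnatr_eq0// mul1r.
Qed.

(** Along the segment from 0 to s, e^(-s u) times the partial sum of e^(s u) has value 1 at u = 0
    and derivative -s e^(-s u) (s u)^N / N!, which tends to 0 uniformly on [0, 1]. *)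
Lemma cexp_series s : cvgC (fun N => \sum_(k < N) expcoef k s) (cexp s).
Proof.
pose E N (t : R) := \sum_(k < N) expcoef k (s * t%:C).
pose v : 'rV[R]_1 := delta_mx 0 ord0.
pose c (u : 'rV[R]_1) := (u ord0 ord0)%:C : R[i].
have hc : isD v c (fun=> 1).
  by have := @isD_coord R 1 v ord0; rewrite /v mxE !eqxx.
have hs := isDZ s hc.
have dE N : isD v (fun u => \sum_(k < N.+1) expcoef k (s * c u))
    (fun u => s * \sum_(k < N) expcoef k (s * c u)).
  elim: N => [|N IH].
    under [fun u => \sum_(k < 1) _]eq_fun do rewrite big_ord1 /expcoef expr0.
    by apply: isD_eq (isD_cst _ _) => u; rewrite big_ord0 mulr0.
  under [fun u => \sum_(k < N.+2) _]eq_fun do rewrite big_ord_recr.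
  apply: isD_eq (isDD IH (isDZ ((N.+1)`!%:R^-1)%:C (isDX N hs))) => u.
  rewrite big_ord_recr mulrDr; congr (_ + _).
  by rewrite /expcoef (invfactS N); ring.
pose F N u := cexp (- s * c u) * \sum_(k < N.+1) expcoef k (s * c u).
pose G N u := - s * (cexp (- s * c u) * expcoef N (s * c u)).
have dF N : isD v (F N) (G N).
  apply: isD_eq (isDM (isD_cexp (isDZ (- s) hc)) (dE N)) => u.
  by rewrite /G big_ord_recr /=; ring.
have cv u : complex.Re (- s * c u) <= normc (s * c u).
  rewrite -(normcN (s * c u)) -mulNr (le_trans (ler_norm _))//; exact: normc_Re_le.
pose M N := normc s * (expR (normc s) * exp_coeff (normc s) N).
have cE (t : R) : c (t *: v + 0) = t%:C by rewrite /c !mxE !eqxx mulr1 addr0.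
have FM N : normc (F N (1 *: v + 0) - F N (0 *: v + 0)) <= 2 * M N.
  rewrite -[leRHS]mulr1 -[X in _ <= _ * X](subr0 1).
  apply: (@normc_MVT (fun t => F N (t *: v + 0)) (fun t => G N (t *: v + 0))) => // t /andP[t0 t1].
    have [d1 d2] := dF N (t *: v + 0); split.
      exact: (@is_derive_lineT _ _ (fun u => complex.Re (F N u)) 0 v t _ d1).
    exact: (@is_derive_lineT _ _ (fun u => complex.Im (F N u)) 0 v t _ d2).
  have st : normc (s * t%:C) <= normc s.
    by rewrite normcM normc_real ger0_norm// ler_piMr ?normc_ge0.
  rewrite /G cE normcM normcN /M.
  apply: ler_wpM2l; first exact: normc_ge0.
  rewrite normcM normc_cexp normc_expcoef.
  apply: ler_pM; rewrite ?expR_ge0 ?exp_coeff_ge0 ?normc_ge0 ?ler_expR//.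
    by have := cv (t *: v + 0); rewrite cE => /le_trans; apply.
  rewrite /exp_coeff /= ler_wpM2r ?invr_ge0// lerXn2r ?nnegrE ?normc_ge0//.
have F0 N : F N (0 *: v + 0) = 1.
  rewrite /F cE !mulr0 cexp0 mul1r big_ord_recl big1 ?addr0.
    by rewrite /expcoef expr0 fact0 invr1 mulr1.
  by move=> k _; rewrite /expcoef exprS mul0r mulr0.
have h N : normc (\sum_(k < N.+1) expcoef k s - cexp s) <= normc (cexp s) * (2 * M N).
  have -> : \sum_(k < N.+1) expcoef k s - cexp s = cexp s * (F N (1 *: v + 0) - F N (0 *: v + 0)).
    by rewrite F0 /F cE !mulr1 mulrBr mulr1 mulrA -cexpD subrr cexp0 mul1r.
  by rewrite normcM ler_wpM2l ?normc_ge0.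
have c0 : normc (cexp s) * (2 * M N) @[N --> \oo] --> (0 : R).
  have e := cvg_exp_coeff (normc s).
  rewrite (_ : (fun N => _) = (fun N => (normc (cexp s) * (2 * (normc s * expR (normc s)))) * exp_coeff (normc s) N)).
    by rewrite -[X in _ --> X](mulr0 (normc (cexp s) * (2 * (normc s * expR (normc s)))));
      exact: cvgM (cvg_cst _) e.
  by apply/funext => N; rewrite /M; ring.
rewrite /cvgC -(cvg_shiftS (fun n => normc (\sum_(k < n) expcoef k s - cexp s))) /=.
apply: (squeeze_cvgr _ (cvg_cst 0) c0); apply: nearW => N.
by rewrite normc_ge0 /=; exact: h.
Qed.

End complex_exponential_series.

Section multinomial.
Context {R : realType} {N : nat}.

(** The exponential series truncated below degree N, with s scaled into the coefficients. Truncation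
    does not affect coefficients of index below N in a product, so the multinomial formula becomes a
    comparison of coefficients. *)
Let T (s : R[i]) : {poly R[i]} := \poly_(i < N) expcoef i s.

Lemma expcoefD k (s t : R[i]) :
  \sum_(i < k.+1) expcoef i s * expcoef (k - i) t = expcoef k (s + t).
Proof.
rewrite /expcoef addrC exprDn mulr_sumr; apply: eq_bigr => i _.
have ik : (i <= k)%N by rewrite -ltnS.
rewrite -[_ *+ 'C(k, i)]mulr_natr -(rmorph_nat (real_complex R) 'C(k, i)).
have -> : (k`!%:R^-1)%:C * (t ^+ (k - i) * s ^+ i * real_complex R 'C(k, i)%:R) =
  (k`!%:R^-1 * 'C(k, i)%:R)%:C * (s ^+ i * t ^+ (k - i)) by rewrite rmorphM /=; ring.
have -> : (k`!%:R^-1 * 'C(k, i)%:R : R) = i`!%:R^-1 * (k - i)`!%:R^-1.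
  rewrite -(bin_fact ik) !natrM; field.
  by rewrite !pnatr_eq0 -!lt0n !fact_gt0 bin_gt0 ik.
by rewrite rmorphM /=; ring.
Qed.

Let coefT (I : Type) (r : seq I) (s : I -> R[i]) k : (k < N)%N ->
  (\prod_(j <- r) T (s j))`_k = expcoef k (\sum_(j <- r) s j).
Proof.
elim: r k => [|j r IH] k kN.
  rewrite !big_nil coef1 /expcoef; case: k {kN} => [|k]; last by rewrite expr0n mulr0.
  by rewrite expr0 fact0 invr1 mulr1.
rewrite !big_cons coefM -expcoefD; apply: eq_bigr => i _.
have ik : (i <= k)%N by rewrite -ltnS.
rewrite IH; last exact: leq_ltn_trans (leq_subr _ _) kN.
by rewrite coef_poly (leq_ltn_trans ik kN).
Qed.

Lemma multinomial d (s : 'I_d -> R[i]) k : (k < N)%N ->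
  \sum_(b : {ffun 'I_d -> 'I_N} | mlength (fun j => b j) == k) \prod_j expcoef (b j) (s j) =
  expcoef k (\sum_j s j).
Proof.
move=> kN; rewrite -coefT//.
have -> : \prod_j T (s j) = \sum_(b : {ffun 'I_d -> 'I_N}) (\prod_j expcoef (b j) (s j)) *: 'X^(mlength (fun j => b j)).
  under eq_bigr do rewrite /T poly_def.
  rewrite bigA_distr_bigA /=; apply: eq_bigr => b _.
  by rewrite scaler_prod prodrXr.
rewrite coef_sum big_mkcond; apply: eq_bigr => b _.
by rewrite coefZ coefXn eq_sym; case: eqP => _; rewrite ?mulr1 ?mulr0.
Qed.

Lemma multinomial_sum d (s : 'I_d -> R[i]) (m : nat -> R[i]) :
  \sum_(b : {ffun 'I_d -> 'I_N} | (mlength (fun j => b j) < N)%N)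
     m (mlength (fun j => b j)) * \prod_j expcoef (b j) (s j) =
  \sum_(k < N) m k * expcoef k (\sum_j s j).
Proof.
transitivity (\sum_(k < N) \sum_(b : {ffun 'I_d -> 'I_N})
    if mlength (fun j => b j) == k then m (mlength (fun j => b j)) * \prod_j expcoef (b j) (s j) else 0).
  rewrite exchange_big big_mkcond; apply: eq_bigr => b _.
  rewrite -big_mkcond; case: ifP => bN.
    by rewrite (big_pred1 (Ordinal bN)).
  by rewrite big_pred0// => k; apply/eqP => e; move: bN; rewrite e ltn_ord.
apply: eq_bigr => k _; rewrite -big_mkcond -(multinomial s (ltn_ord k)) mulr_sumr.
by apply: eq_bigr => b /eqP ->.
Qed.

End multinomial.

(** * The kernel as a limit of finite sums over special Hermite indices *)

Section coherent_kernel.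
Context {R : realType} {d : nat}.
Local Notation leb n := (lebesgue_rV R n).
Local Notation V := 'rV[R]_(d + d).
Local Notation W := 'rV[R]_((d + d) + (d + d)).
Local Notation mu := (leb (d + d)).
Local Notation sh := (@special_hermite R d).
Implicit Types (F f : V -> R[i]) (w z : W) (m : nat -> R[i]).

(* The sum of the series, which converges for bounded m; the value is 0 if it
   diverges. *)
Definition gfun m (s : R[i]) : R[i] :=
  xget 0 [set l | cvgC (fun N => \sum_(k < N) m k * expcoef k s) l].

Lemma gfun_cvg m s : (forall k, normc (m k) <= 1) ->
  cvgC (fun N => \sum_(k < N) m k * expcoef k s) (gfun m s).
Proof.
move=> hm; apply: (@xgetPex _ (0 : R[i]) (fun l => cvgC (fun N => \sum_(k < N) m k * expcoef k s) l)).
apply: (@cvgC_series_abs _ (fun k => m k * expcoef k s)).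
apply: series_le_cvg (is_cvg_series_exp_coeff (normc s)) => n; first exact: normc_ge0.
  by rewrite exp_coeff_ge0 ?normc_ge0.
rewrite normcM normc_expcoef ler_piMl ?exp_coeff_ge0 ?normc_ge0//.
Qed.

Lemma mfC_gfun {d' : measure_display} {T : measurableType d'} m (h : T -> R[i]) :
  (forall k, normc (m k) <= 1) -> mfC h -> mfC (fun x => gfun m (h x)).
Proof.
move=> hm mh; apply: (mfC_cvg (F := fun N x => \sum_(k < N) m k * expcoef k (h x))).
  move=> N; apply: mfC_sum => k; apply: mfCM; first exact: mfC_cst.
  by apply: mfCM; [exact: mfC_cst|exact: mfCX].
by move=> x; exact: gfun_cvg.
Qed.

Definition phase (A B : R[i]) : R[i] :=
  expi (- complex.Im (A * B) / 2) * (expR (- (normc A ^+ 2 + normc B ^+ 2) / 4))%:C.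

Lemma normc_phase A B : normc (phase A B) = expR (- (normc A ^+ 2 + normc B ^+ 2) / 4).
Proof. by rewrite normcM normc_expi mul1r normc_real ger0_norm ?expR_ge0. Qed.

(** The factorials and powers of 2 in [shnorm] turn the product of monomials into terms of the
    exponential series at A conj(A') / 2 and B conj(B') / 2. *)
Lemma coh_conjc k n (A B A' B' : R[i]) : coh k n A B * conjc (coh k n A' B') =
  phase A B * conjc (phase A' B') *
  (expcoef k (2^-1%:C * (A * conjc A')) * expcoef n (2^-1%:C * (B * conjc B'))).
Proof.
have s0 : 0 < 2 ^+ (k + n) * k`!%:R * n`!%:R :> R.
  by rewrite !mulr_gt0 ?exprn_gt0 ?ltr0n ?fact_gt0.
have e : (@shnorm R k n)^-1 * (@shnorm R k n)^-1 =
    (k`!%:R^-1 * 2^-1 ^+ k) * (n`!%:R^-1 * 2^-1 ^+ n).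
  rewrite -invfM -expr2 /shnorm sqr_sqrtr ?(ltW s0)// exprD !invfM !exprVn; ring.
have cohE (X Y : R[i]) : coh k n X Y = phase X Y * ((@shnorm R k n)^-1)%:C * (X ^+ k * Y ^+ n).
  by rewrite /coh /phase rmorphM; ring.
rewrite !cohE; set p := phase A B; set p' := phase A' B'.
rewrite [conjc (_ * _)]conjcM [conjc (p' * _)]conjcM [conjc (A' ^+ k * _)]conjcM.
rewrite (conjc_real (@shnorm R k n)^-1) !conjcX.
transitivity (p * conjc p' * (((@shnorm R k n)^-1 * (@shnorm R k n)^-1)%:C *
    (A ^+ k * conjc A' ^+ k * (B ^+ n * conjc B' ^+ n)))).
  by rewrite rmorphM; ring.
rewrite e /expcoef !exprMn -!rmorphXn !rmorphM; ring.
Qed.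

Definition csig z w (j : 'I_d) : R[i] := 2^-1%:C * (cal z j * conjc (cal w j)).
Definition ctau z w (j : 'I_d) : R[i] := 2^-1%:C * (cbe z j * conjc (cbe w j)).
Definition cwt z w : R[i] :=
  \prod_j (phase (cal z j) (cbe z j) * conjc (phase (cal w j) (cbe w j))).

Lemma ccoef_conjc a b z w : ccoef a b z * conjc (ccoef a b w) =
  cwt z w * ((\prod_j expcoef (a j) (csig z w j)) * \prod_j expcoef (b j) (ctau z w j)).
Proof.
rewrite /ccoef conjc_prod -big_split /= /cwt -!big_split /=.
by apply: eq_bigr => j _; exact: coh_conjc.
Qed.

Local Notation box N := ({ffun 'I_d -> 'I_N} * {ffun 'I_d -> 'I_N})%type.
Local Notation small N p := (mlength (fun j => p.2 j : nat) < N)%N.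
Local Notation fst_ p := (fun j => nat_of_ord (p.1 j)).
Local Notation snd_ p := (fun j => nat_of_ord (p.2 j)).

(** The truncation is shaped so that the sum factors: a runs over a full cube and gives a product of
    truncated exponentials, while |b| < N gives, by [multinomial_sum], exactly the N-th partial sum
    of the series of [gfun]. *)
Lemma box_kernel N m z w :
  \sum_(p : box N | small N p) m (mlength (snd_ p)) * (ccoef (fst_ p) (snd_ p) z * conjc (ccoef (fst_ p) (snd_ p) w)) =
  cwt z w * (\prod_j \sum_(i < N) expcoef i (csig z w j)) * \sum_(k < N) m k * expcoef k (\sum_j ctau z w j).
Proof.
rewrite -multinomial_sum bigA_distr_bigA /= -mulrA big_distrlr /= pair_big /= mulr_sumr.
by apply: eq_bigr => p _; rewrite ccoef_conjc; ring.
Qed.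

(* Sum over a, b of m(|b|) times [ccoef a b z] times the conjugate of
   [ccoef a b w]. *)
Definition kernK m z w : R[i] :=
  cwt z w * cexp (\sum_j csig z w j) * gfun m (\sum_j ctau z w j).

Lemma box_kernel_cvg m z w : (forall k, normc (m k) <= 1) ->
  cvgC (fun N => \sum_(p : box N | small N p) m (mlength (snd_ p)) *
     (ccoef (fst_ p) (snd_ p) z * conjc (ccoef (fst_ p) (snd_ p) w))) (kernK m z w).
Proof.
move=> hm; under [fun N => _]eq_fun do rewrite box_kernel.
apply: cvgCM; last exact: gfun_cvg.
apply: cvgCM; first exact: cvgC_cst.
by rewrite cexp_sum; apply: cvgC_prod => j _; exact: cexp_series.
Qed.

Definition boxmass N w : R := \sum_(p : box N | small N p) normc (ccoef (fst_ p) (snd_ p) w) ^+ 2.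

(** This is [box_kernel] with m = 1 on the diagonal, where the exponentials cancel the Gaussians. It
    is the form in which completeness is used: a shifted Gaussian loses no mass in its expansion. *)
Lemma boxmass_cvg w : boxmass N w @[N --> \oo] --> (1 : R).
Proof.
have H : cvgC (fun N => (boxmass N w)%:C) 1.
  have -> : (fun N => (boxmass N w)%:C) = (fun N => cwt w w * (\prod_j \sum_(i < N) expcoef i (csig w w j)) *
      \sum_(k < N) expcoef k (\sum_j ctau w w j)).
    apply/funext => N; have := box_kernel N (fun=> 1) w w.
    under [X in _ = _ * X]eq_bigr do rewrite mul1r.
    move=> <-; rewrite /boxmass rmorph_sum; apply: eq_bigr => p _.
    by rewrite mul1r mul_conjc.
  have E1 : cwt w w * cexp (\sum_j csig w w j) * cexp (\sum_j ctau w w j) = 1 :> R[i].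
    rewrite !cexp_sum /cwt -!big_split big1// => j _.
    rewrite /= mul_conjc normc_phase /csig /ctau !mul_conjc -!rmorphM !cexp_real -!rmorphM.
    by rewrite expr2 -!expRD -[RHS]/(1%:C) -expR0; congr ((expR _)%:C); field.
  suff : cvgC (fun N => cwt w w * (\prod_j \sum_(i < N) expcoef i (csig w w j)) *
      \sum_(k < N) expcoef k (\sum_j ctau w w j))
    (cwt w w * cexp (\sum_j csig w w j) * cexp (\sum_j ctau w w j)) by rewrite E1.
  apply: cvgCM; last exact: cexp_series.
  apply: cvgCM; first exact: cvgC_cst.
  by rewrite cexp_sum; apply: cvgC_prod => j _; exact: cexp_series.
exact: (cvgC_Re H).
Qed.

Definition kap : R := (2 * pi) ^+ d.
Lemma kap_gt0 : 0 < kap. Proof. by rewrite exprn_gt0// mulr_gt0// pi_gt0. Qed.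

Lemma sq_gphi : sq mu (@gphi R (d + d)) = kap.
Proof.
have h : (0 : R) < 2^-1 by rewrite invr_gt0.
pose l0 (i : 'I_(d + d)) : R[i] := 0.
have := sq_ip (nice_sqi (@nice_gphi R (d + d))); rewrite /ip.
rewrite (_ : (fun x => _) = (fun x : V => \prod_i gaussC 2^-1 (l0 i) (x ord0 i))); last first.
  apply/funext => x; rewrite /gphi conjc_real -cexp_real -cexpD -cexp_sum; congr cexp.
  under [in RHS]eq_bigr do rewrite /l0 mul0r addr0.
  by rewrite -rmorph_sum -rmorphD; congr (_%:C); rewrite sumrN -mulr_sumr; field.
rewrite (intC_gaussD l0 h).
under eq_bigr do rewrite /l0 expr0n mul0r cexp0 mulr1.
rewrite prodr_const card_ord -rmorphXn => /(@complexI R) <-.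
rewrite addnn -mul2n exprM sqr_sqrtr ?divr_ge0 ?pi_ge0 ?(ltW h)//.
by rewrite invrK mulrC.
Qed.

Lemma sq_tfshift w : sq mu (tfshift (@gphi R (d + d)) w) = kap.
Proof.
have m2 : mfC (fun x : V => (normc (@gphi R (d + d) x) ^+ 2)%:C).
  by apply: mfC_real; apply: measurable_normc2; apply: nice_mfC; exact: nice_gphi.
have := intC_shift (- lsubmx w) m2; rewrite !intC_real => /(@complexI R).
have sg := sq_gphi; rewrite /sq in sg; rewrite sg => <-; apply: eq_Rintegral => y _.
by rewrite /tfshift normcM normc_expi mulr1.
Qed.

Let hsh a b : sqi mu (sh a b) := sh_sqi a b.
Let htf w : sqi mu (tfshift gphi w).
Proof. by apply: nice_sqi; apply: nice_tfshift; exact: nice_gphi. Qed.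

Definition boxproj N w (y : V) : R[i] :=
  \sum_(p : box N | small N p) kap%:C * ccoef (fst_ p) (snd_ p) w * sh (fst_ p) (snd_ p) y.

Let boxproj_sqi N w : sqi mu (boxproj N w).
Proof. by apply: sqi_sum => p; exact: sqiZ. Qed.

Lemma ip_boxproj N w F : sqi mu F -> ip mu (boxproj N w) F =
  \sum_(p : box N | small N p) kap%:C * ccoef (fst_ p) (snd_ p) w * ip mu (sh (fst_ p) (snd_ p)) F.
Proof.
move=> hF; rewrite ip_suml//; last by move=> p; exact: sqiZ.
by apply: eq_bigr => p _; rewrite ipZl.
Qed.

(** [boxproj] is the orthogonal projection of the shifted Gaussian onto the span of the box, so
    Pythagoras gives the remainder. Its nonnegativity yields [boxmass_le1]. *)
Lemma sq_boxproj N w : sq mu (fun y => tfshift gphi w y - boxproj N w y) = kap * (1 - boxmass N w).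
Proof.
have k0 := kap_gt0.
have e1 : ip mu (tfshift gphi w) (boxproj N w) = (kap * boxmass N w)%:C.
  rewrite (ip_conjc (boxproj_sqi N w) (htf w)) ip_boxproj// conjc_sum /boxmass mulr_sumr rmorph_sum.
  apply: eq_bigr => p _; rewrite (ip_conjc (htf w) (hsh _ _)) tfshift_ip -mulrA mul_conjc.
  by rewrite -rmorphM conjc_real.
have e2 : ip mu (boxproj N w) (boxproj N w) = (kap * boxmass N w)%:C.
  rewrite ip_boxproj// /boxmass mulr_sumr rmorph_sum; apply: eq_bigr => p hp.
  rewrite ip_sumr//; last by move=> q; exact: sqiZ.
  rewrite (bigD1 p)//= big1 ?addr0.
    rewrite ipZr// special_hermite_sq conjcM conjc_real -/kap.
    transitivity ((kap * kap * kap^-1)%:C * (ccoef (fst_ p) (snd_ p) w * conjc (ccoef (fst_ p) (snd_ p) w))).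
      by rewrite !rmorphM /=; ring.
    by rewrite mul_conjc -rmorphM mulfK// gt_eqF.
  move=> q /andP[_ qp]; rewrite ipZr// special_hermite_ortho ?mulr0// => -[E1 E2].
  move/eqP: qp; apply; case: p q E1 E2 {hp} => p1 p2 [q1 q2] /= E1 E2.
  by congr pair; apply/ffunP => j; apply: val_inj;
    [have := congr1 (fun h => h j) E1|have := congr1 (fun h => h j) E2].
have e3 : sq mu (boxproj N w) = kap * boxmass N w.
  by apply: (@complexI R); rewrite -sq_ip.
by rewrite sqB// e1 e3 sq_tfshift /=; ring.
Qed.

Lemma boxmass_le1 N w : boxmass N w <= 1.
Proof.
have := sq_ge0 mu (fun y => tfshift gphi w y - boxproj N w y).
by rewrite sq_boxproj pmulr_rge0 ?kap_gt0// subr_ge0.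
Qed.

(** The projections [boxproj] converge in norm to the shifted Gaussian, hence their pairings with F
    converge to the transform. *)
Lemma stf_expansion F w : sqi mu F -> cvgC (fun N => \sum_(p : box N | small N p)
  kap%:C * conjc (ccoef (fst_ p) (snd_ p) w) * ip mu F (sh (fst_ p) (snd_ p))) (stf gphi F w).
Proof.
move=> hF; rewrite stf_ip (ip_conjc (htf w) hF).
have h : sq mu (fun y => tfshift gphi w y - boxproj N w y) @[N --> \oo] --> (0 : R).
  under eq_fun do rewrite sq_boxproj.
  have h1 := cvgM (cvg_cst kap) (cvgB (cvg_cst (1 : R)) (boxmass_cvg w)).
  by rewrite subrr mulr0 in h1; exact: h1.
have := cvgC_conjc (ip_cvg (boxproj_sqi ^~ w) (htf w) hF h).
under [fun N => _]eq_fun do rewrite ip_boxproj// conjc_sum.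
congr cvgC; apply/funext => N; apply: eq_bigr => p _.
by rewrite conjcM (ip_conjc hF (hsh _ _)) conjcK conjcM conjc_real.
Qed.

Lemma stf_sh a b z : stf gphi (sh a b) z = conjc (ccoef a b z).
Proof. by rewrite stf_ip (ip_conjc (htf z) (hsh a b)) tfshift_ip. Qed.

Lemma mfC_ccoef a b : mfC (ccoef a b : W -> R[i]).
Proof.
rewrite (_ : ccoef a b = fun z => conjc (stf gphi (sh a b) z)); last first.
  by apply/funext => z; rewrite stf_sh conjcK.
apply: mfC_conjc; apply: mfC_stf; first exact: nice_gphi.
by apply: nice_mfC; exact: nice_special_hermite.
Qed.

Let normc_ccoef a b z : normc (ccoef a b z) ^+ 2 <= 1.
Proof.
have := ip_le (htf z) (hsh a b); rewrite tfshift_ip sq_tfshift.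
have -> : sq mu (sh a b) = kap^-1.
  by apply: (@complexI R); rewrite -sq_ip// special_hermite_sq.
by rewrite mulfV// gt_eqF// kap_gt0.
Qed.

Variable f : V -> R[i].
Hypotheses (hf : sqi mu f) (hV : intgC (leb ((d + d) + (d + d))) (stf gphi f)).

(** Moyal's identity in dimension 2 d contributes (2 pi)^(2d) = kap^2, and the squared norm of the
    Gaussian one more factor [kap]. *)
Lemma ip_sh_stf a b : intC (leb ((d + d) + (d + d))) (fun z => stf gphi f z * ccoef a b z) =
  (kap ^+ 3)%:C * ip mu f (sh a b).
Proof.
have hi : intgC (leb ((d + d) + (d + d))) (fun z => stf gphi f z * conjc (stf gphi (sh a b) z)).
  rewrite (_ : (fun z => _) = fun z => ccoef a b z * stf gphi f z); last first.
    by apply/funext => z; rewrite stf_sh conjcK mulrC.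
  apply: (intgC_bounded (M := 1) (mfC_ccoef a b)) => // z.
  by rewrite -(@ler_pXn2r _ 2)// ?nnegrE ?normc_ge0// expr1n; exact: normc_ccoef.
have := moyal hf (nice_special_hermite a b) (@nice_gphi R (d + d)) (@nice_gphi R (d + d)) hi.
rewrite (_ : (fun z => _) = fun z => stf gphi f z * ccoef a b z); last first.
  by apply/funext => z; rewrite stf_sh conjcK.
move=> ->; rewrite sq_ip; last by apply: nice_sqi; exact: nice_gphi.
have -> : (kap ^+ 3)%:C = (kap * kap)%:C * kap%:C :> R[i].
  by rewrite -rmorphM; congr (_%:C); ring.
by rewrite sq_gphi exprD -!/kap; ring.
Qed.

(** Write each coefficient of f as a phase-space integral by [ip_sh_stf] and exchange sum and
    integral by dominated convergence. The constant is the [kap] of the expansion over kap^3. *)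
Lemma kernel_representation m F w : (forall k, normc (m k) <= 1) -> sqi mu F ->
  (forall a b, ip mu F (sh a b) = m (mlength b) * ip mu f (sh a b)) ->
  stf gphi F w = (kap ^- 2)%:C * intC (leb ((d + d) + (d + d))) (fun z => stf gphi f z * kernK m z w).
Proof.
move=> hm hF mF; have k0 := kap_gt0.
pose KN N z := \sum_(p : box N | small N p) m (mlength (snd_ p)) *
     (ccoef (fst_ p) (snd_ p) z * conjc (ccoef (fst_ p) (snd_ p) w)).
(* A bound uniform in N and z: x y <= (x^2 + y^2) / 2 in each term, then [boxmass_le1] at z and at
   w. *)
have K1 N z : normc (KN N z) <= 1.
  apply: le_trans (ler_normc_sum _ _ _) _.
  apply: (@le_trans _ _ (\sum_(p : box N | small N p)
    (normc (ccoef (fst_ p) (snd_ p) z) ^+ 2 + normc (ccoef (fst_ p) (snd_ p) w) ^+ 2) / 2)).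
    apply: ler_sum => p _; rewrite !normcM normc_conjc.
    set x := normc (ccoef _ _ z); set y := normc (ccoef _ _ w).
    have x0 : 0 <= x by exact: normc_ge0.
    have y0 : 0 <= y by exact: normc_ge0.
    apply: (@le_trans _ _ (x * y)); first by rewrite ler_piMl ?mulr_ge0.
    have := sqr_ge0 (x - y); rewrite sqrrB; lra.
  rewrite -mulr_suml big_split /= -/(boxmass N z) -/(boxmass N w).
  have := boxmass_le1 N z; have := boxmass_le1 N w; lra.
have i1 : intgC (leb ((d + d) + (d + d))) (stf gphi f) := hV.
have iK a b : intgC (leb ((d + d) + (d + d))) (fun z => stf gphi f z * ccoef a b z).
  under [fun z => _]eq_fun do rewrite mulrC.
  apply: (intgC_bounded (M := 1) (mfC_ccoef a b)) => // z.
  by rewrite -(@ler_pXn2r _ 2)// ?nnegrE ?normc_ge0// expr1n; exact: normc_ccoef.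
have [||||_ cv] := @dominatedC _ _ _ (leb ((d + d) + (d + d))) (fun N z => stf gphi f z * KN N z)
  (fun z => stf gphi f z * kernK m z w) (fun z => normc (stf gphi f z)).
- move=> N; apply: mfCM; first by case: i1.
  apply: mfC_sum => p; apply: mfCM; first exact: mfC_cst.
  by apply: mfCM; [exact: mfC_ccoef|exact: mfC_cst].
- by move=> z; apply: cvgCM; [exact: cvgC_cst|exact: box_kernel_cvg].
- exact: intgC_normc.
- by move=> N z; rewrite normcM ler_piMr ?normc_ge0.
apply: (cvgC_unique (stf_expansion w hF)).
have := cvgCM (cvgC_cst (kap ^- 2)%:C) cv; congr cvgC; apply/funext => N.
have -> : intC (leb ((d + d) + (d + d))) (fun z => stf gphi f z * KN N z) =
   \sum_(p : box N | small N p) m (mlength (snd_ p)) * conjc (ccoef (fst_ p) (snd_ p) w) *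
     ((kap ^+ 3)%:C * ip mu f (sh (fst_ p) (snd_ p))).
  rewrite (_ : (fun z => _) = (fun z => \sum_(p : box N | small N p)
     m (mlength (snd_ p)) * conjc (ccoef (fst_ p) (snd_ p) w) * (stf gphi f z * ccoef (fst_ p) (snd_ p) z))).
    rewrite intC_sum; last by move=> p; exact: intgCZ.
    by apply: eq_bigr => p _; rewrite intCZ// ip_sh_stf.
  by apply/funext => z; rewrite /KN mulr_sumr; apply: eq_bigr => p _; ring.
rewrite mulr_sumr; apply: eq_bigr => p _; rewrite mF.
have -> : kap%:C = (kap ^- 2)%:C * (kap ^+ 3)%:C :> R[i].
  by rewrite -rmorphM; congr (_%:C); field; rewrite gt_eqF.
by ring.
Qed.

End coherent_kernel.

(** * The estimate on one complex plane *)

Section poisson_moments.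
Context {R : realType}.
Implicit Types rho : R.

(** The factorial moments of the Poisson law, up to e^(-rho). Shifting the index by one trades a
    factor k of the falling factorial for a factor rho. *)
Let falling_cvg rho j :
  series (fun k => (k ^_ j)%:R * exp_coeff rho k) @ \oo --> rho ^+ j * expR rho.
Proof.
elim: j => [|j IH].
  rewrite (_ : (fun k => _) = exp_coeff rho); last by apply/funext => k; rewrite ffactn0 mul1r.
  rewrite expr0 mul1r; exact: is_cvg_series_exp_coeff.
rewrite -cvg_shiftS.
rewrite (_ : (fun n => _) = (fun n => rho * series (fun k => (k ^_ j)%:R * exp_coeff rho k) n)).
  by rewrite exprS -mulrA; exact: (cvgM (cvg_cst rho) IH).
apply/funext => n; rewrite /series /= big_nat_recl// ffact0n mul0r add0r mulr_sumr.
apply: eq_bigr => k _; rewrite ffactSS /exp_coeff /= factS !natrM exprS.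
have a0 : (k.+1%:R : R) != 0 by rewrite pnatr_eq0.
have b0 : (k`!%:R : R) != 0 by rewrite pnatr_eq0 -lt0n fact_gt0.
by move: (k.+1%:R) a0 => c a0; field; rewrite a0 b0.
Qed.

(** f is expanded in falling factorials, whose Poisson sums are rho^j e^rho; since f >= 0, partial
    sums stay below the total. *)
Lemma poisson_bound (f : nat -> R) (a0 a1 a2 a3 a4 rho : R) : 0 <= rho -> (forall k, 0 <= f k) ->
  (forall k, let x : R := k%:R in f k = a0 + a1 * x + a2 * (x * (x - 1)) +
     a3 * (x * (x - 1) * (x - 2)) + a4 * (x * (x - 1) * (x - 2) * (x - 3))) ->
  forall N, \sum_(k < N) f k * exp_coeff rho k <=
    (a0 + a1 * rho + a2 * rho ^+ 2 + a3 * rho ^+ 3 + a4 * rho ^+ 4) * expR rho.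
Proof.
move=> r0 f0 fE N.
have ff k j : (k ^_ j.+1)%:R = (k ^_ j)%:R * (k%:R - j%:R) :> R.
  rewrite ffactnSr natrM; case: (leqP j k) => [jk|kj]; first by rewrite natrB.
  by rewrite ffact_small// !mul0r.
have cv : series (fun k => f k * exp_coeff rho k) @ \oo -->
    (a0 + a1 * rho + a2 * rho ^+ 2 + a3 * rho ^+ 3 + a4 * rho ^+ 4) * expR rho.
  pose S j := series (fun k => (k ^_ j)%:R * exp_coeff rho k).
  rewrite (_ : series _ = (fun n => a0 * S 0%N n + a1 * S 1%N n + a2 * S 2%N n + a3 * S 3%N n + a4 * S 4%N n)).
    have h (j : nat) : series (fun k => (k ^_ j)%:R * exp_coeff rho k) @ \oo --> rho ^+ j * expR rho.
      exact: falling_cvg.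
    have := cvgD (cvgD (cvgD (cvgD (cvgM (cvg_cst a0) (h 0%N)) (cvgM (cvg_cst a1) (h 1%N)))
      (cvgM (cvg_cst a2) (h 2%N))) (cvgM (cvg_cst a3) (h 3%N))) (cvgM (cvg_cst a4) (h 4%N)).
    by rewrite (_ : a0 * _ + _ + _ + _ + _ = (a0 + a1 * rho + a2 * rho ^+ 2 + a3 * rho ^+ 3 + a4 * rho ^+ 4) * expR rho);
      [exact|ring].
  apply/funext => n; rewrite /S /series /= !mulr_sumr -!big_split; apply: eq_bigr => k _ /=.
  by rewrite fE !ff ffactn0; ring.
have nd : nondecreasing_seq (series (fun k => f k * exp_coeff rho k)).
  by apply: nondecreasing_series => k _ _; rewrite mulr_ge0// exp_coeff_ge0.
have := nondecreasing_cvgn_le nd (cvgP _ cv) N.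
by rewrite (cvg_lim _ cv)// /series /= big_mkord.
Qed.

End poisson_moments.

(** * Norms in the Fock space *)

Section fock_space.
Context {R : realType}.
Local Notation leb n := (lebesgue_rV R n).
Local Notation P2 := 'rV[R]_(1 + 1).

(** The polynomials [shp k 0] are the monomials theta^k, whose orthogonality and norms are the case
    n = n' = 0 of [wint_shp_ortho]. *)
Lemma fock_norm N (c : nat -> R[i]) :
  (\int[leb (1 + 1)]_p ((normc (\sum_(k < N) c k * theta p ^+ k)) ^+ 2 * expR (- normc (theta p) ^+ 2 / 2))%:E =
   (2 * pi * \sum_(k < N) normc (c k) ^+ 2 * (2 ^+ k * k`!%:R))%:E)%E.
Proof.
pose S (p : P2) := \sum_(k < N) c k * shp k 0 (theta p).
have pshp k : polyb (fun p : P2 => shp k 0 (theta p)) by have [] := @wirtinger_shp R k 0.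
have pZ a k : polyb (fun p : P2 => a * shp k 0 (theta p)) by apply: polybM => //; exact: polyb_cst.
have psum (M : nat) (F : nat -> P2 -> R[i]) : (forall k, polyb (F k)) -> polyb (fun p => \sum_(k < M) F k p).
  move=> pF; elim: M => [|M IH].
    by under [fun p => _]eq_fun do rewrite big_ord0; exact: polyb_cst.
  by under [fun p => _]eq_fun do rewrite big_ord_recr; exact: polybD.
have pS : polyb S by apply: (psum N (fun k p => c k * shp k 0 (theta p))).
have wsum (M : nat) (F : nat -> P2 -> R[i]) : (forall k, polyb (F k)) ->
    wint 0 0 (fun p => \sum_(k < M) F k p) = \sum_(k < M) wint 0 0 (F k).
  move=> pF; elim: M => [|M IH].
    rewrite big_ord0 /wint (_ : (fun p => _) = fun=> 0) ?intC0//.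
    by apply/funext => p; rewrite big_ord0 mul0r.
  under [X in wint _ _ X]eq_fun do rewrite big_ord_recr.
  by rewrite wintD ?IH ?big_ord_recr//; exact: psum.
have E p : (normc (S p) ^+ 2 * expR (- normc (theta p) ^+ 2 / 2))%:C = S p * conjc (S p) * cexp (wexp 0 0 p).
  rewrite rmorphM /= -mul_conjc; congr (_ * _).
  rewrite -cexp_real /wexp !mul0r subr0 addr0 mul_conjc; congr cexp.
  by move: (normc _ ^+ 2) => y; apply: complex_eqP; rewrite !(ReM, ImM, ReN, ImN) /=; field.
have pSS := polybM pS (polyb_conjc pS).
have iS := intgC_wint 0 0 pSS.
have V : wint 0 0 (fun p => S p * conjc (S p)) =
    (2 * pi * \sum_(k < N) normc (c k) ^+ 2 * (2 ^+ k * k`!%:R))%:C.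
  rewrite /S; under [X in wint _ _ X]eq_fun do rewrite mulr_suml.
  rewrite (wsum N (fun k p => c k * shp k 0 (theta p) * conjc (S p))); last first.
    by move=> k; apply: polybM => //; exact: polyb_conjc.
  rewrite mulr_sumr rmorph_sum; apply: eq_bigr => k _.
  rewrite /S; under [X in wint _ _ X]eq_fun do rewrite conjc_sum mulr_sumr.
  rewrite (wsum N (fun j p => c k * shp k 0 (theta p) * conjc (c j * shp j 0 (theta p)))); last first.
    by move=> j; apply: polybM => //; exact: polyb_conjc.
  have W j : wint 0 0 (fun p => c k * shp k 0 (theta p) * conjc (c j * shp j 0 (theta p))) =
      c k * conjc (c j) * if (k == j :> nat) then (2 * pi * (2 ^+ j * j`!%:R))%:C else 0.
    rewrite (_ : (fun p => _) = (fun p => c k * conjc (c j) * (shp k 0 (theta p) * conjc (shp j 0 (theta p))))); last first.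
      by apply/funext => p; rewrite conjcM; ring.
    rewrite wintZ; last by apply: polybM => //; exact: polyb_conjc.
    by rewrite wint_shp_ortho andbT addn0 fact0 mulr1.
  rewrite (bigD1 k)//= W eqxx big1 ?addr0; last first.
    by move=> j jk; rewrite W ifF ?mulr0//; apply/negbTE; rewrite eq_sym.
  by rewrite mul_conjc -rmorphM; congr (_%:C); ring.
transitivity (\int[leb (1 + 1)]_p (normc (S p * conjc (S p) * cexp (wexp 0 0 p)))%:E)%E.
  apply: eq_integral => p _; rewrite -E normc_real ger0_norm//.
  by rewrite mulr_ge0 ?sqr_ge0 ?expR_ge0.
rewrite -EFin_int_normc//; congr (_%:E); apply: (@complexI R).
rewrite -V /wint -intC_real; apply: eq_intC => p; rewrite -E normc_real ger0_norm//.
by rewrite mulr_ge0 ?sqr_ge0 ?expR_ge0.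
Qed.

End fock_space.

(** * The weighted Cauchy-Schwarz estimate for G *)

Section plane_estimate.
Context {R : realType}.
Local Notation leb n := (lebesgue_rV R n).
Local Notation P2 := 'rV[R]_(1 + 1).
Variables (m : nat -> R[i]) (A : R).
Hypotheses (A0 : 0 <= A) (m1 : forall k, normc (m k) <= 1).
Hypothesis m2 : forall k, k.+1%:R * normc (m k.+1 - m k) ^+ 2 <= A ^+ 2.
Hypothesis m3 : forall k, k.+1%:R * normc (m k.+2 - 2 * m k.+1 + m k) <= A.

(* With rho = r^2/2, the coefficients of (lambda - r)^2 G(r lambda / 2) are
   those of the exponential series times dfock k. *)
Let dfock (rho : R) k : R[i] := (2 * rho)%:C * m k - (4 * k%:R)%:C * m k.-1 +
  (2 * (k%:R * (k%:R - 1)) / rho)%:C * m k.-2.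

Let dfock_bound rho k : 1 <= rho -> normc (dfock rho k) ^+ 2 <= 12 / rho ^+ 2 *
  (((rho - k%:R) ^+ 2 - k%:R) ^+ 2 + 4 * A ^+ 2 * (k%:R * (rho - k%:R + 1) ^+ 2) + A ^+ 2 * k%:R ^+ 2).
Proof.
move=> rho1; have rho0 : 0 < rho by rewrite (lt_le_trans ltr01).
set x : R := k%:R.
pose d1 := m k - m k.-1; pose d2 := m k - 2 * m k.-1 + m k.-2.
(* Regrouped by differences of m: typically |rho - k| is of order rho^(1/2), so the three
   coefficients have orders rho, rho^(3/2) and rho^2, matched by the bounds on m and on its first
   and second differences. *)
have E : dfock rho k = (2 / rho)%:C * (((rho - x) ^+ 2 - x)%:C * m k + (2 * x * (rho - x + 1))%:C * d1 +
    (x * (x - 1))%:C * d2).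
  rewrite /dfock -/x /d1 /d2.
  case: (m k) => a b; case: (m k.-1) => a' b'; case: (m k.-2) => a2 b2.
  by apply: complex_eqP; rewrite !(ReM, ImM, ReD, ImD, ReN, ImN) /=; field; rewrite gt_eqF.
have x0 : 0 <= x by [].
have Y : (2 * x * `|rho - x + 1| * normc d1) ^+ 2 <= 4 * A ^+ 2 * (x * (rho - x + 1) ^+ 2).
  have h : x * normc d1 ^+ 2 <= A ^+ 2.
    rewrite /x /d1; case: (k) => [|k'] /=; first by rewrite mul0r sqr_ge0.
    exact: m2.
  rewrite !exprMn real_normK ?num_real//.
  have q : 0 <= 4 * x * (rho - x + 1) ^+ 2 by apply: mulr_ge0; [rewrite mulr_ge0|exact: sqr_ge0].
  have := ler_wpM2l q h; rewrite expr2; lra.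
have Z : x * (x - 1) * normc d2 <= A * x.
  rewrite /x /d2; case: (k) => [|[|k']] /=.
  - by rewrite !mul0r mulr0.
  - by rewrite subrr mulr0 mul0r mulr1.
  - have e : k'.+2%:R - 1 = k'.+1%:R :> R by rewrite -[in LHS]addn1 natrD addrK.
    rewrite e -mulrA [A * _]mulrC; apply: ler_wpM2l => //; exact: m3.
have Z0 : 0 <= x * (x - 1) * normc d2.
  apply: mulr_ge0; last exact: normc_ge0.
  rewrite /x; case: (k) => [|k']; first by rewrite mul0r.
  by rewrite mulr_ge0// subr_ge0 ler1n.
have N : normc (((rho - x) ^+ 2 - x)%:C * m k + (2 * x * (rho - x + 1))%:C * d1 + (x * (x - 1))%:C * d2) <=
   `|(rho - x) ^+ 2 - x| + 2 * x * `|rho - x + 1| * normc d1 + x * (x - 1) * normc d2.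
  apply: le_trans (le_normcD _ _) _; apply: lerD; last first.
    rewrite normcM normc_real ger0_norm//.
    rewrite /x; case: (k) => [|k']; first by rewrite mul0r.
    by rewrite mulr_ge0// subr_ge0 ler1n.
  apply: le_trans (le_normcD _ _) _; apply: lerD.
    by rewrite normcM normc_real ler_piMr.
  by rewrite normcM normc_real normrM ger0_norm ?mulr_ge0.
rewrite E normcM exprMn normc_real ger0_norm ?divr_ge0 ?(ltW rho0)//.
(* The factor 3 is for (X + Y + Z)^2 <= 3 (X^2 + Y^2 + Z^2). *)
have -> : 12 / rho ^+ 2 = (2 / rho) ^+ 2 * 3 by field; rewrite gt_eqF.
rewrite -[leRHS]mulrA; apply: ler_wpM2l; first exact: sqr_ge0.
set X := `|(rho - x) ^+ 2 - x| in N *.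
have X2 : X ^+ 2 = ((rho - x) ^+ 2 - x) ^+ 2 by rewrite real_normK// num_real.
set Y1 := 2 * x * `|rho - x + 1| * normc d1 in Y N *.
set Z1 := x * (x - 1) * normc d2 in Z Z0 N *.
have Y0 : 0 <= Y1 by rewrite !mulr_ge0// normc_ge0.
apply: (@le_trans _ _ ((X + Y1 + Z1) ^+ 2)).
  have X0 : 0 <= X by exact: normr_ge0.
  by rewrite lerXn2r ?nnegrE ?normc_ge0// addr_ge0// addr_ge0.
have Z2 : Z1 ^+ 2 <= A ^+ 2 * x ^+ 2.
  by rewrite -exprMn lerXn2r ?nnegrE// mulr_ge0.
rewrite -X2; have := sqr_ge0 (X - Y1); have := sqr_ge0 (X - Z1); have := sqr_ge0 (Y1 - Z1).
rewrite !sqrrB => h1 h2 h3.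
have e : (X + Y1 + Z1) ^+ 2 = X ^+ 2 + Y1 ^+ 2 + Z1 ^+ 2 + X * Y1 *+ 2 + X * Z1 *+ 2 + Y1 * Z1 *+ 2 by ring.
rewrite e; move: Y Z2 h1 h2 h3; lra.
Qed.

(** (rho - k)^2 - k is a Charlier polynomial: in its second Poisson moment the powers rho^4 and
    rho^3 cancel and 2 rho^2 remains, which the factor 1 / rho^2 absorbs. The other two terms of f
    have moments 4 A^2 rho^2 and A^2 (rho^2 + rho). *)
Lemma dfock_sum rho N : 1 <= rho ->
  \sum_(k < N) normc (dfock rho k) ^+ 2 * exp_coeff rho k <= 12 * (2 + 6 * A ^+ 2) * expR rho.
Proof.
move=> rho1; have rho0 : 0 < rho by rewrite (lt_le_trans ltr01).
have r0 := ltW rho0.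
pose f k : R := ((rho - k%:R) ^+ 2 - k%:R) ^+ 2 + 4 * A ^+ 2 * (k%:R * (rho - k%:R + 1) ^+ 2) + A ^+ 2 * k%:R ^+ 2.
have f0 k : 0 <= f k.
  have h : 0 <= 4 * A ^+ 2 by rewrite mulr_ge0// sqr_ge0.
  by apply: addr_ge0; [apply: addr_ge0; [exact: sqr_ge0|apply: mulr_ge0 => //; apply: mulr_ge0 => //; exact: sqr_ge0]|
    apply: mulr_ge0; exact: sqr_ge0].
(* The five arguments are the coefficients of f in the basis of falling factorials of k. *)
have := @poisson_bound R f (rho ^+ 4) (4 * rho ^+ 2 - 4 * rho ^+ 3 + 4 * A ^+ 2 * rho ^+ 2 + A ^+ 2)
  (6 * rho ^+ 2 - 8 * rho + 2 + 4 * A ^+ 2 * (1 - 2 * rho) + A ^+ 2)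
  (4 - 4 * rho + 4 * A ^+ 2) 1 rho r0 f0 _ N.
move=> /(_ ltac:(by move=> k x; rewrite /f -/x; ring)) H.
apply: (@le_trans _ _ (12 / rho ^+ 2 * \sum_(k < N) f k * exp_coeff rho k)).
  rewrite mulr_sumr; apply: ler_sum => k _; rewrite [leRHS]mulrA.
  apply: ler_wpM2r; first exact: exp_coeff_ge0.
  exact: dfock_bound.
have c0 : 0 <= 12 / rho ^+ 2 by rewrite divr_ge0 ?sqr_ge0.
apply: le_trans (ler_wpM2l c0 H) _.
rewrite [leLHS]mulrA; apply: ler_wpM2r; first exact: expR_ge0.
rewrite -[leLHS]mulrA; apply: ler_wpM2l => //; rewrite ler_pdivrMl ?exprn_gt0//.
(* The linear part of the moment of k^2 is absorbed because rho >= 1. *)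
have : A ^+ 2 * rho <= A ^+ 2 * rho ^+ 2.
  by apply: ler_wpM2l; rewrite ?sqr_ge0// expr2 ler_peMr.
lra.
Qed.

Let gk (r : R) k : R[i] := m k * ((r / 2) ^+ k / k`!%:R)%:C.
(** Multiplication of a power series by its variable. Accordingly [hk] lists the coefficients of (t
    - r)^2 G(r t / 2). *)
Let shift (c : nat -> R[i]) k : R[i] := if k is k'.+1 then c k' else 0.
Let hk (r : R) k : R[i] := (r ^+ 2)%:C * gk r k - (2 * r)%:C * shift (gk r) k + shift (shift (gk r)) k.

Let hkE r k : 0 < r -> hk r k = ((r / 2) ^+ k / k`!%:R)%:C * dfock (r ^+ 2 / 2) k.
Proof.
move=> r0; have f0 j : (j`!%:R : R) != 0 by rewrite pnatr_eq0 -lt0n fact_gt0.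
have e2 : r ^+ 2 = 2 * (r ^+ 2 / 2) by field.
(* For k = 0 and k = 1 the clipped predecessors in [dfock] have coefficient 0, in agreement with the
   zeros introduced by [shift]. *)
rewrite /hk /dfock /gk -e2; case: k => [|[|k]] /=.
- by rewrite !mul0r !mulr0 !mul0r !subr0 !addr0 expr0 fact0 divr1; ring.
- rewrite subrr mulr0 mulr0 mul0r mul0r !addr0 expr0 expr1 fact0 divr1 mulr1.
  have -> : (1`!%:R : R) = 1 by [].
  rewrite divr1 mulr1 mulrBr; congr (_ - _); first by ring.
  rewrite mulrA -rmorphM (_ : r / 2 * 4 = 2 * r); [by rewrite mulrC|by field].
- have F1 : (k.+1)`!%:R = k.+1%:R * k`!%:R :> R by rewrite factS natrM.
  have F2 : (k.+2)`!%:R = k.+2%:R * (k.+1%:R * k`!%:R) :> R by rewrite factS natrM F1.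
  rewrite mulrDr mulrBr; congr (_ - _ + _).
  + ring.
  + rewrite mulrCA [RHS]mulrA -!(rmorphM (real_complex R)) mulrC; congr (_%:C * _).
    rewrite F1 F2 !exprS; have := f0 k.
    have a1 : (k.+1%:R : R) != 0 by rewrite pnatr_eq0.
    have a2 : (k.+2%:R : R) != 0 by rewrite pnatr_eq0.
    by move: (k.+1%:R : R) (k.+2%:R : R) a1 a2 => c1 c2 a1 a2 fk; field; rewrite a1 a2 fk.
  + rewrite [RHS]mulrA -!(rmorphM (real_complex R)) mulrC; congr (_%:C * _).
    rewrite F2 !exprS; have := f0 k.
    have e1 : k.+2%:R - 1 = k.+1%:R :> R by rewrite -[in LHS]addn1 natrD addrK.
    rewrite e1.
    have a1 : (k.+1%:R : R) != 0 by rewrite pnatr_eq0.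
    have a2 : (k.+2%:R : R) != 0 by rewrite pnatr_eq0.
    by move: (k.+1%:R : R) (k.+2%:R : R) a1 a2 => c1 c2 a1 a2 fk; field; rewrite a1 a2 fk gt_eqF.
Qed.

(** The squared coefficient of e^(r t / 2) times the squared Fock norm of t^k, up to 2 pi: the
    Poisson weight of parameter r^2 / 2. *)
Let coefsq (r : R) k : normc ((r / 2) ^+ k / k`!%:R)%:C ^+ 2 * (2 ^+ k * k`!%:R) =
  exp_coeff (r ^+ 2 / 2) k.
Proof.
rewrite normc_real real_normK ?num_real// /exp_coeff /= !expr_div_n -exprM mulnC exprM.
have f0 : (k`!%:R : R) != 0 by rewrite pnatr_eq0 -lt0n fact_gt0.
have e0 : (2 ^+ k : R) != 0 by rewrite expf_neq0.
by field; rewrite f0 e0.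
Qed.

Let gk_sum r N : \sum_(k < N) normc (gk r k) ^+ 2 * (2 ^+ k * k`!%:R) <= expR (r ^+ 2 / 2).
Proof.
have := @poisson_bound R (fun=> 1) 1 0 0 0 0 (r ^+ 2 / 2) _ (fun=> ler01) _ N.
rewrite !mul0r !addr0 mul1r => /(_ ltac:(by rewrite divr_ge0 ?sqr_ge0) ltac:(by move=> k x; rewrite !mul0r !addr0)).
apply: le_trans; apply: ler_sum => k _.
rewrite /gk normcM exprMn -mulrA coefsq; apply: ler_wpM2r.
  by rewrite exp_coeff_ge0// divr_ge0 ?sqr_ge0.
by rewrite exprn_ile1 ?normc_ge0.
Qed.

Let hk_sum r N : 0 < r -> 1 <= r ^+ 2 / 2 ->
  \sum_(k < N) normc (hk r k) ^+ 2 * (2 ^+ k * k`!%:R) <= 12 * (2 + 6 * A ^+ 2) * expR (r ^+ 2 / 2).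
Proof.
move=> r0 r1; apply: le_trans (dfock_sum N r1); rewrite le_eqVlt; apply/orP; left; apply/eqP.
by apply: eq_bigr => k _; rewrite hkE// normcM exprMn mulrAC coefsq mulrC.
Qed.

Let shift_sum (c : nat -> R[i]) (t : R[i]) N :
  \sum_(k < N.+1) shift c k * t ^+ k = t * \sum_(k < N) c k * t ^+ k.
Proof.
rewrite big_ord_recl mul0r add0r mulr_sumr; apply: eq_bigr => k _.
by rewrite lift0 /= exprS; ring.
Qed.

Let gk_cvg r t : cvgC (fun N => \sum_(k < N) gk r k * t ^+ k) (gfun m ((r / 2)%:C * t)).
Proof.
have := gfun_cvg ((r / 2)%:C * t) m1; congr cvgC; apply/funext => N.
by apply: eq_bigr => k _; rewrite /gk /expcoef exprMn -rmorphXn rmorphM; ring.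
Qed.

(** Each factor t shifts coefficients by one, so the partial sum of [hk] of order N + 2 is built
    from those of [gk] of orders N + 2, N + 1 and N. *)
Let hk_cvg r t : cvgC (fun N => \sum_(k < N.+2) hk r k * t ^+ k)
  ((t - r%:C) ^+ 2 * gfun m ((r / 2)%:C * t)).
Proof.
have r2 : (r ^+ 2)%:C = r%:C ^+ 2 :> R[i] by rewrite rmorphXn.
have rr : (2 * r)%:C = 2 * r%:C :> R[i] by rewrite rmorphM rmorph_nat.
have h0 := gk_cvg r t.
have h1 : cvgC (fun N => \sum_(k < N.+1) gk r k * t ^+ k) (gfun m ((r / 2)%:C * t)).
  by rewrite /cvgC (cvg_shiftS (fun N => normc (\sum_(k < N) gk r k * t ^+ k - gfun m ((r / 2)%:C * t)))).
have h2 : cvgC (fun N => \sum_(k < N.+2) gk r k * t ^+ k) (gfun m ((r / 2)%:C * t)).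
  by rewrite /cvgC (cvg_shiftS (fun N => normc (\sum_(k < N.+1) gk r k * t ^+ k - gfun m ((r / 2)%:C * t)))).
have := cvgCD (cvgCD (cvgCM (cvgC_cst (r ^+ 2)%:C) h2) (cvgCM (cvgC_cst (- (2 * r)%:C * t)) h1))
  (cvgCM (cvgC_cst (t * t)) h0).
rewrite (_ : _ + _ + _ = (t - r%:C) ^+ 2 * gfun m ((r / 2)%:C * t)); last by rewrite r2 rr; ring.
congr cvgC; apply/funext => N.
have -> : \sum_(k < N.+2) hk r k * t ^+ k = (r ^+ 2)%:C * \sum_(k < N.+2) gk r k * t ^+ k -
    (2 * r)%:C * \sum_(k < N.+2) shift (gk r) k * t ^+ k + \sum_(k < N.+2) shift (shift (gk r)) k * t ^+ k.
  by rewrite !mulr_sumr -sumrB -big_split; apply: eq_bigr => k _; rewrite /hk /=; ring.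
by rewrite !shift_sum; ring.
Qed.

Let thetaB (p : P2) (r : R) : theta p - r%:C = theta (p - row_mx 0 (const_mx r)).
Proof.
have E1 : (row_mx 0 (const_mx r) : P2) ord0 (rshift 1 ord0) = r by rewrite row_mxEr mxE.
have E2 : (row_mx 0 (const_mx r) : P2) ord0 (lshift 1 ord0) = 0 by rewrite row_mxEl mxE.
rewrite /theta ![(_ - _ : P2) _ _]mxE ![(- _ : P2) _ _]mxE E1 E2.
by apply: complex_eqP; rewrite /= ?subr0 ?oppr0 ?addr0.
Qed.

(** Translation invariance makes the bound independent of r. In the plane [japN] is (1 + |p|)^(-4),
    and (1 + a)^4 <= 8 (1 + b^4) whenever a^2 <= b^2. *)
Lemma weight_integral : exists2 J : R, 0 <= J & forall r : R,
  (\int[leb (1 + 1)]_p ((1 + normc (theta p - r%:C) ^+ 4)^-1)%:E <= J%:E)%E.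
Proof.
pose I := (\int[leb (1 + 1)]_p (8 * japN p)%:E)%E.
have I0 : (0 <= I)%E by apply: integral_ge0 => p _; rewrite lee_fin mulr_ge0// ltW// japN_gt0.
have Ioo : I \is a fin_num.
  have := integrableZl measurableT 8 (@integrable_japN R (1 + 1)) => i.
  by apply: integrable_fin_num => //; apply: eq_integrable i => // p _ /=; rewrite EFinM.
have mt : mfC (theta : P2 -> R[i]) by have [[]] := @wirtinger_theta R.
have mw : measurable_fun setT (fun p : P2 => ((1 + normc (theta p) ^+ 4)^-1)%:E).
  have mh : measurable_fun setT (fun t : R => (1 + t ^+ 4)^-1).
    apply: continuous_measurable_fun => t; apply: cvgV.
      by rewrite gt_eqF// ltr_wpDr// (_ : t ^+ 4 = (t ^+ 2) ^+ 2) ?sqr_ge0// -exprM.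
    by apply: cvgD; [exact: cvg_cst|exact: exprn_continuous].
  by apply/measurable_EFinP; exact: (measurableT_comp mh (measurable_normc mt)).
exists (fine I); first exact: fine_ge0.
move=> r; rewrite fineK//.
under eq_integral do rewrite thetaB.
rewrite (integral_shift_rV (- row_mx 0 (const_mx r)) mw); last first.
  by move=> p; rewrite lee_fin invr_ge0 addr_ge0// exprn_ge0 ?normc_ge0.
apply: ge0_le_integral => //.
- by move=> p _; rewrite lee_fin invr_ge0 addr_ge0// exprn_ge0 ?normc_ge0.
- apply/measurable_EFinP; apply: measurable_funM => //; exact: measurable_japN.
- move=> p _; rewrite lee_fin /japN.
  have h1 : `|p| ^+ 2 <= normc (theta p) ^+ 2.
    apply: le_trans (sumsq_ge_norm p) _.
    by rewrite normc_sqr big_split_ord /= !big_ord1 addrC.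
  set a := `|p| in h1 *; have a0 : 0 <= a by exact: normr_ge0.
  set b := normc (theta p) in h1 *.
  have b4 : b ^+ 4 = (b ^+ 2) ^+ 2 by rewrite -exprM.
  have p4 : 0 < (1 + a) ^+ (2 * (1 + 1))%N by rewrite exprn_gt0// ltr_wpDr.
  have q4 : 0 < 1 + b ^+ 4 by rewrite b4 ltr_wpDr// sqr_ge0.
  rewrite -[leLHS]mul1r ler_pdivrMr// mulrAC ler_pdivlMr// mul1r.
  rewrite (_ : (2 * (1 + 1))%N = (2 * 2)%N)// exprM b4.
  have h2 : (1 + a) ^+ 2 <= 2 * (1 + a ^+ 2) by have := sqr_ge0 (a - 1); nra.
  have h3 : ((1 + a) ^+ 2) ^+ 2 <= (2 * (1 + b ^+ 2)) ^+ 2.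
    rewrite lerXn2r ?nnegrE ?sqr_ge0//; first by rewrite mulr_ge0// addr_ge0// sqr_ge0.
    by apply: le_trans h2 _; rewrite ler_wpM2l// lerD2l.
  apply: le_trans h3 _; have := sqr_ge0 (b ^+ 2 - 1); move: (b ^+ 2) => c; nra.
Qed.

Lemma normc_gfun s : normc (gfun m s) <= expR (normc s).
Proof.
have cv := cvgC_normc (gfun_cvg s m1).
rewrite -(cvg_lim _ cv)//; apply: limr_le; first by apply/cvg_ex; eexists; exact: cv.
apply: nearW => N; apply: le_trans (ler_normc_sum _ _ _) _.
have := @poisson_bound R (fun=> 1) 1 0 0 0 0 (normc s) (normc_ge0 _) (fun=> ler01) _ N.
rewrite !mul0r !addr0 mul1r => /(_ ltac:(by move=> k x; rewrite !mul0r !addr0)).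
apply: le_trans; apply: ler_sum => k _; rewrite normcM normc_expcoef.
by apply: ler_wpM2r; [rewrite exp_coeff_ge0 ?normc_ge0|].
Qed.

Variables J K : R.
Hypotheses (J0 : 0 <= J) (K0 : 0 <= K).
Hypothesis hJ : forall r : R, (\int[leb (1 + 1)]_p ((1 + normc (theta p - r%:C) ^+ 4)^-1)%:E <= J%:E)%E.
Hypothesis hK : (\int[leb (1 + 1)]_p (expR (- normc (theta p) ^+ 2 / 8))%:E <= K%:E)%E.

Let mt : mfC (theta : P2 -> R[i]). Proof. by have [[]] := @wirtinger_theta R. Qed.
Let mG r : mfC (fun p : P2 => gfun m ((r / 2)%:C * theta p)).
Proof. by apply: mfC_gfun => //; apply: mfCM => //; exact: mfC_cst. Qed.
Let mexp (c : R) : measurable_fun setT (fun p : P2 => expR (- normc (theta p) ^+ 2 / c)).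
Proof.
apply: measurableT_comp => //; apply: measurable_funM => //; apply: measurableT_comp => //.
exact: measurable_normc2.
Qed.
(** 2 pi is the factor of [fock_norm]; the summands 1 and 12 (2 + 6 A^2) bound the sums for [gk] and
    [hk]. *)
Let C1 : R := 2 * pi * (1 + 12 * (2 + 6 * A ^+ 2)).

(** [fock_norm] concerns finite sums; Fatou's lemma passes their uniform bounds to the limit. *)
Let fock_limit r : 0 < r -> 1 <= r ^+ 2 / 2 ->
  (\int[leb (1 + 1)]_p ((normc (gfun m ((r / 2)%:C * theta p)) ^+ 2 +
     normc ((theta p - r%:C) ^+ 2 * gfun m ((r / 2)%:C * theta p)) ^+ 2) * expR (- normc (theta p) ^+ 2 / 2))%:E
   <= (C1 * expR (r ^+ 2 / 2))%:E)%E.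
Proof.
move=> r0 r1.
pose u N p := \sum_(k < N) gk r k * theta p ^+ k.
pose v N p := \sum_(k < N.+2) hk r k * theta p ^+ k.
have mu N : mfC (u N) by apply: mfC_sum => k; apply: mfCM; [exact: mfC_cst|exact: mfCX].
have mv N : mfC (v N) by apply: mfC_sum => k; apply: mfCM; [exact: mfC_cst|exact: mfCX].
have mH : mfC (fun p : P2 => (theta p - r%:C) ^+ 2 * gfun m ((r / 2)%:C * theta p)).
  by apply: mfCM => //; apply: mfCX; apply: mfCB => //; exact: mfC_cst.
have mw N c : measurable_fun setT (fun p : P2 => normc (u N p) ^+ 2 * expR (- normc (theta p) ^+ 2 / c)).
  by apply: measurable_funM => //; exact: measurable_normc2.
have mw' N c : measurable_fun setT (fun p : P2 => normc (v N p) ^+ 2 * expR (- normc (theta p) ^+ 2 / c)).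
  by apply: measurable_funM => //; exact: measurable_normc2.
apply: (@fatou_ae _ _ _ (leb (1 + 1)) (fun N p => (normc (u N p) ^+ 2 + normc (v N p) ^+ 2) * expR (- normc (theta p) ^+ 2 / 2))).
- by move=> N; apply: measurable_funM => //; apply: measurable_funD; exact: measurable_normc2.
- by move=> N p; rewrite mulr_ge0 ?expR_ge0// addr_ge0// sqr_ge0.
- by apply: measurable_funM => //; apply: measurable_funD; exact: measurable_normc2.
- by move=> p; rewrite mulr_ge0 ?expR_ge0// addr_ge0// sqr_ge0.
- apply: aeW => p.
  have h1 := cvgC_normc (gk_cvg r (theta p)); have h2 := cvgC_normc (hk_cvg r (theta p)).
  exact: (cvgM (cvgD (cvgM h1 h1) (cvgM h2 h2)) (cvg_cst (expR (- normc (theta p) ^+ 2 / 2)))).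
- apply: nearW => N.
  under eq_integral do rewrite mulrDl EFinD.
  rewrite ge0_integralD//; last 4 first.
  + by move=> p _; rewrite lee_fin mulr_ge0 ?expR_ge0 ?sqr_ge0.
  + exact/measurable_EFinP.
  + by move=> p _; rewrite lee_fin mulr_ge0 ?expR_ge0 ?sqr_ge0.
  + exact/measurable_EFinP.
  rewrite !fock_norm -EFinD lee_fin -mulrDr /C1 -[leRHS]mulrA; apply: ler_wpM2l.
    by rewrite mulr_ge0// pi_ge0.
  by rewrite mulrDl mul1r; apply: lerD; [exact: gk_sum|exact: hk_sum].
Qed.

(** Cauchy-Schwarz in the pointwise form 2 X <= w + X^2 / w, where X is the integrand divided by
    e^(r^2/4) and w the weight of [weight_integral]. Then X^2 / w is e^(-r^2/2) times the integrand
    of [fock_limit], and both terms integrate to constants. *)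
Lemma plane_bound_large r : 0 < r -> 1 <= r ^+ 2 / 2 ->
  (\int[leb (1 + 1)]_p (expR (- normc (theta p) ^+ 2 / 4) * normc (gfun m ((r / 2)%:C * theta p)))%:E
   <= ((2^-1 * (J + C1)) * expR (r ^+ 2 / 4))%:E)%E.
Proof.
move=> r0 r1.
pose w (p : P2) : R := (1 + normc (theta p - r%:C) ^+ 4)^-1.
pose g (p : P2) : R := (normc (gfun m ((r / 2)%:C * theta p)) ^+ 2 +
     normc ((theta p - r%:C) ^+ 2 * gfun m ((r / 2)%:C * theta p)) ^+ 2) * expR (- normc (theta p) ^+ 2 / 2).
pose c : R := 2^-1 * expR (r ^+ 2 / 4).
pose e : R := expR (- (r ^+ 2 / 2)).
have c0 : 0 <= c by rewrite mulr_ge0// expR_ge0.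
have e0 : 0 <= e by exact: expR_ge0.
have w0 p : 0 < w p.
  rewrite invr_gt0 ltr_wpDr// (_ : normc _ ^+ 4 = (normc (theta p - r%:C) ^+ 2) ^+ 2) ?sqr_ge0//.
  by rewrite -exprM.
have g0 p : 0 <= g p by rewrite mulr_ge0 ?expR_ge0// addr_ge0// sqr_ge0.
have mH : mfC (fun p : P2 => (theta p - r%:C) ^+ 2 * gfun m ((r / 2)%:C * theta p)).
  by apply: mfCM => //; apply: mfCX; apply: mfCB => //; exact: mfC_cst.
have mg : measurable_fun setT (fun p => (g p)%:E).
  by apply/measurable_EFinP; apply: measurable_funM => //; apply: measurable_funD; exact: measurable_normc2.
have mw : measurable_fun setT (fun p => (w p)%:E).
  have mh : measurable_fun setT (fun t : R => (1 + t ^+ 4)^-1).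
    apply: continuous_measurable_fun => t; apply: cvgV.
      by rewrite gt_eqF// ltr_wpDr// (_ : t ^+ 4 = (t ^+ 2) ^+ 2) ?sqr_ge0// -exprM.
    by apply: cvgD; [exact: cvg_cst|exact: exprn_continuous].
  apply/measurable_EFinP; apply: (measurableT_comp mh).
  by apply: measurable_normc; apply: mfCB => //; exact: mfC_cst.
apply: (@le_trans _ _ (\int[leb (1 + 1)]_p (c%:E * ((w p)%:E + e%:E * (g p)%:E)))%E).
  apply: ge0_le_integral => //.
  - by move=> p _; rewrite lee_fin mulr_ge0 ?expR_ge0 ?normc_ge0.
  - by apply/measurable_EFinP; apply: measurable_funM => //; exact: measurable_normc.
  - by apply: measurable_funeM; apply: emeasurable_funD => //; exact: measurable_funeM.
  - move=> p _; rewrite -[(e%:E * _)%E]EFinM -[((w p)%:E + _)%E]EFinD -EFinM lee_fin.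
    set Y := normc (gfun _ _); set t := normc (theta p).
    pose X : R := expR (- t ^+ 2 / 4) * expR (- (r ^+ 2 / 4)) * Y.
    have -> : expR (- t ^+ 2 / 4) * Y = expR (r ^+ 2 / 4) * X.
      have h : expR (r ^+ 2 / 4) * expR (- (r ^+ 2 / 4)) = 1 by rewrite -expRD subrr expR0.
      transitivity (expR (r ^+ 2 / 4) * expR (- (r ^+ 2 / 4)) * (expR (- t ^+ 2 / 4) * Y)).
        by rewrite h mul1r.
      by rewrite /X; ring.
    have X2 : X ^+ 2 = e * (Y ^+ 2 * expR (- t ^+ 2 / 2)).
      rewrite /X /e !exprMn -!expRM_natl (_ : 2%:R * (- t ^+ 2 / 4) = - t ^+ 2 / 2); last by field.
      rewrite (_ : 2%:R * - (r ^+ 2 / 4) = - (r ^+ 2 / 2)); [by ring|by field].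
    have gE : e * g p = X ^+ 2 / w p.
      by rewrite /g X2 /w invrK normcM normcX -/Y -/t; ring.
    rewrite gE (_ : c * _ = expR (r ^+ 2 / 4) * (2^-1 * (w p + X ^+ 2 / w p))); last by rewrite /c; ring.
    apply: ler_wpM2l; first exact: expR_ge0.
    have h : X ^+ 2 = w p * (X ^+ 2 / w p) by rewrite mulrCA mulfV ?mulr1// gt_eqF.
    move: h; set q := X ^+ 2 / w p => h.
    have wp := w0 p.
    have : 4 * X ^+ 2 <= (w p + q) ^+ 2 by rewrite h; have := sqr_ge0 (w p - q); rewrite sqrrB sqrrD; lra.
    have q0 : 0 <= q by rewrite divr_ge0 ?sqr_ge0// ltW.
    have X0 : 0 <= X by rewrite !mulr_ge0 ?expR_ge0 ?normc_ge0.
    rewrite (_ : 4 * X ^+ 2 = (2 * X) ^+ 2); last by ring.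
    have s1 : 0 <= 2 * X by rewrite mulr_ge0.
    have s2 : 0 <= w p + q by rewrite addr_ge0// ltW.
    rewrite (@ler_pXn2r _ 2)// => h2.
    by rewrite mulrC ler_pdivlMr// mulrC.
rewrite ge0_integralZl//; last 2 first.
- by apply: emeasurable_funD => //; exact: measurable_funeM.
- by move=> p _; rewrite adde_ge0 ?lee_fin ?(ltW (w0 p))// mulr_ge0.
rewrite ge0_integralD//; last 3 first.
- by move=> p _; rewrite lee_fin ltW.
- by move=> p _; rewrite -EFinM lee_fin mulr_ge0.
- exact: measurable_funeM.
rewrite ge0_integralZl//; last by move=> p _; rewrite lee_fin.
apply: (@le_trans _ _ (c%:E * (J%:E + e%:E * (C1 * expR (r ^+ 2 / 2))%:E))%E).
  apply: lee_wpmul2l; first by rewrite lee_fin.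
  by apply: leeD; [exact: hJ|apply: lee_wpmul2l; [rewrite lee_fin|exact: fock_limit]].
have eE : e * expR (r ^+ 2 / 2) = 1 by rewrite /e -expRD addNr expR0.
rewrite (_ : (c%:E * _)%E = (c * (J + e * (C1 * expR (r ^+ 2 / 2))))%:E)// lee_fin.
rewrite (_ : e * _ = C1 * (e * expR (r ^+ 2 / 2))); last by ring.
by rewrite eE mulr1 /c mulrAC.
Qed.

(** The estimate through [dfock] covers rho >= 1. For smaller r the crude |G(r s / 2)| <= e^(r |s| /
    2) suffices, because r t / 2 <= t^2 / 8 + r^2 / 2. *)
Lemma plane_bound_small r : 0 <= r -> r ^+ 2 / 2 <= 1 ->
  (\int[leb (1 + 1)]_p (expR (- normc (theta p) ^+ 2 / 4) * normc (gfun m ((r / 2)%:C * theta p)))%:E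
   <= (expR 1 * K)%:E)%E.
Proof.
move=> r0 r1.
apply: (@le_trans _ _ (\int[leb (1 + 1)]_p ((expR 1)%:E * (expR (- normc (theta p) ^+ 2 / 8))%:E))%E).
  apply: ge0_le_integral => //.
  - by move=> p _; rewrite lee_fin mulr_ge0 ?expR_ge0 ?normc_ge0.
  - by apply/measurable_EFinP; apply: measurable_funM => //; exact: measurable_normc.
  - by apply: measurable_funeM; apply/measurable_EFinP.
  - move=> p _; rewrite -EFinM lee_fin -expRD.
    apply: le_trans (ler_wpM2l (expR_ge0 _) (normc_gfun _)) _.
    rewrite -expRD ler_expR normcM normc_real ger0_norm ?divr_ge0//.
    set t := normc (theta p); have := sqr_ge0 (t - 2 * r); rewrite sqrrB exprMn; lra.
have m8 : measurable_fun setT (fun p : P2 => (expR (- normc (theta p) ^+ 2 / 8))%:E) by exact/measurable_EFinP.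
rewrite (ge0_integralZl (leb (1 + 1)) measurableT m8); last 2 first.
- by move=> p _; rewrite lee_fin expR_ge0.
- by rewrite lee_fin expR_ge0.
by rewrite EFinM; apply: lee_wpmul2l => //; rewrite lee_fin expR_ge0.
Qed.

End plane_estimate.

Section plane_bound.
Context {R : realType}.
Local Notation leb n := (lebesgue_rV R n).

Lemma plane_gaussian (c : R) : 0 < c ->
  (\int[leb (1 + 1)]_p (expR (- normc (theta p) ^+ 2 / c))%:E < +oo)%E.
Proof.
move=> c0.
have [[mt _] _ _ _ _] := @wirtinger_theta R.
have h (p : 'rV[R]_(1 + 1)) : complex.Re (- normc (theta p) ^+ 2 / c)%:C <= 0 * `|p| - c^-1 * `|p| ^+ 2.
  rewrite mul0r sub0r (_ : complex.Re _ = - (c^-1 * normc (theta p) ^+ 2)); last first.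
    by change (- normc (theta p) ^+ 2 / c = - (c^-1 * normc (theta p) ^+ 2)); rewrite mulNr mulrC.
  rewrite lerN2 ler_pM2l ?invr_gt0//; apply: le_trans (sumsq_ge_norm p) _.
  by rewrite normc_sqr big_split_ord /= !big_ord1 addrC.
have ci : 0 < c^-1 by rewrite invr_gt0.
have mq : mfC (fun p : 'rV[R]_(1 + 1) => (- normc (theta p) ^+ 2 / c)%:C).
  by apply: mfC_real; apply: measurable_funM => //; apply: measurableT_comp => //; exact: measurable_normc2.
have [_] := intgC_polyb_cexp ci (polyb_cst _ 1) mq h.
congr (_ < _)%E; apply: eq_integral => p _.
by rewrite mul1r cexp_real normc_real ger0_norm ?expR_ge0.
Qed.

Lemma plane_bound (A : R) : 0 <= A -> exists2 C : R, 0 < C & forall m : nat -> R[i],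
  (forall k, normc (m k) <= 1) ->
  (forall k, k.+1%:R * normc (m k.+1 - m k) ^+ 2 <= A ^+ 2) ->
  (forall k, k.+1%:R * normc (m k.+2 - 2 * m k.+1 + m k) <= A) ->
  forall r, 0 <= r ->
  (\int[leb (1 + 1)]_p (expR (- normc (theta p) ^+ 2 / 4) * normc (gfun m ((r / 2)%:C * theta p)))%:E
   <= (C * expR (r ^+ 2 / 4))%:E)%E.
Proof.
move=> A0; have [J J0 hJ] := @weight_integral R.
have K8 := @plane_gaussian 8 ltac:(by []).
set I8 := (\int[_]_p _)%E in K8.
have I80 : (0 <= I8)%E by apply: integral_ge0 => p _; rewrite lee_fin expR_ge0.
have hK : (I8 <= (fine I8)%:E)%E by rewrite fineK// ge0_fin_numE.
have K0 : 0 <= fine I8 by exact: fine_ge0.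
pose C1 : R := 2 * pi * (1 + 12 * (2 + 6 * A ^+ 2)).
have C10 : 0 < C1.
  rewrite mulr_gt0 ?mulr_gt0 ?pi_gt0//; have := sqr_ge0 A; lra.
exists (2^-1 * (J + C1) + expR 1 * fine I8).
  by rewrite ltr_wpDr ?mulr_ge0 ?expR_ge0// mulr_gt0// ltr_wpDl.
move=> m m1 m2 m3 r r0.
have e1 : 1 <= expR (r ^+ 2 / 4).
  by rewrite -expR0 ler_expR divr_ge0 ?sqr_ge0.
have X0 : 0 <= 2^-1 * (J + C1) by rewrite mulr_ge0// addr_ge0// ltW.
have [r1|r1] := leP 1 (r ^+ 2 / 2).
  have rp : 0 < r.
    rewrite lt_neqAle r0 andbT eq_sym; apply/eqP => e; move: r1; rewrite e expr0n mul0r; lra.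
  apply: le_trans (plane_bound_large A0 m1 m2 m3 hJ rp r1) _.
  by rewrite lee_fin ler_wpM2r ?expR_ge0// lerDl mulr_ge0// expR_ge0.
apply: le_trans (plane_bound_small m1 hK r0 (ltW r1)) _.
rewrite lee_fin -[leLHS]mulr1; apply: ler_pM => //; first by rewrite mulr_ge0// expR_ge0.
by rewrite lerDr.
Qed.

End plane_bound.

(** * Gaussian integrals of a linear form *)

Section plane_rotation.
Context {R : realType}.
Local Notation leb n := (lebesgue_rV R n).
Local Notation leb1 := (@lebesgue_measure R).
Local Notation mR := (measurableTypeR R).
Local Notation P2 := 'rV[R]_(1 + 1).
Local Open Scope ereal_scope.

Let plane_meas (f : R -> R -> \bar R) (a b c e : R) :
  measurable_fun setT (fun p : mR * mR => f p.1 p.2) ->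
  measurable_fun setT (fun p : mR * mR => f (a * p.1 + b * p.2)%R (c * p.1 + e * p.2)%R).
Proof.
move=> mf.
have mh : measurable_fun setT (fun p : mR * mR => ((a * p.1 + b * p.2)%R : mR, (c * p.1 + e * p.2)%R : mR)).
  by apply: measurable_fun_pair; apply: measurable_funD; apply: measurable_funM;
    rewrite //; (exact: measurable_fst || exact: measurable_snd).
exact: (measurableT_comp mf mh).
Qed.

Let shear2 (f : R -> R -> \bar R) (c : R) :
  measurable_fun setT (fun p : mR * mR => f p.1 p.2) -> (forall t s, 0 <= f t s) ->
  \int[leb1]_t \int[leb1]_s f t (s + c * t)%R = \int[leb1]_t \int[leb1]_s f t s.
Proof.
move=> mf f0; apply: eq_integral => t _.
have mft : measurable_fun setT (f t).
  exact: (measurableT_comp mf (pair1_measurable t)).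
have := integral_affine (c * t)%R (oner_neq0 R) mft (f0 t).
rewrite normr1 invr1 mul1e => <-; apply: eq_integral => s _; by rewrite mul1r.
Qed.

Let swap (f : R -> R -> \bar R) :
  measurable_fun setT (fun p : mR * mR => f p.1 p.2) -> (forall t s, 0 <= f t s) ->
  \int[leb1]_t \int[leb1]_s f t s = \int[leb1]_s \int[leb1]_t f t s.
Proof.
by move=> mf f0; exact: (@fubini_tonelli _ _ _ _ _ leb1 leb1 (fun p => f p.1 p.2)).
Qed.

Let shear1 (f : R -> R -> \bar R) (c : R) :
  measurable_fun setT (fun p : mR * mR => f p.1 p.2) -> (forall t s, 0 <= f t s) ->
  \int[leb1]_t \int[leb1]_s f (t + c * s)%R s = \int[leb1]_t \int[leb1]_s f t s.
Proof.
move=> mf f0.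
have mf' : measurable_fun setT (fun p : mR * mR => f p.2 p.1).
  exact: (measurableT_comp mf (@measurable_swap _ _ _ _)).
have mf1 : measurable_fun setT (fun p : mR * mR => f (p.1 + c * p.2)%R p.2).
  have := @plane_meas f 1 c 0 1 mf; apply: eq_measurable_fun => p _.
  by rewrite !mul1r mul0r add0r.
rewrite (swap mf1)// (swap mf)//.
exact: (@shear2 (fun s t => f t s) c).
Qed.

(** A rotation other than plus or minus the identity is a product of three shears, two of them with
    parameter (1 - a) / b, the tangent of the half angle. Each shear preserves the integral by
    Tonelli and translation on a line. *)
Lemma integral_rotation (k : R[i] -> \bar R) (u : R[i]) :
  measurable_fun setT (fun p : P2 => k (theta p)) -> (forall z, 0 <= k z) -> normc u = 1%R ->
  \int[leb (1 + 1)]_p k (u * theta p)%R = \int[leb (1 + 1)]_p k (theta p).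
Proof.
move=> mk k0 u1; pose f (t s : R) := k (s +i* t).
have mf : measurable_fun setT (fun p : mR * mR => f p.1 p.2).
  pose q (p : mR * mR) : P2 := row_mx (const_mx p.1) (const_mx p.2).
  have mq : measurable_fun setT q.
    apply: measurable_row_mx; apply: measurable_fun_rV => i; under eq_fun do rewrite mxE.
      exact: measurable_fst.
    exact: measurable_snd.
  have := measurableT_comp mk mq; congr (measurable_fun _ _); apply/funext => p.
  by rewrite /f /q /= /theta row_mxEr row_mxEl !mxE.
have f0 t s : 0 <= f t s by exact: k0.
have e0 : \int[leb (1 + 1)]_p k (theta p) = \int[leb1]_t \int[leb1]_s f t s.
  by rewrite -integral_plane.
case: u u1 => a b u1.
have ab : (a ^+ 2 + b ^+ 2 = 1)%R.
  by have := normc_sqr (a +i* b); rewrite u1 expr1n => <-.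
have [b0|b0] := eqVneq b 0%R.
  move: ab; rewrite b0 expr0n addr0 => /eqP; rewrite sqrf_eq1 => /orP[] /eqP ->.
    by apply: eq_integral => p _; rewrite mul1r.
  rewrite -(integral_reflect_rV 0 mk)//; apply: eq_integral => p _; congr k.
  by apply: complex_eqP; rewrite !(ReM, ImM) /theta !mxE /=; ring.
pose c := ((1 - a) / b)%R.
have e1 : \int[leb (1 + 1)]_p k ((a +i* b) * theta p)%R =
    \int[leb1]_t \int[leb1]_s f (a * t + b * s)%R (- b * t + a * s)%R.
  rewrite -integral_plane//; last exact: plane_meas.
  apply: eq_integral => p _; congr k.
  by apply: complex_eqP; rewrite !(ReM, ImM) /theta /=; ring.
rewrite e1 e0.
pose f1 t s := f (t + c * s)%R s.
pose f2 t s := f1 t (s + - b * t)%R.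
have m1 : measurable_fun setT (fun p : mR * mR => f1 p.1 p.2).
  have := @plane_meas f 1 c 0 1 mf; apply: eq_measurable_fun => p _.
  by rewrite !mul1r mul0r add0r.
have m2 : measurable_fun setT (fun p : mR * mR => f2 p.1 p.2).
  have := @plane_meas f1 1 0 (- b) 1 m1; apply: eq_measurable_fun => p _.
  by rewrite !mul1r mul0r addr0 [(_ + p.2)%R]addrC.
have f10 t s : 0 <= f1 t s by exact: f0.
have f20 t s : 0 <= f2 t s by exact: f10.
rewrite -(shear1 c mf f0) -[RHS]/(\int[leb1]_t \int[leb1]_s f1 t s).
rewrite -(shear2 (- b) m1 f10) -[RHS]/(\int[leb1]_t \int[leb1]_s f2 t s) -(shear1 c m2 f20).
apply: eq_integral => t _; apply: eq_integral => s _.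
have hb : (b * s = (1 - a ^+ 2) / b * s)%R.
  by rewrite -ab addrAC subrr add0r expr2 mulfK.
rewrite /f2 /f1 /f; congr k; apply: complex_eqP => /=.
- by rewrite /c; field.
- by rewrite hb /c; field.
Qed.

End plane_rotation.

Lemma integralZR {d : measure_display} {T : measurableType d} {R : realType}
    (mu : {measure set T -> \bar R}) (f : T -> R) (c : R) : 0 <= c ->
  measurable_fun setT f -> (forall x, 0 <= f x) ->
  (\int[mu]_x (c * f x)%:E = c%:E * \int[mu]_x (f x)%:E)%E.
Proof.
move=> c0 mf f0; under eq_integral do rewrite EFinM.
rewrite ge0_integralZl//; [exact/measurable_EFinP|by move=> x _; rewrite lee_fin].
Qed.

Lemma tonelliR {d1 d2 : measure_display} {T1 : measurableType d1} {T2 : measurableType d2}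
    {R : realType} (m1 : {sigma_finite_measure set T1 -> \bar R})
    (m2 : {sigma_finite_measure set T2 -> \bar R}) (f : T1 -> T2 -> R) :
  measurable_fun setT (fun p : T1 * T2 => f p.1 p.2) -> (forall x y, 0 <= f x y) ->
  (\int[m1]_x \int[m2]_y (f x y)%:E = \int[m2]_y \int[m1]_x (f x y)%:E)%E.
Proof.
move=> mf f0; apply: (@fubini_tonelli _ _ _ _ _ m1 m2 (fun p => (f p.1 p.2)%:E)).
  exact/measurable_EFinP.
by move=> p; rewrite lee_fin.
Qed.

(** * Sums of independent planar Gaussians *)

Section gaussian_sum.
Context {R : realType}.
Local Notation leb n := (lebesgue_rV R n).
Local Notation P2 := 'rV[R]_(1 + 1).

Definition gau (p : P2) : R := expR (- normc (theta p) ^+ 2 / 4).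

Lemma gau_ge0 p : 0 <= gau p. Proof. exact: expR_ge0. Qed.

Lemma mfC_theta : mfC (theta : P2 -> R[i]).
Proof. by have [[]] := @wirtinger_theta R. Qed.

Lemma measurable_gau : measurable_fun setT gau.
Proof.
apply: measurableT_comp => //; apply: measurable_funM => //; apply: measurableT_comp => //.
by apply: measurable_normc2; exact: mfC_theta.
Qed.

Definition cpl (z : R[i]) : P2 := row_mx (const_mx (complex.Im z)) (const_mx (complex.Re z)).

Lemma theta_cpl z : theta (cpl z) = z.
Proof. by rewrite /theta /cpl row_mxEr row_mxEl !mxE; case: z. Qed.

Lemma theta_affine (c : R) (p a : P2) : theta (c *: p + a) = c%:C * theta p + theta a.
Proof. by apply: complex_eqP; rewrite !(ReD, ImD, ReM, ImM) /theta !mxE /=; ring. Qed.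

Lemma measurable_ofC {d : measure_display} {T : measurableType d} (h : R[i] -> R) (F : T -> R[i]) :
  measurable_fun setT (fun p : P2 => h (theta p)) -> mfC F -> measurable_fun setT (fun x => h (F x)).
Proof.
move=> mh [mR mI].
have mq : measurable_fun setT (fun x => cpl (F x)).
  by apply: measurable_row_mx; apply: measurable_fun_rV => i; under eq_fun do rewrite mxE.
have := measurableT_comp mh mq; congr (measurable_fun _ _); apply/funext => x.
by rewrite /= theta_cpl.
Qed.

Lemma integral_scale (k : R[i] -> R) (c : R) (a : R[i]) : c != 0 ->
  measurable_fun setT (fun p : P2 => k (theta p)) -> (forall z, 0 <= k z) ->
  (\int[leb (1 + 1)]_p (k (c%:C * theta p + a))%:E =
   ((c ^+ 2)^-1)%:E * \int[leb (1 + 1)]_p (k (theta p))%:E)%E.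
Proof.
move=> c0 mk k0.
have mke : measurable_fun setT (fun p : P2 => (k (theta p))%:E) by exact/measurable_EFinP.
have k0e p : (0 <= (k (theta p))%:E)%E by rewrite lee_fin.
have := integral_affine_rV (cpl a) c0 mke k0e.
rewrite (_ : `|c| ^+ (1 + 1) = c ^+ 2); last by rewrite -[RHS]real_normK ?num_real.
by move=> <-; apply: eq_integral => p _; rewrite theta_affine theta_cpl.
Qed.

Lemma integral_gau : (\int[leb (1 + 1)]_p (gau p)%:E = (4 * pi)%:E)%E.
Proof.
have s2 : (Num.sqrt 2^-1 : R) ^+ 2 = 2^-1 by rewrite sqr_sqrtr.
have c0 : Num.sqrt 2^-1 != 0 :> R by rewrite gt_eqF// sqrtr_gt0 invr_gt0.
pose k (z : R[i]) : R := expR (- normc z ^+ 2 / 2).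
have mk : measurable_fun setT (fun p : P2 => k (theta p)).
  apply: measurableT_comp => //; apply: measurable_funM => //; apply: measurableT_comp => //.
  by apply: measurable_normc2; exact: mfC_theta.
have := integral_scale 0 c0 mk (fun=> expR_ge0 _).
have := @fock_norm R 1 (fun=> 1); rewrite big_ord1 normc1 expr1n fact0 expr0 !mulr1 => F.
rewrite s2 invrK (_ : (\int[leb (1 + 1)]_p (k (theta p))%:E)%E = (2 * pi)%:E); last first.
  by rewrite -F; apply: eq_integral => p _; rewrite big_ord1 expr0 mulr1 normc1 expr1n mul1r.
rewrite -EFinM mulrA (_ : 2 * 2 = 4 :> R); last by ring.
move=> <-; apply: eq_integral => p _; rewrite addr0 /k /gau normcM exprMn normc_real.
by rewrite real_normK ?num_real// s2; congr ((expR _)%:E); field.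
Qed.

Let mgh (h : R[i] -> R) (F : P2 -> R[i]) : measurable_fun setT (fun p : P2 => h (theta p)) ->
  mfC F -> measurable_fun setT (fun p : P2 => (gau p * h (F p))%:E).
Proof.
move=> mh mF; apply/measurable_EFinP; apply: measurable_funM; first exact: measurable_gau.
exact: measurable_ofC.
Qed.

(** Rotation invariance of the Gaussian: only the modulus of the coefficient matters. *)
Lemma gau_rotate (h : R[i] -> R) (c v : R[i]) :
  measurable_fun setT (fun p : P2 => h (theta p)) -> (forall z, 0 <= h z) ->
  (\int[leb (1 + 1)]_p (gau p * h (c * theta p + v))%:E =
   \int[leb (1 + 1)]_p (gau p * h ((normc c)%:C * theta p + v))%:E)%E.
Proof.
move=> mh h0; have [->|c0] := eqVneq c 0; first by rewrite normc0.
have n0 : 0 < normc c.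
  by rewrite lt_neqAle normc_ge0 andbT eq_sym; apply: contra c0 => /eqP/eq0_normc ->.
pose k (z : R[i]) : \bar R := (expR (- normc z ^+ 2 / 4) * h ((normc c)%:C * z + v))%:E.
have u1 : normc (c * ((normc c)^-1)%:C) = 1.
  by rewrite normcM normc_real ger0_norm ?invr_ge0 ?(ltW n0)// mulfV// gt_eqF.
rewrite -(@integral_rotation R k (c * ((normc c)^-1)%:C))//; first last.
- by move=> z; rewrite lee_fin mulr_ge0 ?expR_ge0.
- apply: mgh => //; apply: mfCD; last exact: mfC_cst.
  by apply: mfCM; [exact: mfC_cst|exact: mfC_theta].
apply: eq_integral => p _; rewrite /k normcM u1 mul1r /gau; congr (_ * h (_ + v))%:E.
have e : (normc c)%:C * ((normc c)^-1)%:C = 1 :> R[i] by rewrite -rmorphM mulfV// gt_eqF.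
rewrite (_ : (normc c)%:C * _ = (normc c)%:C * ((normc c)^-1)%:C * (c * theta p)); last by ring.
by rewrite e mul1r.
Qed.

(** The joint exponent of P and of q = (Q - r1 P) / r2 is regrouped as a term in Q alone plus a
    square that can be integrated out in P. *)
Let complete_square (r1 r2 s : R) (P Q : R[i]) : r2 != 0 -> s != 0 -> s ^+ 2 = r1 ^+ 2 + r2 ^+ 2 ->
  normc P ^+ 2 + normc ((r2^-1)%:C * (Q - r1%:C * P)) ^+ 2 =
  normc Q ^+ 2 / s ^+ 2 + normc ((s / r2)%:C * P + (- (r1 / (s * r2)))%:C * Q) ^+ 2.
Proof.
move=> r20 s0 s2.
have H (a b : R) : a ^+ 2 + (r2^-1 * (b - r1 * a)) ^+ 2 =
    b ^+ 2 / s ^+ 2 + (s / r2 * a + - (r1 / (s * r2)) * b) ^+ 2.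
  have -> : (s / r2 * a + - (r1 / (s * r2)) * b) ^+ 2 =
      s ^+ 2 * a ^+ 2 / r2 ^+ 2 - 2 * r1 * a * b / r2 ^+ 2 + r1 ^+ 2 * b ^+ 2 / (s ^+ 2 * r2 ^+ 2).
    by field; rewrite s0 r20.
  have S0 : r1 ^+ 2 + r2 ^+ 2 != 0 by rewrite -s2 expf_neq0.
  by rewrite s2; field; rewrite S0 r20.
rewrite !normc_sqr mulrDl addrACA [RHS]addrACA; congr (_ + _).
- case: P Q => a b [a' b']; rewrite !(ReM, ReD, ImM, ImD, ReN, ImN) /= !mul0r !subr0; exact: H.
- case: P Q => a b [a' b']; rewrite !(ReM, ReD, ImM, ImD, ReN, ImN) /= !mul0r !addr0; exact: H.
Qed.

Let mfC_pair1 c : mfC (fun x : P2 * P2 => c * theta x.1).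
Proof. by apply: mfCM; [exact: mfC_cst|exact: (mfC_comp mfC_theta measurable_fst)]. Qed.
Let mfC_pair2 c : mfC (fun x : P2 * P2 => c * theta x.2).
Proof. by apply: mfCM; [exact: mfC_cst|exact: (mfC_comp mfC_theta measurable_snd)]. Qed.
Let mgau1 : measurable_fun setT (fun x : P2 * P2 => gau x.1).
Proof. exact: (measurableT_comp measurable_gau measurable_fst). Qed.
Let mgau2 : measurable_fun setT (fun x : P2 * P2 => gau x.2).
Proof. exact: (measurableT_comp measurable_gau measurable_snd). Qed.

(** Change q into Q = r1 P + r2 q, then integrate P out by [complete_square]; what remains is a
    Gaussian in Q of scale s. *)
Let gau_sum2_pos (h : R[i] -> R) (r1 r2 : R) :
  measurable_fun setT (fun p : P2 => h (theta p)) -> (forall z, 0 <= h z) -> 0 < r2 ->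
  (\int[leb (1 + 1)]_p \int[leb (1 + 1)]_q (gau p * gau q * h (r1%:C * theta p + r2%:C * theta q))%:E =
   (4 * pi)%:E * \int[leb (1 + 1)]_p (gau p * h ((Num.sqrt (r1 ^+ 2 + r2 ^+ 2))%:C * theta p))%:E)%E.
Proof.
move=> mh h0 r2p; set s := Num.sqrt _.
have S0 : 0 < r1 ^+ 2 + r2 ^+ 2 by rewrite ltr_wpDl ?sqr_ge0// exprn_gt0.
have s0 : 0 < s by rewrite sqrtr_gt0.
have s2 : s ^+ 2 = r1 ^+ 2 + r2 ^+ 2 by rewrite sqr_sqrtr// ltW.
have r20 : r2 != 0 by rewrite gt_eqF.
have sn0 : s != 0 by rewrite gt_eqF.
pose E (P Q : R[i]) : R := expR (- normc ((r2^-1)%:C * (Q - r1%:C * P)) ^+ 2 / 4).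
pose D (P Q : R[i]) : R := expR (- normc ((s / r2)%:C * P + (- (r1 / (s * r2)))%:C * Q) ^+ 2 / 4).
pose B (Q : R[i]) : R := expR (- (normc Q ^+ 2 / s ^+ 2) / 4).
have mE P : measurable_fun setT (fun q : P2 => E P (theta q) * h (theta q)).
  apply: measurable_funM => //; apply: measurableT_comp => //; apply: measurable_funM => //.
  apply: measurableT_comp => //; apply: measurable_normc2; apply: mfCM; first exact: mfC_cst.
  by apply: mfCB; [exact: mfC_theta|exact: mfC_cst].
have mE2 : measurable_fun setT (fun x : P2 * P2 => E (theta x.1) (theta x.2)).
  apply: measurableT_comp => //; apply: measurable_funM => //.
  apply: measurableT_comp => //; apply: measurable_normc2; apply: mfCM; first exact: mfC_cst.
  by apply: mfCB; [exact: (mfC_comp mfC_theta measurable_snd)|exact: mfC_pair1].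
have mh2 : measurable_fun setT (fun x : P2 * P2 => h (theta x.2)).
  exact: (measurableT_comp mh measurable_snd).
have mB : measurable_fun setT (fun q : P2 => B (theta q) * h (theta q)).
  apply: measurable_funM => //; apply: measurableT_comp => //; apply: measurable_funM => //.
  apply: measurableT_comp => //; apply: measurable_funM => //.
  by apply: measurable_normc2; exact: mfC_theta.
have e0 P Q : 0 <= E P Q * h Q by rewrite mulr_ge0 ?expR_ge0.
have gE P Q : expR (- normc P ^+ 2 / 4) * E P Q = B Q * D P Q.
  rewrite -!expRD; congr expR; rewrite -!mulrDl -!opprD; congr (- _ / _).
  exact: complete_square.
pose c : R := (r2 ^+ 2)^-1.
have c0 : 0 <= c by rewrite invr_ge0 sqr_ge0.
pose F (x : P2 * P2) : R := c * (gau x.1 * (E (theta x.1) (theta x.2) * h (theta x.2))).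
have mF : measurable_fun setT F.
  by apply: measurable_funM => //; apply: measurable_funM => //; exact: measurable_funM.
have F0 x : 0 <= F x by rewrite mulr_ge0// mulr_ge0// gau_ge0.
transitivity (\int[leb (1 + 1)]_p \int[leb (1 + 1)]_q (F (p, q))%:E)%E.
  apply: eq_integral => p _.
  have H := integral_scale (r1%:C * theta p) r20 (mE (theta p)) (e0 (theta p)).
  rewrite (eq_integral (fun q => (gau p * (E (theta p) (r2%:C * theta q + r1%:C * theta p) *
    h (r2%:C * theta q + r1%:C * theta p)))%:E)); last first.
    move=> q _; rewrite [r2%:C * _ + _]addrC -mulrA; congr ((_ * (_ * _))%:E).
    rewrite /gau /E addrAC subrr add0r mulrA -rmorphM mulVf// mul1r//.
  have mq : measurable_fun setT (fun q : P2 => E (theta p) (r2%:C * theta q + r1%:C * theta p) *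
      h (r2%:C * theta q + r1%:C * theta p)).
    apply: (measurable_ofC (h := fun z => E (theta p) z * h z)) => //.
    by apply: mfCD; [apply: mfCM; [exact: mfC_cst|exact: mfC_theta]|exact: mfC_cst].
  rewrite integralZR ?gau_ge0// H -(integralZR (leb (1 + 1)) c0)//.
  rewrite -integralZR ?gau_ge0//; last 2 first.
  - exact: measurable_funM.
  - by move=> q; rewrite mulr_ge0.
  by apply: eq_integral => q _; rewrite /F /= mulrCA.
have mF' : measurable_fun setT (fun x : P2 * P2 => F (x.1, x.2)).
  by rewrite (_ : (fun _ => _) = F)//; apply/funext => -[].
rewrite (@tonelliR _ _ _ _ _ (leb (1 + 1)) (leb (1 + 1)) (fun p q => F (p, q)) mF' (fun p q => F0 (p, q))).
have inner q : (\int[leb (1 + 1)]_p (F (p, q))%:E = (4 * pi * (s ^+ 2)^-1 * (B (theta q) * h (theta q)))%:E)%E.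
  transitivity (\int[leb (1 + 1)]_p (c * (B (theta q) * h (theta q)) * D (theta p) (theta q))%:E)%E.
    apply: eq_integral => p _; congr (_%:E); rewrite /F /= (mulrA (gau p)) (gE (theta p)); ring.
  have mD : measurable_fun setT (fun p : P2 => D (theta p) (theta q)).
    apply: measurableT_comp => //; apply: measurable_funM => //; apply: measurableT_comp => //.
    apply: measurable_normc2; apply: mfCD; last exact: mfC_cst.
    by apply: mfCM; [exact: mfC_cst|exact: mfC_theta].
  have BH0 : 0 <= B (theta q) * h (theta q) by rewrite mulr_ge0 ?expR_ge0.
  rewrite integralZR//; last 2 first.
  - by rewrite mulr_ge0.
  - by move=> p; exact: expR_ge0.
  have c1 : s / r2 != 0 by rewrite mulf_neq0// invr_eq0.
  have := @integral_scale (fun z => expR (- normc z ^+ 2 / 4)) (s / r2) ((- (r1 / (s * r2)))%:C * theta q) c1 measurable_gau (fun=> expR_ge0 _).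
  rewrite -/(D _ _) => ->; rewrite integral_gau -!EFinM; congr (_%:E).
  by rewrite /c; field; rewrite sn0 r20.
under eq_integral do rewrite inner.
rewrite integralZR//; last 2 first.
- by rewrite mulr_ge0 ?invr_ge0 ?sqr_ge0// mulr_ge0// pi_ge0.
- by move=> q; rewrite mulr_ge0 ?expR_ge0.
have := @integral_scale (fun z => B z * h z) s 0 sn0 mB (fun z => mulr_ge0 (expR_ge0 _) (h0 z)).
rewrite EFinM -muleA => <-; congr (_ * _)%E; apply: eq_integral => q _.
rewrite addr0 /B /gau normcM exprMn normc_real real_normK ?num_real// mulrAC mulfV ?mul1r//.
by rewrite expf_neq0.
Qed.

(** [gau_rotate] replaces the complex coefficients by their moduli one at a time, with Tonelli in
    between. If the second modulus is 0 its variable simply integrates to 4 pi; otherwise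
    [gau_sum2_pos] applies. *)
Lemma gau_sum2 (h : R[i] -> R) (c1 c2 v : R[i]) :
  measurable_fun setT (fun p : P2 => h (theta p)) -> (forall z, 0 <= h z) ->
  (\int[leb (1 + 1)]_p \int[leb (1 + 1)]_q (gau p * gau q * h (c1 * theta p + c2 * theta q + v))%:E =
   (4 * pi)%:E * \int[leb (1 + 1)]_p
     (gau p * h ((Num.sqrt (normc c1 ^+ 2 + normc c2 ^+ 2))%:C * theta p + v))%:E)%E.
Proof.
move=> mh h0.
have mG (a b w : R[i]) : measurable_fun setT (fun x : P2 * P2 =>
    gau x.1 * gau x.2 * h (a * theta x.1 + b * theta x.2 + w)).
  apply: measurable_funM; first exact: measurable_funM.
  by apply: measurable_ofC => //; apply: mfCD; [apply: mfCD|exact: mfC_cst].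
have G0 (a b w : R[i]) (p q : P2) : 0 <= gau p * gau q * h (a * theta p + b * theta q + w).
  by rewrite mulr_ge0// mulr_ge0 ?gau_ge0.
have inner (a b : R[i]) p : (\int[leb (1 + 1)]_q (gau p * gau q * h (a * theta p + b * theta q + v))%:E =
   \int[leb (1 + 1)]_q (gau p * gau q * h (a * theta p + (normc b)%:C * theta q + v))%:E)%E.
  have e z : (\int[leb (1 + 1)]_q (gau p * gau q * h (a * theta p + z * theta q + v))%:E =
      (gau p)%:E * \int[leb (1 + 1)]_q (gau q * h (z * theta q + (a * theta p + v)))%:E)%E.
    rewrite -integralZR ?gau_ge0//; last 2 first.
    - apply/measurable_EFinP; apply: mgh => //; apply: mfCD; last exact: mfC_cst.
      by apply: mfCM; [exact: mfC_cst|exact: mfC_theta].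
    - by move=> q; rewrite mulr_ge0 ?gau_ge0.
    apply: eq_integral => q _; rewrite mulrA; congr ((_ * h _)%:E); ring.
  by rewrite !e gau_rotate.
under eq_integral do rewrite inner.
rewrite (@tonelliR _ _ _ _ _ (leb (1 + 1)) (leb (1 + 1)) _ (mG c1 (normc c2)%:C v) (G0 _ _ _)).
have sw (a b : R[i]) q : (\int[leb (1 + 1)]_p (gau p * gau q * h (a * theta p + b * theta q + v))%:E =
   \int[leb (1 + 1)]_p (gau q * gau p * h (b * theta q + a * theta p + v))%:E)%E.
  by apply: eq_integral => p _; rewrite [gau p * _]mulrC [a * _ + _]addrC.
under eq_integral do rewrite sw inner -sw.
rewrite -(@tonelliR _ _ _ _ _ (leb (1 + 1)) (leb (1 + 1)) _ (mG (normc c1)%:C (normc c2)%:C v) (G0 _ _ _)).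
set r1 := normc c1; set r2 := normc c2.
have r10 : 0 <= r1 by exact: normc_ge0.
have := normc_ge0 c2; rewrite -/r2 le_eqVlt => /predU1P[r20|r20].
  rewrite -r20 expr0n addr0 sqrtr_sqr ger0_norm//.
  transitivity (\int[leb (1 + 1)]_p ((4 * pi) * (gau p * h (r1%:C * theta p + v)))%:E)%E.
    apply: eq_integral => p _.
    transitivity (\int[leb (1 + 1)]_q (gau p * h (r1%:C * theta p + v) * gau q)%:E)%E.
      by apply: eq_integral => q _; rewrite mul0r addr0; congr (_%:E); ring.
    rewrite integralZR ?integral_gau//; [|by rewrite mulr_ge0 ?gau_ge0|exact: measurable_gau|exact: gau_ge0].
    by rewrite -EFinM; congr (_%:E); ring.
  rewrite integralZR//; [by rewrite mulr_ge0// pi_ge0| |by move=> p; rewrite mulr_ge0 ?gau_ge0].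
  apply/measurable_EFinP; apply: mgh => //; apply: mfCD; last exact: mfC_cst.
  by apply: mfCM; [exact: mfC_cst|exact: mfC_theta].
apply: (@gau_sum2_pos (fun z => h (z + v))) => //.
by apply: measurable_ofC => //; apply: mfCD; [exact: mfC_theta|exact: mfC_cst].
Qed.

End gaussian_sum.

Section gaussian_sum_dim.
Context {R : realType}.
Local Notation leb n := (lebesgue_rV R n).
Local Notation P2 := 'rV[R]_(1 + 1).
Local Notation gau := (@gau R).

Definition gaup d (z : 'rV[R]_(d + d)) : R := \prod_j gau (pairrV j z).

Lemma gaup_ge0 d (z : 'rV[R]_(d + d)) : 0 <= gaup z.
Proof. by apply: prodr_ge0 => j _; exact: gau_ge0. Qed.

Lemma mfC_sum_theta d (c : 'I_d -> R[i]) :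
  mfC (fun z : 'rV[R]_(d + d) => \sum_j c j * theta (pairrV j z)).
Proof.
apply: mfC_sum => j; apply: mfCM; first exact: mfC_cst.
exact: (mfC_comp mfC_theta (measurable_pairrV j)).
Qed.

Lemma measurable_gaup d : measurable_fun setT (@gaup d).
Proof.
apply: measurable_prod => j _.
exact: (measurableT_comp (@measurable_gau R) (measurable_pairrV j)).
Qed.

Lemma measurable_gaup_gau (dT : measure_display) (T : measurableType dT) d
    (P : T -> 'rV[R]_(d + d)) (q p : T -> P2) (h : R[i] -> R) (F : T -> R[i]) :
  measurable_fun setT P -> measurable_fun setT q -> measurable_fun setT p -> mfC F ->
  measurable_fun setT (fun p : P2 => h (theta p)) ->
  measurable_fun setT (fun x => (gaup (P x) * (gau (q x) * gau (p x) * h (F x)))%:E).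
Proof.
move=> mP mq mp mF mh; apply/measurable_EFinP; apply: measurable_funM.
  exact: (measurableT_comp (@measurable_gaup d) mP).
apply: measurable_funM; last exact: measurable_ofC.
by apply: measurable_funM; apply: (measurableT_comp (@measurable_gau R)).
Qed.

Lemma measurable_gaup_gau1 (dT : measure_display) (T : measurableType dT) d
    (P : T -> 'rV[R]_(d + d)) (p : T -> P2) (h : R[i] -> R) (F : T -> R[i]) :
  measurable_fun setT P -> measurable_fun setT p -> mfC F ->
  measurable_fun setT (fun p : P2 => h (theta p)) ->
  measurable_fun setT (fun x => (gaup (P x) * (gau (p x) * h (F x)))%:E).
Proof.
move=> mP mp mF mh; apply/measurable_EFinP; apply: measurable_funM.
  exact: (measurableT_comp (@measurable_gaup d) mP).
apply: measurable_funM; last exact: measurable_ofC.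
exact: (measurableT_comp (@measurable_gau R)).
Qed.

Lemma measurable_integralP (dT : measure_display) (T : measurableType dT) (f : T -> P2 -> R) :
  measurable_fun setT (fun x : T * P2 => (f x.1 x.2)%:E) -> (forall x p, 0 <= f x p) ->
  measurable_fun setT (fun x => (\int[leb (1 + 1)]_p (f x p)%:E)%E).
Proof.
move=> mf f0; apply: (measurable_fun_fubini_tonelli_F (fun x : T * P2 => (f x.1 x.2)%:E)) => //.
by move=> x; rewrite lee_fin.
Qed.

Lemma mfC_sum_thetaT (dT : measure_display) (T : measurableType dT) d (P : T -> 'rV[R]_(d + d))
    (c : 'I_d -> R[i]) : measurable_fun setT P ->
  mfC (fun x => \sum_j c j * theta (pairrV j (P x))).
Proof. exact: (mfC_comp (mfC_sum_theta c)). Qed.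

Lemma mfC_thetaT (dT : measure_display) (T : measurableType dT) (P : T -> P2)
    (c : R[i]) : measurable_fun setT P -> mfC (fun x => c * theta (P x)).
Proof. by move=> mP; apply: mfCM; [exact: mfC_cst|exact: (mfC_comp mfC_theta)]. Qed.

(** A linear form in independent planar Gaussians behaves as one Gaussian scaled by the norm of its
    coefficients. The extra variable p with coefficient r is the accumulator that absorbs one plane
    at each induction step. *)
Lemma gau_sum d (h : R[i] -> R) (r : R[i]) (c : 'I_d -> R[i]) :
  measurable_fun setT (fun p : P2 => h (theta p)) -> (forall z, 0 <= h z) ->
  (\int[leb (d + d)]_z \int[leb (1 + 1)]_p
     (gaup z * (gau p * h (r * theta p + \sum_j c j * theta (pairrV j z))))%:E =
   ((4 * pi) ^+ d)%:E * \int[leb (1 + 1)]_p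
     (gau p * h ((Num.sqrt (normc r ^+ 2 + \sum_j normc (c j) ^+ 2))%:C * theta p))%:E)%E.
Proof.
move=> mh h0; elim: d r c => [|d IH] r c.
  rewrite expr0 mul1e big_ord0 addr0 sqrtr_sqr ger0_norm ?normc_ge0//.
  rewrite integral_rV0; last first.
    apply: measurable_integralP; last by move=> x p; rewrite mulr_ge0 ?gaup_ge0// mulr_ge0 ?gau_ge0.
    apply: measurable_gaup_gau1 => //; apply: mfCD; first exact: mfC_thetaT.
    exact: (@mfC_sum_thetaT _ _ 0).
  rewrite /gaup big_ord0 big_ord0.
  under eq_integral do rewrite mul1r.
  rewrite gau_rotate//.
  by apply: eq_integral => p _; rewrite addr0.
have pi0 : 0 <= 4 * pi :> R by rewrite mulr_ge0// pi_ge0.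
pose G (z : 'rV[R]_(d + d)) (q p : P2) : R :=
  gaup z * (gau q * gau p * h (c ord0 * theta q + r * theta p + \sum_j c (lift ord0 j) * theta (pairrV j z))).
have G0 z q p : 0 <= G z q p by rewrite mulr_ge0 ?gaup_ge0// mulr_ge0// mulr_ge0 ?gau_ge0.
rewrite integral_glue; last 2 first.
- apply: measurable_integralP; last by move=> x p; rewrite mulr_ge0 ?gaup_ge0// mulr_ge0 ?gau_ge0.
  apply: measurable_gaup_gau1 => //; apply: mfCD; first exact: mfC_thetaT.
  exact: mfC_sum_thetaT.
- by move=> x; apply: integral_ge0 => p _; rewrite lee_fin mulr_ge0 ?gaup_ge0// mulr_ge0 ?gau_ge0.
transitivity (\int[leb (1 + 1)]_q \int[leb (d + d)]_z \int[leb (1 + 1)]_p (G z q p)%:E)%E.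
  apply: eq_integral => q _; apply: eq_integral => z _; apply: eq_integral => p _.
  congr (_%:E); rewrite /G /gaup big_ord_recl pairrV_glue0 big_ord_recl pairrV_glue0 /=.
  under [in LHS]eq_bigr do rewrite pairrV_glueS.
  under [X in h (_ + (_ + X))]eq_bigr do rewrite pairrV_glueS.
  rewrite addrCA addrA; ring.
rewrite (@fubini_tonelli _ _ _ _ _ (leb (1 + 1)) (leb (d + d)) (fun x => \int[leb (1 + 1)]_p (G x.2 x.1 p)%:E)%E); last 2 first.
- apply: (@measurable_integralP _ (P2 * 'rV[R]_(d + d))%type (fun x p => G x.2 x.1 p)) => //.
  have m1 := measurableT_comp measurable_fst (@measurable_fst _ _ (P2 * 'rV[R]_(d + d))%type P2).
  have m2 := measurableT_comp measurable_snd (@measurable_fst _ _ (P2 * 'rV[R]_(d + d))%type P2).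
  apply: measurable_gaup_gau => //; apply: mfCD; last exact: mfC_sum_thetaT.
  by apply: mfCD; exact: mfC_thetaT.
- by move=> x; apply: integral_ge0 => p _; rewrite lee_fin.
transitivity (\int[leb (d + d)]_z ((4 * pi)%:E * \int[leb (1 + 1)]_p
   (gaup z * (gau p * h ((Num.sqrt (normc r ^+ 2 + normc (c ord0) ^+ 2))%:C * theta p +
     \sum_j c (lift ord0 j) * theta (pairrV j z))))%:E))%E.
  apply: eq_integral => z _.
  set v := \sum_j _; set s := Num.sqrt _.
  transitivity (\int[leb (1 + 1)]_q \int[leb (1 + 1)]_p ((gaup z)%:E * (gau q * gau p * h (c ord0 * theta q + r * theta p + v))%:E))%E.
    by [].
  have mG : measurable_fun setT (fun x : P2 * P2 => (gau x.1 * gau x.2 * h (c ord0 * theta x.1 + r * theta x.2 + v))%:E).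
    apply/measurable_EFinP; apply: measurable_funM.
      by apply: measurable_funM; apply: (measurableT_comp (@measurable_gau R)).
    by apply: measurable_ofC => //; apply: mfCD; [apply: mfCD; exact: mfC_thetaT|exact: mfC_cst].
  have G1 q p : (0 <= (gau q * gau p * h (c ord0 * theta q + r * theta p + v))%:E)%E.
    by rewrite lee_fin mulr_ge0// mulr_ge0 ?gau_ge0.
  transitivity ((gaup z)%:E * \int[leb (1 + 1)]_q \int[leb (1 + 1)]_p (gau q * gau p * h (c ord0 * theta q + r * theta p + v))%:E)%E.
    rewrite -ge0_integralZl//; last 3 first.
    - exact: (measurable_fun_fubini_tonelli_F (fun x : P2 * P2 => (gau x.1 * gau x.2 * h (c ord0 * theta x.1 + r * theta x.2 + v))%:E)).
    - by move=> q _; apply: integral_ge0 => p _.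
    - by rewrite lee_fin gaup_ge0.
    apply: eq_integral => q _; rewrite ge0_integralZl//; last by rewrite lee_fin gaup_ge0.
    exact: (measurableT_comp mG (pair1_measurable q)).
  rewrite gau_sum2// muleCA; congr (_ * _)%E.
  rewrite -integralZR ?gaup_ge0//.
  - by rewrite /s addrC.
  - apply: measurable_funM; first exact: measurable_gau.
    by apply: measurable_ofC => //; apply: mfCD; [exact: mfC_thetaT|exact: mfC_cst].
  - by move=> p; rewrite mulr_ge0 ?gau_ge0.
rewrite ge0_integralZl//; last 2 first.
- apply: measurable_integralP; last by move=> x p; rewrite mulr_ge0 ?gaup_ge0// mulr_ge0 ?gau_ge0.
  apply: measurable_gaup_gau1 => //; apply: mfCD; first exact: mfC_thetaT.
  exact: mfC_sum_thetaT.
- by move=> z _; apply: integral_ge0 => p _; rewrite lee_fin mulr_ge0 ?gaup_ge0// mulr_ge0 ?gau_ge0.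
rewrite IH muleA -EFinM -exprS normc_real big_ord_recl addrA.
by rewrite (ger0_norm (sqrtr_ge0 _)) sqr_sqrtr// addr_ge0 ?sqr_ge0.
Qed.

End gaussian_sum_dim.

(** * Schur bounds for the kernel *)

Section kernel_integral.
Context {R : realType}.
Local Notation leb n := (lebesgue_rV R n).
Local Notation P2 := 'rV[R]_(1 + 1).
Local Notation gau := (@gau R).

(** At r = 0 the accumulator of [gau_sum] integrates to 4 pi. This factor is kept on the left so
    that the power on the right is also meaningful at d = 0. *)
Lemma gau_sum0 d (h : R[i] -> R) (c : 'I_d -> R[i]) :
  measurable_fun setT (fun p : P2 => h (theta p)) -> (forall z, 0 <= h z) ->
  ((4 * pi)%:E * \int[leb (d + d)]_z (gaup z * h (\sum_j c j * theta (pairrV j z)))%:E =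
   ((4 * pi) ^+ d)%:E * \int[leb (1 + 1)]_p
     (gau p * h ((Num.sqrt (\sum_j normc (c j) ^+ 2))%:C * theta p))%:E)%E.
Proof.
move=> mh h0; have := gau_sum 0 c mh h0; rewrite normc0 expr0n add0r => <-.
rewrite -ge0_integralZl//; last 3 first.
- apply/measurable_EFinP; apply: measurable_funM; first exact: measurable_gaup.
  by apply: measurable_ofC => //; exact: mfC_sum_theta.
- by move=> z _; rewrite lee_fin mulr_ge0 ?gaup_ge0.
- by rewrite lee_fin mulr_ge0// pi_ge0.
apply: eq_integral => z _.
transitivity (\int[leb (1 + 1)]_p (gaup z * h (\sum_j c j * theta (pairrV j z)) * gau p)%:E)%E.
  rewrite integralZR ?mulr_ge0 ?gaup_ge0//; [|exact: measurable_gau|exact: gau_ge0].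
  by rewrite integral_gau muleC.
by apply: eq_integral => p _; rewrite mul0r add0r; congr (_%:E); ring.
Qed.

Lemma integral_gaup d : (\int[leb (d + d)]_z (gaup z)%:E = ((4 * pi) ^+ d)%:E)%E.
Proof.
have p0 : 0 < 4 * pi :> R by rewrite mulr_gt0// pi_gt0.
have := @gau_sum0 d (fun=> 1) (fun=> 0) (measurable_cst _) (fun=> ler01).
under eq_integral do rewrite mulr1.
under [X in _ = (_ * X)%E -> _]eq_integral do rewrite mulr1.
rewrite integral_gau muleC => /(congr1 (fun x => x * (4 * pi)^-1%:E)%E).
by rewrite -!muleA -!EFinM mulfV ?gt_eqF// mulr1 mule1.
Qed.

Definition cplV d (c : 'I_d -> R[i]) : 'rV[R]_(d + d) :=
  row_mx (\row_j complex.Im (c j)) (\row_j complex.Re (c j)).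

Lemma theta_pairrV d (x : 'rV[R]_(d + d)) j :
  theta (pairrV j x) = x ord0 (rshift d j) +i* x ord0 (lshift d j).
Proof. by rewrite /theta /pairrV row_mxEl row_mxEr !mxE. Qed.

Lemma theta_cplV d (c : 'I_d -> R[i]) j : theta (pairrV j (cplV c)) = c j.
Proof.
by rewrite theta_pairrV /cplV row_mxEl row_mxEr !mxE; case: (c j).
Qed.

Lemma theta_pairrVD d (x y : 'rV[R]_(d + d)) j :
  theta (pairrV j (x + y)) = theta (pairrV j x) + theta (pairrV j y).
Proof. by rewrite !theta_pairrV !mxE. Qed.

Lemma measurable_cplV (dT : measure_display) (T : measurableType dT) d (c : T -> 'I_d -> R[i]) :
  (forall j, mfC (c ^~ j)) -> measurable_fun setT (fun x => cplV (c x)).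
Proof.
move=> mc; apply: measurable_row_mx; apply: measurable_fun_rV => j;
  by under eq_fun do rewrite mxE; case: (mc j).
Qed.

Variable d : nat.
Local Notation V := 'rV[R]_(d + d).
Local Notation W := 'rV[R]_((d + d) + (d + d)).
Implicit Types (w z : W).

(* Translating the frequency by [shear x] makes [cbe] depend on the frequency
   alone. *)
Definition shear (x : V) : V := row_mx (2^-1 *: rsubmx x) (- 2^-1 *: lsubmx x).

Lemma cal_shear (x y : V) j : cal (row_mx x (y + shear x)) j =
  conjc (theta (pairrV j x) - 'i%C * theta (pairrV j y)).
Proof.
rewrite /cal row_mxKl row_mxKr !theta_pairrV.
rewrite [(y + _) _ _]mxE [(y + _) _ _]mxE row_mxEl row_mxEr !mxE.
by apply: complex_eqP; rewrite /= ; lra.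
Qed.

Lemma cbe_shear (x y : V) j : cbe (row_mx x (y + shear x)) j = - ('i%C * theta (pairrV j y)).
Proof.
rewrite /cbe row_mxKl row_mxKr !theta_pairrV.
rewrite [(y + _) _ _]mxE [(y + _) _ _]mxE row_mxEl row_mxEr !mxE.
by apply: complex_eqP; rewrite /= ; lra.
Qed.

Lemma normcB_sqr (A B : R[i]) :
  normc (A - B) ^+ 2 = normc A ^+ 2 + normc B ^+ 2 - 2 * complex.Re (A * conjc B).
Proof. by case: A B => a b [c e]; rewrite !normc_sqr /=; ring. Qed.

Lemma normci : normc ('i%C : R[i]) = 1.
Proof. by rewrite /= expr0n expr1n add0r sqrtr1. Qed.

Lemma Re_realM (a : R) (z : R[i]) : complex.Re (a%:C * z) = a * complex.Re z.
Proof. by rewrite ReM /= mul0r subr0. Qed.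

(** In A the factor e^(Re(A conj(A')) / 2) completes the two Gaussians to one in A - A'. In B the
    exponential is replaced by [gfun], so the Gaussians in B and B' stay separate. *)
Lemma normc_kernK (m : nat -> R[i]) z w : normc (kernK m z w) =
  \prod_j expR (- normc (cal z j - cal w j) ^+ 2 / 4) *
  \prod_j expR (- normc (cbe z j) ^+ 2 / 4) *
  (\prod_j expR (- normc (cbe w j) ^+ 2 / 4) * normc (gfun m (\sum_j ctau z w j))).
Proof.
rewrite /kernK normcM mulrA; congr (_ * _).
rewrite normcM /cwt normc_prod cexp_sum normc_prod -!big_split.
apply: eq_bigr => j _.
rewrite [LHS](_ : _ = normc (phase (cal z j) (cbe z j) * conjc (phase (cal w j) (cbe w j))) *
  normc (cexp (csig z w j)))//.
rewrite [RHS](_ : _ = expR (- normc (cal z j - cal w j) ^+ 2 / 4) *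
  expR (- normc (cbe z j) ^+ 2 / 4) * expR (- normc (cbe w j) ^+ 2 / 4))//.
rewrite normcM normc_conjc !normc_phase normc_cexp -!expRD; congr expR.
rewrite normcB_sqr /csig Re_realM; set t := complex.Re (_ * _); lra.
Qed.

Lemma mfC_cal j : mfC (fun w : W => cal w j).
Proof.
have ml : measurable_fun setT (fun w : W => lsubmx w) by exact: measurable_lsubmx.
have mr : measurable_fun setT (fun w : W => rsubmx w) by exact: measurable_rsubmx.
apply: mfC_complex; [apply: measurable_funD|apply: measurable_funB];
  try (apply: measurable_funM => //); exact: measurable_coordT.
Qed.

Lemma mfC_cbe j : mfC (fun w : W => cbe w j).
Proof.
have ml : measurable_fun setT (fun w : W => lsubmx w) by exact: measurable_lsubmx.
have mr : measurable_fun setT (fun w : W => rsubmx w) by exact: measurable_rsubmx.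
apply: mfC_complex; [apply: measurable_funB|apply: measurableT_comp => //; apply: measurable_funD];
  try (apply: measurable_funM => //); exact: measurable_coordT.
Qed.

Variable m : nat -> R[i].
Hypothesis m1 : forall k, normc (m k) <= 1.

Lemma measurable_kernK : measurable_fun setT (fun x : W * W => normc (kernK m x.1 x.2)).
Proof.
have mp (f : R -> R) (g : W * W -> R) : measurable_fun setT f -> measurable_fun setT g ->
  measurable_fun setT (fun x => f (g x)) by move=> mf mg; exact: (measurableT_comp mf mg).
have mA1 j : mfC (fun x : W * W => cal x.1 j) := mfC_comp (mfC_cal j) measurable_fst.
have mA2 j : mfC (fun x : W * W => cal x.2 j) := mfC_comp (mfC_cal j) measurable_snd.
have mB1 j : mfC (fun x : W * W => cbe x.1 j) := mfC_comp (mfC_cbe j) measurable_fst.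
have mB2 j : mfC (fun x : W * W => cbe x.2 j) := mfC_comp (mfC_cbe j) measurable_snd.
have me (F : W * W -> R[i]) : mfC F -> measurable_fun setT (fun x => expR (- normc (F x) ^+ 2 / 4)).
  move=> mF; apply: measurableT_comp => //; apply: measurable_funM => //.
  by apply: measurableT_comp => //; exact: measurable_normc2.
under eq_fun do rewrite normc_kernK.
apply: measurable_funM; [apply: measurable_funM|apply: measurable_funM].
- by apply: measurable_prod => j _; apply: me; exact: mfCB.
- by apply: measurable_prod => j _; exact: me.
- by apply: measurable_prod => j _; exact: me.
- apply: measurable_normc; apply: mfC_gfun => //; apply: mfC_sum => j.
  by apply: mfCM; [exact: mfC_cst|apply: mfCM => //; exact: mfC_conjc].
Qed.

Variable C : R.
Hypothesis hC : forall r, 0 <= r ->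
  (\int[leb (1 + 1)]_p (expR (- normc (theta p) ^+ 2 / 4) * normc (gfun m ((r / 2)%:C * theta p)))%:E
   <= (C * expR (r ^+ 2 / 4))%:E)%E.

(** After the frequency translation by [shear x], the position x occurs only in a translated
    Gaussian and integrates out first. The frequency integral is a Gaussian integral of a linear
    form, reduced by [gau_sum0] to the planar bound with r the norm of B(w). *)
Lemma kernK_row w : (\int[leb ((d + d) + (d + d))]_z (normc (kernK m z w))%:E <=
  ((4 * pi) ^+ d * ((4 * pi) ^+ d * (4 * pi)^-1 * C))%:E)%E.
Proof.
have p0 : 0 < 4 * pi :> R by rewrite mulr_gt0// pi_gt0.
have mK : measurable_fun setT (fun z => (normc (kernK m z w))%:E).
  by apply/measurable_EFinP; exact: (measurableT_comp measurable_kernK (pair2_measurable w)).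
have K0 z : (0 <= (normc (kernK m z w))%:E)%E by rewrite lee_fin normc_ge0.
have ar (a1 a2 a3 a4 : R) : a1 * a2 * (a3 * a4) = a3 * (a2 * a4) * a1 by ring.
rewrite integral_rVD//.
pose h (s : R[i]) : R := normc (gfun m (2^-1%:C * s)).
pose c (j : 'I_d) : R[i] := - 'i%C * conjc (cbe w j).
pose r : R := Num.sqrt (\sum_j normc (c j) ^+ 2).
pose e : R := \prod_(j < d) expR (- normc (cbe w j) ^+ 2 / 4).
(* Chosen so that the conjugate of A(z) - A(w) is the complex coordinate of x + b y. *)
pose b (y : V) : V := cplV (fun j => - ('i%C * theta (pairrV j y) + conjc (cal w j))).
pose k (y : V) : R := e * (gaup y * h (\sum_j c j * theta (pairrV j y))).
have e0 : 0 <= e by apply: prodr_ge0 => j _; exact: expR_ge0.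
have h0 s : 0 <= h s by exact: normc_ge0.
have k0 y : 0 <= k y by rewrite mulr_ge0// mulr_ge0 ?gaup_ge0.
have mh : measurable_fun setT (fun p : P2 => h (theta p)).
  by apply: measurable_normc; apply: mfC_gfun => //; apply: mfCM; [exact: mfC_cst|exact: mfC_theta].
have mgh : measurable_fun setT (fun y : V => gaup y * h (\sum_j c j * theta (pairrV j y))).
  apply: measurable_funM; first exact: measurable_gaup.
  by apply: measurable_ofC => //; exact: mfC_sum_theta.
have mk : measurable_fun setT k by apply: measurable_funM.
have mb : measurable_fun setT b.
  apply: measurable_cplV => j; apply: mfCN; apply: mfCD; last exact: mfC_cst.
  by apply: mfCM; [exact: mfC_cst|exact: (mfC_comp mfC_theta (measurable_pairrV j))].
have -> : (\int[leb (d + d)]_x \int[leb (d + d)]_y (normc (kernK m (row_mx x y) w))%:E =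
  \int[leb (d + d)]_x \int[leb (d + d)]_y (k y * gaup (x + b y))%:E)%E.
  apply: eq_integral => x _.
  rewrite -(@integral_shift_rV _ _ (shear x)); last 2 first.
  - exact: (measurableT_comp mK (measurable_row_mx (measurable_cst x) (@measurable_id _ _ setT))).
  - by move=> y; exact: K0.
  apply: eq_integral => y _; congr (_%:E); rewrite normc_kernK.
  have E1 : \prod_j expR (- normc (cal (row_mx x (y + shear x)) j - cal w j) ^+ 2 / 4) = gaup (x + b y).
    apply: eq_bigr => j _; rewrite cal_shear /gau theta_pairrVD theta_cplV -normc_conjc conjcB conjcK.
    by rewrite opprD addrA.
  have E2 : \prod_j expR (- normc (cbe (row_mx x (y + shear x)) j) ^+ 2 / 4) = gaup y.
    by apply: eq_bigr => j _; rewrite cbe_shear normcN normcM normci mul1r.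
  have E3 : \sum_j ctau (row_mx x (y + shear x)) w j = 2^-1%:C * \sum_j c j * theta (pairrV j y).
    rewrite mulr_sumr; apply: eq_bigr => j _; rewrite /ctau cbe_shear /c; ring.
  by rewrite E1 E2 E3; exact: ar.
rewrite (@tonelliR _ _ _ _ _ (leb (d + d)) (leb (d + d)) (fun x y => k y * gaup (x + b y))); last 2 first.
- apply: measurable_funM; first exact: (measurableT_comp mk measurable_snd).
  apply: (measurableT_comp (@measurable_gaup R d)); apply: measurable_addrV; first exact: measurable_fst.
  exact: (measurableT_comp mb measurable_snd).
- by move=> x y; rewrite mulr_ge0 ?gaup_ge0.
have mg1 (a : V) : measurable_fun setT (fun x : V => gaup (x + a)).
  apply: (measurableT_comp (@measurable_gaup R d)).
  by apply: measurable_addrV; [exact: measurable_id|exact: measurable_cst].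
have -> : (\int[leb (d + d)]_y \int[leb (d + d)]_x (k y * gaup (x + b y))%:E =
   \int[leb (d + d)]_y ((4 * pi) ^+ d * k y)%:E)%E.
  apply: eq_integral => y _; rewrite integralZR//; last by move=> x; exact: gaup_ge0.
  rewrite (@integral_shift_rV _ _ (b y) (fun x => (gaup x)%:E)); last 2 first.
  - by apply/measurable_EFinP; exact: measurable_gaup.
  - by move=> x; rewrite lee_fin gaup_ge0.
  by rewrite integral_gaup -EFinM mulrC.
rewrite integralZR ?exprn_ge0 ?(ltW p0)// integralZR//; last first.
  by move=> y; rewrite mulr_ge0 ?gaup_ge0.
have r0 : 0 <= r by exact: sqrtr_ge0.
have r2 : r ^+ 2 = \sum_(j < d) normc (cbe w j) ^+ 2.
  rewrite sqr_sqrtr; last by apply: sumr_ge0 => j _; exact: sqr_ge0.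
  by apply: eq_bigr => j _; rewrite /c normcM normc_conjc normcN normci mul1r.
(* The growth e^(r^2/4) of the planar bound is cancelled exactly by the Gaussian in B(w), so the
   result does not depend on w. *)
have eE : e * expR (r ^+ 2 / 4) = 1.
  rewrite r2 /e -expR_sum -expRD -[RHS]expR0; congr expR.
  rewrite mulr_suml -big_split; apply: big1 => j _; move: (normc (cbe w j)) => t /=; ring.
have le1 := hC r0.
have := gau_sum0 c mh h0; rewrite -/r => E4.
have E5 : (\int[leb (d + d)]_z (gaup z * h (\sum_j c j * theta (pairrV j z)))%:E =
   ((4 * pi) ^+ d * (4 * pi)^-1)%:E * \int[leb (1 + 1)]_p (gau p * h (r%:C * theta p))%:E)%E.
  rewrite mulrC EFinM -muleA -E4 muleA -EFinM mulVf ?gt_eqF// mul1e//.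
rewrite E5.
have E6 : (\int[leb (1 + 1)]_p (gau p * h (r%:C * theta p))%:E <= (C * expR (r ^+ 2 / 4))%:E)%E.
  have Er (z : R[i]) : 2^-1%:C * (r%:C * z) = (r / 2)%:C * z.
    by rewrite (rmorphM (real_complex R)); ring.
  by under eq_integral => p _ do rewrite /h Er.
have q0 : 0 <= (4 * pi) ^+ d :> R by rewrite exprn_ge0// ltW.
apply: (@le_trans _ _ (((4 * pi) ^+ d)%:E * (e%:E * (((4 * pi) ^+ d * (4 * pi)^-1)%:E * (C * expR (r ^+ 2 / 4))%:E)))%E).
  by do 3 (apply: lee_wpmul2l; first by rewrite lee_fin ?mulr_ge0// invr_ge0 ltW).
rewrite -!EFinM lee_fin le_eqVlt; apply/orP; left; apply/eqP.
move: eE q0 p0; move: (e) (expR _) ((4 * pi) ^+ d) ((4 * pi)^-1) => e1 e2 e3 e4 ee _ _.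
transitivity (e3 * (e3 * e4 * C) * (e1 * e2)); first by ring.
by rewrite ee mulr1.
Qed.

End kernel_integral.

Section kernel_columns.
Context {R : realType} {d : nat}.
Local Notation leb n := (lebesgue_rV R n).
Local Notation P2 := 'rV[R]_(1 + 1).
Local Notation W := 'rV[R]_((d + d) + (d + d)).
Implicit Types (w z : W).

Lemma gfun_conjc (m : nat -> R[i]) s : (forall k, normc (m k) <= 1) ->
  gfun (fun k => conjc (m k)) (conjc s) = conjc (gfun m s).
Proof.
move=> m1; apply: (cvgC_unique (u := fun N => \sum_(k < N) conjc (m k) * expcoef k (conjc s))).
  by apply: gfun_cvg => k; rewrite normc_conjc.
have := cvgC_conjc (gfun_cvg s m1); congr (cvgC _ _); apply/funext => N.
by rewrite conjc_sum; apply: eq_bigr => k _; rewrite conjcM /expcoef [conjc (_ * s ^+ k)]conjcM conjcX conjc_real.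
Qed.

(** The adjoint kernel belongs to the conjugate multiplier, which satisfies the same bounds; column
    integrals are thus row integrals. *)
Lemma normc_kernK_sym (m : nat -> R[i]) z w : (forall k, normc (m k) <= 1) ->
  normc (kernK m z w) = normc (kernK (fun k => conjc (m k)) w z).
Proof.
move=> m1; rewrite !normc_kernK.
have -> : \sum_j ctau w z j = conjc (\sum_j ctau z w j) :> R[i].
  rewrite conjc_sum; apply: eq_bigr => j _.
  by rewrite /ctau [RHS]conjcM conjc_real [conjc (cbe z j * _)]conjcM conjcK [_ * conjc (cbe z j)]mulrC.
rewrite gfun_conjc// normc_conjc.
under eq_bigr do rewrite normcBC.
by rewrite -!mulrA; congr (_ * _); rewrite mulrCA.
Qed.

Lemma kernel_operator (A : R) : 0 <= A -> exists2 C : R, 0 < C & forall m : nat -> R[i],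
  (forall k, normc (m k) <= 1) ->
  (forall k, k.+1%:R * normc (m k.+1 - m k) ^+ 2 <= A ^+ 2) ->
  (forall k, k.+1%:R * normc (m k.+2 - 2 * m k.+1 + m k) <= A) ->
  forall (p : \bar R) (U V : W -> R), (1 <= p)%E ->
  measurable_fun setT U -> measurable_fun setT V ->
  (forall x, 0 <= U x) -> (forall x, 0 <= V x) ->
  (forall w, ((V w)%:E <= \int[leb ((d + d) + (d + d))]_z (normc (kernK m z w) * U z)%:E)%E) ->
  (Lnorm (leb ((d + d) + (d + d))) p (fun x => (V x)%:E) <=
   C%:E * Lnorm (leb ((d + d) + (d + d))) p (fun x => (U x)%:E))%E.
Proof.
move=> A0; have [C C0 hC] := plane_bound A0.
have p0 : 0 < 4 * pi :> R by rewrite mulr_gt0// pi_gt0.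
exists ((4 * pi) ^+ d * ((4 * pi) ^+ d * (4 * pi)^-1 * C)).
  by rewrite !mulr_gt0// ?exprn_gt0// invr_gt0.
move=> m m1 m2 m3 p U V p1 mU mV U0 V0 UV.
have cm : (forall k, normc (conjc (m k)) <= 1) by move=> k; rewrite normc_conjc.
apply: (@schur_test _ _ _ _ (fun x : W * W => normc (kernK m x.1 x.2))) => //.
- exact: measurable_kernK.
- by move=> x; exact: normc_ge0.
- by rewrite !mulr_gt0// ?exprn_gt0// invr_gt0.
- by move=> w; apply: kernK_row => //; exact: hC.
- move=> z.
  have c2 k : k.+1%:R * normc (conjc (m k.+1) - conjc (m k)) ^+ 2 <= A ^+ 2.
    by rewrite -conjcB normc_conjc.
  have c3 k : k.+1%:R * normc (conjc (m k.+2) - 2 * conjc (m k.+1) + conjc (m k)) <= A.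
    rewrite (_ : _ + _ = conjc (m k.+2 - 2 * m k.+1 + m k)) ?normc_conjc//.
    by rewrite conjcD conjcB conjcM (conjc_nat _ 2).
  apply: le_trans (kernK_row cm (hC _ cm c2 c3) z).
  by under eq_integral => w _ do rewrite (normc_kernK_sym _ _ m1).
Qed.

End kernel_columns.

(** * The oscillating multiplier *)

Section oscillating_multiplier.
Context {R : realType}.
Implicit Types (x : R) (F G : R -> R[i]) (l : R[i]).

Let half_shift (b : R) : b <= 2^-1 -> b - 1 <= - 2^-1 /\ b - 2 <= -1.
Proof. by move=> h; split; lra. Qed.

Definition dC x F l := is_derive x 1 (fun y => complex.Re (F y)) (complex.Re l) /\
  is_derive x 1 (fun y => complex.Im (F y)) (complex.Im l).

Lemma dC_eq x F l l' : l = l' -> dC x F l -> dC x F l'.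
Proof. by move=> ->. Qed.

Lemma dCM x F G l l' : dC x F l -> dC x G l' ->
  dC x (fun y => F y * G y) (l * G x + F x * l').
Proof.
move=> [a b] [c e]; split.
  under [fun y => _]eq_fun do rewrite ReM.
  apply: is_derive_eq; rewrite ReD !ReM /GRing.scale /=; ring.
under [fun y => _]eq_fun do rewrite ImM.
apply: is_derive_eq; rewrite ImD !ImM /GRing.scale /=; ring.
Qed.

Lemma dCB x F G l l' : dC x F l -> dC x G l' -> dC x (fun y => F y - G y) (l - l').
Proof.
move=> [a b] [c e]; split.
  under [fun y => _]eq_fun do rewrite ReD ReN.
  by rewrite ReD ReN; exact: is_deriveB.
under [fun y => _]eq_fun do rewrite ImD ImN.
by rewrite ImD ImN; exact: is_deriveB.
Qed.

Lemma dC_shift x F l (s : R) : dC (x + s) F l -> dC x (fun y => F (y + s)) l.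
Proof.
have H (g : R -> R) k : is_derive (x + s) 1 g k -> is_derive x 1 (fun y => g (y + s)) k.
  move=> hg; rewrite -[k]mulr1.
  apply: (@is_derive1_comp R g (fun y => y + s) x k 1 hg).
  by apply: is_derive_eq; rewrite addr0.
by move=> [a b]; split; exact: H.
Qed.

Lemma is_derive_powR x (b : R) : 0 < x -> is_derive x 1 (fun y : R => y `^ b) (b * x `^ (b - 1)).
Proof.
move=> x0; have xi : x \in `]0, +oo[%R by rewrite in_itv /= x0.
apply: DeriveDef; first exact: derivable_powR.
by rewrite -derive1E powR_derive1.
Qed.

Lemma dC_expi x (v : R -> R) (dv : R) : is_derive x 1 v dv ->
  dC x (fun y => expi (v y)) ((0 +i* dv) * expi (v x)).
Proof.
move=> hv; have hc := is_derive1_comp (is_derive_cos (v x)) hv.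
have hs := is_derive1_comp (is_derive_sin (v x)) hv; split.
  by apply: (is_derive_eq hc); rewrite ReM /=; ring.
by apply: (is_derive_eq hs); rewrite ImM /=; ring.
Qed.

Variables (a b t : R).

Let f x : R[i] := (x `^ (- a))%:C * expi (t * x `^ b).
(** The logarithmic derivative of [f]: f' = ph f, hence f'' = (dph + ph^2) f. *)
Let ph x : R[i] := (- a * x `^ (-1)) +i* (t * (b * x `^ (b - 1))).
Let dph x : R[i] := (a * x `^ (- 2)) +i* (t * (b * ((b - 1) * x `^ (b - 2)))).

Lemma dC_osc x : 0 < x -> dC x f (ph x * f x).
Proof.
move=> x0.
have d1 : dC x (fun y => (y `^ (- a))%:C) ((- a * x `^ (- a - 1))%:C).
  by split => /=; [exact: is_derive_powR|exact: is_derive_cst].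
have hb := is_derive_powR b x0.
have d2 : is_derive x 1 (fun y : R => t * y `^ b) (t * (b * x `^ (b - 1))).
  by apply: is_derive_eq; rewrite /GRing.scale /=; ring.
apply: dC_eq (dCM d1 (dC_expi d2)).
rewrite (@powRD _ x (- a) (-1)); last by apply/implyP => _; rewrite gt_eqF.
rewrite /f /ph; case: (expi _) => c s; apply: complex_eqP; rewrite /=; ring.
Qed.

Lemma dC_osc_phase x : 0 < x -> dC x ph (dph x).
Proof.
move=> x0; have h1 := is_derive_powR (-1) x0; have h2 := is_derive_powR (b - 1) x0.
split => /=.
  apply: is_derive_eq; rewrite /GRing.scale /=.
  by rewrite (_ : -1 - 1 = - 2 :> R); ring.
apply: is_derive_eq; rewrite /GRing.scale /=.
by rewrite (_ : b - 1 - 1 = b - 2); ring.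
Qed.

Lemma dC_osc2 x : 0 < x -> dC x (fun y => ph y * f y) (dph x * f x + ph x * (ph x * f x)).
Proof. by move=> x0; apply: dCM; [exact: dC_osc_phase|exact: dC_osc]. Qed.

Variable T : R.
Hypotheses (a0 : 0 <= a) (b1 : b <= 2^-1) (t0 : 0 < t) (tT : t <= T).

(** Constants for x >= 1 and t <= T: M1 x^(-1/2) bounds [ph], using b - 1 <= -1/2. In M2 the terms
    before M1^2 bound x [dph], and M1^2 bounds x ph^2. *)
Let M1 := a + T * `|b|.
Let M2 := a + T * (`|b| * `|b - 1|) + M1 ^+ 2.

Lemma normc_osc x : 1 <= x -> normc (f x) <= 1.
Proof.
move=> x1; rewrite normcM normc_expi mulr1 normc_real ger0_norm ?powR_ge0//.
by rewrite -(powRr0 x); apply: ler_powR => //; rewrite oppr_le0.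
Qed.

Lemma normc_osc_phase x : 1 <= x -> normc (ph x) <= M1 * x `^ (- 2^-1).
Proof.
move=> x1; apply: le_trans (normc_le_ReIm _) _; rewrite /= [leRHS]mulrDl; apply: lerD.
  rewrite mulNr normrN ger0_norm; last by rewrite mulr_ge0 ?powR_ge0.
  by apply: ler_wpM2l => //; apply: ler_powR => //; lra.
rewrite !normrM (gtr0_norm t0) (ger0_norm (powR_ge0 _ _)) -mulrA.
apply: ler_pM => //; first exact: ltW.
  by rewrite mulr_ge0 ?powR_ge0.
by apply: ler_wpM2l => //; apply: ler_powR => //; have [] := half_shift b1.
Qed.

Lemma normc_osc_dphase x : 1 <= x ->
  normc (dph x) <= (a + T * (`|b| * `|b - 1|)) * x `^ (-1).
Proof.
move=> x1; apply: le_trans (normc_le_ReIm _) _; rewrite /= [leRHS]mulrDl; apply: lerD.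
  rewrite ger0_norm; last by rewrite mulr_ge0 ?powR_ge0.
  by apply: ler_wpM2l => //; apply: ler_powR => //; lra.
rewrite !normrM (gtr0_norm t0) (ger0_norm (powR_ge0 _ _)) -!mulrA.
apply: ler_pM => //; first exact: ltW.
  by rewrite !mulr_ge0 ?powR_ge0.
by do 2 (apply: ler_wpM2l => //); apply: ler_powR => //; have [] := half_shift b1.
Qed.

Let T0 : 0 <= T. Proof. exact: le_trans (ltW t0) tT. Qed.
Let M10 : 0 <= M1. Proof. by rewrite addr_ge0// mulr_ge0. Qed.
Let M20 : 0 <= M2. Proof. by rewrite addr_ge0 ?sqr_ge0// addr_ge0// !mulr_ge0. Qed.

Lemma normc_dosc x : 1 <= x -> normc (ph x * f x) <= M1 * x `^ (- 2^-1).
Proof.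
move=> x1; rewrite normcM; apply: le_trans (normc_osc_phase x1).
by rewrite ler_piMr ?normc_ge0// normc_osc.
Qed.

Lemma normc_d2osc x : 1 <= x -> normc (dph x * f x + ph x * (ph x * f x)) <= M2 * x^-1.
Proof.
move=> x1; have x0 : 0 <= x by lra.
apply: le_trans (le_normcD _ _) _; rewrite mulrDl; apply: lerD.
  rewrite normcM -(powR_inv1 x0); apply: le_trans (normc_osc_dphase x1).
  by rewrite ler_piMr ?normc_ge0// normc_osc.
have e : x^-1 = x `^ (- 2^-1) * x `^ (- 2^-1).
  rewrite -powRD; last by apply/implyP => _; rewrite gt_eqF//; lra.
  by rewrite -powR_inv1//; congr (_ `^ _); field.
rewrite normcM expr2 e mulrACA; apply: ler_pM; rewrite ?normc_ge0//.
  exact: normc_osc_phase.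
exact: normc_dosc.
Qed.

(** The step is 2, the gap between consecutive eigenvalues d + 2k. The factor 4 is the 2 of
    [normc_MVT] times this length; [osc_diff2] incurs it twice. *)
Lemma osc_diff1 x : 1 <= x -> normc (f (x + 2) - f x) <= 4 * (M1 * x `^ (- 2^-1)).
Proof.
move=> x1; have := @normc_MVT R f (fun y => ph y * f y) x (x + 2) (M1 * x `^ (- 2^-1)).
rewrite (_ : x + 2 - x = 2); last by ring.
rewrite (_ : 2 * _ * 2 = 4 * (M1 * x `^ (- 2^-1))); last by ring.
apply; first by lra.
  by move=> y /andP[xy _]; apply: dC_osc; lra.
move=> y /andP[xy _]; apply: le_trans (normc_dosc _) _; first by lra.
apply: ler_wpM2l => //; rewrite !powRN lef_pV2 ?posrE ?powR_gt0//; try lra.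
by apply: ge0_ler_powR; rewrite ?nnegrE; lra.
Qed.

Lemma osc_diff2 x : 1 <= x ->
  normc (f (x + 4) - 2 * f (x + 2) + f x) <= 16 * (M2 * x^-1).
Proof.
move=> x1.
have g1 y : x <= y -> normc (ph (y + 2) * f (y + 2) - ph y * f y) <= 4 * (M2 * x^-1).
  move=> xy; have := @normc_MVT R (fun y => ph y * f y) (fun x => dph x * f x + ph x * (ph x * f x)) y (y + 2) (M2 * x^-1).
  rewrite (_ : y + 2 - y = 2); last by ring.
  rewrite (_ : 2 * _ * 2 = 4 * (M2 * x^-1)); last by ring.
  apply; first by lra.
    by move=> s /andP[ys _]; apply: dC_osc2; lra.
  move=> s /andP[ys _]; apply: le_trans (normc_d2osc _) _; first by lra.
  by apply: ler_wpM2l => //; rewrite lef_pV2 ?posrE; lra.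
have := @normc_MVT R (fun y => f (y + 2) - f y) (fun y => ph (y + 2) * f (y + 2) - ph y * f y) x (x + 2) (4 * (M2 * x^-1)).
rewrite (_ : x + 2 - x = 2); last by ring.
rewrite (_ : 2 * _ * 2 = 16 * (M2 * x^-1)); last by ring.
rewrite (_ : f (x + 2 + 2) - _ - _ = f (x + 4) - 2 * f (x + 2) + f x); last first.
  rewrite (_ : x + 2 + 2 = x + 4); ring.
apply; first by lra.
  move=> y /andP[xy _]; apply: dCB; last by apply: dC_osc; lra.
  by apply: dC_shift; apply: dC_osc; lra.
by move=> y /andP[xy _]; exact: g1.
Qed.

End oscillating_multiplier.

Lemma wave_multiplier_bounds {R : realType} (d : nat) (gamma delta T : R) :
  (0 < d)%N -> gamma <= 1 -> 0 <= delta -> 0 < T ->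
  exists2 A : R, 0 <= A & forall t, 0 < t <= T ->
    let m k := wave_multiplier gamma delta t (d + 2 * k)%:R in
    [/\ forall k, normc (m k) <= 1,
        forall k, k.+1%:R * normc (m k.+1 - m k) ^+ 2 <= A ^+ 2 &
        forall k, k.+1%:R * normc (m k.+2 - 2 * m k.+1 + m k) <= A].
Proof.
move=> d0 g1 dl0 T0.
pose b := gamma / 2; pose a := delta / 2.
pose M1 := a + T * `|b|; pose M2 := a + T * (`|b| * `|b - 1|) + M1 ^+ 2.
have a0 : 0 <= a by rewrite /a; lra.
have b1 : b <= 2^-1 by rewrite /b; lra.
have M10 : 0 <= M1 by rewrite addr_ge0// mulr_ge0// ltW.
have M20 : 0 <= M2 by rewrite addr_ge0 ?sqr_ge0// addr_ge0// !mulr_ge0// ltW.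
(* One constant must serve both bounds: 4 M1 comes from the first differences, 16 M2 from the
   second. *)
exists (4 * M1 + 16 * M2); first by rewrite addr_ge0// mulr_ge0.
move=> t /andP[t0 tT] m.
(* Since d >= 1 the eigenvalues stay in [1, +oo), where the bounds on [f] hold; the same condition
   gives k + 1 <= d + 2k below. *)
have x1 k : 1 <= (d + 2 * k)%:R :> R by rewrite ler1n; lia.
have kx k : k.+1%:R <= (d + 2 * k)%:R :> R by rewrite ler_nat; lia.
have e2 k : (d + 2 * k.+1)%:R = (d + 2 * k)%:R + 2 :> R by rewrite -natrD; congr _%:R; lia.
have e4 k : (d + 2 * k.+2)%:R = (d + 2 * k)%:R + 4 :> R by rewrite -natrD; congr _%:R; lia.
split => k.
- exact: (@normc_osc _ a b t a0).
- have := @osc_diff1 R a b t T a0 b1 t0 tT _ (x1 k).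
  rewrite -e2 -/M1 => H.
  have H2 : normc (m k.+1 - m k) ^+ 2 <= 16 * M1 ^+ 2 * (d + 2 * k)%:R^-1.
    apply: (@le_trans _ _ ((4 * (M1 * (d + 2 * k)%:R `^ (- 2^-1))) ^+ 2)).
      by rewrite ler_sqr ?nnegrE ?normc_ge0// mulr_ge0// mulr_ge0 ?powR_ge0.
    rewrite !exprMn -[(_ `^ _) ^+ 2]powR_mulrn ?powR_ge0// -powRrM.
    rewrite (_ : - 2^-1 * 2%:R = -1 :> R); last by field.
    by rewrite powR_inv1 ?ler0n// le_eqVlt; apply/orP; left; apply/eqP; ring.
  apply: (@le_trans _ _ (16 * M1 ^+ 2)).
    apply: (@le_trans _ _ ((d + 2 * k)%:R * (16 * M1 ^+ 2 * (d + 2 * k)%:R^-1))).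
      by apply: ler_pM; rewrite ?sqr_ge0.
    by rewrite mulrCA mulfV ?mulr1// gt_eqF//; have := x1 k; lra.
  rewrite (_ : 16 * M1 ^+ 2 = (4 * M1) ^+ 2); last by ring.
  by rewrite ler_sqr ?nnegrE ?addr_ge0 ?mulr_ge0// lerDl mulr_ge0.
- have := @osc_diff2 R a b t T a0 b1 t0 tT _ (x1 k).
  rewrite -e2 -e4 -/M1 -/M2 => H.
  apply: (@le_trans _ _ ((d + 2 * k)%:R * (16 * (M2 * (d + 2 * k)%:R^-1)))).
    by apply: ler_pM; rewrite ?normc_ge0.
  rewrite (mulrCA _ 16) (mulrCA _ M2) mulfV ?mulr1.
    by rewrite lerDr mulr_ge0.
  by rewrite gt_eqF//; have := x1 k; lra.
Qed.

(** * Boundedness on modulation spaces *)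

Section square_integrable_distributions.
Context {R : realType} {n : nat}.
Local Notation leb n := (lebesgue_rV R n).
Implicit Types F : 'rV[R]_n -> R[i].

(** Cauchy-Schwarz: the seminorm of order 2 n bounds phi by a multiple of [japN], hence its L^2
    norm. *)
Lemma tempered_sqi F : sqi (leb n) F -> tempered (fun_distr F).
Proof.
move=> hF; split=> [a phi psi /schwartz_nice hphi /schwartz_nice hpsi|eps eps0].
  have sphi := sqiM hF (nice_sqi hphi); have spsi := sqiM hF (nice_sqi hpsi).
  rewrite /fun_distr; change (intC (leb n) (fun x => F x * (a * phi x + psi x)) =
    a * intC (leb n) (fun x => F x * phi x) + intC (leb n) (fun x => F x * psi x)).
  rewrite -intCZ// -intCD//; last exact: intgCZ.
  by apply: eq_intC => x; ring.
pose J := \int[leb n]_x japN x.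
have J0 : 0 <= J by apply: Rintegral_ge0 => x _; exact: ltW (japN_gt0 x).
have K0 : 0 <= sq (leb n) F * J by rewrite mulr_ge0 ?sq_ge0.
set K := sq (leb n) F * J in K0.
(* The squared pairing is at most K eta^2, and K <= (1 + K)^2. *)
have eta0 : 0 < eps / (1 + K) by rewrite divr_gt0// ltr_wpDr.
exists (2 * n)%N, (eps / (1 + K)); split => //; set eta := eps / (1 + K) in eta0 *.
move=> phi /schwartz_nice hphi hb.
have sphi := nice_sqi (nice_conjc hphi).
have -> : fun_distr F phi = ip (leb n) F (fun x => conjc (phi x)).
  by apply: eq_intC => x; rewrite conjcK.
rewrite -(@ler_pXn2r _ 2) ?nnegrE ?normc_ge0 ?(ltW eps0)//.
apply: le_trans (ip_le hF sphi) _.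
have le1 : sq (leb n) (fun x => conjc (phi x)) <= eta ^+ 2 * J.
  have hJ : (leb n).-integrable setT (EFin \o @japN R n) := integrable_japN n.
  rewrite /J -(RintegralZl (eta ^+ 2) measurableT hJ).
  apply: le_Rintegral => //.
  - by case: sphi.
  - by apply: eq_integrable (integrableZl measurableT (eta ^+ 2) hJ) => // x _ /=; rewrite EFinM.
  move=> x _; rewrite normc_conjc.
  have le2 : normc (phi x) <= eta * japN x.
    rewrite /japN ler_pdivlMr ?exprn_gt0 ?jap_gt0// mulrC.
    exact: (hb [::] x (leq0n _)).
  apply: (@le_trans _ _ ((eta * japN x) ^+ 2)).
    by rewrite ler_sqr ?nnegrE ?normc_ge0// mulr_ge0// ?ltW// japN_gt0.
  rewrite exprMn ler_wpM2l ?sqr_ge0// expr2 ler_piMl ?japN_le1//.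
  exact: ltW (japN_gt0 x).
apply: le_trans (ler_wpM2l (sq_ge0 _ _) le1) _.
rewrite mulrCA -/K /eta expr_div_n mulrAC -mulrA ler_piMr ?sqr_ge0//.
rewrite ler_pdivrMr ?mul1r ?exprn_gt0 ?ltr_wpDr//.
have := sqr_ge0 K; nra.
Qed.

End square_integrable_distributions.

Section modulation_bounds.
Context {R : realType}.
Local Notation leb n := (lebesgue_rV R n).

(** [window_change] bounds one transform by a convolution of the other with an integrable function.
    The factors c and c' let the normalization of [stft] and the powers of [kap] be carried
    along. *)
Lemma window_bound n (psi gam : 'rV[R]_n -> R[i]) (c c' : R) :
  nice psi -> nice gam -> 0 < sq (leb n) psi ->
  (exists C, forall z, normc (stf psi gam z) <= C * japN z) -> 0 < c -> 0 < c' ->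
  exists2 C : R, 0 < C & forall F p, sqi (leb n) F -> (1 <= p)%E ->
    (Lnorm (leb (n + n)) p (fun z => (c * normc (stf gam F z))%:E) <=
     C%:E * Lnorm (leb (n + n)) p (fun z => (c' * normc (stf psi F z))%:E))%E.
Proof.
move=> np ng s0 hd c0 c'0.
have [D hD] := hd.
pose kk := ((2 * pi) ^+ n * sq (leb n) psi)^-1 * (c / c').
have kk0 : 0 < kk.
  by rewrite mulr_gt0 ?divr_gt0// invr_gt0 mulr_gt0// exprn_gt0// mulr_gt0// pi_gt0.
pose k z := kk * normc (stf psi gam z).
have k0 z : 0 <= k z by rewrite mulr_ge0 ?normc_ge0// ltW.
have mS : mfC (stf psi gam) by apply: mfC_stf => //; exact: nice_mfC.
have iS : intgC (leb (n + n)) (stf psi gam) := intgC_japN mS hD.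
have mk : measurable_fun setT k by apply: measurable_funM => //; exact: measurable_normc.
pose I := \int[leb (n + n)]_z normc (stf psi gam z).
have I0 : 0 <= I by apply: Rintegral_ge0 => z _; exact: normc_ge0.
(* The added 1 keeps the constant positive when only I >= 0 is known. *)
have C0 : 0 < kk * (I + 1) by rewrite mulr_gt0// ltr_wpDl.
exists (kk * (I + 1)) => // F p hF p1.
apply: (@schur_convolution R _ k (kk * (I + 1))) => //.
- rewrite integralZR ?(ltW kk0)//; [|exact: measurable_normc|by move=> z; exact: normc_ge0].
  rewrite -EFin_int_normc// -EFinM lee_fin ler_wpM2l ?(ltW kk0)// lerDl//.
- apply: measurable_funM => //; apply: measurable_normc; apply: mfC_stf => //; exact: hF.1.
- apply: measurable_funM => //; apply: measurable_normc; apply: mfC_stf => //; exact: hF.1.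
- by move=> x; rewrite mulr_ge0 ?normc_ge0// ltW.
- by move=> x; rewrite mulr_ge0 ?normc_ge0// ltW.
move=> w; have := window_change hF np ng s0 hd w.
have m1 : measurable_fun setT (fun z : 'rV[R]_(n + n) => ((2 * pi) ^+ n * sq (leb n) psi)^-1 *
    normc (stf psi gam (z - w)) * normc (stf psi F z)).
  apply: measurable_funM; last by apply: measurable_normc; apply: mfC_stf => //; exact: hF.1.
  apply: measurable_funM => //; apply: (measurableT_comp (measurable_normc mS)).
  by apply: measurable_subrV; [exact: measurable_id|exact: measurable_cst].
have q0 : 0 <= ((2 * pi) ^+ n * sq (leb n) psi)^-1.
  by rewrite invr_ge0 ltW// mulr_gt0// exprn_gt0// mulr_gt0// pi_gt0.
move=> /(@lee_wpmul2l _ c%:E _ _ _) H.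
rewrite EFinM; apply: le_trans (H _) _; first by rewrite lee_fin ltW.
rewrite -integralZR ?(ltW c0)//; last by move=> z; rewrite !mulr_ge0 ?normc_ge0.
rewrite le_eqVlt; apply/orP; left; apply/eqP; apply: eq_integral => z _; congr (_%:E).
rewrite /k /kk; move: (normc _) (normc _) (_^-1) => u v q.
by field; rewrite gt_eqF.
Qed.

Variable d : nat.
Local Notation V := 'rV[R]_(d + d).
Local Notation mu := (leb (d + d)).

(** F - F' has zero coefficients, so its Gaussian transform vanishes by [stf_expansion]; Moyal's
    identity then kills its pairing with every Schwartz function. *)
Lemma multiplier_unique (m : R -> R[i]) (f F F' : V -> R[i]) : sqi mu f ->
  is_multiplier m f F -> is_multiplier m f F' ->
  forall phi, schwartz phi -> fun_distr F phi = fun_distr F' phi.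
Proof.
move=> hf hF hF' phi /schwartz_nice nphi.
have sF := multiplier_sqi hF; have sF' := multiplier_sqi hF'; have sD := sqiB sF sF'.
have D0 a b : ip mu (fun x => F x - F' x) (special_hermite a b) = 0.
  by rewrite ipBl ?(multiplier_sh _ _ hf hF) ?(multiplier_sh _ _ hf hF') ?subrr//; exact: sh_sqi.
have S0 w : stf gphi (fun x => F x - F' x) w = 0.
  apply: cvgC_unique (stf_expansion w sD) _.
  under [fun N => _]eq_fun do under eq_bigr do rewrite D0 mulr0.
  by under [fun N => _]eq_fun do rewrite big1_eq; exact: cvgC_cst.
have Z0 : (fun z => stf gphi (fun x => F x - F' x) z * conjc (stf gphi (fun x => conjc (phi x)) z)) = fun=> 0.
  by apply/funext => z; rewrite S0 mul0r.
have := @moyal R _ _ _ gphi gphi sD (nice_conjc nphi) nice_gphi nice_gphi.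
rewrite Z0 intC0 => /(_ (intgC0 _)) /esym/eqP.
rewrite (sq_ip (nice_sqi nice_gphi)) sq_gphi mulf_eq0 => /orP[/eqP/(congr1 (@normc R))|].
  rewrite normc_real normc0 => /eqP; rewrite normr_eq0 expf_eq0 => /andP[_].
  by rewrite mulf_eq0 pnatr_eq0 /= gt_eqF// pi_gt0.
rewrite mulf_eq0 => /orP[|/eqP/(congr1 (@normc R))]; last first.
  by rewrite normc_real normc0 => /eqP; rewrite normr_eq0 gt_eqF// kap_gt0.
rewrite ipBl//; last by apply: nice_sqi; exact: nice_conjc.
rewrite subr_eq0 => /eqP E.
have e (G : V -> R[i]) : fun_distr G phi = ip mu G (fun x => conjc (phi x)).
  by apply: eq_intC => x; rewrite conjcK.
by rewrite !e.
Qed.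

Lemma multiplier_operator (m : R -> R[i]) : (0 < d)%N ->
  (forall k, normc (m (d + 2 * k)%:R) <= 1) -> operator_SS' (@multiplier R d m).
Proof.
move=> d0 m1 f /schwartz_nice nf; have hf := nice_sqi nf; split.
  have [F hF] := multiplier_exists d0 m1 hf.
  by exists (fun_distr F), F.
split=> [u [F hF ->]|u v [F hF ->] [F' hF' ->]].
  exact/tempered_sqi/(multiplier_sqi hF).
exact: multiplier_unique hF hF'.
Qed.

Lemma mfC_kernK (m : nat -> R[i]) w : (forall k, normc (m k) <= 1) ->
  mfC (fun z : 'rV[R]_((d + d) + (d + d)) => kernK m z w).
Proof.
move=> m1; apply: mfC_cvg (fun z => box_kernel_cvg z w m1) => N.
apply: mfC_sum => p; apply: mfCM; first exact: mfC_cst.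
by apply: mfCM; [exact: mfC_ccoef|exact: mfC_cst].
Qed.

(** Three bounds are chained: C1 from window g to the Gaussian, C2 for the kernel, C3 back to g. All
    are fixed before m, so the bound depends on m only through A; this gives uniformity in t. *)
Lemma multiplier_Mp_bound (g : V -> R[i]) (A : R) (p : \bar R) : (0 < d)%N -> schwartz g ->
  (exists x, g x != 0) -> 0 <= A -> (1 <= p)%E ->
  exists2 C : R, 0 < C & forall m : R -> R[i], let mk k := m (d + 2 * k)%:R in
    (forall k, normc (mk k) <= 1) ->
    (forall k, k.+1%:R * normc (mk k.+1 - mk k) ^+ 2 <= A ^+ 2) ->
    (forall k, k.+1%:R * normc (mk k.+2 - 2 * mk k.+1 + mk k) <= A) ->
    Mp_bound g p (@multiplier R d m) C.
Proof.
move=> d0 hg g0 A0 p1; have ng := schwartz_nice hg.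
have sg : 0 < sq mu g := sq_gt0 ng g0.
have [D hD] := stf_gphi_decay hg.
have ka0 : 0 < @kap R d := kap_gt0.
pose c : R := (2 * pi) `^ (- ((d + d)%:R / 2)).
have c0 : 0 < c by rewrite powR_gt0// mulr_gt0// pi_gt0.
(* The factor kap^2 offsets the kap^(-2) of [kernel_representation]. *)
have kc0 : 0 < @kap R d ^+ 2 * c by rewrite mulr_gt0// exprn_gt0.
have hD' : exists C, forall z, normc (stf g (@gphi R (d + d)) z) <= C * japN z.
  exists D => z; rewrite (stf_swap _ ng nice_gphi); apply: le_trans (hD _) _.
  by rewrite /japN normrN.
have sphi : 0 < sq mu (@gphi R (d + d)) by rewrite sq_gphi.
have [C1 C10 H1] := window_bound ng nice_gphi sg hD' c0 c0.
have [C2 C20 H2] := @kernel_operator R d A A0.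
have [C3 C30 H3] := window_bound nice_gphi ng sphi (ex_intro _ D hD) c0 kc0.
exists (C3 * (C2 * C1)); first by rewrite !mulr_gt0.
move=> m mk m1 m2 m3 f u sf [F hF ->].
have nf := schwartz_nice sf; have sqf := nice_sqi nf.
have sqF := multiplier_sqi hF.
have E (G : V -> R[i]) : Mnorm g p (fun_distr G) =
    Lnorm (leb ((d + d) + (d + d))) p (fun z => (c * normc (stf g G z))%:E).
  rewrite /Mnorm /LnormC; congr Lnorm; apply/funext => z; congr (_%:E).
  transitivity (normc (c%:C * stf g G z)) => //.
  by rewrite normcM normc_real gtr0_norm.
rewrite !E; apply: le_trans (H3 F p sqF p1) _.
rewrite EFinM -muleA; apply: lee_wpmul2l; first by rewrite lee_fin ltW.
rewrite EFinM -muleA; apply: (@le_trans _ _ (C2%:E * Lnorm (leb ((d + d) + (d + d))) p (fun z => (c * normc (stf gphi f z))%:E))%E).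
  have mst (G : V -> R[i]) : sqi mu G -> measurable_fun setT (fun z => normc (stf gphi G z)).
    by move=> hG; apply: measurable_normc; apply: mfC_stf; [exact: nice_gphi|exact: hG.1].
  apply: (H2 mk m1 m2 m3) => //.
  - by apply: measurable_funM => //; exact: mst.
  - by apply: measurable_funM => //; exact: mst.
  - by move=> z; rewrite mulr_ge0 ?normc_ge0// ltW.
  - by move=> z; rewrite mulr_ge0 ?normc_ge0// ltW.
  move=> w.
  have hV : intgC (leb ((d + d) + (d + d))) (stf gphi f).
    have [D' hD2] := stf_gphi_decay sf.
    by apply: intgC_japN hD2; apply: mfC_stf; [exact: nice_gphi|exact: sqf.1].
  have hm a b := multiplier_sh a b sqf hF.
  have := kernel_representation sqf hV w m1 sqF hm.
  move=> ->; rewrite normcM normc_real ger0_norm ?invr_ge0 ?sqr_ge0//.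
  rewrite (_ : @kap R d ^+ 2 * c * _ = c * normc (intC (leb ((d + d) + (d + d))) (fun z => stf gphi f z * kernK mk z w))); last first.
    by move: (@kap R d) ka0 (normc _) => ka ka_gt0 v; field; rewrite gt_eqF.
  have mfK : mfC (fun z => stf gphi f z * kernK mk z w).
    by apply: mfCM; [apply: mfC_stf; [exact: nice_gphi|exact: sqf.1]|exact: mfC_kernK].
  rewrite EFinM; apply: (@le_trans _ _ (c%:E * \int[leb ((d + d) + (d + d))]_z (normc (stf gphi f z * kernK mk z w))%:E)%E).
    by apply: lee_wpmul2l; [rewrite lee_fin ltW|exact: normc_intC_le].
  rewrite -integralZR ?(ltW c0)//; last 2 first.
  - exact: measurable_normc.
  - by move=> z; exact: normc_ge0.
  rewrite le_eqVlt; apply/orP; left; apply/eqP; apply: eq_integral => z _; congr (_%:E).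
  by rewrite normcM; ring.
have C2e : (0 <= C2%:E)%E by rewrite lee_fin ltW.
exact: (lee_wpmul2l C2e (H1 f p sqf p1)).
Qed.

End modulation_bounds.

Theorem corollary3p12 (R : realType) (d : nat) (gamma delta : R) :
  (0 < d)%N -> gamma <= 1 -> 0 <= delta ->
  forall g : 'rV[R]_(d + d) -> R[i], schwartz g -> (exists x, g x != 0) ->
  forall p : \bar R, (1 <= p)%E ->
  (forall t : R, 0 < t ->
     Mp_bounded g p (multiplier (wave_multiplier gamma delta t))) /\
  (forall T : R, 0 < T -> exists C : R, 0 < C /\
     forall t : R, 0 < t <= T ->
       Mp_bound g p (multiplier (wave_multiplier gamma delta t)) C).
Proof.
move=> d0 g1 dl0 g hg g0 p p1.
have bound T : 0 < T -> exists C : R, 0 < C /\ forall t : R, 0 < t <= T ->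
    Mp_bound g p (multiplier (wave_multiplier gamma delta t)) C.
  move=> T0; have [A A0 hA] := wave_multiplier_bounds d0 g1 dl0 T0.
  have [C C0 hC] := multiplier_Mp_bound d0 hg g0 A0 p1.
  by exists C; split => // t /hA [m1 m2 m3]; exact: hC.
split=> // t t0; split.
  have [A _ /(_ t)] := wave_multiplier_bounds d0 g1 dl0 t0.
  by rewrite t0 lexx => /(_ isT) [m1 _ _]; exact: multiplier_operator.
have [C [C0 hC]] := bound t t0.
by exists C; split => //; apply: hC; rewrite t0 lexx.
Qed.
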